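(* Let $\mu$ be a probability measure on $\mathbb R^d$ with density proportional to $e^{-U}$ satisfying the standing assumptions in the context (Poincaré inequality with constant $\frac1m$, discrete spectrum, $\nabla^2U\ge-Km\cdot I_d$ with $K\ge0$). Assume that there exist $a\in[0,1)$ and $b\ge0$ such that $$\Delta U(x)\le a|\nabla U(x)|^2+b\qquad\text{for all }x\in\mathbb R^d .$$ Then, choosing $T=m^{-1/2}$, the transition semigroup of the Forward process with refreshment rate $\gamma>0$ is exponentially contractive in $T$-average with rate $$\nu=\Omega\left(\frac{\gamma m}{\gamma^2+\frac{m(1+K)+b}{(1-a)^2}}\right).$$ In particular, if $\gamma=\Theta\left(\frac{\sqrt{m(1+K)+b}}{1-a}\right)$, then $\nu=\Omega\left(\frac{\sqrt m\,(1-a)}{\sqrt{1+K+b/m}}\right)$.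
   Context: Standing assumptions: $U:\mathbb R^d\to\mathbb R$ is $C^2$ with $\int e^{-U(x)}dx<\infty$, $\mu(dx)\propto e^{-U(x)}dx$; $\mu$ satisfies a Poincaré inequality with constant $\frac1m$, $m>0$, i.e. $\mathrm{Var}_\mu(f)\le\frac1m\int|\nabla f|^2d\mu$; the generator of the overdamped Langevin diffusion, i.e. the closure in $L^2(\mu)$ of $\mathcal Lf=-\frac12\nabla U\cdot\nabla f+\frac12\Delta f$ on $C_c^\infty(\mathbb R^d)$, has discrete spectrum; and $\nabla^2U(x)\ge-Km\cdot I_d$ for all $x$, for some $K\ge0$. Forward process (full-orthogonal refresh variant of the forward Event Chain process): the piecewise deterministic Markov process $(X_t,V_t)$ on $\mathbb R^d\times\mathbb R^d$ with invariant probability measure $\hat\mu=\mu\otimes\kappa$, $\kappa=\mathcal N(0,I_d)$, whose generator is, for $f\in C_c^1(\mathbb R^{2d})$, $$\hat{\mathcal L}f(x,v)=v\cdot\nabla_xf(x,v)+(v\cdot\nabla U(x))_+(B_-f-f)(x,v)+\gamma(\Pi_vf-f)(x,v),$$ where $\Pi_vf(x,v)=\int f(x,w)\kappa(dw)$, $B_-f(x,v)=\frac1{Z_x}\int_{\mathbb R^d}(w\cdot\nabla U(x))_-f(x,w)\kappa(dw)$, $Z_x=\int(w\cdot\nabla U(x))_+\kappa(dw)=\frac1{\sqrt{2\pi}}|\nabla U(x)|$, and $y_+=\max(y,0)$, $y_-=\max(-y,0)$. That is, it moves with $\dot X=V$; with rate $(v\cdot\nabla U(x))_+$ the velocity is resampled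 from $Z_x^{-1}(w\cdot\nabla U(x))_-\kappa(dw)$; and with rate $\gamma$ it is resampled from $\kappa$. Let $(\hat P_t)$ be its transition semigroup on $L^2(\hat\mu)$. Exponentially contractive in $T$-average with rate $\nu$ means: $\int_t^{t+T}\|\hat P_sf\|^2_{L^2(\hat\mu)}ds\le e^{-2\nu t}\int_0^T\|\hat P_sf\|^2_{L^2(\hat\mu)}ds$ for all $t\ge0$ and all $f\in L^2(\hat\mu)$ with $\int f\,d\hat\mu=0$. $\nu=\Omega(A)$ means that the statement holds with $\nu=cA$ for a universal constant $c>0$ (independent of $d$, $U$ and all parameters). $\gamma=\Theta(A)$ means $c_1A\le\gamma\le c_2A$ with universal constants $c_1,c_2>0$ (on which the constant in the subsequent $\Omega$ may depend). *)

(* Defs.v *)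
From HB Require Import structures.
From mathcomp Require Import all_boot all_order all_algebra.
From mathcomp Require Import all_classical all_reals all_analysis.

Set Implicit Arguments.
Unset Strict Implicit.
Unset Printing Implicit Defensive.

Import Order.TTheory GRing.Theory Num.Theory.
Import numFieldNormedType.Exports.

Local Open Scope classical_set_scope.
Local Open Scope ring_scope.

Definition rV_display : measure_display.
Proof. exact: default_measure_display. Qed.

Definition rV_coord (R : realType) (n : nat) (i : 'I_n) (v : 'rV[R]_n) :
  measurableTypeR R := v ord0 i.

(* The product sigma-algebra, generated by the coordinates; since R is second
   countable it is the Borel sigma-algebra of 'rV[R]_n. *)
HB.instance Definition _ (R : realType) (n : nat) :=
  @isMeasurable.Build rV_display 'rV[R]_n
    (g_sigma_preimage (@rV_coord R n))
    (@sigma_algebra0 _ _ _)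
    (@sigma_algebraC _ _)
    (@sigma_algebra_bigcup _ _ _).

Lemma measurable_rV_coord (R : realType) n (i : 'I_n) :
  measurable_fun [set: 'rV[R]_n] (@rV_coord R n i).
Proof.
move=> _ Y mY; rewrite setTI; apply: sub_sigma_algebra => /=.
rewrite -bigcup_seq/=; exists i => /=; first by rewrite mem_index_enum.
by exists Y => //; rewrite setTI.
Qed.

Lemma measurable_fun_rV (R : realType) d (T : measurableType d) n
    (f : T -> 'rV[R]_n) :
  (forall i, measurable_fun [set: T] (@rV_coord R n i \o f)) ->
  measurable_fun [set: T] f.
Proof.
move=> mf.
have sf : g_sigma_preimage (fun i => @rV_coord R n i \o f) `<=` measurable.
  apply: smallest_sub; first exact: sigma_algebra_measurable.
  case: n => [|n] in f mf *; first by rewrite big_ord0.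
  rewrite -bigcup_mkord_ord; apply: bigcup_sub => i Ii.
  by move=> A [B mB <-]; exact: mf.
move: sf; rewrite g_sigma_preimage_comp => sf _ A mA.
by apply: sf; exists A.
Qed.

Definition rV_cons (R : realType) n (p : measurableTypeR R * 'rV[R]_n) :
  'rV[R]_n.+1 := \row_i oapp (p.2 ord0) p.1 (unlift ord0 i).

Definition rV_uncons (R : realType) n (v : 'rV[R]_n.+1) :
  measurableTypeR R * 'rV[R]_n := (v ord0 ord0, \row_j v ord0 (lift ord0 j)).

Lemma rV_consK (R : realType) n : cancel (@rV_cons R n) (@rV_uncons R n).
Proof.
case=> x y; rewrite /rV_uncons /rV_cons; congr pair.
  by rewrite mxE unlift_none.
by apply/rowP => j; rewrite !mxE liftK.
Qed.

Lemma measurable_rV_cons (R : realType) n :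
  measurable_fun [set: measurableTypeR R * 'rV[R]_n] (@rV_cons R n).
Proof.
apply: measurable_fun_rV => i; case: (unliftP ord0 i) => [j|] ij.
  rewrite (_ : _ \o _ = @rV_coord R n j \o snd); last first.
    by apply/funext => p; rewrite /rV_coord/= mxE ij liftK.
  exact: measurableT_comp (@measurable_rV_coord R n j) measurable_snd.
rewrite (_ : _ \o _ = fst); first exact: measurable_fst.
by apply/funext => p; rewrite /rV_coord/= mxE ij unlift_none.
Qed.

Lemma measurable_rV_uncons (R : realType) n :
  measurable_fun [set: 'rV[R]_n.+1] (@rV_uncons R n).
Proof.
apply/measurable_fun_pairP; split.
  exact: (@measurable_rV_coord R n.+1 ord0).
apply: measurable_fun_rV => j.
rewrite (_ : _ \o _ = @rV_coord R n.+1 (lift ord0 j)).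
  exact: measurable_rV_coord.
by apply/funext => v; rewrite /rV_coord/= mxE.
Qed.

Section product_step.
Local Open Scope ereal_scope.
Context (R : realType) (n : nat).
Context (nu : {sigma_finite_measure set (measurableTypeR R) -> \bar R}).
Context (mu : {sigma_finite_measure set 'rV[R]_n -> \bar R}).

Definition prodS : set 'rV[R]_n.+1 -> \bar R :=
  pushforward (nu \x mu) (@rV_cons R n).

Let prodS0 : prodS set0 = 0.
Proof. by rewrite /prodS /pushforward preimage_set0 measure0. Qed.

Let prodS_ge0 A : 0 <= prodS A.
Proof. by rewrite /prodS /pushforward; apply: measure_ge0. Qed.

Let prodS_sigma_additive : semi_sigma_additive prodS.
Proof.
move=> F mF tF mUF; rewrite /prodS /pushforward preimage_bigcup.
apply: measure_semi_sigma_additive.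
- by move=> k; rewrite -[X in measurable X]setTI; exact: measurable_rV_cons.
- apply/trivIsetP => /= i j _ _ ij; rewrite -preimage_setI.
  by move/trivIsetP : tF => /(_ _ _ _ _ ij) ->//; rewrite preimage_set0.
- by rewrite -preimage_bigcup -[X in measurable X]setTI; exact: measurable_rV_cons.
Qed.

HB.instance Definition _ := isMeasure.Build _ _ _ prodS
  prodS0 prodS_ge0 prodS_sigma_additive.

Let prod_sigma_finite : sigma_finite setT (nu \x mu).
Proof.
have /sigma_finiteP[F [TF ndF Foo]] := sigma_finiteT nu.
have /sigma_finiteP[G [TG ndG Goo]] := sigma_finiteT mu.
exists (fun k => F k `*` G k).
  rewrite -setXTT TF TG predeqE => -[x y]; split.
    move=> [/= [i _ Fix] [k _ Gky]]; exists (maxn i k) => //; split.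
    - by move: x Fix; exact/subsetPset/ndF/leq_maxl.
    - by move: y Gky; exact/subsetPset/ndG/leq_maxr.
  by move=> [k _ []/= ? ?]; split; exists k.
move=> k; have [? ?] := Foo k; have [? ?] := Goo k.
split; first exact: measurableX.
by rewrite product_measure1E// lte_mul_pinfty// ge0_fin_numE.
Qed.

Let prodS_sigma_finite : sigma_finite setT prodS.
Proof.
have [F TF Ffin] := prod_sigma_finite.
exists (fun k => @rV_uncons R n @^-1` F k).
  by rewrite -preimage_bigcup -TF preimage_setT.
move=> k; have [mF Foo] := Ffin k; split.
  by rewrite -[X in measurable X]setTI; exact: measurable_rV_uncons.
rewrite /prodS /pushforward (_ : _ @^-1` _ = F k)//.
by apply/seteqP; split => p; rewrite /preimage/= rV_consK.
Qed.

HB.instance Definition _ := Measure_isSigmaFinite.Build _ _ _ prodS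
  prodS_sigma_finite.

End product_step.

Fixpoint prod_measure (R : realType)
    (nu : {sigma_finite_measure set (measurableTypeR R) -> \bar R}) (n : nat) :
    {sigma_finite_measure set 'rV[R]_n -> \bar R} :=
  if n is n'.+1 then prodS nu (prod_measure nu n') else dirac (0 : 'rV[R]_0).

Definition lebesgue_rV (R : realType) (d : nat) :
    {sigma_finite_measure set 'rV[R]_d -> \bar R} :=
  prod_measure lebesgue_measure d.

Definition std_gauss (R : realType) (d : nat) :
    {sigma_finite_measure set 'rV[R]_d -> \bar R} :=
  prod_measure (normal_prob 0 1) d.

Section calculus.
Context (R : realType) (d : nat).
Implicit Types (f U : 'rV[R]_d -> R) (x v w : 'rV[R]_d).

Definition dotv v w : R := \sum_i v ord0 i * w ord0 i.

Definition partial (i : 'I_d) f x : R := 'D_(delta_mx ord0 i) f x.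

(* Class C^k: all iterated partial derivatives up to order k exist and are
   continuous. *)
Fixpoint is_C (k : nat) f : Prop :=
  continuous f /\
  (if k is k'.+1 then
     forall i : 'I_d, (forall x, derivable f x (delta_mx ord0 i)) /\
                      is_C k' (partial i f)
   else True).

Definition grad f x : 'rV[R]_d := \row_i partial i f x.

Definition hess f x : 'M[R]_d := \matrix_(i, j) partial i (partial j f) x.

Definition laplacian f x : R := \tr (hess f x).

Definition test_function f : Prop :=
  (forall k, is_C k f) /\ compact (closure [set x | f x != 0]).

End calculus.

Section spectrum.
Local Open Scope ereal_scope.
Context (R : realType) (disp : measure_display) (T : measurableType disp).
Context (mu : {measure set T -> \bar R}).

Definition L2norm (f : T -> R) : \bar R := 'N[mu]_(2%:E)[EFin \o f].

(* An unbounded operator on L^2(mu) is represented by its graph, a relation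
   between square-integrable functions (not classes) that is compatible with
   equality mu-a.e.; L^2(mu) is the real Hilbert space, which has the same
   resolvent set in R as its complexification.  [in_resolvent A l] says that
   l - A has a bounded inverse defined on all of L^2(mu). *)
Definition in_resolvent (A : (T -> R) -> (T -> R) -> Prop) (l : R) : Prop :=
  (exists C : R, forall f g, A f g ->
     L2norm f <= C%:E * L2norm (fun x => l * f x - g x)%R) /\
  (forall h : T -> R, h \in Lfun mu 2%:E ->
     exists f g, A f g /\
       {ae mu, forall x, (l * f x - g x)%R = h x}).

Definition eigenfunction (A : (T -> R) -> (T -> R) -> Prop) (l : R)
    (f : T -> R) : Prop :=
  A f (fun x => l * f x)%R.

(* Every point of the spectrum is isolated in it and is an eigenvalue of finite
   multiplicity. *)
Definition discrete_spectrum (A : (T -> R) -> (T -> R) -> Prop) : Prop :=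
  forall l : R, ~ in_resolvent A l ->
    [/\ \forall l' \near l^', in_resolvent A l',
        exists f, eigenfunction A l f /\ ~ {ae mu, forall x, f x = 0%R} &
        exists (n : nat) (e : 'I_n -> T -> R), forall f, eigenfunction A l f ->
          exists c : 'I_n -> R,
            {ae mu, forall x, f x = (\sum_i c i * e i x)%R}].

End spectrum.

Section langevin.
Context (R : realType) (d : nat).
Implicit Types (f g U : 'rV[R]_d -> R) (mu : probability 'rV[R]_d R).

Definition langevin_op U f (x : 'rV[R]_d) : R :=
  - 2^-1 * dotv (grad U x) (grad f x) + 2^-1 * laplacian f x.

(* The graph of the closure in L^2(mu) of [langevin_op U] on C_c^oo. *)
Definition langevin_closure U mu f g : Prop :=
  [/\ f \in Lfun mu 2%:E, g \in Lfun mu 2%:E &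
      exists u : nat -> 'rV[R]_d -> R,
      [/\ forall n, test_function (u n),
          (fun n => L2norm mu (u n \- f)) @ \oo --> 0%E &
          (fun n => L2norm mu (langevin_op U (u n) \- g)) @ \oo --> 0%E]].

(* mu(dx) is proportional to exp(- U(x)) dx, with a finite normalisation. *)
Definition gibbs_measure U mu : Prop :=
  (\int[lebesgue_rV R d]_x (expR (- U x))%:E < +oo)%E /\
  forall A, measurable A ->
    (mu A * \int[lebesgue_rV R d]_x (expR (- U x))%:E =
     \int[lebesgue_rV R d]_(x in A) (expR (- U x))%:E)%E.

Definition poincare mu (C : R) : Prop :=
  forall f, is_C 1 f -> f \in Lfun mu 2%:E ->
    ('V_mu[f] <= C%:E * \int[mu]_x (dotv (grad f x) (grad f x))%:E)%E.

Definition standing_assumptions U mu (m K : R) : Prop :=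
  [/\ is_C 2 U /\ gibbs_measure U mu,
      0 < m /\ poincare mu m^-1,
      discrete_spectrum mu (langevin_closure U mu) &
      0 <= K /\
      forall x v : 'rV[R]_d,
        - (K * m) * dotv v v <= (v *m hess U x *m v^T) ord0 ord0].

End langevin.

Section forward.
Context (R : realType) (d : nat).
Context (U : 'rV[R]_d -> R) (gamma : R).
Implicit Types (z : 'rV[R]_d * 'rV[R]_d) (g : 'rV[R]_d * 'rV[R]_d -> \bar R).

Let kappa := std_gauss R d.
Let pos (y : R) := Num.max y 0.
Let neg (y : R) := Num.max (- y) 0.

Definition bounce_norm (x : 'rV[R]_d) : R :=
  \int[kappa]_w pos (dotv w (grad U x)).

(* At critical points of U the normalisation vanishes and [bounce g] is 0 by
   convention; the bounce rate vanishes there. *)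
Definition bounce g z : \bar R :=
  ((bounce_norm z.1)^-1%:E *
   \int[kappa]_w ((neg (dotv w (grad U z.1)))%:E * g (z.1, w)))%E.

Definition refresh g z : \bar R := (\int[kappa]_w g (z.1, w))%E.

Definition bounce_rate z : R := pos (dotv z.2 (grad U z.1)).

Definition flow (s : R) z : 'rV[R]_d * 'rV[R]_d := (z.1 + s *: z.2, z.2).

(* Probability of no jump before time t. *)
Definition survival (t : R) z : R :=
  expR (- \int[lebesgue_measure]_(s in `[0, t]) (bounce_rate (flow s z) + gamma)).

(* E_z[g(X_t, V_t); exactly n jumps before time t], for g >= 0, by conditioning
   on the first jump: given that it occurs at time s, in state z' = flow s z,
   its intensity is bounce_rate z' + gamma, and
   bounce_rate z' * bounce + gamma * refresh is the rate times the law of the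
   new state. *)
Fixpoint forward_jumps (n : nat) g (t : R) z : \bar R :=
  if n is n'.+1 then
    (\int[lebesgue_measure]_(s in `[0%R, t])
       ((survival s z)%:E *
        ((bounce_rate (flow s z))%:E *
           bounce (forward_jumps n' g (t - s)) (flow s z) +
         gamma%:E * refresh (forward_jumps n' g (t - s)) (flow s z))))%E
  else ((survival t z)%:E * g (flow t z))%E.

(* The transition semigroup f |-> E_z[f(X_t, V_t)], as the sum over the number
   of jumps before time t.  It is computed pointwise for a representative f of
   a class in L^2(mu \x kappa); as mu \x kappa is invariant, the result is
   finite and independent of the representative almost everywhere. *)
Definition forward_semigroup (t : R) (f : 'rV[R]_d * 'rV[R]_d -> R) z : \bar R :=
  (\sum_(0 <= n <oo) forward_jumps n (fun y => (f^\+ y)%:E) t z -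
   \sum_(0 <= n <oo) forward_jumps n (fun y => (f^\- y)%:E) t z)%E.

End forward.

Section contractivity.
Local Open Scope ereal_scope.
Context (R : realType) (disp : measure_display) (E : measurableType disp).

Definition T_average_contractive (P : R -> (E -> R) -> E -> \bar R)
    (m : {measure set E -> \bar R}) (T nu : R) : Prop :=
  forall f : E -> R, f \in Lfun m 2%:E -> \int[m]_z (f z)%:E = 0 ->
  forall t : R, (0 <= t)%R ->
    \int[lebesgue_measure]_(s in `[t, (t + T)%R]) ('N[m]_(2%:E)[P s f]) ^+ 2 <=
    (expR (- (2 * nu * t)))%:E *
    \int[lebesgue_measure]_(s in `[0%R, T]) ('N[m]_(2%:E)[P s f]) ^+ 2.

End contractivity.

(* Main.v *)
Require Import Defs.
From HB Require Import structures.
From mathcomp Require Import all_boot all_order all_algebra.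
From mathcomp Require Import all_classical all_reals all_analysis.
From mathcomp Require Import measurable_realfun.
From mathcomp Require Import ring lra.

(** Write N = - Delta + grad U . grad (so N = -2L for the Langevin generator L),
    Pi for the average over velocities and F_t for the semigroup applied to a
    mean-zero function. Dissipation only acts on velocities,
    d/dt |F_t|^2 <= - 2 gamma |F_t - Pi F_t|^2, so |Pi F_t|^2 has to be
    recovered from the transport term. The Langevin spectrum is nonpositive and
    discrete, hence m + N has dense range on test functions: choose u_t with
    m u_t + N u_t close to Pi F_t and follow B_t = <F_t, v . grad u_t>. By the
    Poincare inequality the derivative of B_t is at least a multiple of
    |Pi F_t|^2, up to the pairing of F_t - Pi F_t with the adjoint generator
    applied to v . grad u_t. Bochner's identity (curvature bound) controls the
    Hessian of u_t, and an integration by parts with the growth condition on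
    Delta U controls |grad U| |grad u_t|; both give the factor
    Gamma^2 = ((m (1 + K) + b) / (1 - a)^2 + gamma^2) / m. A time weight
    vanishing at both ends of [0, T] removes the boundary terms, whence, for
    T = m^(-1/2),
      |F_T|^2 <= |F_0|^2 / 2 + c (Gamma^2 / T) int_0^T |F_t - Pi F_t|^2 dt.
    With the dissipation inequality this becomes
    |F_(t+T)|^2 <= (1 - T k) |F_t|^2 with k of order gamma / Gamma^2, and the
    decay of the averages over [t, t + T] follows since |F_t| is nonincreasing.

    For bounded data the semigroup is a bounded measurable solution of the
    equation integrated along the backward characteristics (x - t v, v). No
    regularity in x is available, so derivatives in time are replaced by
    increments over a grid, for Steklov averages of the solution (which are
    Lipschitz in time); square-integrable data are reached by truncation. *)

Set Implicit Arguments.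
Unset Strict Implicit.
Unset Printing Implicit Defensive.

Import Order.TTheory GRing.Theory Num.Theory.
Import numFieldNormedType.Exports.

Local Open Scope classical_set_scope.
Local Open Scope ring_scope.

(** * Measures and Gaussian moments *)

(** The functional <F, v . grad u> is adapted to the problem because the adjoint generator maps v .
    grad u to a function whose velocity average is N u. Its time derivative therefore contains <Pi
    F, N u>, while the remainder only meets F - Pi F. Working with m + N instead of N costs a factor
    3 in the Poincare step, but avoids restricting the equation to mean-zero functions.

    As u_t moves with time, the derivative of B also contains <F, v . grad (d/dt u)>. This term is
    harmless: (m + N)(d/dt u) is nearly d/dt Pi F, which is in weak form a divergence of the first
    velocity moment of F - Pi F, so an energy estimate bounds |grad (d/dt u)| by |F - Pi F|.

    The bounce kernel is nonlocal in v and contributes (v . grad U)_- (grad U . grad u) / (2 Z) to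
    the adjoint. Dividing by Z is safe because Z >= |grad U| / sqrt 12, a lower bound that replaces
    the exact value of Z. Bounces dissipate nothing that is used: by Jensen's inequality they do not
    increase the norm, and the decay comes from refreshments only. *)

Section density.
Local Open Scope ereal_scope.
Context d (T : measurableType d) (R : realType).
Variables (mu nu : {measure set T -> \bar R}) (p : T -> R).
Hypothesis mp : measurable_fun [set: T] p.
Hypothesis p0 : forall x, (0 <= p x)%R.
Hypothesis nuE : forall A, measurable A -> nu A = \int[mu]_(x in A) (p x)%:E.

Import HBNNSimple.

(** The hypothesis [nuE] is the case of indicators; linearity gives simple functions, and monotone
    convergence along [nnsfun_approx] gives the rest. It serves both for the normal law on the line
    and for the Gibbs measure. *)
Lemma ge0_integral_density (f : T -> \bar R) :
  measurable_fun [set: T] f -> (forall x, 0 <= f x) ->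
  \int[nu]_x f x = \int[mu]_x (f x * (p x)%:E).
Proof.
move=> mf f0.
pose f_ := nnsfun_approx measurableT mf.
transitivity (limn (fun n => \int[nu]_x (f_ n x)%:E)).
  rewrite -monotone_convergence//.
  - by apply: eq_integral => x _; apply/esym/cvg_lim => //; exact: cvg_nnsfun_approx.
  - by move=> n; exact/measurable_EFinP/measurable_funTS.
  - by move=> n x _; rewrite lee_fin.
  - by move=> x _ a b ab; rewrite lee_fin; exact/lefP/nd_nnsfun_approx.
have -> : (fun n => \int[nu]_x (f_ n x)%:E) =
          (fun n => \int[mu]_x ((f_ n x)%:E * (p x)%:E)).
  apply/funext => n.
  transitivity (\int[nu]_x (\sum_(y \in range (f_ n))
      (y * \1_(f_ n @^-1` [set y]) x)%:E)).
    by apply: eq_integral => x _; rewrite fsumEFin// -fimfunE.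
  rewrite ge0_integral_fsum//; last 2 first.
  - by move=> y; exact/measurable_EFinP/measurable_funM.
  - by move=> y x _; rewrite nnfun_muleindic_ge0.
  transitivity (\sum_(y \in range (f_ n))
      \int[mu]_x (y%:E * (\1_(f_ n @^-1` [set y]) x)%:E * (p x)%:E)).
    apply: eq_fsbigr => y /set_mem[z _ fz].
    have y0 : (0 <= y)%R by rewrite -fz.
    under eq_integral do rewrite EFinM.
    rewrite ge0_integralZl//; try (exact/measurable_EFinP/measurable_indic); try (by move=> x _; rewrite lee_fin).
    rewrite integral_indic// setIT nuE//.
    rewrite integral_mkcond -ge0_integralZl//;
      try (by apply: (measurable_restrictT _ _).1 => //; apply: measurable_funTS; exact/measurable_EFinP);
      try (by move=> x _; rewrite patchE; case: ifP => //; rewrite lee_fin).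
    apply: eq_integral => x _; rewrite patchE indicE.
    by case: ifP => _; rewrite ?mule1 ?mule0 ?mul0e.
  rewrite -ge0_integral_fsum//;
    try (by move=> y x _; apply: mule_ge0; [rewrite -EFinM; exact: nnfun_muleindic_ge0|rewrite lee_fin]);
    try (by move=> y; apply: emeasurable_funM; [apply: emeasurable_funM; [exact: measurable_cst|exact/measurable_EFinP/measurable_indic]|exact/measurable_EFinP]).
  apply: eq_integral => x _.
  rewrite -ge0_mule_fsuml; last by move=> y; rewrite -EFinM nnfun_muleindic_ge0.
  congr (_ * _).
  by under eq_fsbigr do rewrite -EFinM; rewrite fsumEFin// -fimfunE.
rewrite -monotone_convergence//.
- apply: eq_integral => x _; apply/cvg_lim => //.
  by apply: cvgeZr => //; exact: cvg_nnsfun_approx.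
- by move=> n; apply: emeasurable_funM => //; exact/measurable_EFinP.
- by move=> n x _; rewrite mule_ge0// lee_fin.
- move=> x _ a b ab; rewrite lee_wpmul2r ?lee_fin//.
  by have /lefP := @nd_nnsfun_approx _ _ _ _ measurableT _ mf _ _ ab; exact.
Qed.
End density.

Section lebesgue_shift.
Local Open Scope ereal_scope.
Context (R : realType).
Notation leb := (@lebesgue_measure R).
Notation mR := (measurableTypeR R).

Lemma lebesgue_measureD (a : R) (A : set R) : measurable A ->
  pushforward leb (fun x : mR => (x + a)%R : mR) A = leb A.
Proof.
have mf : measurable_fun [set: mR] (fun x : mR => (x + a)%R : mR).
  exact: measurable_funD.
move=> mA; apply/esym.
pose m := pushforward leb (fun x : mR => (x + a)%R : mR).
pose mfM : {mfun mR >-> mR} := HB.pack (fun x : mR => (x + a)%R : mR) (isMeasurableFun.Build _ _ _ _ _ mf).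
have := @lebesgue_measure_unique R (pushforward leb mfM).
apply => // _ [[b c]] _ <-.
rewrite /pushforward/= [X in _ = leb X](_ : _ = `](b - a)%R, (c - a)%R]%classic).
  rewrite !lebesgue_measure_itv/= !lte_fin ltrD2r; case: ifP => // _.
  by rewrite -!EFinB; congr EFin; ring.
by apply/seteqP; split => x /=; rewrite !in_itv/= ltrBlDr lerBrDr.
Qed.

Lemma ge0_integral_lebesgueD (f : R -> \bar R) (a : R) :
  measurable_fun [set: mR] f -> (forall x, 0 <= f x) ->
  \int[leb]_x f (x + a)%R = \int[leb]_x f x.
Proof.
have mf : measurable_fun [set: mR] (fun x : mR => (x + a)%R : mR).
  exact: measurable_funD.
move=> mg g0.
pose mfM : {mfun mR >-> mR} := HB.pack (fun x : mR => (x + a)%R : mR) (isMeasurableFun.Build _ _ _ _ _ mf).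
transitivity (\int[pushforward leb mfM]_x f x).
  by rewrite ge0_integral_pushforward.
by apply: eq_measure_integral => A mA _; exact: lebesgue_measureD.
Qed.

Lemma ge0_integral_lebesgueN (f : R -> \bar R) :
  measurable_fun [set: mR] f -> (forall x, 0 <= f x) ->
  \int[leb]_x f (- x)%R = \int[leb]_x f x.
Proof.
move=> mg g0.
transitivity (\int[pushforward leb (-%R : _ -> mR)]_x f x).
  by rewrite ge0_integral_pushforward.
by apply: eq_measure_integral => A mA _; exact: lebesgue_measureN.
Qed.

End lebesgue_shift.

Section prod_measure_tonelli.
Local Open Scope ereal_scope.
Context (R : realType).
Notation mR := (measurableTypeR R).
Implicit Types (nu : {sigma_finite_measure set mR -> \bar R}).

Lemma ge0_integral_prod_measureS nu n (f : 'rV[R]_n.+1 -> \bar R) :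
  measurable_fun [set: 'rV[R]_n.+1] f -> (forall x, 0 <= f x) ->
  \int[prod_measure nu n.+1]_x f x =
  \int[prod_measure nu n]_y \int[nu]_t f (rV_cons (t, y)).
Proof.
move=> mf f0.
transitivity (\int[nu \x prod_measure nu n]_p f (rV_cons p)).
  rewrite /= /prodS.
  rewrite ge0_integral_pushforward//; exact: measurable_rV_cons.
rewrite fubini_tonelli2//.
by apply: measurableT_comp => //; exact: measurable_rV_cons.
Qed.

Lemma integral_prod_measure0 nu (f : 'rV[R]_0 -> \bar R) :
  measurable_fun [set: 'rV[R]_0] f -> \int[prod_measure nu 0]_x f x = f 0%R.
Proof. by move=> mf; rewrite /= integral_dirac// diracT mul1e. Qed.

Lemma rV0E (x : 'rV[R]_0) : x = 0%R.
Proof. by apply/rowP => -[]. Qed.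

Lemma rV_consE0 n (t : mR) (y : 'rV[R]_n) : rV_cons (t, y) ord0 ord0 = t.
Proof. by rewrite mxE unlift_none. Qed.
Lemma rV_consEl n (t : mR) (y : 'rV[R]_n) i : rV_cons (t, y) ord0 (lift ord0 i) = y ord0 i.
Proof. by rewrite mxE liftK. Qed.

Lemma measurable_cons1 n (y : 'rV[R]_n) :
  measurable_fun [set: mR] (fun t : mR => rV_cons (t, y)).
Proof.
by apply: (measurableT_comp (@measurable_rV_cons R n)); exact: measurable_pair2.
Qed.

Lemma measurable_rV_add n (a : 'rV[R]_n) :
  measurable_fun [set: 'rV[R]_n] (fun x : 'rV[R]_n => (x + a)%R).
Proof.
apply: measurable_fun_rV => i.
rewrite (_ : _ \o _ = (fun x => rV_coord i x + a ord0 i)%R); last first.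
  by apply/funext => x; rewrite /rV_coord /= mxE.
by apply: measurable_funD => //; exact: measurable_rV_coord.
Qed.

Lemma measurable_rV_opp n :
  measurable_fun [set: 'rV[R]_n] (fun x : 'rV[R]_n => (- x)%R).
Proof.
apply: measurable_fun_rV => i.
rewrite (_ : _ \o _ = (fun x => - rV_coord i x)%R); last first.
  by apply/funext => x; rewrite /rV_coord /= mxE.
by apply: measurableT_comp => //; exact: measurable_rV_coord.
Qed.

(** Induction on the dimension: Tonelli isolates the first coordinate, and one-dimensional
    invariance applies under the integral over the others. Reflection invariance of product measures
    is obtained below in the same way. *)
Lemma ge0_integral_lebesgue_rVD n (f : 'rV[R]_n -> \bar R) (a : 'rV[R]_n) :
  measurable_fun [set: 'rV[R]_n] f -> (forall x, 0 <= f x) ->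
  \int[lebesgue_rV R n]_x f (x + a)%R = \int[lebesgue_rV R n]_x f x.
Proof.
elim: n => [|n ih] in f a *; move=> mf f0.
  by apply: eq_integral => x _; rewrite [a]rV0E addr0.
have mfa : measurable_fun [set: 'rV[R]_n.+1] (fun x => f (x + a)%R).
  by apply: measurableT_comp => //; exact: measurable_rV_add.
rewrite /lebesgue_rV (ge0_integral_prod_measureS _ mfa (fun x => f0 _)) (ge0_integral_prod_measureS _ mf f0).
pose a' : 'rV[R]_n := \row_j a ord0 (lift ord0 j).
have consD (t : mR) y : (rV_cons (t, y) + a = rV_cons ((t + a ord0 ord0 : mR), y + a'))%R.
  apply/rowP => i; rewrite mxE; case: (unliftP ord0 i) => [j ->|->].
    by rewrite !rV_consEl !mxE.
  by rewrite !rV_consE0.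
under eq_integral do under eq_integral do rewrite consD.
have m2 : measurable_fun [set: 'rV[R]_n] (fun y => \int[lebesgue_measure]_t f (rV_cons (t, y))).
  apply: (measurable_fun_fubini_tonelli_G (fun p => f (rV_cons p))) => //.
  by apply: measurableT_comp => //; exact: measurable_rV_cons.
rewrite -/(lebesgue_rV R n) -(ih _ a' m2 (fun y => integral_ge0 _ (fun t _ => f0 _))).
apply: eq_integral => y _.
rewrite (ge0_integral_lebesgueD (f := fun t => f (rV_cons (t, y + a')%R)))//.
by apply: measurableT_comp => //; exact: measurable_cons1.
Qed.

Lemma ge0_integral_prod_measureN nu n (f : 'rV[R]_n -> \bar R) :
  (forall g : R -> \bar R, measurable_fun [set: mR] g -> (forall x, 0 <= g x) ->
    \int[nu]_x g (- x)%R = \int[nu]_x g x) ->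
  measurable_fun [set: 'rV[R]_n] f -> (forall x, 0 <= f x) ->
  \int[prod_measure nu n]_x f (- x)%R = \int[prod_measure nu n]_x f x.
Proof.
move=> nuN.
elim: n => [|n ih] in f *; move=> mf f0.
  by apply: eq_integral => x _; rewrite [x]rV0E oppr0.
have mfa : measurable_fun [set: 'rV[R]_n.+1] (fun x => f (- x)%R).
  by apply: measurableT_comp => //; exact: measurable_rV_opp.
rewrite (ge0_integral_prod_measureS _ mfa (fun x => f0 _)) (ge0_integral_prod_measureS _ mf f0).
have consD (t : mR) y : (- rV_cons (t, y) = rV_cons ((- t : mR), - y))%R.
  apply/rowP => i; rewrite mxE; case: (unliftP ord0 i) => [j ->|->].
    by rewrite !rV_consEl !mxE.
  by rewrite !rV_consE0.
under eq_integral do under eq_integral do rewrite consD.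
have m2 : measurable_fun [set: 'rV[R]_n] (fun y => \int[nu]_t f (rV_cons (t, y))).
  apply: (measurable_fun_fubini_tonelli_G (fun p => f (rV_cons p))) => //.
  by apply: measurableT_comp => //; exact: measurable_rV_cons.
rewrite -[RHS](ih _ m2 (fun y => integral_ge0 _ (fun t _ => f0 _))).
apply: eq_integral => y _.
rewrite (nuN (fun t => f (rV_cons (t, - y)%R)))//.
by apply: measurableT_comp => //; exact: measurable_cons1.
Qed.

End prod_measure_tonelli.

Section measurability_rV.
Context (R : realType).
Notation mR := (measurableTypeR R).

Lemma measurable_rV_entry d (T : measurableType d) n (f : T -> 'rV[R]_n) (i : 'I_n) :
  measurable_fun [set: T] f -> measurable_fun [set: T] (fun x => f x ord0 i : mR).
Proof.
by move=> mf; apply: (measurableT_comp (@measurable_rV_coord R n i)).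
Qed.

Lemma measurable_axpy d (T : measurableType d) n (f g : T -> 'rV[R]_n) (h : T -> R) :
  measurable_fun [set: T] f -> measurable_fun [set: T] g ->
  measurable_fun [set: T] h ->
  measurable_fun [set: T] (fun x => f x + h x *: g x).
Proof.
move=> mf mg mh; apply: measurable_fun_rV => i.
rewrite (_ : _ \o _ = (fun x => f x ord0 i + h x * g x ord0 i)); last first.
  by apply/funext => x; rewrite /rV_coord /= !mxE.
apply: measurable_funD; first exact: measurable_rV_entry.
by apply: measurable_funM => //; exact: measurable_rV_entry.
Qed.

Lemma measurable_dotv d (T : measurableType d) n (f g : T -> 'rV[R]_n) :
  measurable_fun [set: T] f -> measurable_fun [set: T] g ->
  measurable_fun [set: T] (fun x => dotv (f x) (g x) : mR).
Proof.
move=> mf mg; rewrite /dotv.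
apply: measurable_sum => i.
by apply: measurable_funM; exact: measurable_rV_entry.
Qed.

(** The sigma-algebra is generated by the coordinates, not by the open sets. Hence f is written as
    the pointwise limit of its values at the lattice points [c k (e k x)] of mesh 1/(k+1), and each
    approximation is constant on countably many boxes. *)
Lemma continuous_rV_measurable n (f : 'rV[R]_n -> R) :
  continuous f -> measurable_fun [set: 'rV[R]_n] f.
Proof.
move=> cf.
pose c k (z : 'rV[int]_n) : 'rV[R]_n := \row_i ((z ord0 i)%:~R / k.+1%:R).
pose e k (x : 'rV[R]_n) : 'rV[int]_n := \row_i Num.floor (x ord0 i * k.+1%:R).
apply: (@measurable_fun_cvg _ _ _ _ (fun k => f \o c k \o e k)).
- move=> k _ Y mY; rewrite setTI.
  rewrite (_ : _ @^-1` Y = \bigcup_(z in [set z | Y (f (c k z))]) (e k @^-1` [set z])); last first.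
    apply/seteqP; split => x /=; first by move=> h; exists (e k x).
    by case=> z /= Yz xz; move: Yz; rewrite -xz.
  rewrite bigcup_mkcond; apply: countable_bigcupT_measurable => //.
  move=> z; case: ifP => _ //.
  rewrite (_ : _ @^-1` _ = \big[setI/setT]_(i < n)
     ((fun x : 'rV[R]_n => x ord0 i) @^-1` `[((z ord0 i)%:~R / k.+1%:R), ((z ord0 i + 1)%:~R / k.+1%:R)[%classic)).
    apply: bigsetI_measurable => i _.
    rewrite -[X in measurable X]setTI.
    by apply: (@measurable_rV_coord R n i) => //; exact: measurable_itv.
  apply/seteqP; split => x /=.
    move=> <-; rewrite -bigcap_seq => i _ /=; rewrite in_itv/= !mxE.
    have /andP[h1 h2] := floor_itv (x ord0 i * k.+1%:R).
    by rewrite ler_pdivrMr// h1/= ltr_pdivlMr.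
  rewrite -bigcap_seq => h; apply/rowP => i; rewrite mxE.
  have /= := h i (mem_index_enum i).
  rewrite in_itv/= ler_pdivrMr// ltr_pdivlMr// => h'.
  exact: floor_def.
- move=> x _; apply: (cvg_comp (fun k => c k (e k x)) f); last exact: cf.
  apply/cvgrPdist_lt => ee e0.
  have [N _ HN] := near_infty_natSinv_lt (PosNum e0).
  exists N => // k /= Nk.
  rewrite [X in X < _](_ : _ = mx_norm (x - c k (e k x)))//.
  rewrite mx_normrE; apply/bigmax_ltP; split => //= -[i j] _ /=.
  rewrite !mxE ord1.
  have /andP[h1 h2] := floor_itv (x ord0 j * k.+1%:R).
  apply: le_lt_trans (HN _ Nk) => /=; rewrite -[_^-1]mul1r.
  rewrite ler_norml; apply/andP; split.
    rewrite (@le_trans _ _ 0)// ?oppr_le0 ?mul1r ?invr_ge0//.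
    by rewrite subr_ge0 ler_pdivrMr.
  rewrite !mul1r lerBlDl -[X in _ + X]mul1r -mulrDl ler_pdivlMr//.
  by move/ltW: h2; rewrite intrD.
Qed.

Lemma measurable_continuous_rV_comp d (T : measurableType d) n (f : T -> 'rV[R]_n)
    (g : 'rV[R]_n -> R) :
  continuous g -> measurable_fun [set: T] f ->
  measurable_fun [set: T] (fun x => g (f x) : mR).
Proof. by move=> cg mf; apply: measurableT_comp => //; exact: continuous_rV_measurable. Qed.

End measurability_rV.

(** * Locally bounded functions of time and their integrals *)

Section locally_bounded.
Context (R : realType).
Notation mR := (measurableTypeR R).
Notation leb := (@lebesgue_measure R).
Implicit Types f g : R -> R.

(* Measurable and locally bounded. *)
Definition lbm f := measurable_fun [set: mR] f /\
  forall N : R, exists M : R, 0 <= M /\ forall x, `|x| <= N -> `|f x| <= M.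

Lemma lbm_integrable f s t : lbm f -> leb.-integrable `[s, t] (EFin \o f).
Proof.
move=> [mf bf]; apply: measurable_bounded_integrable => //.
- by rewrite /= lebesgue_measure_itv/=; case: ifPn => _; rewrite ?ltry// -EFinB ltry.
- exact: measurable_funTS.
- have [M [M0 HM]] := bf (`|s| + `|t|).
  exists M; split; first exact: num_real.
  move=> M' MM' x /=; rewrite in_itv/= => /andP[sx xt].
  apply: le_trans (ltW MM'); apply: HM.
  rewrite ler_norml; apply/andP; split.
    by rewrite (le_trans _ sx)// opprD -[leRHS]addr0 lerD// ?oppr_le0// lerNl -normrN ler_norm.
  by rewrite (le_trans xt)// (le_trans (ler_norm t))// lerDr.
Qed.

Lemma lbmD f g : lbm f -> lbm g -> lbm (fun x => f x + g x).
Proof.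
move=> [mf bf] [mg bg]; split; first exact: measurable_funD.
move=> N; have [M1 [M10 H1]] := bf N; have [M2 [M20 H2]] := bg N.
exists (M1 + M2); split; first exact: addr_ge0.
by move=> x xN; rewrite (le_trans (ler_normD _ _))// lerD ?H1 ?H2.
Qed.

Lemma lbmM f g : lbm f -> lbm g -> lbm (fun x => f x * g x).
Proof.
move=> [mf bf] [mg bg]; split; first exact: measurable_funM.
move=> N; have [M1 [M10 H1]] := bf N; have [M2 [M20 H2]] := bg N.
exists (M1 * M2); split; first exact: mulr_ge0.
by move=> x xN; rewrite normrM ler_pM ?H1 ?H2.
Qed.

Lemma lbm_cst c : lbm (fun=> c).
Proof. by split => // N; exists `|c|. Qed.

Lemma lbmN f : lbm f -> lbm (fun x => - f x).
Proof.
move=> [mf bf]; split; first exact: measurableT_comp.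
by move=> N; have [M [M0 H]] := bf N; exists M; split => // x /H; rewrite normrN.
Qed.

Lemma continuous_lbm f : continuous f -> lbm f.
Proof.
move=> cf; split; first exact: continuous_measurable_fun.
move=> N.
have : compact (f @` `[-N, N]%classic).
  by apply: continuous_compact; [exact: continuous_subspaceT|exact: segment_compact].
move=> /compact_bounded [M [Mr HM]].
exists (`|M| + 1); split; first by rewrite addr_ge0.
move=> x xN; apply: HM; first by rewrite (le_lt_trans (ler_norm _))// ltrDl.
by exists x => //=; rewrite in_itv/= -ler_norml.
Qed.

(* Not an oriented integral: it is 0 when t < s. *)
Definition ri f s t : R := \int[leb]_(x in `[s, t]) f x.

Lemma riD f g s t : lbm f -> lbm g -> ri (fun x => f x + g x) s t = ri f s t + ri g s t.
Proof. by move=> lf lg; rewrite /ri RintegralD//; exact: lbm_integrable. Qed.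

Lemma riB f g s t : lbm f -> lbm g -> ri (fun x => f x - g x) s t = ri f s t - ri g s t.
Proof. by move=> lf lg; rewrite /ri RintegralB//; exact: lbm_integrable. Qed.

Lemma riZ f c s t : lbm f -> ri (fun x => c * f x) s t = c * ri f s t.
Proof. by move=> lf; rewrite /ri RintegralZl//; exact: lbm_integrable. Qed.

Lemma ri_cst c s t : s <= t -> ri (fun=> c) s t = c * (t - s).
Proof.
move=> st; rewrite /ri Rintegral_cst//= lebesgue_measure_itv/=.
by move: st; rewrite lte_fin le_eqVlt => /predU1P[->|->//]; rewrite ltxx subrr.
Qed.

Lemma ri_le f g s t : lbm f -> lbm g -> (forall x, s <= x <= t -> f x <= g x) ->
  ri f s t <= ri g s t.
Proof.
move=> lf lg fg; by apply: le_Rintegral => //; try exact: lbm_integrable.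
Qed.

Lemma ri_eq f g s t : (forall x, s <= x <= t -> f x = g x) -> ri f s t = ri g s t.
Proof. by move=> fg; apply: eq_Rintegral => x; rewrite inE/= in_itv/=; exact: fg. Qed.

Lemma ri_abs f s t : lbm f -> `|ri f s t| <= ri (fun x => `|f x|) s t.
Proof. by move=> lf; apply: le_normr_Rintegral => //; exact: lbm_integrable. Qed.

Lemma lbm_abs f : lbm f -> lbm (fun x => `|f x|).
Proof.
move=> [mf bf]; split; first exact: measurableT_comp.
by move=> N; have [M [M0 H]] := bf N; exists M; split => // x /H; rewrite normr_id.
Qed.

Lemma ri_bound f M s t : s <= t -> lbm f -> (forall x, s <= x <= t -> `|f x| <= M) ->
  `|ri f s t| <= M * (t - s).
Proof.
move=> st lf fM; apply: le_trans (ri_abs _ _ lf) _; rewrite -ri_cst//.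
by apply: ri_le => //; [exact: lbm_abs|exact: lbm_cst].
Qed.

Lemma ri_pt f s : ri f s s = 0.
Proof. by rewrite /ri set_itv1 Rintegral_set1. Qed.

Lemma ri_cat f s t u : lbm f -> s <= t -> t <= u -> ri f s u = ri f s t + ri f t u.
Proof.
move=> lf st tu; rewrite /ri.
have := @Rintegral_itvB R f (BLeft s) (BRight u) t (lbm_integrable s u lf).
rewrite !bnd_simp => /(_ st tu).
rewrite [X in _ = X](@Rintegral_itv_obnd_cbnd R t (BRight u) f).
  by move=> <-; rewrite subrKC.
apply: integrableS (lbm_integrable t u lf) => //.
by apply: subset_itvr; rewrite bnd_simp.
Qed.

(* Replaces differentiation, unavailable for merely locally Lipschitz functions. *)
Lemma quad_increment_cst (h : R -> R) (T C : R) : 0 <= T -> 0 <= C ->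
  (forall s t : R, 0 <= s -> s <= t -> t <= T -> `|h t - h s| <= C * (t - s) ^+ 2) ->
  h T = h 0.
Proof.
move=> T0 C0 H; apply/eqP; rewrite -subr_eq0 -normr_le0.
apply/ler_addgt0Pl => e e0; rewrite addr0.
have [n Hn] : exists n : nat, C * T ^+ 2 / n.+1%:R < e.
  have [n _ /(_ n)/=] := near_infty_natSinv_lt (PosNum (divr_gt0 e0 (ltr_wpDl (mulr_ge0 C0 (sqr_ge0 T)) (@ltr01 R)))).
  move=> /(_ (leqnn _)) h'; exists n.
  rewrite (le_lt_trans _ (_ : (C * T ^+ 2 + 1) * n.+1%:R^-1 < e))//.
    by rewrite ler_wpM2r// lerDl.
  by rewrite mulrC -ltr_pdivlMr// ltr_wpDl// mulr_ge0// sqr_ge0.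
apply: le_trans (ltW Hn).
(* Each of the n+1 cells of length T/(n+1) contributes at most C (T/(n+1))^2, so the total increment
   is at most C T^2/(n+1). *)
have step k : (k <= n.+1)%N ->
    `|h (k%:R * (T / n.+1%:R)) - h 0| <= k%:R * (C * (T / n.+1%:R) ^+ 2).
  elim: k => [|k ih] kn; first by rewrite !mul0r subrr normr0.
  have k0 : 0 <= k%:R * (T / n.+1%:R) by rewrite mulr_ge0// divr_ge0.
  have kk : k.+1%:R * (T / n.+1%:R) - k%:R * (T / n.+1%:R) = T / n.+1%:R.
    by rewrite -mulrBl -natrB// subSnn mul1r.
  have kle : k%:R * (T / n.+1%:R) <= k.+1%:R * (T / n.+1%:R).
    by rewrite -subr_ge0 kk divr_ge0.
  have kT : k.+1%:R * (T / n.+1%:R) <= T.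
    by rewrite mulrCA ler_piMr// ler_pdivrMr// mul1r ler_nat.
  have := H _ _ k0 kle kT; rewrite kk => hk.
  rewrite -(subrK (h (k%:R * (T / n.+1%:R))) (h (k.+1%:R * _))) -addrA.
  rewrite (le_trans (ler_normD _ _))//.
  have -> : k.+1%:R * (C * (T / n.+1%:R) ^+ 2) =
      C * (T / n.+1%:R) ^+ 2 + k%:R * (C * (T / n.+1%:R) ^+ 2) by rewrite -natr1; ring.
  rewrite lerD//.
  by apply: ih; exact: ltnW.
have := step n.+1 (leqnn _).
rewrite mulrCA divff// mulr1 => /le_trans; apply.
by rewrite le_eqVlt; apply/orP; left; apply/eqP; field.
Qed.

(** Product rule for functions given as integrals. The defect between s and t is the integral of
    a'(r) (b t - b r) + b'(r) (a s - a r), which is of order (t - s)^2, so that [quad_increment_cst]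
    applies. *)
Lemma ri_mul (a a' b b' : R -> R) (T : R) : 0 <= T -> lbm a -> lbm b -> lbm a' -> lbm b' ->
  (forall t, 0 <= t <= T -> a t = a 0 + ri a' 0 t) ->
  (forall t, 0 <= t <= T -> b t = b 0 + ri b' 0 t) ->
  a T * b T = a 0 * b 0 + ri (fun r => a' r * b r + a r * b' r) 0 T.
Proof.
move=> T0 la lb la' lb' aE bE.
have incr (f f' : R -> R) : lbm f' -> (forall t, 0 <= t <= T -> f t = f 0 + ri f' 0 t) ->
    forall s t, 0 <= s -> s <= t -> t <= T -> f t - f s = ri f' s t.
  move=> lf' fE s t s0 st tT; rewrite fE ?(le_trans s0 st)// (fE s) ?s0 ?(le_trans st tT)//.
  by rewrite (ri_cat lf' s0 st); ring.
have [M [M0 HM]] : exists M : R, 0 <= M /\ forall x : R, 0 <= x <= T -> `|a' x| <= M /\ `|b' x| <= M.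
  have [Ma [Ma0 Ha]] := la'.2 T; have [Mb [Mb0 Hb]] := lb'.2 T.
  exists (Ma + Mb); split; first exact: addr_ge0.
  move=> x /andP[x0 xT]; have xT' : `|x| <= T by rewrite ger0_norm.
  by split; [rewrite (le_trans (Ha _ xT'))// lerDl|rewrite (le_trans (Hb _ xT'))// lerDr].
have lab : lbm (fun r => a' r * b r + a r * b' r) by apply: lbmD; apply: lbmM.
pose h t := a t * b t - ri (fun r => a' r * b r + a r * b' r) 0 t.
suff : h T = h 0 by rewrite /h ri_pt subr0 => /eqP; rewrite subr_eq => /eqP.
apply: (@quad_increment_cst h T (M * M + M * M) T0).
  by rewrite addr_ge0// mulr_ge0.
move=> s t s0 st tT.
have ia := incr _ _ la' aE; have ib := incr _ _ lb' bE.
have -> : h t - h s = ri (fun r => a' r * (b t - b r) + b' r * (a s - a r)) s t.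
  rewrite /h (ri_cat lab s0 st).
  have -> : ri (fun r => a' r * (b t - b r) + b' r * (a s - a r)) s t =
     ri (fun r => (b t * a' r + a s * b' r) - (a' r * b r + a r * b' r)) s t.
    by apply: ri_eq => r _; ring.
  rewrite riB ?riD ?riZ//; try (by do ?[apply: lbmD | apply: lbmM | exact: lbm_cst]).
  by rewrite -ia// -ib//; ring.
have bd (f f' : R -> R) : lbm f' -> (forall x, 0 <= x <= T -> `|f' x| <= M) ->
   (forall s t : R, 0 <= s -> s <= t -> t <= T -> f t - f s = ri f' s t) ->
   forall u v, 0 <= u -> u <= v -> v <= T -> `|f v - f u| <= M * (v - u).
  move=> lf' fM fi u v u0 uv vT; rewrite fi//; apply: ri_bound => // x /andP[ux xv].
  by apply: fM; rewrite (le_trans u0 ux) (le_trans xv vT).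
have -> : (M * M + M * M) * (t - s) ^+ 2 = ((M * M + M * M) * (t - s)) * (t - s) by ring.
apply: ri_bound => //.
  apply: lbmD; apply: lbmM => //; apply: lbmD; try exact: lbm_cst; exact: lbmN.
move=> x /andP[sx xt].
have x0T : 0 <= x <= T by rewrite (le_trans s0 sx) (le_trans xt tT).
have [/andP[x0 xT] [a'M b'M]] := (x0T, HM _ x0T).
rewrite (le_trans (ler_normD _ _))// !normrM mulrDl lerD//.
  rewrite -mulrA ler_pM// (le_trans (bd _ _ lb' (fun x hx => (HM x hx).2) ib x t x0 xt tT))//.
  by rewrite ler_wpM2l// lerB.
rewrite -mulrA ler_pM// distrC (le_trans (bd _ _ la' (fun x hx => (HM x hx).1) ia s x s0 sx xT))//.
by rewrite ler_wpM2l// lerB.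
Qed.

End locally_bounded.

(** * Moments of the one-dimensional Gaussian *)

Section gauss_moments.
Context (R : realType).
Notation mR := (measurableTypeR R).
Notation leb := (@lebesgue_measure R).

Let G (x : R) : R := expR (- (x ^+ 2 / 2)).

Let continuousG : continuous G.
Proof.
move=> x; apply: (@continuous_comp _ _ _ (fun x : R => - (x ^+ 2 / 2)) expR).
  by apply: cvgN; apply: cvgM; [exact: exprn_continuous|exact: cvg_cst].
exact: continuous_expR.
Qed.

Let is_deriveG (x : R) : is_derive x (1 : R) G (- x * G x).
Proof.
have -> : G = expR \o (fun x : R => - (x ^+ 2 / 2)) by [].
apply: is_derive_eq; rewrite /GRing.scale/= /GRing.scale/= /G; field => //.
Qed.

Let tailG (k n : nat) : (0 < n)%N ->
  n%:R ^+ k.+1 * G n%:R <= (k.+1`!)%:R * 2 ^+ k.+1 * n%:R^-1.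
Proof.
move=> n0; have n0' : 0 < n%:R :> R by rewrite ltr0n.
rewrite /G expRN ler_pdivrMr ?expR_gt0//.
have := @expR_ge1Dxn R (n%:R ^+ 2 / 2) k.
have h0 : 0 <= n%:R ^+ 2 / 2 :> R by rewrite divr_ge0// sqr_ge0.
move=> /(_ h0) h.
apply: (@le_trans _ _ (k.+1`!%:R * 2 ^+ k.+1 / n%:R * ((n%:R ^+ 2 / 2) ^+ k.+1 / k.+1`!%:R))).
  rewrite (_ : k.+1`!%:R * 2 ^+ k.+1 / n%:R * _ = n%:R ^+ k.+1 * n%:R ^+ k).
    by rewrite ler_peMr ?exprn_ge0 ?ler0n// exprn_ege1// ler1n.
  have f0 : k.+1`!%:R != 0 :> R by rewrite pnatr_eq0 -lt0n fact_gt0.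
  have t0 : 2 ^+ k.+1 != 0 :> R by rewrite expf_neq0.
  rewrite exprMn exprVn [n%:R ^+ 2]expr2 exprMn [n%:R ^+ k.+1]exprS.
  field.
  by rewrite f0 t0 lt0r_neq0.
rewrite ler_wpM2l//.
by apply: le_trans h; rewrite lerDr.
Qed.

Let cvg_tailG (k : nat) : (fun n => n%:R ^+ k.+1 * G n%:R) @ \oo --> (0 : R).
Proof.
apply: (@squeeze_cvgr _ _ _ _ (cst 0) (fun n => (k.+1`!)%:R * 2 ^+ k.+1 * n%:R^-1)).
- near=> n; apply/andP; split; first by rewrite mulr_ge0 ?exprn_ge0 ?expR_ge0.
  by apply: tailG; near: n; exact: nbhs_infty_gt.
- exact: cvg_cst.
- rewrite -[X in _ --> X](mulr0 ((k.+1`!)%:R * 2 ^+ k.+1)).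
  by apply: cvgMr; rewrite -cvg_shiftS; exact: cvg_harmonic.
Unshelve. all: by end_near. Qed.

Let contXG (k : nat) : continuous (fun x : R => x ^+ k * G x).
Proof. by move=> x; apply: cvgM; [exact: exprn_continuous|exact: continuousG]. Qed.

Let is_deriveXG (k : nat) (x : R) :
  is_derive x (1 : R) (fun x => - (x ^+ k.+1 * G x)) (x ^+ k.+2 * G x - k.+1%:R * (x ^+ k * G x)).
Proof.
have -> : (fun x => - (x ^+ k.+1 * G x)) = - ((@GRing.exp R ^~ k.+1) * G) by [].
have dX : is_derive x (1 : R) (@GRing.exp R ^~ k.+1) (k.+1%:R * x ^+ k).
  have -> : (@GRing.exp R ^~ k.+1) = (@id R) ^+ k.+1 by apply/funext => y; rewrite exprfctE.
  by apply: is_derive_eq; rewrite /GRing.scale/= mulr1.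
apply: (is_derive_eq (is_deriveN (is_deriveM dX (is_deriveG x)))).
by rewrite /GRing.scale/= !exprS; ring.
Qed.

(** Integration by parts on [0, n] with the primitive - x^(k+1) G(x): the boundary term vanishes at
    0 and tends to 0 at n. On the half line all integrands are nonnegative, so monotone convergence
    gives the limit before any moment is known to be finite. *)
Lemma half_gauss_moment (k : nat) :
  (\int[leb]_(x in `[0%R, +oo[) (x ^+ k.+2 * G x)%:E =
   k.+1%:R%:E * \int[leb]_(x in `[0%R, +oo[) (x ^+ k * G x)%:E)%E.
Proof.
have ge0 (j : nat) (n : R) x : `[0, n]%classic x -> (0 <= (x ^+ j * G x)%:E)%E.
  by rewrite /= in_itv/= => /andP[x0 _]; rewrite lee_fin mulr_ge0 ?exprn_ge0 ?expR_ge0.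
have cv (j : nat) : (fun n : nat => \int[leb]_(x in `[0%R, n%:R%R]) (x ^+ j * G x)%:E)%E @ \oo -->
    (\int[leb]_(x in `[0%R, +oo[) (x ^+ j * G x)%:E)%E.
  rewrite (_ : [set` `[0%R, +oo[] = \bigcup_i `[0%R, i%:R]%classic); last first.
    apply/seteqP; split => x /=; rewrite in_itv/= ?andbT => x0.
      exists (`|Num.ceil x|%N) => //=; rewrite in_itv/= x0/= natr_absz ger0_norm ?ceil_ge0 ?ceil_ge//.
      by rewrite (lt_le_trans _ x0)// ltrN10.
    by move: x0 => -[i _ /=]; rewrite in_itv/= => /andP[].
  apply: ge0_nondecreasing_set_cvg_integral => //.
  - move=> m n mn; apply/subsetPset => x /=; rewrite !in_itv/= => /andP[-> /le_trans]; apply.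
    by rewrite ler_nat.
  - move=> i; apply/measurable_EFinP/measurable_funTS.
    exact: continuous_measurable_fun.
  - by move=> i x; exact: ge0.
have fin (j n : nat) : (\int[leb]_(x in `[0%R, n%:R%R]) (x ^+ j * G x)%:E =
    (ri (fun x => x ^+ j * G x) 0 n%:R)%:E)%E.
  rewrite /ri /Rintegral fineK//; apply: integrable_fin_num => //.
  by apply: lbm_integrable; exact: continuous_lbm.
have key (n : nat) : (0 < n)%N ->
   ri (fun x => x ^+ k.+2 * G x) 0 n%:R + n%:R ^+ k.+1 * G n%:R =
   k.+1%:R * ri (fun x => x ^+ k * G x) 0 n%:R.
  move=> n0; have n0' : (0 : R) < n%:R by rewrite ltr0n.
  have lb j : lbm (fun x : R => x ^+ j * G x) by exact: continuous_lbm.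
  have cF : continuous (fun x : R => - (x ^+ k.+1 * G x)).
    by move=> x; apply: cvgN; exact: contXG.
  have := @continuous_FTC2 R (fun x => x ^+ k.+2 * G x - k.+1%:R * (x ^+ k * G x))
     (fun x => - (x ^+ k.+1 * G x)) 0 n%:R n0'.
  have H1 : {within `[0, n%:R], continuous (fun x => x ^+ k.+2 * G x - k.+1%:R * (x ^+ k * G x))}.
    apply: continuous_subspaceT => x; apply: cvgB; first exact: contXG.
    by apply: cvgM; [exact: cvg_cst|exact: contXG].
  have H2 : derivable_oo_LRcontinuous (fun x : R => - (x ^+ k.+1 * G x)) 0 n%:R.
    split; first by move=> x _; exact: (@ex_derive _ _ _ _ _ _ _ (is_deriveXG k x)).
      by apply: cvg_at_right_filter; exact: cF.
    by apply: cvg_at_left_filter; exact: cF.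
  have H3 : {in `]0, n%:R[, (fun x : R => - (x ^+ k.+1 * G x))^`()%classic =1 (fun x => x ^+ k.+2 * G x - k.+1%:R * (x ^+ k * G x))}.
    by move=> x _; rewrite derive1E; exact: (@derive_val _ _ _ _ _ _ _ (is_deriveXG k x)).
  move=> /(_ H1 H2 H3); have -> : (0 : R) ^+ k.+1 * G 0 = 0 by rewrite exprS !mul0r.
  rewrite oppr0 sube0.
  move=> /(congr1 fine) /=; rewrite -/(Rintegral _ _ _) -/(ri _ _ _).
  rewrite riB ?riZ//; last by apply: lbmM => //; exact: lbm_cst.
  by move=> h; lra.
have c1 : (fun n : nat => \int[leb]_(x in `[0%R, n%:R%R]) (x ^+ k.+2 * G x)%:E +
    (n%:R ^+ k.+1 * G n%:R)%:E)%E @ \oo -->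
    (\int[leb]_(x in `[0%R, +oo[) (x ^+ k.+2 * G x)%:E + 0)%E.
  apply: cvgeD; [exact: fin_num_adde_defl|exact: cv|].
  by apply/fine_cvgP; split; [exact: nearW|exact: cvg_tailG].
have c2 : (fun n : nat => k.+1%:R%:E * \int[leb]_(x in `[0%R, n%:R%R]) (x ^+ k * G x)%:E)%E @ \oo -->
    (k.+1%:R%:E * \int[leb]_(x in `[0%R, +oo[) (x ^+ k * G x)%:E)%E.
  by apply: cvgeZl => //; exact: cv.
rewrite adde0 in c1.
apply: (@cvg_unique _ (@ereal_hausdorff R) _ _ _ _ _ c2).
apply: cvg_trans c1; apply: near_eq_cvg.
near=> n.
rewrite !fin -EFinD -EFinM key//.
by near: n; exact: nbhs_infty_gt.
Unshelve. all: by end_near. Qed.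

Notation N := (normal_prob (0 : R) 1).

Lemma ge0_integral_normal (f : R -> \bar R) : measurable_fun [set: mR] f -> (forall x, 0 <= f x)%E ->
  (\int[N]_x f x = (normal_peak 1)%:E * \int[leb]_x (f x * (G x)%:E))%E.
Proof.
move=> mf f0.
have mG : measurable_fun [set: mR] G by exact: continuous_measurable_fun.
have pE x : normal_pdf (0 : R) 1 x = normal_peak 1 * G x.
  rewrite normal_pdfE ?oner_neq0//; congr (_ * expR _).
  by rewrite subr0 expr1n mulr2n mulNr.
rewrite (@ge0_integral_density _ _ _ leb N (normal_pdf 0 1))//.
- rewrite -ge0_integralZl//.
  + by apply: eq_integral => x _; rewrite pE EFinM muleCA.
  + by apply: emeasurable_funM => //; exact/measurable_EFinP.
  + by move=> x _; rewrite mule_ge0// lee_fin expR_ge0.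
  + by rewrite lee_fin normal_peak_ge0.
- exact: measurable_normal_pdf.
- exact: normal_pdf_ge0.
Qed.

Lemma ge0_integral_normalN (f : R -> \bar R) : measurable_fun [set: mR] f -> (forall x, 0 <= f x)%E ->
  (\int[N]_x f (- x)%R = \int[N]_x f x)%E.
Proof.
move=> mf f0.
have mG : measurable_fun [set: mR] G by exact: continuous_measurable_fun.
have mfN : measurable_fun [set: mR] (fun x => f (- x)%R).
  by apply: measurableT_comp => //; exact: oppr_measurable.
rewrite !ge0_integral_normal//; congr (_ * _)%E.
have m2 : measurable_fun [set: mR] (fun x => f x * (G x)%:E)%E by apply: emeasurable_funM => //; exact/measurable_EFinP.
have p2 x : (0 <= f x * (G x)%:E)%E by rewrite mule_ge0// lee_fin expR_ge0.
rewrite -(ge0_integral_lebesgueN m2 p2).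
by apply: eq_integral => x _; rewrite /G sqrrN.
Qed.

Lemma normal_even_moment (k : nat) : ~~ odd k ->
  (\int[N]_x (x ^+ k.+2)%:E = k.+1%:R%:E * \int[N]_x (x ^+ k)%:E)%E.
Proof.
move=> ek.
have mX j : measurable_fun [set: mR] (fun x : R => (x ^+ j)%:E).
  by apply/measurable_EFinP; exact: exprn_measurable.
have X0 j (x : R) : ~~ odd j -> (0 <= (x ^+ j)%:E)%E.
  by move=> ej; rewrite lee_fin exprn_even_ge0.
have full j : ~~ odd j -> (\int[N]_x (x ^+ j)%:E = (normal_peak 1)%:E * (2%:E * \int[leb]_(x in `[0%R, +oo[) (x ^+ j * G x)%:E))%E.
  move=> ej; rewrite ge0_integral_normal//; last by move=> x; exact: X0.
  congr (_ * _)%E; under eq_integral do rewrite -EFinM.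
  rewrite (@ge0_symfun_integralT R (fun x => x ^+ j * G x)).
  - congr (_ * _)%E; rewrite (_ : [set x : R | 0 <= x] = `[0%R, +oo[%classic)//.
    by apply/seteqP; split => x /=; rewrite in_itv/= andbT.
  - by move=> x; rewrite mulr_ge0 ?expR_ge0// exprn_even_ge0.
  - exact: contXG.
  - by move=> x /=; rewrite /G sqrrN exprNn -signr_odd (negbTE ej) expr0 mul1r.
rewrite !full//= ?negbK// half_gauss_moment.
by rewrite (muleCA 2%:E) [LHS]muleCA.
Qed.

Lemma normal_moment2 : (\int[N]_x (x ^+ 2)%:E = 1)%E.
Proof.
rewrite normal_even_moment// mul1e.
by under eq_integral do rewrite expr0; rewrite integral_cst//= probability_setT mule1.
Qed.

Lemma normal_moment4 : (\int[N]_x (x ^+ 4)%:E = 3%:E)%E.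
Proof. by rewrite normal_even_moment// normal_moment2 mule1. Qed.

Let int4 (f : R -> R) : measurable_fun [set: mR] f -> (forall x, `|f x| <= 1 + x ^+ 4) ->
  N.-integrable setT (EFin \o f).
Proof.
move=> mf f4.
have i4 : N.-integrable setT (EFin \o (fun x : R => x ^+ 4)).
  apply/integrableP; split; first by apply/measurable_EFinP; exact: exprn_measurable.
  under eq_integral do rewrite /= ger0_norm ?exprn_even_ge0//.
  by rewrite normal_moment4 ltry.
have i1 : N.-integrable setT (EFin \o (fun x : R => 1)).
  exact: finite_measure_integrable_cst.
have : N.-integrable setT (EFin \o (fun x : R => 1 + x ^+ 4)) by apply: integrableD i1 i4.
apply: le_integrable => //; first exact/measurable_EFinP.
move=> x _; have h0 : 0 <= 1 + x ^+ 4 by rewrite addr_ge0// exprn_even_ge0.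
by rewrite /= lee_fin (ger0_norm h0).
Qed.

Let pow4 (x : R) (j : nat) : (j <= 4)%N -> `|x ^+ j| <= 1 + x ^+ 4.
Proof.
move=> j4; have y0 : 0 <= `|x| by [].
have -> : x ^+ 4 = `|x| ^+ 4 by rewrite -normrX ger0_norm// exprn_even_ge0.
rewrite normrX; have [y1|y1] := leP `|x| 1.
  by rewrite (le_trans (exprn_ile1 _ y0 y1))// lerDl exprn_ge0.
by rewrite (le_trans (ler_weXn2l (ltW y1) j4))// lerDr.
Qed.

Lemma normal_quadratic (h b q : R) :
  (\int[N]_t ((h * t ^+ 2 + b * t + q) ^+ 2)%:E = (3 * h ^+ 2 + b ^+ 2 + 2 * h * q + q ^+ 2)%:E)%E.
Proof.
have iX j : (j <= 4)%N -> N.-integrable setT (EFin \o (fun x : R => x ^+ j)).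
  move=> j4; apply: int4; first exact: exprn_measurable.
  by move=> x; exact: pow4.
pose m j := Rintegral N setT (fun x : R => x ^+ j).
have m0 : m 0%N = 1.
  rewrite /m /Rintegral; under eq_integral do rewrite expr0.
  by rewrite integral_cst//= probability_setT mule1.
have m2 : m 2 = 1 by rewrite /m /Rintegral normal_moment2.
have m4 : m 4 = 3 by rewrite /m /Rintegral normal_moment4.
have expand (h' b' q' : R) : (\int[N]_t ((h' * t ^+ 2 + b' * t + q') ^+ 2)%:E =
   (h' ^+ 2 * m 4 + 2 * h' * b' * m 3 + (b' ^+ 2 + 2 * h' * q') * m 2 + 2 * b' * q' * m 1%N + q' ^+ 2 * m 0%N)%:E)%E.
  have iZ c j : (j <= 4)%N -> N.-integrable setT (EFin \o (fun x : R => c * x ^+ j)).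
    by move=> j4; exact: integrableZl (iX _ j4).
  have iD f g : N.-integrable setT (EFin \o f) -> N.-integrable setT (EFin \o g) ->
     N.-integrable setT (EFin \o (fun x : R => f x + g x)).
    by move=> i j; exact: (integrableD _ i j).
  transitivity (\int[N]_t (h' ^+ 2 * t ^+ 4 + 2 * h' * b' * t ^+ 3 + (b' ^+ 2 + 2 * h' * q') * t ^+ 2 + 2 * b' * q' * t ^+ 1 + q' ^+ 2 * t ^+ 0)%:E)%E.
    by apply: eq_integral => t _; congr EFin; ring.
  rewrite -[LHS]fineK; last by apply: integrable_fin_num => //; do !apply: (iD); exact: iZ.
  congr EFin; rewrite -/(Rintegral _ _ _).
  by rewrite !RintegralD// ?RintegralZl//; try (do !apply: (iD)); try exact: iZ; exact: iX.
have symm (h' b' q' : R) : (\int[N]_t ((h' * t ^+ 2 + (- b') * t + q') ^+ 2)%:E = \int[N]_t ((h' * t ^+ 2 + b' * t + q') ^+ 2)%:E)%E.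
  rewrite -[RHS]ge0_integral_normalN.
  - by apply: eq_integral => t _; rewrite sqrrN mulrN mulNr.
  - apply/measurable_EFinP; apply: measurable_funX.
    apply: measurable_funD => //; apply: measurable_funD.
      by apply: measurable_funM => //; exact: exprn_measurable.
    exact: mulrl_measurable.
  - by move=> x; rewrite lee_fin sqr_ge0.
(* The odd moments follow from the symmetry t -> -t of the normal law: (t + 1)^2 isolates the first
   one, and (t^2 + t)^2 then the third. *)
have m1 : m 1%N = 0.
  have := symm 0 1 1; rewrite !expand => -[]; rewrite m0 m2 m4 => hh; lra.
have m3 : m 3 = 0.
  have := symm 1 1 0; rewrite !expand => -[]; rewrite m0 m2 m4 m1 => hh; lra.
rewrite expand m0 m1 m2 m3 m4; congr EFin; ring.
Qed.

End gauss_moments.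

(** * The standard Gaussian in dimension d *)

Section gaussian_measure.
Context (R : realType).
Notation mR := (measurableTypeR R).

Lemma std_gauss_setT d : std_gauss R d [set: 'rV[R]_d] = 1%E.
Proof.
have E1 (nu : {sigma_finite_measure set 'rV[R]_d -> \bar R}) : nu setT = (\int[nu]_x (cst 1%E) x)%E.
  by rewrite integral_cst// mul1e.
rewrite {}E1; elim: d => [|d ih].
  by rewrite /std_gauss integral_prod_measure0.
rewrite /std_gauss ge0_integral_prod_measureS//.
rewrite -/(std_gauss R d) -[RHS]ih; apply: eq_integral => y _.
rewrite /= (integral_cst (normal_prob 0 1) measurableT 1%E) mul1e.
exact: (probability_setT (normal_prob (0 : R) 1)).
Qed.

(** The same measure as [std_gauss], under a name that can carry the structure of a probability
    measure. *)
Definition gaussm d : set 'rV[R]_d -> \bar R := std_gauss R d.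
HB.instance Definition _ d := Measure.on (@gaussm d).
HB.instance Definition _ d :=
  @Measure_isProbability.Build _ _ R (@gaussm d) (@std_gauss_setT d).

Lemma integral_gaussmE d (f : 'rV[R]_d -> \bar R) :
  (\int[std_gauss R d]_v f v = \int[@gaussm d]_v f v)%E.
Proof. by []. Qed.

Lemma dotv_cons d (t : mR) (y : 'rV[R]_d) (a : 'rV[R]_d.+1) :
  dotv (rV_cons (t, y)) a = t * a ord0 ord0 + dotv y (\row_j a ord0 (lift ord0 j)).
Proof.
rewrite /dotv big_ord_recl rV_consE0; congr (_ + _).
by apply: eq_bigr => j _; rewrite rV_consEl !mxE.
Qed.

Lemma dotvS d (a : 'rV[R]_d.+1) :
  dotv a a = a ord0 ord0 ^+ 2 + dotv (\row_j a ord0 (lift ord0 j)) (\row_j a ord0 (lift ord0 j)).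
Proof.
rewrite /dotv big_ord_recl; congr (_ + _).
by apply: eq_bigr => j _; rewrite !mxE.
Qed.

Lemma measurable_dotv_cst d (a : 'rV[R]_d) :
  measurable_fun [set: 'rV[R]_d] (fun v => dotv v a).
Proof. by apply: measurable_dotv => //; exact: measurable_id. Qed.

Lemma gauss_affine_sqr d (a : 'rV[R]_d) (c : R) :
  (\int[@gaussm d]_v ((dotv v a + c) ^+ 2)%:E = (dotv a a + c ^+ 2)%:E)%E.
Proof.
rewrite -integral_gaussmE.
elim: d => [|d ih] in a c *.
  rewrite integral_prod_measure0.
    by rewrite /dotv !big_ord0 !add0r.
  apply/measurable_EFinP; apply: measurable_funX; apply: measurable_funD => //.
  exact: measurable_dotv_cst.
rewrite /std_gauss ge0_integral_prod_measureS; last 2 first.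
- apply/measurable_EFinP; apply: measurable_funX; apply: measurable_funD => //.
  exact: measurable_dotv_cst.
- by move=> x; rewrite lee_fin sqr_ge0.
set a' := \row_j a ord0 (lift ord0 j).
have inner (y : 'rV[R]_d) : (\int[normal_prob 0 1]_t ((dotv (rV_cons (t, y)) a + c) ^+ 2)%:E =
    (a ord0 ord0 ^+ 2)%:E + ((dotv y a' + c) ^+ 2)%:E)%E.
  rewrite -EFinD -[RHS]/((a ord0 ord0 ^+ 2 + (dotv y a' + c) ^+ 2)%:E).
  have := normal_quadratic 0 (a ord0 ord0) (dotv y a' + c).
  rewrite (_ : 3 * _ + _ + _ + _ = a ord0 ord0 ^+ 2 + (dotv y a' + c) ^+ 2); last by ring.
  move=> <-; apply: eq_integral => t _; congr EFin; rewrite dotv_cons; ring.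
under eq_integral do rewrite inner.
rewrite -/(std_gauss R d) ge0_integralD//.
- rewrite ih integral_cst// [X in (_ * X)%E]std_gauss_setT mule1 -EFinD; congr EFin.
  by rewrite [in RHS]dotvS addrA.
- by move=> x _; rewrite lee_fin sqr_ge0.
- by move=> x _; rewrite lee_fin sqr_ge0.
- apply/measurable_EFinP; apply: measurable_funX; apply: measurable_funD => //.
  exact: measurable_dotv_cst.
Qed.

Definition qform d (H : 'M[R]_d) (v : 'rV[R]_d) : R := \sum_i \sum_j v ord0 i * H i j * v ord0 j.

Definition frob d (H : 'M[R]_d) : R := \sum_i \sum_j H i j ^+ 2.

Lemma measurable_qform d (H : 'M[R]_d) : measurable_fun [set: 'rV[R]_d] (qform H).
Proof.
apply: measurable_sum => i; apply: measurable_sum => j.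
apply: measurable_funM; last exact: measurable_rV_coord.
by apply: measurable_funM => //; exact: measurable_rV_coord.
Qed.

(** Induction on the dimension: for fixed y the form is a quadratic polynomial in the first
    coordinate, integrated by [normal_quadratic]. The exact variance is twice the squared Frobenius
    norm of the symmetric part of H; the only loss is (p + q)^2 <= 2 p^2 + 2 q^2 on pairs of
    off-diagonal entries. *)
Lemma gauss_qform_sqr d (H : 'M[R]_d) (c : R) :
  (\int[@gaussm d]_v ((qform H v + c) ^+ 2)%:E <= ((\tr H + c) ^+ 2 + 2 * frob H)%:E)%E.
Proof.
rewrite -integral_gaussmE.
elim: d => [|d ih] in H c *.
  rewrite integral_prod_measure0.
    by rewrite /qform /frob /mxtrace !big_ord0 mulr0 addr0.
  apply/measurable_EFinP; apply: measurable_funX; apply: measurable_funD => //.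
  exact: measurable_qform.
rewrite /std_gauss ge0_integral_prod_measureS; last 2 first.
- apply/measurable_EFinP; apply: measurable_funX; apply: measurable_funD => //.
  exact: measurable_qform.
- by move=> x; rewrite lee_fin sqr_ge0.
pose H' : 'M[R]_d := \matrix_(i, j) H (lift ord0 i) (lift ord0 j).
pose r : 'rV[R]_d := \row_j (H ord0 (lift ord0 j) + H (lift ord0 j) ord0).
pose h := H ord0 ord0.
have qE (t : mR) (y : 'rV[R]_d) : qform H (rV_cons (t, y)) = h * t ^+ 2 + dotv y r * t + qform H' y.
  rewrite /qform big_ord_recl big_ord_recl rV_consE0.
  have -> : \sum_(i < d) t * H ord0 (lift ord0 i) * rV_cons (t, y) ord0 (lift ord0 i) =
     \sum_(i < d) (H ord0 (lift ord0 i) * y ord0 i) * t.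
    by apply: eq_bigr => i _; rewrite rV_consEl; ring.
  have -> : \sum_(i < d) \sum_j rV_cons (t, y) ord0 (lift ord0 i) * H (lift ord0 i) j * rV_cons (t, y) ord0 j =
     \sum_(i < d) (H (lift ord0 i) ord0 * y ord0 i) * t + qform H' y.
    rewrite /qform -big_split/=; apply: eq_bigr => i _.
    rewrite big_ord_recl rV_consE0 !rV_consEl; congr (_ + _); first by ring.
    by apply: eq_bigr => j _; rewrite rV_consEl !mxE.
  have -> : dotv y r * t = \sum_(i < d) (H ord0 (lift ord0 i) * y ord0 i) * t + \sum_(i < d) (H (lift ord0 i) ord0 * y ord0 i) * t.
    rewrite -big_split/= mulr_suml; apply: eq_bigr => i _; rewrite !mxE; ring.
  by rewrite -/(qform H' y) /h; ring.
have inner (y : 'rV[R]_d) : (\int[normal_prob 0 1]_t ((qform H (rV_cons (t, y)) + c) ^+ 2)%:E =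
    (2 * h ^+ 2)%:E + (((dotv y r + 0) ^+ 2)%:E + ((qform H' y + (c + h)) ^+ 2)%:E))%E.
  have := normal_quadratic h (dotv y r) (qform H' y + c).
  rewrite -!EFinD (_ : 3 * _ + _ + _ + _ = 2 * h ^+ 2 + ((dotv y r + 0) ^+ 2 + (qform H' y + (c + h)) ^+ 2)); last by ring.
  by move=> <-; apply: eq_integral => t _; congr EFin; rewrite qE; ring.
under eq_integral do rewrite inner.
have m1 : measurable_fun [set: 'rV[R]_d] (fun y => ((dotv y r + 0) ^+ 2)%:E).
  apply/measurable_EFinP; apply: measurable_funX; apply: measurable_funD => //.
  exact: measurable_dotv_cst.
have m2 : measurable_fun [set: 'rV[R]_d] (fun y => ((qform H' y + (c + h)) ^+ 2)%:E).
  apply/measurable_EFinP; apply: measurable_funX; apply: measurable_funD => //.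
  exact: measurable_qform.
rewrite -/(std_gauss R d) ge0_integralD//; last 3 first.
- by move=> x _; rewrite lee_fin mulr_ge0// sqr_ge0.
- by move=> x _; rewrite -EFinD lee_fin addr_ge0// sqr_ge0.
- exact: emeasurable_funD.
rewrite ge0_integralD//; last 2 first.
- by move=> x _; rewrite lee_fin sqr_ge0.
- by move=> x _; rewrite lee_fin sqr_ge0.
rewrite integral_cst// [X in (_ * X)%E]std_gauss_setT mule1.
rewrite [X in (_ + (X + _))%E](integral_gaussmE (fun y => ((dotv y r + 0) ^+ 2)%:E)) gauss_affine_sqr.
apply: (@le_trans _ _ ((2 * h ^+ 2)%:E + ((dotv r r + 0 ^+ 2)%:E + ((\tr H' + (c + h)) ^+ 2 + 2 * frob H')%:E)))%E.
  by rewrite !leeD2l// ih.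
rewrite -!EFinD lee_fin.
have trE : \tr H = h + \tr H'.
  by rewrite /mxtrace big_ord_recl; congr (_ + _); apply: eq_bigr => i _; rewrite mxE.
have frE : frob H = h ^+ 2 + \sum_(j < d) (H ord0 (lift ord0 j) ^+ 2 + H (lift ord0 j) ord0 ^+ 2) + frob H'.
  rewrite /frob big_ord_recl big_ord_recl big_split/= -!addrA; congr (_ + (_ + _)).
  rewrite -big_split/=; apply: eq_bigr => i _; rewrite big_ord_recl; congr (_ + _).
  by apply: eq_bigr => j _; rewrite mxE.
have rr : dotv r r <= 2 * \sum_(j < d) (H ord0 (lift ord0 j) ^+ 2 + H (lift ord0 j) ord0 ^+ 2).
  rewrite mulr_sumr; apply: ler_sum => j _; rewrite !mxE.
  set p := H _ _; set q := H _ _; rewrite -subr_ge0.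
  by rewrite (_ : _ - _ = (p - q) ^+ 2) ?sqr_ge0//; ring.
by rewrite trE frE; nra.
Qed.

Lemma ge0_integral_gaussN d (f : 'rV[R]_d -> \bar R) :
  measurable_fun [set: 'rV[R]_d] f -> (forall x, 0 <= f x)%E ->
  (\int[@gaussm d]_x f (- x)%R = \int[@gaussm d]_x f x)%E.
Proof.
move=> mf f0; rewrite -!integral_gaussmE.
by apply: ge0_integral_prod_measureN => // g; exact: ge0_integral_normalN.
Qed.

End gaussian_measure.
Arguments gaussm {R} d.

(** * Partial and directional derivatives *)

Section directional.
Context (R : realType) (d : nat).
Implicit Types (f : 'rV[R]_d -> R) (x v : 'rV[R]_d).

Lemma is_derive_line f x v s D : is_derive (x + s *: v) v f D ->
  is_derive s 1 (fun s => f (x + s *: v)) D.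
Proof.
move=> [df dE].
have E : (fun h => h^-1 *: (((fun s => f (x + s *: v)) \o shift s) (h *: (1 : R)) - f (x + s *: v))) =
         (fun h => h^-1 *: ((f \o shift (x + s *: v)) (h *: v) - f (x + s *: v))).
  apply/funext => h /=; congr (_ *: (f _ - _)).
  by rewrite [h *: 1]mulr1 scalerDl addrCA.
split; first by rewrite /derivable E.
by rewrite /derive E.
Qed.

(** The difference quotient is split into a displacement along v from x and one along e from x + h
    v. The mean value theorem writes the second as a value of g near x, so continuity of g at x
    concludes. Adding the coordinate directions one by one gives [is_derive_dir]. *)
Lemma is_deriveD_dir f (g : 'rV[R]_d -> R) (e : 'rV[R]_d) x v D c :
  (forall x, is_derive x e f (g x)) -> {for x, continuous g} ->
  is_derive x v f D -> is_derive x (v + c *: e) f (D + c * g x).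
Proof.
move=> fe cg [dv vE].
suff H : h^-1 *: ((f \o shift x) (h *: (v + c *: e)) - f x) @[h --> 0^'] --> (D + c * g x).
  split; first by apply/cvg_ex; exists (D + c * g x).
  exact/cvg_lim.
have E : (fun h : R => h^-1 *: ((f \o shift x) (h *: (v + c *: e)) - f x)) =
  (fun h => h^-1 *: ((f \o shift x) (h *: v) - f x) +
            h^-1 *: (f (x + h *: v + (h * c) *: e) - f (x + h *: v))).
  apply/funext => h /=; rewrite -scalerDr; congr (_ *: _).
  rewrite (_ : h *: (v + c *: e) + x = x + h *: v + (h * c) *: e).
    by rewrite (addrC (h *: v)); ring.
  by rewrite scalerDr scalerA addrC addrA.
rewrite E; apply: cvgD; first by rewrite -vE; exact: dv.
apply/cvgrPdist_le => eps eps0.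
have eps1 : 0 < eps / (`|c| + 1) by rewrite divr_gt0// ltr_wpDl.
have /cvgrPdist_lt /(_ _ eps1) := cg.
move=> /nbhs_ballP[r /= r0 Hr].
pose L := `|v| + `|c *: e| + 1.
have L0 : 0 < L by rewrite ltr_wpDl// addr_ge0.
have rL0 : 0 < r / L by rewrite divr_gt0.
near=> h.
have h0 : h != 0 by near: h; exact: nbhs_dnbhs_neq.
have hr : `|h| < r / L.
  near: h; exists (r / L) => //= z.
  by rewrite /ball_/= sub0r normrN.
pose G s := f (x + h *: v + s *: ((h * c) *: e)).
have dG (s : R) : is_derive s (1 : R) G (g (x + h *: v + ((h * c) * s) *: e) * (h * c)).
  have dH (u : R) : is_derive u (1 : R) (fun u => f (x + h *: v + u *: e)) (g (x + h *: v + u *: e)).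
    by apply: is_derive_line; exact: fe.
  have -> : G = (fun u => f (x + h *: v + u *: e)) \o ((h * c) \*: id).
    by apply/funext => t; rewrite /G/= scalerA mulrC.
  apply: is_derive1_comp; first exact: dH.
  by apply: is_derive_eq; rewrite /GRing.scale/= mulr1.
have cG : {within `[0, 1], continuous G}.
  apply: continuous_subspaceT => s.
  by apply: differentiable_continuous; apply/derivable1_diffP; exact: (@ex_derive _ _ _ _ _ _ _ (dG s)).
have [s /[!in_itv]/= /andP[s0 s1]] := @MVT_segment R G _ 0 1 ler01 (fun s _ => dG s) cG.
rewrite /G scale1r scale0r addr0 subr0 mulr1 => ->.
rewrite /GRing.scale/= mulrCA mulKf// mulrC -mulrBl normrM.
apply: (@le_trans _ _ (eps / (`|c| + 1) * `|c|)).
  rewrite ler_wpM2r// ltW//; apply: Hr.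
  rewrite -ball_normE; change (`|x - (x + h *: v + ((h * c) * s) *: e)| < r).
  rewrite opprD addrA opprD addrA subrr sub0r -opprD normrN.
  have E3 : `|((h * c) * s) *: e| = `|h| * `|c| * s * `|e|.
    by rewrite normrZ normrM normrM (ger0_norm s0).
  apply: (le_lt_trans (ler_normD _ _)); rewrite E3 normrZ.
  apply: (@le_lt_trans _ _ (`|h| * L)); last by rewrite -ltr_pdivlMr.
  rewrite /L !mulrDr mulr1 -addrA lerD// normrZ.
  rewrite (@le_trans _ _ (`|h| * (`|c| * `|e|)))// ?lerDl//.
  by rewrite mulrA ler_wpM2r// ler_piMr// mulr_ge0.
rewrite mulrAC ler_pdivrMr ?ltr_wpDl// ler_wpM2l// ?lerDl//.
exact: ltW.
Unshelve. all: by end_near. Qed.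

Lemma rV_sum_delta v : v = \sum_i v ord0 i *: delta_mx ord0 i.
Proof.
apply/rowP => j; rewrite summxE (bigD1 j)//= big1 ?addr0 => [|i ij].
  by rewrite !mxE !eqxx mulr1.
by rewrite !mxE eqxx eq_sym (negbTE ij) mulr0.
Qed.

Lemma is_derive_dir f (g : 'I_d -> 'rV[R]_d -> R) x v :
  (forall i x, is_derive x (delta_mx ord0 i) f (g i x)) -> (forall i, continuous (g i)) ->
  is_derive x v f (\sum_i v ord0 i * g i x).
Proof.
move=> fe cg; rewrite {1}(rV_sum_delta v).
elim/big_rec2: _ => [|i D w _ ih].
  have E : (fun h : R => h^-1 *: ((f \o shift x) (h *: (0 : 'rV[R]_d)) - f x)) = cst 0.
    by apply/funext => h /=; rewrite scaler0 add0r subrr scaler0.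
  split; first by rewrite /derivable E; exact: is_cvg_cst.
  by rewrite /derive E; apply/cvg_lim => //; exact: cvg_cst.
rewrite addrC [X in is_derive _ _ _ X]addrC.
apply: is_deriveD_dir => //; exact: cg.
Qed.

Lemma continuous_dir f (g : 'I_d -> 'rV[R]_d -> R) x v :
  (forall i x, is_derive x (delta_mx ord0 i) f (g i x)) -> (forall i, continuous (g i)) ->
  forall s : R, is_derive s (1 : R) (fun s => f (x + s *: v)) (\sum_i v ord0 i * g i (x + s *: v)).
Proof. by move=> fe cg s; apply: is_derive_line; exact: is_derive_dir. Qed.

Lemma mean_value_line f (g : 'rV[R]_d -> R) e x (h : R) : 0 <= h ->
  (forall x, is_derive x e f (g x)) ->
  exists2 s : R, 0 <= s <= h & f (x + h *: e) - f x = h * g (x + s *: e).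
Proof.
move=> h0 fe.
have dG (s : R) : is_derive s (1 : R) (fun s => f (x + s *: e)) (g (x + s *: e)).
  by apply: is_derive_line; exact: fe.
have cG : {within `[0, h], continuous (fun s => f (x + s *: e))}.
  apply: continuous_subspaceT => s.
  by apply: differentiable_continuous; apply/derivable1_diffP; exact: (@ex_derive _ _ _ _ _ _ _ (dG s)).
have [s /[!in_itv]/= sh] := @MVT_segment R _ _ 0 h h0 (fun s _ => dG s) cG.
by rewrite scale0r addr0 subr0 mulrC => E; exists s.
Qed.

(** The second difference of f over a parallelogram with sides h ei and h ej is evaluated by the
    mean value theorem in both orders. It equals h^2 times either mixed derivative at some point
    near x, and continuity at x identifies the two. *)
Lemma schwarz f (fi fj fij fji : 'rV[R]_d -> R) (ei ej : 'rV[R]_d) x :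
  (forall x, is_derive x ei f (fi x)) -> (forall x, is_derive x ej f (fj x)) ->
  (forall x, is_derive x ej fi (fij x)) -> (forall x, is_derive x ei fj (fji x)) ->
  {for x, continuous fij} -> {for x, continuous fji} -> fij x = fji x.
Proof.
move=> fei fej fiej fjei cij cji.
have key (a b : 'rV[R]_d) (p q r : 'rV[R]_d -> R) (h : R) : 0 < h ->
    (forall x, is_derive x a p (q x)) -> (forall x, is_derive x b q (r x)) ->
    exists s u : R, [/\ 0 <= s <= h, 0 <= u <= h &
      p (x + h *: a + h *: b) - p (x + h *: a) - (p (x + h *: b) - p x) =
      h * (h * r (x + s *: a + u *: b))].
  move=> h0 pa qb; have h0' := ltW h0.
  have d1 y : is_derive y a (fun y => p (y + h *: b) - p y) (q (y + h *: b) - q y).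
    apply: is_deriveB => //.
    have [e1 e2] := pa (y + h *: b).
    have E : (fun k : R => k^-1 *: (((fun y => p (y + h *: b)) \o shift y) (k *: a) - p (y + h *: b))) =
         (fun k => k^-1 *: ((p \o shift (y + h *: b)) (k *: a) - p (y + h *: b))).
      by apply/funext => k /=; rewrite addrA.
    split; first by rewrite /derivable E.
    by rewrite /derive E.
  have [s sh sE] := mean_value_line x h0' d1.
  have [u uh uE] := mean_value_line (x + s *: a) h0' qb.
  exists s, u; split => //.
  by rewrite -uE -sE; ring.
apply/eqP; rewrite -subr_eq0 -normr_le0; apply/ler_addgt0Pl => e e0; rewrite addr0.
have e2 : 0 < e / 2 by rewrite divr_gt0.
have /cvgrPdist_lt /(_ _ e2) /nbhs_ballP[r1 /= r10 H1] := cij.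
have /cvgrPdist_lt /(_ _ e2) /nbhs_ballP[r2 /= r20 H2] := cji.
pose L := `|ei| + `|ej| + 1.
have L0 : 0 < L by rewrite ltr_wpDl// addr_ge0.
(* Small enough for all points x + p ei + q ej with p, q in [0, h] to lie in both balls of
   continuity. *)
pose h := Num.min r1 r2 / (2 * L).
have m0 : 0 < Num.min r1 r2 by rewrite lt_min r10 r20.
have h0 : 0 < h by rewrite divr_gt0// mulr_gt0.
have [s [u [sh uh E1]]] := key ei ej f fi fij h h0 fei fiej.
have [s' [u' [sh' uh' E2]]] := key ej ei f fj fji h h0 fej fjei.
have close (a b : 'rV[R]_d) (p q : R) : `|a| + `|b| + 1 = L -> 0 <= p <= h -> 0 <= q <= h ->
    forall r : R, Num.min r1 r2 <= r -> ball x r (x + p *: a + q *: b).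
  move=> abL /andP[p0 p1] /andP[q0 q1] r mr.
  rewrite -ball_normE /ball_/= opprD addrA opprD addrA subrr sub0r -opprD normrN.
  rewrite (le_lt_trans (ler_normD _ _))// !normrZ !ger0_norm//.
  apply: (@le_lt_trans _ _ (h * L)).
    rewrite -abL !mulrDr mulr1 (@le_trans _ _ (h * `|a| + h * `|b|))//.
      by rewrite lerD// ler_wpM2r.
    by rewrite lerDl ltW.
  rewrite /h invfM mulrA -mulrA mulVf ?gt_eqF// mulr1 (lt_le_trans _ mr)//.
  by rewrite ltr_pdivrMr// ltr_pMr// ltr1n.
have hE : fij (x + s *: ei + u *: ej) = fji (x + s' *: ej + u' *: ei).
  apply: (mulfI (lt0r_neq0 h0)); apply: (mulfI (lt0r_neq0 h0)).
  rewrite -E1 -E2 [x + h *: ej + h *: ei]addrAC; ring.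
have m1 : Num.min r1 r2 <= r1 by rewrite ge_min lexx.
have m2 : Num.min r1 r2 <= r2 by rewrite ge_min lexx orbT.
have L' : `|ej| + `|ei| + 1 = L by rewrite /L (addrC `|ei|).
have B1 := H1 _ (close ei ej s u erefl sh uh r1 m1).
have B2 := H2 _ (close ej ei s' u' L' sh' uh' r2 m2).
rewrite -(subrK (fij (x + s *: ei + u *: ej)) (fij x)) -addrA (le_trans (ler_normD _ _))//.
rewrite (splitr e) lerD//; first exact: ltW.
by rewrite hE distrC ltW.
Qed.

End directional.

(** * Expectations and velocity averages *)

Section expectation.
Context disp (T : measurableType disp) (R : realType) (P : probability T R).
Implicit Types f g : T -> R.

Definition itg f := P.-integrable [set: T] (EFin \o f).
Definition EX f : R := \int[P]_x f x.

Lemma itgD f g : itg f -> itg g -> itg (fun x => f x + g x).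
Proof. by move=> i j; exact: (integrableD _ i j). Qed.
Lemma itgB f g : itg f -> itg g -> itg (fun x => f x - g x).
Proof. by move=> i j; exact: (integrableB _ i j). Qed.
Lemma itgZ c f : itg f -> itg (fun x => c * f x).
Proof. by move=> i; exact: (integrableZl _ _ i). Qed.
Lemma itg_cst c : itg (fun=> c).
Proof. exact: finite_measure_integrable_cst. Qed.
Lemma itg_dom f g : measurable_fun [set: T] f -> itg g -> (forall x, `|f x| <= g x) -> itg f.
Proof.
move=> mf ig fg; apply: le_integrable ig => //; first exact/measurable_EFinP.
move=> x _; rewrite /= lee_fin (le_trans (fg x))//; exact: ler_norm.
Qed.
Lemma itg_meas f : itg f -> measurable_fun [set: T] f.
Proof. by move=> /integrableP[/measurable_EFinP]. Qed.
Lemma itg_sum I (r : seq I) (Q : pred I) (f : I -> T -> R) :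
  (forall i, Q i -> itg (f i)) -> itg (fun x => \sum_(i <- r | Q i) f i x).
Proof.
move=> h; elim: r => [|i r ih].
  by rewrite (_ : (fun _ => _) = fun=> 0); [exact: itg_cst|apply/funext => x; rewrite big_nil].
case: (boolP (Q i)) => Qi.
  rewrite (_ : (fun _ => _) = fun x => f i x + \sum_(j <- r | Q j) f j x).
    exact: itgD (h _ Qi) ih.
  by apply/funext => x; rewrite big_cons Qi.
rewrite (_ : (fun _ => _) = fun x => \sum_(j <- r | Q j) f j x)//.
by apply/funext => x; rewrite big_cons (negbTE Qi).
Qed.

Lemma EXD f g : itg f -> itg g -> EX (fun x => f x + g x) = EX f + EX g.
Proof. by move=> i j; exact: RintegralD. Qed.
Lemma EXB f g : itg f -> itg g -> EX (fun x => f x - g x) = EX f - EX g.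
Proof. by move=> i j; exact: RintegralB. Qed.
Lemma EXZ c f : itg f -> EX (fun x => c * f x) = c * EX f.
Proof. by move=> i; exact: RintegralZl. Qed.
Lemma EX_cst c : EX (fun=> c) = c.
Proof. by rewrite /EX Rintegral_cst// [X in fine X]probability_setT mulr1. Qed.
Lemma EX_sum I (r : seq I) (Q : pred I) (f : I -> T -> R) :
  (forall i, Q i -> itg (f i)) ->
  EX (fun x => \sum_(i <- r | Q i) f i x) = \sum_(i <- r | Q i) EX (f i).
Proof.
move=> h; elim: r => [|i r ih].
  rewrite big_nil -[RHS](EX_cst 0); apply: eq_Rintegral => x _; exact: big_nil.
case: (boolP (Q i)) => Qi; rewrite big_cons ?Qi ?(negbTE Qi).
  rewrite -ih -EXD ?h//; last exact: itg_sum.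
  by apply: eq_Rintegral => x _; rewrite big_cons Qi.
by rewrite -ih; apply: eq_Rintegral => x _; rewrite big_cons (negbTE Qi).
Qed.
Lemma EX_le f g : itg f -> itg g -> (forall x, f x <= g x) -> EX f <= EX g.
Proof. by move=> i j fg; apply: le_Rintegral. Qed.
Lemma EX_ge0 f : (forall x, 0 <= f x) -> 0 <= EX f.
Proof. by move=> f0; apply: Rintegral_ge0. Qed.
Lemma EX_eq f g : (forall x, f x = g x) -> EX f = EX g.
Proof. by move=> fg; apply: eq_Rintegral => x _. Qed.
Lemma EX_abs f : itg f -> `|EX f| <= EX (fun x => `|f x|).
Proof. by move=> i; apply: le_normr_Rintegral. Qed.
Lemma EX_E f : itg f -> (\int[P]_x (f x)%:E = (EX f)%:E)%E.
Proof. by move=> i; rewrite /EX /Rintegral fineK// integrable_fin_num. Qed.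

Definition bddm f := measurable_fun [set: T] f /\ exists C, 0 <= C /\ forall x, `|f x| <= C.

Lemma bddm_itg f : bddm f -> itg f.
Proof. by move=> [mf [C [_ fC]]]; apply: itg_dom (itg_cst C) fC. Qed.

Lemma itgM f g : bddm f -> itg g -> itg (fun x => f x * g x).
Proof.
move=> [mf [C [C0 fC]]] ig; have mg := itg_meas ig.
have : P.-integrable setT (fun x => (C * `|g x|)%:E).
  apply: (@itgZ C (fun x => `|g x|)).
  exact: (integrable_norm ig).
by move=> iC; apply: itg_dom iC _; [exact: measurable_funM|move=> x; rewrite normrM ler_wpM2r].
Qed.
End expectation.
Arguments EX_E {disp T R P f}.

Section fubini_prob.
Context d1 d2 (T1 : measurableType d1) (T2 : measurableType d2) (R : realType).
Variables (P1 : probability T1 R) (P2 : probability T2 R).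

Definition prodp : set (T1 * T2) -> \bar R := (P1 \x P2)%E.
HB.instance Definition _ := Measure.on prodp.
Lemma prodp_setT : prodp [set: T1 * T2] = 1%E.
Proof.
rewrite /prodp -setXTT; transitivity (P1 setT * P2 setT)%E; first exact: product_measure1E.
by rewrite !probability_setT mule1.
Qed.
HB.instance Definition _ := @Measure_isProbability.Build _ _ R prodp prodp_setT.

(** Integrability is asked of every section, so that the inner [EX] is a genuine integral at each x
    and not the default value of [fine]. *)
Lemma EX_prod (h : T1 * T2 -> R) : itg prodp h -> (forall x, itg P2 (fun w => h (x, w))) ->
  itg P1 (fun x => EX P2 (fun w => h (x, w))) /\
  EX prodp h = EX P1 (fun x => EX P2 (fun w => h (x, w))).
Proof.
move=> ih ih2.
have E : (fun x => (\int[P2]_w (h (x, w))%:E)%E) = (fun x => (EX P2 (fun w => h (x, w)))%:E).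
  by apply/funext => x; rewrite EX_E.
split.
  by have := integrable_fubini_F ih; rewrite /fubini_F /= E.
have key : (\int[prodp]_z (h z)%:E = \int[P1]_x (EX P2 (fun w => h (x, w)))%:E)%E.
  transitivity (\int[P1]_x \int[P2]_w (h (x, w))%:E)%E.
    by symmetry; exact: (integral12_prod_meas1 ih).
  by apply: eq_integral => x _; exact: EX_E.
by rewrite [LHS]/EX [LHS]/Rintegral key.
Qed.
End fubini_prob.

(** * Polynomial growth in the velocity and velocity averages *)

Section domclass.
Context (R : realType) (d : nat) (mu : probability 'rV[R]_d R).
Notation E := ('rV[R]_d * 'rV[R]_d)%type.
Notation kappa := (@gaussm R d).
Notation muh := (prodp mu kappa).
Implicit Types (h g : E -> R).

Definition vw (v : 'rV[R]_d) : R := 1 + dotv v v.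

Lemma dotv_ge0 (v : 'rV[R]_d) : 0 <= dotv v v.
Proof. by apply: sumr_ge0 => i _; rewrite -expr2 sqr_ge0. Qed.

Lemma vw_ge1 v : 1 <= vw v.
Proof. by rewrite lerDl dotv_ge0. Qed.

Lemma measurable_vw : measurable_fun [set: 'rV[R]_d] vw.
Proof. by apply: measurable_funD => //; apply: measurable_dotv; exact: measurable_id. Qed.

Lemma itg_gauss_sqr (f : 'rV[R]_d -> R) C : measurable_fun setT f ->
  (\int[kappa]_v ((f v) ^+ 2)%:E <= C%:E)%E -> itg kappa (fun v => f v ^+ 2) /\ EX kappa (fun v => f v ^+ 2) <= C.
Proof.
move=> mf fC.
have i : itg kappa (fun v => f v ^+ 2).
  apply/integrableP; split; first by apply/measurable_EFinP; exact: measurable_funX.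
  under eq_integral do rewrite /= ger0_norm ?sqr_ge0//.
  by rewrite (le_lt_trans fC)// ltry.
by split => //; rewrite -lee_fin -EX_E.
Qed.

Lemma gauss_affine_EX (a : 'rV[R]_d) c : itg kappa (fun v => (dotv v a + c) ^+ 2) /\
  EX kappa (fun v => (dotv v a + c) ^+ 2) = dotv a a + c ^+ 2.
Proof.
have := gauss_affine_sqr a c => h.
have [] := @itg_gauss_sqr (fun v => dotv v a + c) (dotv a a + c ^+ 2).
- by apply: measurable_funD => //; exact: measurable_dotv_cst.
- by rewrite h.
by move=> i _; split => //; rewrite /EX /Rintegral h.
Qed.

Lemma gauss_qform_EX (H : 'M[R]_d) c : itg kappa (fun v => (qform H v + c) ^+ 2) /\
  EX kappa (fun v => (qform H v + c) ^+ 2) <= (\tr H + c) ^+ 2 + 2 * frob H.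
Proof.
apply: (@itg_gauss_sqr (fun v => qform H v + c)) => //.
- by apply: measurable_funD => //; exact: measurable_qform.
- exact: gauss_qform_sqr.
Qed.

(** 1 + |v|^2 is the quadratic form of the identity plus 1, and [gauss_qform_EX] integrates its
    square. This is the origin of the condition k <= 2 in all integrability statements about
    [dom]. *)
Lemma itg_vw k : (k <= 2)%N -> itg kappa (fun v => vw v ^+ k).
Proof.
move=> k2.
have [i2 _] := gauss_qform_EX 1%:M 1.
have E v : qform 1%:M v + 1 = vw v.
  rewrite addrC /vw; congr (_ + _); apply: eq_bigr => i _.
  rewrite (bigD1 i)//= big1 ?addr0 => [|j ji]; first by rewrite mxE eqxx mulr1.
  by rewrite mxE eq_sym (negbTE ji) mulr0 mul0r.
apply: itg_dom i2 _; first by apply: measurable_funX; exact: measurable_vw.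
move=> v; rewrite E ger0_norm ?exprn_ge0 ?(le_trans ler01) ?vw_ge1//.
by apply: ler_weXn2l => //; exact: vw_ge1.
Qed.

(* Polynomial growth in the velocity, uniform in the position; all moments
   under mu * kappa are then finite without any assumption on the tails of mu. *)
Definition dom k h := measurable_fun [set: E] h /\
  exists C : R, 0 <= C /\ forall z, `|h z| <= C * vw z.2 ^+ k.

Lemma vwX_ge1 k (z : E) : 1 <= vw z.2 ^+ k.
Proof. by rewrite exprn_ege1 // vw_ge1. Qed.

Lemma dom_le k l h : (k <= l)%N -> dom k h -> dom l h.
Proof.
move=> kl [mh [C [C0 hC]]]; split => //; exists C; split => // z.
by rewrite (le_trans (hC z))// ler_wpM2l// ler_weXn2l// vw_ge1.
Qed.

Lemma domD k h g : dom k h -> dom k g -> dom k (fun z => h z + g z).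
Proof.
move=> [mh [C [C0 hC]]] [mg [D [D0 gD]]]; split; first exact: measurable_funD.
exists (C + D); split; first exact: addr_ge0.
by move=> z; rewrite (le_trans (ler_normD _ _))// mulrDl lerD.
Qed.

Lemma domM k l h g : dom k h -> dom l g -> dom (k + l) (fun z => h z * g z).
Proof.
move=> [mh [C [C0 hC]]] [mg [D [D0 gD]]]; split; first exact: measurable_funM.
exists (C * D); split; first exact: mulr_ge0.
by move=> z; rewrite normrM exprD mulrACA ler_pM.
Qed.

Lemma domN k h : dom k h -> dom k (fun z => - h z).
Proof.
move=> [mh [C [C0 hC]]]; split; first exact: measurableT_comp.
by exists C; split => // z; rewrite normrN.
Qed.

Lemma domB k h g : dom k h -> dom k g -> dom k (fun z => h z - g z).
Proof. by move=> dh dg; apply: domD => //; exact: domN. Qed.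

Lemma dom_cst k c : dom k (fun=> c).
Proof.
split => //; exists `|c|; split => // z.
by rewrite ler_peMr// vwX_ge1.
Qed.

Lemma domZ k c h : dom k h -> dom k (fun z => c * h z).
Proof. by move=> dh; have := domM (dom_cst 0 c) dh. Qed.

Lemma dom_sum k I (r : seq I) (h : I -> E -> R) :
  (forall i, dom k (h i)) -> dom k (fun z => \sum_(i <- r) h i z).
Proof.
move=> dh; elim: r => [|i r ih].
  by rewrite (_ : (fun _ => _) = fun=> 0); [exact: dom_cst|apply/funext => x; rewrite big_nil].
rewrite (_ : (fun _ => _) = fun x => h i x + \sum_(j <- r) h j x); first exact: domD.
by apply/funext => x; rewrite big_cons.
Qed.

Lemma dom_bdd h C : measurable_fun setT h -> (forall z, `|h z| <= C) -> dom 0 h.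
Proof.
move=> mh hC; split => //; exists `|C|; split => // z.
by rewrite expr0 mulr1 (le_trans (hC z))// ler_norm.
Qed.

Lemma dom_x (f : 'rV[R]_d -> R) : bddm f -> dom 0 (fun z => f z.1).
Proof.
move=> [mf [C [C0 fC]]]; apply: (@dom_bdd _ C) => //.
exact: measurableT_comp.
Qed.

Lemma dotv_entry2 (v : 'rV[R]_d) i j : `|v ord0 i * v ord0 j| <= dotv v v.
Proof.
have le k : v ord0 k ^+ 2 <= dotv v v.
  by rewrite /dotv (bigD1 k)//= -expr2 lerDl; apply: sumr_ge0 => l _; rewrite -expr2 sqr_ge0.
have := le i; have := le j; rewrite normrM -(real_normK (num_real (v ord0 i))) -(real_normK (num_real (v ord0 j))).
move: (normr_ge0 (v ord0 i)) (normr_ge0 (v ord0 j)).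
have : 0 <= (`|v ord0 i| - `|v ord0 j|) ^+ 2 by exact: sqr_ge0.
by nra.
Qed.

Lemma dom_vv i j : dom 1 (fun z => z.2 ord0 i * z.2 ord0 j).
Proof.
split.
  by apply: measurable_funM; apply: measurable_rV_entry; exact: measurable_snd.
exists 1; split => // z; rewrite mul1r expr1 (le_trans (dotv_entry2 _ _ _))//.
by rewrite /vw lerDr.
Qed.

Lemma dom_v i : dom 1 (fun z => z.2 ord0 i).
Proof.
split; first by apply: measurable_rV_entry; exact: measurable_snd.
exists 1; split => // z; rewrite mul1r expr1 /vw.
have := dotv_entry2 z.2 i i; rewrite -expr2 normrX.
by move: (normr_ge0 (z.2 ord0 i)) (dotv_ge0 z.2); nra.
Qed.

Lemma dom_sec k h x : (k <= 2)%N -> dom k h -> itg kappa (fun w => h (x, w)).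
Proof.
move=> k2 [mh [C [C0 hC]]].
apply: itg_dom (itgZ C (itg_vw k2)) _ => [|w]; last exact: (hC (x, w)).
by apply: measurableT_comp => //; exact: measurable_pair1.
Qed.

Lemma dom_itg k h : (k <= 2)%N -> dom k h -> itg muh h.
Proof.
move=> k2 [mh [C [C0 hC]]].
apply: itg_dom mh _ hC.
apply: itgZ.
apply/integrableP; split.
  apply/measurable_EFinP; apply: measurable_funX.
  by apply: measurableT_comp => //; exact: measurable_vw.
rewrite fubini_tonelli1//=; last first.
  apply/measurable_EFinP; apply: measurableT_comp => //; apply: measurable_funX.
  by apply: measurableT_comp => //; exact: measurable_vw.
rewrite /fubini_F/=.
have /integrableP[_ i] := itg_vw k2.
by rewrite integral_cst//= probability_setT mule1.
Qed.

Definition Pi h (x : 'rV[R]_d) : R := EX kappa (fun w => h (x, w)).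

Lemma Pi_bddm k h : (k <= 2)%N -> dom k h -> bddm (Pi h).
Proof.
move=> k2 dh; split.
  have [i _] := EX_prod (dom_itg k2 dh) (fun x => dom_sec x k2 dh).
  exact: itg_meas i.
have [mh [C [C0 hC]]] := dh.
exists (C * EX kappa (fun v => vw v ^+ k)); split.
  by rewrite mulr_ge0// EX_ge0// => v; rewrite exprn_ge0// (le_trans ler01) ?vw_ge1.
move=> x; rewrite (le_trans (EX_abs (dom_sec x k2 dh)))//.
rewrite -EXZ; last exact: itg_vw.
apply: EX_le; last by move=> w; exact: (hC (x, w)).
- exact: (integrable_norm (dom_sec x k2 dh)).
- by apply: itgZ; exact: itg_vw.
Qed.

Lemma EX_Pi k h : (k <= 2)%N -> dom k h -> EX muh h = EX mu (Pi h).
Proof. by move=> k2 dh; have [_ ->] := EX_prod (dom_itg k2 dh) (fun x => dom_sec x k2 dh). Qed.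

Lemma EX_Pi_mul k h (f : 'rV[R]_d -> R) : (k <= 2)%N -> dom k h -> bddm f ->
  EX muh (fun z => f z.1 * h z) = EX mu (fun x => f x * Pi h x).
Proof.
move=> k2 dh bf; rewrite (EX_Pi k2 (domM (dom_x bf) dh)).
by apply: EX_eq => x; rewrite /Pi/= (EXZ _ (dom_sec x k2 dh)).
Qed.

Lemma EX_x (f : 'rV[R]_d -> R) : bddm f -> EX muh (fun z => f z.1) = EX mu f.
Proof.
move=> bf; rewrite (EX_Pi (isT : (0 <= 2)%N) (dom_x bf)).
by apply: EX_eq => x; rewrite /Pi/= EX_cst.
Qed.

(** Polarisation of the second moments of [gauss_affine_EX]. The vanishing of the mean below is read
    off from the shifts 1 and 0 in the same way. *)
Lemma gauss_cov (a b : 'rV[R]_d) : itg kappa (fun v => dotv v a * dotv v b) /\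
  EX kappa (fun v => dotv v a * dotv v b) = dotv a b.
Proof.
have [i1 e1] := gauss_affine_EX (a + b) 0.
have [i2 e2] := gauss_affine_EX a 0.
have [i3 e3] := gauss_affine_EX b 0.
have dD (u v w : 'rV[R]_d) : dotv u (v + w) = dotv u v + dotv u w.
  by rewrite /dotv -big_split/=; apply: eq_bigr => i _; rewrite mxE mulrDr.
have dC (u v : 'rV[R]_d) : dotv u v = dotv v u.
  by apply: eq_bigr => i _; rewrite mulrC.
have E : (fun v => dotv v a * dotv v b) = (fun v => 2^-1 * ((dotv v (a + b) + 0) ^+ 2 - (dotv v a + 0) ^+ 2 - (dotv v b + 0) ^+ 2)).
  by apply/funext => v; rewrite dD; field.
have i : itg kappa (fun v => (dotv v (a + b) + 0) ^+ 2 - (dotv v a + 0) ^+ 2 - (dotv v b + 0) ^+ 2).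
  by apply: itgB => //; apply: itgB.
rewrite E; split; first exact: itgZ.
rewrite EXZ// EXB//; last exact: itgB.
rewrite EXB// e1 e2 e3 dD ![dotv (a + b) _]dC !dD (dC b a); field => //.
Qed.

Lemma gauss_mean (a : 'rV[R]_d) : itg kappa (fun v => dotv v a) /\ EX kappa (fun v => dotv v a) = 0.
Proof.
have [i1 e1] := gauss_affine_EX a 1.
have [i2 e2] := gauss_affine_EX a 0.
have E : (fun v => dotv v a) = (fun v => 2^-1 * ((dotv v a + 1) ^+ 2 - (dotv v a + 0) ^+ 2 - 1)).
  by apply/funext => v; field.
have ic : itg kappa (fun=> 1) by exact: itg_cst.
have i : itg kappa (fun v => (dotv v a + 1) ^+ 2 - (dotv v a + 0) ^+ 2).
  exact: itgB.
rewrite E; split; first by apply: itgZ; exact: itgB.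
rewrite EXZ; last exact: itgB.
rewrite EXB// EXB// e1 e2 EX_cst; field => //.
Qed.

End domclass.

(** * Transport of the Gibbs measure *)

Section gibbs.
Context (R : realType) (d : nat) (U : 'rV[R]_d -> R) (mu : probability 'rV[R]_d R).
Hypothesis cU : continuous U.
Hypothesis gU : gibbs_measure U mu.
Notation Leb := (lebesgue_rV R d).

(** Shows that Lebesgue measure is not zero, hence that the normalisation Z of the Gibbs measure is
    positive and can be divided by. *)
Lemma lebesgue_rV_setT_ge1 n : (1 <= lebesgue_rV R n [set: 'rV[R]_n])%E.
Proof.
have E1 k : lebesgue_rV R k setT = (\int[lebesgue_rV R k]_x (cst 1%E) x)%E.
  by rewrite integral_cst// mul1e.
elim: n => [|n ih]; first by rewrite E1 /lebesgue_rV integral_prod_measure0.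
rewrite E1 /lebesgue_rV ge0_integral_prod_measureS// -/(lebesgue_rV R n).
have inn (y : 'rV[R]_n) : (\int[@lebesgue_measure R]_t cst 1 (rV_cons (t, y)) = lebesgue_measure [set: measurableTypeR R])%E.
  by rewrite /= (integral_cst (@lebesgue_measure R) measurableT 1%E) mul1e.
under eq_integral do rewrite inn.
rewrite (le_trans ih)// E1; apply: ge0_le_integral => // y _.
apply: (@le_trans _ _ (lebesgue_measure `[0%R : R, 1%R]%classic)).
  by rewrite lebesgue_measure_itv/= lte_fin ltr01 oppr0 adde0.
by apply: le_measure => //; rewrite inE.
Qed.

Let Z : \bar R := (\int[Leb]_x (expR (- U x))%:E)%E.

Let mexpU : measurable_fun [set: 'rV[R]_d] (fun x => expR (- U x)).
Proof.
apply: measurableT_comp => //; apply: measurableT_comp => //.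
exact: continuous_rV_measurable.
Qed.

Let Z_gt0 : (0 < Z)%E.
Proof.
have Z0 : (0 <= Z)%E by apply: integral_ge0 => x _; rewrite lee_fin expR_ge0.
rewrite lt_neqAle Z0 andbT; apply/eqP => ZE.
have : (\int[Leb]_x `|(expR (- U x))%:E| = 0)%E.
  rewrite ZE; apply: eq_integral => x _.
  by rewrite gee0_abs// lee_fin expR_ge0.
move=> /(ae_eq_integral_abs _ measurableT) => /(_ (proj2 (measurable_EFinP _ _) mexpU)).
move=> [A [mA A0 sA]].
have := lebesgue_rV_setT_ge1 d.
have -> : [set: 'rV[R]_d] = A.
  apply/seteqP; split => // x _; apply: sA => /= /(_ I) [] /eqP.
  by rewrite expR_eq0.
by rewrite A0 lee_fin ler10.
Qed.

Definition gibbs_density (x : 'rV[R]_d) : R := expR (- U x) / fine Z.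

Let fZ : Z = (fine Z)%:E.
Proof. by rewrite fineK// ge0_fin_numE ?ltW//; case: gU. Qed.

Let fZ0 : 0 < fine Z.
Proof. by rewrite -lte_fin -fZ. Qed.

Lemma ge0_integral_gibbs (f : 'rV[R]_d -> \bar R) :
  measurable_fun [set: 'rV[R]_d] f -> (forall x, 0 <= f x)%E ->
  (\int[mu]_x f x = \int[Leb]_x (f x * (gibbs_density x)%:E))%E.
Proof.
apply: ge0_integral_density.
- by apply: measurable_funM.
- by move=> x; rewrite divr_ge0 ?expR_ge0// ltW.
move=> A mA.
have [_ /(_ _ mA)] := gU; rewrite -/Z fZ => h.
under eq_integral do rewrite /gibbs_density EFinM.
rewrite ge0_integralZr//; try (by move=> x _; rewrite lee_fin expR_ge0);
  try (by rewrite lee_fin invr_ge0 ltW); try (by apply/measurable_EFinP; exact: measurable_funTS).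
by rewrite -h -muleA -EFinM divff ?mule1// gt_eqF.
Qed.

(** Quasi-invariance of mu under translations: Lebesgue measure is invariant, and the ratio of the
    densities at x + a and x is exp(U x - U (x + a)). *)
Lemma ge0_integral_gibbs_shift (f : 'rV[R]_d -> \bar R) (a : 'rV[R]_d) :
  measurable_fun [set: 'rV[R]_d] f -> (forall x, 0 <= f x)%E ->
  (\int[mu]_x (f (x + a)%R * (expR (U x - U (x + a)))%:E) = \int[mu]_x f x)%E.
Proof.
move=> mf f0.
have mx : measurable_fun [set: 'rV[R]_d] (fun x : 'rV[R]_d => x + a) by exact: measurable_rV_add.
have mUa : measurable_fun [set: 'rV[R]_d] (fun x => U (x + a)).
  by apply: measurableT_comp => //; exact: continuous_rV_measurable.
have m1 : measurable_fun [set: 'rV[R]_d] (fun x => f (x + a)%R * (expR (U x - U (x + a)))%:E)%E.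
  apply: emeasurable_funM; first exact: measurableT_comp.
  apply/measurable_EFinP; apply: measurableT_comp => //; apply: measurable_funB => //.
  exact: continuous_rV_measurable.
have m2 : measurable_fun [set: 'rV[R]_d] (fun x => f x * (gibbs_density x)%:E)%E.
  by apply: emeasurable_funM => //; apply/measurable_EFinP; apply: measurable_funM.
have p2 x : (0 <= f x * (gibbs_density x)%:E)%E.
  by rewrite mule_ge0// lee_fin divr_ge0 ?expR_ge0// ltW.
rewrite ge0_integral_gibbs//; last by move=> x; rewrite mule_ge0// lee_fin expR_ge0.
rewrite ge0_integral_gibbs// -(ge0_integral_lebesgue_rVD a m2 p2).
apply: eq_integral => x _; rewrite -muleA -EFinM; congr (_ * _%:E)%E.
by rewrite /gibbs_density mulrA -expRD; congr (expR _ / _); ring.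
Unshelve. all: by [].
Qed.

Notation E := ('rV[R]_d * 'rV[R]_d)%type.
Notation kappa := (@gaussm R d).
Notation muh := (prodp mu kappa).
Notation mR := (measurableTypeR R).

Definition shift_flow (t : R) (z : E) : E := (z.1 - t *: z.2, z.2).
(* Density of the image of mu * kappa under (x, v) |-> (x + t v, v). *)
Definition shift_weight (t : R) (z : E) : R := expR (U z.1 - U (z.1 - t *: z.2)).

Lemma measurable_shift_pos : measurable_fun [set: mR * E] (fun p : mR * E => p.2.1 - (p.1 : R) *: p.2.2).
Proof.
have -> : (fun p : mR * E => p.2.1 - (p.1 : R) *: p.2.2) = (fun p : mR * E => p.2.1 + (- (p.1 : R)) *: p.2.2).
  by apply/funext => p; rewrite scaleNr.
apply: measurable_axpy.
- by apply: measurableT_comp; [exact: measurable_fst|exact: measurable_snd].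
- by apply: measurableT_comp; exact: measurable_snd.
- by apply: measurableT_comp => //; exact: measurable_fst.
Qed.

Lemma measurable_shift_flow : measurable_fun [set: mR * E] (fun p : mR * E => shift_flow p.1 p.2).
Proof.
apply/measurable_fun_pairP; split; first exact: measurable_shift_pos.
rewrite (_ : snd \o _ = (fun p : mR * E => p.2.2))//.
by apply: measurableT_comp; exact: measurable_snd.
Qed.

Lemma measurable_shift_weight : measurable_fun [set: mR * E] (fun p : mR * E => shift_weight p.1 p.2).
Proof.
apply: measurableT_comp => //; apply: measurable_funB.
  apply: measurable_continuous_rV_comp => //.
  by apply: (measurableT_comp (f := fst)); [exact: measurable_fst|exact: measurable_snd].
by apply: measurable_continuous_rV_comp => //; exact: measurable_shift_pos.
Qed.

Lemma measurable_shift_flow1 t : measurable_fun [set: E] (shift_flow t).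
Proof.
exact: (measurableT_comp measurable_shift_flow (@measurable_pair1 _ _ mR E t)).
Qed.

Lemma measurable_shift_weight1 t : measurable_fun [set: E] (shift_weight t).
Proof.
exact: (measurableT_comp measurable_shift_weight (@measurable_pair1 _ _ mR E t)).
Qed.

Lemma ge0_integral_shift (f : E -> \bar R) (t : R) :
  measurable_fun [set: E] f -> (forall z, 0 <= f z)%E ->
  (\int[muh]_z (f (shift_flow t z) * (shift_weight t z)%:E) = \int[muh]_z f z)%E.
Proof.
move=> mf f0.
have m1 : measurable_fun [set: E] (fun z => f (shift_flow t z) * (shift_weight t z)%:E)%E.
  apply: emeasurable_funM; first by apply: measurableT_comp => //; exact: measurable_shift_flow1.
  by apply/measurable_EFinP; exact: measurable_shift_weight1.
have p1 z : (0 <= f (shift_flow t z) * (shift_weight t z)%:E)%E.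
  by rewrite mule_ge0// lee_fin expR_ge0.
rewrite (fubini_tonelli2 _ m1 p1) (fubini_tonelli2 _ mf f0).
apply: eq_integral => v _; rewrite /fubini_G/=.
have mfv : measurable_fun [set: 'rV[R]_d] (fun x => f (x, v)).
  by apply: measurableT_comp => //; exact: measurable_pair2.
exact: (ge0_integral_gibbs_shift (- (t *: v)) mfv (fun x => f0 (x, v))).
Qed.

Lemma EX_shift (h : E -> R) (t : R) : itg muh h ->
  itg muh (fun z => h (shift_flow t z) * shift_weight t z) /\
  EX muh (fun z => h (shift_flow t z) * shift_weight t z) = EX muh h.
Proof.
move=> ih; have mh := itg_meas ih.
have mhs : measurable_fun [set: E] (fun z => h (shift_flow t z) * shift_weight t z).
  apply: measurable_funM; last exact: measurable_shift_weight1.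
  by apply: measurableT_comp => //; exact: measurable_shift_flow1.
have sw0 z : 0 <= shift_weight t z by exact: expR_ge0.
have e1 : (\int[muh]_z `|(h (shift_flow t z) * shift_weight t z)%:E| = \int[muh]_z `|(h z)%:E|)%E.
  rewrite -(@ge0_integral_shift (fun z => `|(h z)%:E|)%E t)//; last first.
    by apply/measurable_EFinP; exact: measurableT_comp.
  by apply: eq_integral => z _; rewrite /= normrM (ger0_norm (sw0 z)) EFinM.
split.
  apply/integrableP; split; first exact/measurable_EFinP.
  by rewrite [X in (X < _)%E]e1; case/integrableP : ih.
rewrite /EX /Rintegral integralE [in RHS]integralE; congr (fine (_ - _)).
- rewrite -(@ge0_integral_shift (fun z => (EFin \o h)^\+ z)%E t)//; last first.
    by apply: measurable_funepos; exact/measurable_EFinP.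
  apply: eq_integral => z _; rewrite !funeposE /= EFinM.
  by rewrite maxe_pMl ?lee_fin// mul0e.
- rewrite -(@ge0_integral_shift (fun z => (EFin \o h)^\- z)%E t)//; last first.
    by apply: measurable_funeneg; exact/measurable_EFinP.
  apply: eq_integral => z _; rewrite !funenegE maxe_pMl ?lee_fin// mul0e /=.
  by rewrite -EFinM mulNr.
Qed.

End gibbs.

(** * Exchange of time integrals and expectations *)

Section time_fubini.
Context (R : realType) disp (T : measurableType disp) (P : probability T R).
Notation mR := (measurableTypeR R).
Notation leb := (@lebesgue_measure R).

(** Fubini for the kernel cut off by the indicator of [s, t]: the uniform bound C on first absolute
    moments makes it integrable on the product. *)
Lemma EX_ri (K : R -> T -> R) (s t C : R) : s <= t ->
  measurable_fun [set: mR * T] (fun p : mR * T => K p.1 p.2) ->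
  (forall z, lbm (K ^~ z)) ->
  (forall r, s <= r <= t -> itg P (K r) /\ EX P (fun z => `|K r z|) <= C) ->
  itg P (fun z => ri (K ^~ z) s t) /\
  EX P (fun z => ri (K ^~ z) s t) = ri (fun r => EX P (K r)) s t.
Proof.
move=> st mK lK bK.
pose D := `[s, t]%classic.
pose KD (p : mR * T) : R := K p.1 p.2 * \1_D (p.1 : R).
have mI : measurable_fun [set: mR * T] (fun p : mR * T => \1_D (p.1 : R) : R).
  have mD : measurable (D : set mR) by exact: measurable_itv.
  rewrite (_ : (fun p : mR * T => _) = (\1_D : mR -> R) \o fst)//.
  by apply: measurableT_comp; [exact: measurable_indic|exact: measurable_fst].
have mKD : measurable_fun [set: mR * T] KD by exact: measurable_funM.
have KDr r z : KD (r, z) = (K ^~ z \_ D) r.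
  by rewrite /KD/= indicE patchE; case: ifP; rewrite ?mulr1 ?mulr0.
have iKD : (leb \x P)%E.-integrable setT (EFin \o KD).
  apply/integrable12ltyP; first exact/measurable_EFinP.
  apply: (@le_lt_trans _ _ (\int[leb]_(r in D) C%:E)%E); last first.
    have -> : (\int[leb]_(r in D) C%:E)%E = (ri (fun=> C) s t)%:E; last by rewrite ltry.
    rewrite /ri /Rintegral fineK// integrable_fin_num//.
    exact: (lbm_integrable _ _ (lbm_cst C)).
  rewrite [in leRHS]integral_mkcond.
  apply: ge0_le_integral => //=.
  - by move=> r _; apply: integral_ge0.
  - apply: (measurable_fun_fubini_tonelli_F (fun p => `|(KD p)%:E|)%E) => //.
    by apply/measurable_EFinP; exact: measurableT_comp.
  - by apply: (measurable_restrictT _ _).1 => //; exact: measurable_itv.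
  - move=> r _; rewrite patchE; case: ifPn => [/set_mem|/negP] rD.
      have rst : s <= r <= t by move: rD; rewrite /D/= in_itv.
      have [i1 i2] := bK _ rst.
      rewrite (eq_integral (fun z => (`|K r z|)%:E)); last first.
        by move=> z _; rewrite KDr patchE mem_set.
      by rewrite EX_E ?lee_fin//; exact: (integrable_norm i1).
    rewrite (eq_integral (cst 0%E)) ?integral0// => z _.
    by rewrite KDr patchE; case: ifP => //= h; rewrite ?h// normr0.
have riE z : (\int[leb]_r (KD (r, z))%:E = (ri (K ^~ z) s t)%:E)%E.
  have : (\int[leb]_(r in D) (K r z)%:E)%E = (ri (K ^~ z) s t)%:E.
    by rewrite /ri /Rintegral fineK// integrable_fin_num//; exact: lbm_integrable.
  move=> <-; rewrite [RHS]integral_mkcond; apply: eq_integral => r _.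
  by rewrite KDr restrict_EFin.
have GE : fubini_G leb (EFin \o KD) = EFin \o (fun z => ri (K ^~ z) s t).
  by apply/funext => z; rewrite /fubini_G /= riE.
have mG : measurable_fun [set: T] (EFin \o (fun z => ri (K ^~ z) s t)).
  by rewrite -GE; have := measurable_fubini_G iKD; exact.
split.
  apply/integrableP; split => //.
  have mEKD : measurable_fun [set: mR * T] (EFin \o KD) by exact/measurable_EFinP.
  apply: le_lt_trans ((integrable21ltyP leb P mEKD).1 iKD).
  apply: ge0_le_integral => //.
  - exact: measurableT_comp.
  - apply: (measurable_fun_fubini_tonelli_G (fun p => `|(KD p)%:E|)%E) => //.
    by apply/measurable_EFinP; exact: measurableT_comp.
  - move=> z _.
    have -> : (EFin \o (fun z => ri (K ^~ z) s t)) z = (\int[leb]_r (KD (r, z))%:E)%E by rewrite riE.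
    apply: le_abse_integral => //; apply/measurable_EFinP.
    exact: (measurableT_comp mKD (@measurable_pair2 _ _ mR T z)).
have := Fubini iKD => /= F.
rewrite /EX /Rintegral.
rewrite [X in fine X](_ : _ = (\int[P]_z \int[leb]_r (KD (r, z))%:E)%E); last first.
  by apply: eq_integral => z _; rewrite riE.
rewrite -F [in RHS]/ri /Rintegral; congr fine.
rewrite [RHS]integral_mkcond; apply: eq_integral => r _.
rewrite patchE; case: ifPn => rD.
  have rst : s <= r <= t by move: rD; rewrite inE /D/= in_itv.
  rewrite -[RHS](EX_E (bK _ rst).1).
  by apply: eq_integral => z _; rewrite KDr patchE rD.
transitivity (\int[P]_z (cst 0%E : T -> \bar R) z)%E; last exact: integral0.
by apply: eq_integral => z _; rewrite KDr patchE (negbTE rD).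
Qed.

Lemma lbm_EX (K : R -> T -> R) :
  measurable_fun [set: mR * T] (fun p : mR * T => K p.1 p.2) ->
  (forall N : R, exists C : R, forall r, `|r| <= N -> itg P (K r) /\ EX P (fun z => `|K r z|) <= C) ->
  lbm (fun r => EX P (K r)).
Proof.
move=> mK bK; split; last first.
  move=> N; have [C hC] := bK N; exists `|C|; split => // r rN.
  have [i le] := hC r rN.
  by rewrite (le_trans (EX_abs i))// (le_trans le)// ler_norm.
(* Tonelli yields measurability for nonnegative kernels; K is the difference of |K| + K and |K|. *)
pose Kp (p : mR * T) := (`|K p.1 p.2| + K p.1 p.2)%:E.
pose Kn (p : mR * T) := (`|K p.1 p.2|)%:E.
have mKp : measurable_fun [set: mR * T] Kp.
  by apply/measurable_EFinP; apply: measurable_funD => //; exact: measurableT_comp.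
have mKn : measurable_fun [set: mR * T] Kn.
  by apply/measurable_EFinP; exact: measurableT_comp.
have -> : (fun r => EX P (K r)) = (fun r => fine (fubini_F P Kp r) - fine (fubini_F P Kn r)).
  apply/funext => r; have [C hC] := bK `|r|; have [i _] := hC r (lexx _).
  have ia : itg P (fun z => `|K r z|) by exact: (integrable_norm i).
  rewrite /fubini_F/= -!/(Rintegral _ _ _) -!/(EX _ _).
  by rewrite EXD// addrC addKr.
apply: measurable_funB.
- apply: measurableT_comp => //.
  apply: measurable_fun_fubini_tonelli_F => //.
  by move=> p; rewrite lee_fin -lerBlDr sub0r -normrN ler_norm.
- apply: measurableT_comp => //.
  by apply: measurable_fun_fubini_tonelli_F => // p; rewrite lee_fin.
Qed.

Lemma ri_FTC (p p' : R -> R) (t : R) : 0 <= t ->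
  (forall s : R, is_derive s (1 : R) p (p' s)) -> continuous p' -> p t = p 0 + ri p' 0 t.
Proof.
rewrite le_eqVlt => /predU1P[<-|t0] dp cp'; first by rewrite ri_pt addr0.
have cp : continuous p.
  move=> s; apply: differentiable_continuous; apply/derivable1_diffP.
  exact: (@ex_derive _ _ _ _ _ _ _ (dp s)).
have := @continuous_FTC2 R p' p 0 t t0 (continuous_subspaceT cp').
have H2 : derivable_oo_LRcontinuous p 0 t.
  split; first by move=> x _; exact: (@ex_derive _ _ _ _ _ _ _ (dp x)).
    by apply: cvg_at_right_filter; exact: cp.
  by apply: cvg_at_left_filter; exact: cp.
have H3 : {in `]0, t[, p^`()%classic =1 p'}.
  by move=> x _; rewrite derive1E; exact: (@derive_val _ _ _ _ _ _ _ (dp x)).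
move=> /(_ H2 H3) /(congr1 fine) /=; rewrite -/(Rintegral _ _ _) -/(ri _ _ _).
by move=> ->; rewrite addrCA subrr addr0.
Qed.

End time_fubini.

Section transport.
Context (R : realType) (d : nat) (U : 'rV[R]_d -> R) (mu : probability 'rV[R]_d R).
Hypothesis gU : gibbs_measure U mu.
Variable dU : 'I_d -> 'rV[R]_d -> R.
Hypothesis dUE : forall i x, is_derive x (delta_mx ord0 i) U (dU i x).
Hypothesis cdU : forall i, continuous (dU i).
Hypothesis cU : continuous U.
Notation E := ('rV[R]_d * 'rV[R]_d)%type.
Notation kappa := (@gaussm R d).
Notation muh := (prodp mu kappa).
Notation mR := (measurableTypeR R).

Definition vdot (f : 'I_d -> 'rV[R]_d -> R) (z : E) : R := \sum_i z.2 ord0 i * f i z.1.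

Lemma continuous_line (x v : 'rV[R]_d) : continuous (fun t : R => x + t *: v).
Proof.
move=> t; apply: cvgD; first exact: cvg_cst.
by apply: cvgZl; exact: cvg_id.
Qed.

(** By [EX_shift], the left side is the mean of a(T) phi taken at (x - T v, v), with the weight
    [shift_weight]. For fixed z, a along the characteristic is an integral by hypothesis, and phi
    times the weight is differentiable by the chain rule, so [ri_mul] gives the increment of the
    product. Undoing the change of variables at each time r gives H. All x-derivatives thus fall on
    phi and U, and v . grad U - v . grad appears as the adjoint of v . grad in L^2(mu). *)
Lemma transport (a b : R -> E -> R) (phi : E -> R) (dphi : 'I_d -> E -> R) (T C : R) :
  0 <= T ->
  (forall i x v, is_derive x (delta_mx ord0 i) (fun x => phi (x, v)) (dphi i (x, v))) ->
  (forall v, continuous (fun x => phi (x, v))) ->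
  (forall i v, continuous (fun x => dphi i (x, v))) ->
  let H := fun t z => b t z * phi z + a t z * (vdot dU z * phi z - \sum_i z.2 ord0 i * dphi i z) in
  measurable_fun [set: mR * E] (fun p : mR * E => H p.1 p.2) ->
  (forall t z, 0 <= t <= T -> `|H t z| <= C * vw z.2 ^+ 2) ->
  (forall z, lbm (fun t => a t (shift_flow t z))) ->
  (forall z, lbm (fun t => b t (shift_flow t z))) ->
  (forall z t, 0 <= t <= T -> a t (shift_flow t z) = a 0 z + ri (fun r => b r (shift_flow r z)) 0 t) ->
  itg muh (fun z => a 0 z * phi z) -> itg muh (fun z => a T z * phi z) ->
  EX muh (fun z => a T z * phi z) = EX muh (fun z => a 0 z * phi z) + ri (fun r => EX muh (H r)) 0 T.
Proof.
move=> T0 dphiE cphi cdphi H mH bH la lb aE i0 iT.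
pose p (z : E) (t : R) := phi (shift_flow t z) * shift_weight U t z.
pose p' (z : E) (t : R) := (vdot dU (shift_flow t z) * phi (shift_flow t z)
   - \sum_i z.2 ord0 i * dphi i (shift_flow t z)) * shift_weight U t z.
have lineE (x v : 'rV[R]_d) (t : R) : x - t *: v = x + t *: (- v) by rewrite scalerN.
have dp z (t : R) : is_derive t (1 : R) (p z) (p' z t).
  case: z => x v.
  have d1 : is_derive t (1 : R) (fun t => phi (x + t *: (- v), v)) (\sum_i (- v) ord0 i * dphi i (x + t *: (- v), v)).
    exact: (@continuous_dir _ _ (fun x => phi (x, v)) (fun i x => dphi i (x, v)) x (- v) (fun i y => dphiE i y v) (fun i => cdphi i v)).
  have d2 : is_derive t (1 : R) (fun t => U (x + t *: (- v))) (\sum_i (- v) ord0 i * dU i (x + t *: (- v))).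
    exact: continuous_dir.
  have -> : p (x, v) = (fun t => phi (x + t *: (- v), v)) * (expR \o ((cst (U x) : R -> R) - (fun t => U (x + t *: (- v))))).
    by apply/funext => s; rewrite /p /shift_flow /shift_weight/= lineE.
  apply: is_derive_eq.
  rewrite /p' /shift_flow /shift_weight /vdot/= /GRing.scale/= lineE.
  have -> (f : 'I_d -> R) : \sum_i (- v) ord0 i * f i = - \sum_i v ord0 i * f i.
    by rewrite -sumrN; apply: eq_bigr => i _; rewrite mxE mulNr.
  have -> (f : 'I_d -> R) : \sum_i (- v) ord0 i * f i = - \sum_i v ord0 i * f i.
    by rewrite -sumrN; apply: eq_bigr => i _; rewrite mxE mulNr.
  rewrite !fctE; ring.
have csh (z : E) : continuous (fun t : R => z.1 - t *: z.2).
  have -> : (fun t : R => z.1 - t *: z.2) = (fun t => z.1 + t *: (- z.2)).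
    by apply/funext => t; rewrite lineE.
  exact: continuous_line.
have cw (z : E) : continuous (fun t : R => shift_weight U t z).
  move=> t; rewrite /shift_weight.
  apply: (cvg_comp (fun t : R => U z.1 - U (z.1 - t *: z.2)) expR _ (@continuous_expR R _)).
  apply: cvgB; first exact: cvg_cst.
  by apply: (cvg_comp (fun t : R => z.1 - t *: z.2) U); [exact: csh|exact: cU].
have cphis (z : E) : continuous (fun t : R => phi (shift_flow t z)).
  by move=> t; apply: (cvg_comp (fun t : R => z.1 - t *: z.2) (fun x => phi (x, z.2))); [exact: csh|exact: cphi].
have csum (f : 'I_d -> R -> R) : (forall i, continuous (f i)) -> continuous (fun t : R => \sum_i f i t).
  move=> cf; rewrite (_ : (fun t : R => _) = \sum_i f i); last by apply/funext => s; rewrite fct_sumE.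
  elim/big_ind : _ => [|g h cg ch|i _]; [by move=> s; exact: cvg_cst| |exact: cf].
  by move=> s; apply: cvgD; [exact: cg|exact: ch].
have cp' (z : E) : continuous (p' z).
  move=> t; apply: cvgM; last exact: cw.
  apply: cvgB.
    apply: cvgM; last exact: cphis.
    apply: (csum (fun i (t : R) => z.2 ord0 i * dU i (z.1 - t *: z.2))) => i s.
    apply: cvgM; first exact: cvg_cst.
    by apply: (cvg_comp (fun t : R => z.1 - t *: z.2) (dU i)); [exact: csh|exact: cdU].
  apply: (csum (fun i (t : R) => z.2 ord0 i * dphi i (z.1 - t *: z.2, z.2))) => i s.
  apply: cvgM; first exact: cvg_cst.
  by apply: (cvg_comp (fun t : R => z.1 - t *: z.2) (fun x => dphi i (x, z.2))); [exact: csh|exact: cdphi].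
have cp (z : E) : continuous (p z) by move=> t; apply: cvgM; [exact: cphis|exact: cw].
have p0 z : p z 0 = phi z.
  by rewrite /p /shift_flow /shift_weight scale0r subr0 subrr expR0 mulr1; case: z.
have a0 z : a 0 (shift_flow 0 z) = a 0 z by rewrite /shift_flow scale0r subr0; case: z.
have pw z : a T (shift_flow T z) * p z T = a 0 z * phi z +
   ri (fun r => H r (shift_flow r z) * shift_weight U r z) 0 T.
  have := @ri_mul R (fun t => a t (shift_flow t z)) (fun t => b t (shift_flow t z)) (p z) (p' z) T T0
     (la z) (continuous_lbm (cp z)) (lb z) (continuous_lbm (cp' z)).
  rewrite a0 p0 => -> //.
  - by congr (_ + _); apply: ri_eq => r _; rewrite /H /p /p'/=; ring.
  - by move=> t tT; rewrite aE.
  - by move=> t /andP[t0 _]; rewrite (ri_FTC t0 (dp z) (cp' z)) p0.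
have iHr r : 0 <= r <= T -> itg muh (H r).
  move=> rT; apply: (@dom_itg _ _ _ 2) => //; split.
    exact: (measurableT_comp mH (@measurable_pair1 _ _ mR E r)).
  have h := bH r _ rT; exists `|C|; split => // z; rewrite (le_trans (h z))//.
  by rewrite ler_wpM2r ?ler_norm// exprn_ge0// (le_trans ler01) ?vw_ge1.
rewrite -(EX_shift cU gU T iT).2.
rewrite (_ : (fun z => _) = (fun z => a 0 z * phi z + ri (fun r => H r (shift_flow r z) * shift_weight U r z) 0 T)); last first.
  by apply/funext => z; rewrite -pw /p mulrA.
have w0 r z : 0 <= shift_weight U r z by exact: expR_ge0.
have ivw : itg muh (fun z => vw z.2 ^+ 2).
  apply: (@dom_itg _ _ _ 2) => //; split; last first.
    by exists 1; split => // z; rewrite mul1r ger0_norm// exprn_ge0// (le_trans ler01) ?vw_ge1.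
  apply: measurable_funX; apply: (measurableT_comp (@measurable_vw R d)).
  exact: measurable_snd.
have [] := @EX_ri R _ _ muh (fun r z => H r (shift_flow r z) * shift_weight U r z) 0 T
   (`|C| * EX muh (fun z => vw z.2 ^+ 2)) T0.
- have ms : measurable_fun [set: mR * E] (fun q : mR * E => (q.1, shift_flow q.1 q.2)).
    by apply/measurable_fun_pairP; split; [exact: measurable_fst|exact: measurable_shift_flow].
  apply: measurable_funM; last exact: measurable_shift_weight.
  exact: (measurableT_comp mH ms).
- move=> z.
  rewrite (_ : (fun _ => _) = (fun r => b r (shift_flow r z) * p z r + a r (shift_flow r z) * p' z r)); last first.
    by apply/funext => r; rewrite /H /p /p'/=; ring.
  by apply: lbmD; apply: lbmM => //; exact: continuous_lbm.
- move=> r rT; have [j1 _] := EX_shift cU gU r (iHr r rT); split => //.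
  have ia : itg muh (fun z => `|H r z|) by exact: (integrable_norm (iHr r rT)).
  rewrite (_ : EX _ _ = EX muh (fun z => `|H r (shift_flow r z)| * shift_weight U r z)); last first.
    by apply: EX_eq => z; rewrite normrM (ger0_norm (w0 _ _)).
  rewrite (EX_shift cU gU r ia).2 -EXZ//.
  apply: EX_le => //; first exact: itgZ.
  move=> z; rewrite (le_trans (bH r z rT))// ler_wpM2r ?ler_norm//.
  by rewrite exprn_ge0// (le_trans ler01) ?vw_ge1.
move=> f1 f2; rewrite EXD// f2; congr (_ + _); apply: ri_eq => r rT.
by rewrite (EX_shift cU gU r (iHr r rT)).2.
Qed.

End transport.

(** * Integration by parts and elliptic estimates *)

Section compact_support.
Context (R : realType) (d : nat).
Implicit Types (f g : 'rV[R]_d -> R).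

(** Bounded support is expressed as vanishing outside a ball, which passes to sums and products by
    comparing radii. *)
Definition CC f := continuous f /\ exists M : R, forall x, M < `|x| -> f x = 0.
(** Relational form of a partial derivative: derivatives are computed by combining rules, the result
    being adjusted afterwards by [pd_eq]. *)
Definition pd (i : 'I_d) f g := forall x, is_derive x (delta_mx ord0 i) f (g x).

Lemma CC_bddm f : CC f -> bddm f.
Proof.
move=> [cf [M hM]]; split; first exact: continuous_rV_measurable.
pose B := closed_ball_ Num.Def.normr (0 : 'rV[R]_d) (`|M| + 1).
have cB : compact B.
  apply: bounded_closed_compact.
    exists (`|M| + 1); split; first exact: num_real.
    move=> N MN x; rewrite /B /closed_ball_/= sub0r normrN => /le_trans; apply.
    exact: ltW.
  rewrite /B -closed_ballE; first exact: closed_ball_closed.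
  by rewrite ltr_wpDl.
have : compact (f @` B) by apply: continuous_compact => //; exact: continuous_subspaceT.
move=> /compact_bounded [C [_ HC]].
exists (`|C| + 1); split; first by rewrite addr_ge0.
move=> x; case: (leP `|x| (`|M| + 1)) => xM; last first.
  rewrite hM ?normr0 ?addr_ge0//; apply: le_lt_trans xM.
  by rewrite (le_trans (ler_norm M))// lerDl.
apply: HC; first by rewrite (le_lt_trans (ler_norm C))// ltrDl.
by exists x => //; rewrite /B /closed_ball_/= sub0r normrN.
Qed.

Lemma contM f g : continuous f -> continuous g -> continuous (fun x => f x * g x).
Proof. by move=> cf cg x; exact: (cvgM (cf x) (cg x)). Qed.
Lemma contD f g : continuous f -> continuous g -> continuous (fun x => f x + g x).
Proof. by move=> cf cg x; exact: (cvgD (cf x) (cg x)). Qed.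
Lemma contZ c f : continuous f -> continuous (fun x => c * f x).
Proof. by move=> cf; apply: contM => //; exact: cst_continuous. Qed.

Lemma CC_cst0 : CC (fun=> 0).
Proof. by split; [exact: cst_continuous|exists 0]. Qed.

Lemma CCD f g : CC f -> CC g -> CC (fun x => f x + g x).
Proof.
move=> [cf [M hM]] [cg [N hN]]; split; first by move=> x; exact: (cvgD (cf x) (cg x)).
exists (Num.max M N) => x; rewrite gt_max => /andP[xM xN].
by rewrite hM// hN// addr0.
Qed.

Lemma CCMr f g : CC f -> continuous g -> CC (fun x => f x * g x).
Proof.
move=> [cf [M hM]] cg; split; first by move=> x; exact: (cvgM (cf x) (cg x)).
by exists M => x xM; rewrite hM// mul0r.
Qed.

Lemma CCMl f g : continuous g -> CC f -> CC (fun x => g x * f x).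
Proof.
by move=> cg cf; rewrite (_ : (fun x => _) = (fun x => f x * g x));
  [exact: CCMr|apply/funext => x; rewrite mulrC].
Qed.

Lemma CCZ c f : CC f -> CC (fun x => c * f x).
Proof. by apply: CCMl; exact: cst_continuous. Qed.

Lemma CCN f : CC f -> CC (fun x => - f x).
Proof.
move=> cf; rewrite (_ : (fun x => _) = (fun x => -1 * f x)); first exact: CCZ.
by apply/funext => x; rewrite mulN1r.
Qed.

Lemma CCB f g : CC f -> CC g -> CC (fun x => f x - g x).
Proof. by move=> cf cg; apply: CCD => //; exact: CCN. Qed.

Lemma CC_sum I (r : seq I) (f : I -> 'rV[R]_d -> R) :
  (forall i, CC (f i)) -> CC (fun x => \sum_(i <- r) f i x).
Proof.
move=> cf; elim: r => [|i r ih].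
  by rewrite (_ : (fun x => _) = fun=> 0); [exact: CC_cst0|apply/funext => x; rewrite big_nil].
rewrite (_ : (fun x => _) = fun x => f i x + \sum_(j <- r) f j x); first exact: CCD.
by apply/funext => x; rewrite big_cons.
Qed.

Lemma pd_eq i f g h : pd i f g -> (forall x, g x = h x) -> pd i f h.
Proof. by move=> p e x; rewrite -e; exact: p. Qed.

Lemma pd_ext i f f' g : (forall x, f x = f' x) -> pd i f g -> pd i f' g.
Proof. by move=> e p; rewrite (_ : f' = f)//; apply/funext => x; rewrite e. Qed.

Lemma pdD i f g df dg : pd i f df -> pd i g dg -> pd i (fun x => f x + g x) (fun x => df x + dg x).
Proof. by move=> p q x; have := p x; have := q x => q' p'; exact: is_deriveD. Qed.

Lemma pdM i f g df dg : pd i f df -> pd i g dg ->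
  pd i (fun x => f x * g x) (fun x => df x * g x + f x * dg x).
Proof.
move=> p q x; have := p x; have := q x => q' p'.
have -> : df x * g x + f x * dg x = f x *: dg x + g x *: df x.
  by rewrite addrC; congr (_ + _); rewrite mulrC.
exact: is_deriveM.
Qed.

Lemma pd_cst i c : pd i (fun=> c) (fun=> 0).
Proof. by move=> x; exact: is_derive_cst. Qed.

Lemma pdZ i c f df : pd i f df -> pd i (fun x => c * f x) (fun x => c * df x).
Proof.
by move=> p; apply: pd_eq (pdM (pd_cst i c) p) _ => x; rewrite mul0r add0r.
Qed.

Lemma pdN i f df : pd i f df -> pd i (fun x => - f x) (fun x => - df x).
Proof. by move=> p x; have := p x => p'; exact: is_deriveN. Qed.

Lemma pd_sum i I (r : seq I) (f df : I -> 'rV[R]_d -> R) :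
  (forall j, pd i (f j) (df j)) ->
  pd i (fun x => \sum_(j <- r) f j x) (fun x => \sum_(j <- r) df j x).
Proof.
move=> p; elim: r => [|j r ih].
  apply: (@pd_ext _ (fun=> 0)) => [x|]; first by rewrite big_nil.
  by apply: pd_eq (pd_cst i 0) _ => x; rewrite big_nil.
apply: (@pd_ext _ (fun x => f j x + \sum_(k <- r) f k x)) => [x|]; first by rewrite big_cons.
by apply: pd_eq (pdD (p j) ih) _ => x; rewrite big_cons.
Qed.

Lemma pd_partial i f : (forall x, derivable f x (delta_mx ord0 i)) -> pd i f (partial i f).
Proof. by move=> df x; exact: derivableP. Qed.

(** If |x| > |M| + 1 then f vanishes on the ball of radius 1 around x, hence so does its derivative
    at x. *)
Lemma CC_pd i f df : CC f -> pd i f df -> continuous df -> CC df.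
Proof.
move=> [cf [M hM]] p cdf; split => //; exists (`|M| + 1) => x xM.
have [_ <-] := p x.
rewrite (@near_eq_derive _ _ _ f (fun=> 0)); first exact: derive_cst.
near=> y; apply: hM.
have yx : `|x - y| < 1.
  near: y; have /nbhs_ballP := nbhsx_ballx x 1 ltr01.
  by move=> /nbhs_ballP; rewrite -ball_normE.
have h : `|x| <= `|x - y| + `|y| by rewrite -{1}(subrK y x) ler_normD.
have := ler_norm M; lra.
Unshelve. all: by end_near. Qed.

Lemma CC_test f : test_function f -> CC f.
Proof.
move=> [/(_ 0%N) [cf _] /compact_bounded [M [_ HM]]]; split => //.
exists (`|M| + 1) => x xM; apply: contraTeq xM => fx; rewrite -leNgt.
apply: HM; first by rewrite (le_lt_trans (ler_norm M))// ltrDl.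
exact: subset_closure.
Qed.

End compact_support.
Arguments pd {R d} i f g.

Section IBP.
Context (R : realType) (d : nat) (U : 'rV[R]_d -> R) (mu : probability 'rV[R]_d R).
Hypothesis gU : gibbs_measure U mu.
Variable dU : 'I_d -> 'rV[R]_d -> R.
Hypothesis dUE : forall i, pd i U (dU i).
Hypothesis cdU : forall i, continuous (dU i).
Hypothesis cU : continuous U.
Notation E := ('rV[R]_d * 'rV[R]_d)%type.
Notation kappa := (@gaussm R d).
Notation muh := (prodp mu kappa).
Notation mR := (measurableTypeR R).

Lemma CC_itg f : CC f -> itg mu f.
Proof. by move=> /CC_bddm; exact: bddm_itg. Qed.

Lemma dom_CC (f : 'rV[R]_d -> R) : CC f -> dom 0 (fun z : E => f z.1).
Proof. by move=> /CC_bddm; exact: dom_x. Qed.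

(* Apply [transport] to the constant solution 1 and the function v_i psi(x):
   averaging v_i v_j over the Gaussian isolates the i-th partial derivative. *)
Lemma IBP (psi : 'rV[R]_d -> R) dpsi i : CC psi -> (forall j, pd j psi (dpsi j)) ->
  (forall j, CC (dpsi j)) -> EX mu (dpsi i) = EX mu (fun x => dU i x * psi x).
Proof.
move=> cpsi pdpsi cdpsi.
pose phi (z : E) := z.2 ord0 i * psi z.1.
pose dphi j (z : E) := z.2 ord0 i * dpsi j z.1.
pose H (z : E) := vdot dU z * phi z - \sum_j z.2 ord0 j * dphi j z.
have Hd : dom 2 H.
  apply: domB; last first.
    apply: dom_sum => j; apply: (@domM _ _ 1 1); first exact: dom_v.
    by apply: (@domM _ _ 1 0); [exact: dom_v|exact: dom_CC].
  rewrite (_ : (fun _ => _) = (fun z : E => \sum_j (z.2 ord0 j * z.2 ord0 i) * (dU j z.1 * psi z.1))).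
    apply: dom_sum => j.
    have := domM (dom_vv R j i) (dom_CC (CCMl (@cdU j) cpsi)); exact: dom_le.
  by apply/funext => z; rewrite /vdot mulr_suml; apply: eq_bigr => j _; rewrite /phi; ring.
have [mH [C [C0 HC]]] := Hd.
have iphi : itg muh phi.
  by apply: (@dom_itg _ _ _ 1) => //; apply: (@domM _ _ 1 0); [exact: dom_v|exact: dom_CC].
have := @transport R d U mu gU dU dUE cdU cU (fun _ _ => 1) (fun _ _ => 0) phi dphi 1 C ler01.
have pphi v j : pd j (fun x => phi (x, v)) (fun x => dphi j (x, v)) by exact: pdZ.
have HE : (fun t z => 0 * phi z + 1 * (vdot dU z * phi z - \sum_j z.2 ord0 j * dphi j z)) = (fun (t : R) z => H z).
  by apply/funext => t; apply/funext => z; rewrite mul0r add0r mul1r.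
rewrite HE /= => tr.
have {tr} : EX muh (fun z => 1 * phi z) = EX muh (fun z => 1 * phi z) + ri (fun=> EX muh H) 0 1.
  apply: tr => //.
  - by move=> j x v; exact: pphi.
  - move=> v; apply: contZ; exact: cpsi.1.
  - by move=> j v; apply: contZ; exact: (cdpsi j).1.
  - by apply: (measurableT_comp mH); exact: measurable_snd.
  - by move=> _; exact: lbm_cst.
  - by move=> _; exact: lbm_cst.
  - by move=> z t /andP[t0 _]; rewrite ri_cst// mul0r addr0.
  - by rewrite (_ : (fun _ => _) = phi)//; apply/funext => z; rewrite mul1r.
  - by rewrite (_ : (fun _ => _) = phi)//; apply/funext => z; rewrite mul1r.
(* The solution 1 is constant in time, so [transport] says exactly that H has mean zero. *)
rewrite -[LHS]addr0 => /addrI; rewrite ri_cst// subr0 mulr1 => /esym.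
rewrite (EX_Pi _ _ Hd)// => EH.
have E1 x : Pi H x = dU i x * psi x - dpsi i x.
  pose a : 'rV[R]_d := \row_j dU j x; pose e : 'rV[R]_d := delta_mx ord0 i.
  pose b : 'rV[R]_d := \row_j dpsi j x.
  have eE w : dotv w e = w ord0 i.
    rewrite /dotv (bigD1 i)//= big1 => [|j ji]; first by rewrite mxE !eqxx mulr1 addr0.
    by rewrite mxE (negbTE ji) andbF mulr0.
  have [i1 e1] := gauss_cov a e; have [i2 e2] := gauss_cov b e.
  transitivity (EX kappa (fun w => psi x * (dotv w a * dotv w e) - dotv w b * dotv w e)).
    apply: EX_eq => w; rewrite /H /phi /dphi /vdot/= eE; congr (_ - _).
      rewrite (_ : dotv w a = \sum_j w ord0 j * dU j x); first by ring.
      by apply: eq_bigr => j _; rewrite mxE.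
    by rewrite /dotv mulr_suml; apply: eq_bigr => j _; rewrite mxE; ring.
  rewrite EXB ?EXZ//; last exact: itgZ.
  rewrite e1 e2 /dotv (bigD1 i)//= big1 ?addr0 => [|j ji]; last first.
    by rewrite !mxE (negbTE ji) andbF mulr0.
  rewrite (bigD1 i)//= big1 ?addr0 => [|j ji]; last first.
    by rewrite !mxE (negbTE ji) andbF mulr0.
  by rewrite !mxE !eqxx !mulr1 mulrC.
move: EH; rewrite (EX_eq _ E1) EXB.
- by move=> /eqP; rewrite subr_eq0 => /eqP.
- by apply: CC_itg; exact: CCMl.
- exact: CC_itg.
Qed.

End IBP.

Section smooth.
Context (R : realType) (d : nat).
Implicit Types (u : 'rV[R]_d -> R).

(** [test_function] with the support condition of [CC], a class stable under [partial] by
    [CC_pd]. *)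
Definition smC u := (forall k, is_C k u) /\ CC u.

Lemma test_smC u : test_function u -> smC u.
Proof. by move=> tu; split; [exact: tu.1|exact: CC_test]. Qed.

Lemma smC_pd u i : smC u -> pd i u (partial i u).
Proof. by move=> [/(_ 1%N) [_ /(_ i) [h _]] _]; exact: pd_partial. Qed.

Lemma smC_partial u i : smC u -> smC (partial i u).
Proof.
move=> su; have [h cu] := su.
have hp k : is_C k (partial i u) by have [_ /(_ i) []] := h k.+1.
by split => //; apply: CC_pd (smC_pd i su) (hp 0%N).1.
Qed.

Lemma smC_cont u : smC u -> continuous u.
Proof. by move=> [/(_ 0%N) []]. Qed.

Lemma smC_sym u i j x : smC u -> partial i (partial j u) x = partial j (partial i u) x.
Proof.
move=> su.
apply: (@schwarz _ _ u (partial j u) (partial i u) _ _ (delta_mx ord0 j) (delta_mx ord0 i)).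
- exact: smC_pd.
- exact: smC_pd.
- by apply: smC_pd; exact: smC_partial.
- by apply: smC_pd; exact: smC_partial.
- by apply: smC_cont; do 2!apply: smC_partial.
- by apply: smC_cont; do 2!apply: smC_partial.
Qed.

End smooth.

(** * Green's formula, Bochner's identity and the bound on |grad U| |grad u| *)

Section elliptic.
Context (R : realType) (d : nat) (U : 'rV[R]_d -> R) (mu : probability 'rV[R]_d R).
Hypothesis gU : gibbs_measure U mu.
Variable (dU : 'I_d -> 'rV[R]_d -> R) (ddU : 'I_d -> 'I_d -> 'rV[R]_d -> R).
Hypothesis dUE : forall i, pd i U (dU i).
Hypothesis cdU : forall i, continuous (dU i).
Hypothesis cU : continuous U.
Hypothesis ddUE : forall i j, pd i (dU j) (ddU i j).
Hypothesis cddU : forall i j, continuous (ddU i j).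

Definition Nop (u : 'rV[R]_d -> R) x := \sum_i (dU i x * partial i u x - partial i (partial i u) x).

Definition grad2 (u : 'rV[R]_d -> R) := \sum_i EX mu (fun x => partial i u x ^+ 2).
Definition hess2 (u : 'rV[R]_d -> R) := \sum_i \sum_j EX mu (fun x => partial i (partial j u) x ^+ 2).

Lemma CCX f : CC f -> CC (fun x : 'rV[R]_d => f x ^+ 2 : R).
Proof. by move=> cf; apply: CCMr => //; exact: cf.1. Qed.

Lemma CC_Nop u : smC u -> CC (Nop u).
Proof.
move=> su; apply: CC_sum => i; apply: CCB; last by apply: (smC_partial _ (smC_partial _ su)).2.
by apply: CCMl => //; exact: (smC_partial _ su).2.
Qed.

(** [IBP] for the products (d_i u) w, which have bounded support even when w has not; this makes w =
    1 available later. *)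
Lemma green u w dw : smC u -> continuous w -> (forall i, pd i w (dw i)) ->
  (forall i, continuous (dw i)) ->
  EX mu (fun x => Nop u x * w x) = \sum_i EX mu (fun x => partial i u x * dw i x).
Proof.
move=> su cw pw cdw.
have c1 i : CC (partial i u) by exact: (smC_partial _ su).2.
have c2 i j : CC (partial i (partial j u)) by exact: (smC_partial _ (smC_partial _ su)).2.
have E i : EX mu (fun x => (dU i x * partial i u x - partial i (partial i u) x) * w x) =
    EX mu (fun x => partial i u x * dw i x).
  have := @IBP _ _ _ _ gU _ dUE cdU cU (fun x => partial i u x * w x)
    (fun j x => partial j (partial i u) x * w x + partial i u x * dw j x) i.
  move=> /(_ (CCMr (c1 i) cw)) h.
  have {}h := h (fun j => pdM (smC_pd j (smC_partial i su)) (pw j)).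
  have {h} := h (fun j => CCD (CCMr (c2 j i) cw) (CCMr (c1 i) (cdw j))).
  rewrite EXD; try by apply: CC_itg; apply: CCMr.
  move=> /esym/eqP; rewrite addrC -subr_eq -EXB; first last.
  - by apply: CC_itg; exact: CCMr.
  - by apply: CC_itg; apply: CCMl => //; exact: CCMr.
  by move=> /eqP <-; apply: EX_eq => x; ring.
rewrite -(eq_bigr _ (fun i _ => E i)) -EX_sum.
  by apply: EX_eq => x; rewrite mulr_suml.
move=> i _; apply: CC_itg; apply: CCMr => //; apply: CCB => //.
exact: CCMl.
Qed.

Lemma pd_Nop u j : smC u -> pd j (Nop u)
  (fun x => Nop (partial j u) x + \sum_i ddU j i x * partial i u x).
Proof.
move=> su.
have p i : pd j (fun x => dU i x * partial i u x - partial i (partial i u) x)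
   (fun x => ddU j i x * partial i u x + dU i x * partial j (partial i u) x
      - partial j (partial i (partial i u)) x).
  apply: pdD; first by apply: pdM => //; apply: smC_pd; exact: smC_partial.
  by apply: pdN; apply: smC_pd; do 2!apply: smC_partial.
apply: pd_eq (pd_sum _ p) _ => x; rewrite /Nop -big_split/=; apply: eq_bigr => i _.
have e1 : partial j (partial i u) = partial i (partial j u).
  by apply/funext => y; exact: smC_sym.
have e2 : partial j (partial i (partial i u)) x = partial i (partial i (partial j u)) x.
  by rewrite (smC_sym _ _ _ (smC_partial i su)) e1.
by rewrite e1 e2 -addrA addrC.
Qed.

(** Green's formula gives the sum over j of <d_j u, d_j (N u)>, and d_j (N u) is N (d_j u) plus a
    term with the Hessian of U ([pd_Nop]). A second use of Green's formula turns <N (d_j u), d_j u>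
    into squared second derivatives of u. *)
Lemma bochner u : smC u ->
  EX mu (fun x => Nop u x ^+ 2) = hess2 u +
  EX mu (fun x => \sum_i \sum_j ddU i j x * partial j u x * partial i u x).
Proof.
move=> su.
have c1 i : CC (partial i u) by exact: (smC_partial _ su).2.
have c2 i j : CC (partial i (partial j u)) by exact: (smC_partial _ (smC_partial _ su)).2.
have cN := CC_Nop su.
have cNd j : CC (Nop (partial j u)) by apply: CC_Nop; exact: smC_partial.
have cs j : CC (fun x => \sum_i ddU j i x * partial i u x) by apply: CC_sum => i; exact: CCMl.
transitivity (EX mu (fun x => Nop u x * Nop u x)); first by apply: EX_eq => x; rewrite expr2.
rewrite (green su cN.1 (fun j => pd_Nop j su)); last by move=> j; exact: (CCD (cNd j) (cs j)).1.
transitivity (\sum_j (EX mu (fun x => Nop (partial j u) x * partial j u x) +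
    EX mu (fun x => \sum_i ddU j i x * partial i u x * partial j u x))).
  apply: eq_bigr => j _; rewrite -EXD.
  - apply: EX_eq => x; rewrite mulrDr [X in X + _]mulrC; congr (_ + _).
    by rewrite mulr_sumr; apply: eq_bigr => i _; rewrite mulrC.
  - exact: (CC_itg mu (CCMr (cNd j) (c1 j).1)).
  - by apply: CC_itg; apply: CC_sum => i; apply: CCMr; [exact: CCMl|exact: (c1 j).1].
rewrite big_split/=; congr (_ + _).
  rewrite /hess2 exchange_big/=; apply: eq_bigr => j _.
  rewrite (green (smC_partial j su) (c1 j).1 (fun i => smC_pd i (smC_partial j su))).
    by apply: eq_bigr => i _; apply: EX_eq => x; rewrite expr2.
  by move=> i; exact: (c2 i j).1.
rewrite EX_sum// => i _; apply: CC_itg; apply: CC_sum => j.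
by apply: CCMr; [exact: CCMl|exact: (c1 i).1].
Qed.

Lemma bochner_le u L : smC u ->
  (forall x (v : 'rV[R]_d), - L * dotv v v <= \sum_i \sum_j ddU i j x * v ord0 j * v ord0 i) ->
  hess2 u <= EX mu (fun x => Nop u x ^+ 2) + L * grad2 u.
Proof.
move=> su hL.
have c1 i : CC (partial i u) by exact: (smC_partial _ su).2.
rewrite bochner// -addrA lerDl.
rewrite (_ : L * grad2 u = EX mu (fun x => L * \sum_i partial i u x ^+ 2)); last first.
  rewrite EXZ; last by apply: itg_sum => i _; apply: CC_itg; exact: CCX.
  by rewrite EX_sum// => i _; apply: CC_itg; exact: CCX.
rewrite -EXD.
- apply: EX_ge0 => x; have := hL x (\row_i partial i u x).
  have -> : dotv (\row_i partial i u x) (\row_i partial i u x) = \sum_i partial i u x ^+ 2.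
    by apply: eq_bigr => i _; rewrite mxE.
  have -> : \sum_i \sum_j ddU i j x * (\row_k partial k u x) ord0 j * (\row_k partial k u x) ord0 i =
      \sum_i \sum_j ddU i j x * partial j u x * partial i u x.
    by apply: eq_bigr => i _; apply: eq_bigr => j _; rewrite !mxE.
  by rewrite mulNr -subr_ge0 opprK.
- apply: CC_itg; apply: CC_sum => i; apply: CC_sum => j.
  by apply: CCMr; [exact: CCMl|exact: (c1 i).1].
- by apply: itgZ; apply: itg_sum => i _; apply: CC_itg; exact: CCX.
Qed.

Definition gradU2 x := \sum_i dU i x ^+ 2.
Definition Ysq u := EX mu (fun x => gradU2 x * \sum_i partial i u x ^+ 2).

Lemma continuous_gradU2 : continuous gradU2.
Proof.
rewrite /gradU2; elim: (index_enum _) => [|i r ih].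
  by rewrite (_ : (fun x => _) = fun=> 0); [exact: cst_continuous|apply/funext => x; rewrite big_nil].
rewrite (_ : (fun x => _) = fun x => dU i x * dU i x + \sum_(j <- r) dU j x ^+ 2).
  by apply: contD => //; exact: contM.
by apply/funext => x; rewrite big_cons expr2.
Qed.

(* Integrate div (|grad u|^2 grad U) by parts, bound Delta U, absorb the cross
   term with the Hessian by Young's inequality with parameter (1 - a) / 2. *)
Lemma Ysq_le u a b : smC u -> 0 <= a < 1 -> 0 <= b ->
  (forall x, \sum_i ddU i i x <= a * gradU2 x + b) ->
  (1 - a) ^+ 2 * Ysq u <= 2 * b * (1 - a) * grad2 u + 4 * hess2 u.
Proof.
move=> su /andP[a0 a1] b0 hab.
have c1 i : CC (partial i u) by exact: (smC_partial _ su).2.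
have c2 i j : CC (partial i (partial j u)) by exact: (smC_partial _ (smC_partial _ su)).2.
pose g x := \sum_i partial i u x ^+ 2.
have cg : CC g by apply: CC_sum => i; exact: CCX.
have pg j : pd j g (fun x => \sum_i 2 * (partial i u x * partial j (partial i u) x)).
  apply: pd_sum => i; apply: (@pd_ext _ _ _ (fun x => partial i u x * partial i u x)).
    by move=> x; rewrite expr2.
  apply: pd_eq (pdM (smC_pd j (smC_partial i su)) (smC_pd j (smC_partial i su))) _.
  by move=> x; ring.
have cdg j : CC (fun x => \sum_i 2 * (partial i u x * partial j (partial i u) x)).
  by apply: CC_sum => i; apply: CCZ; apply: CCMr => //; exact: (c2 j i).1.
have YE j : EX mu (fun x => dU j x ^+ 2 * g x) =
   EX mu (fun x => ddU j j x * g x + dU j x * (\sum_i 2 * (partial i u x * partial j (partial i u) x))).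
  have := @IBP _ _ _ _ gU _ dUE cdU cU (fun x => dU j x * g x)
    (fun k x => ddU k j x * g x + dU j x * \sum_i 2 * (partial i u x * partial k (partial i u) x)) j.
  move=> h; rewrite h.
  - by apply: EX_eq => x; ring.
  - exact: CCMl.
  - by move=> k; apply: pdM.
  - by move=> k; apply: CCD; exact: CCMl.
have Y1 : Ysq u = EX mu (fun x => \sum_j (ddU j j x * g x + dU j x * (\sum_i 2 * (partial i u x * partial j (partial i u) x)))).
  rewrite EX_sum; last by move=> j _; apply: CC_itg; apply: CCD; exact: CCMl.
  rewrite -(eq_bigr _ (fun j _ => YE j)) -EX_sum; last first.
    by move=> j _; apply: CC_itg; apply: CCMl => //; exact: (contM (@cdU j) (@cdU j)).
  by apply: EX_eq => x; rewrite /gradU2 mulr_suml.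
pose q := 1 - a; have q0 : 0 < q by rewrite subr_gt0.
have H2E : hess2 u = EX mu (fun x => \sum_i \sum_j partial i (partial j u) x ^+ 2).
  rewrite EX_sum; last by move=> i _; apply: CC_itg; apply: CC_sum => j; exact: CCX.
  apply: eq_bigr => i _; rewrite EX_sum// => j _; apply: CC_itg; exact: CCX.
have G2E : grad2 u = EX mu g.
  by rewrite EX_sum// => i _; apply: CC_itg; exact: CCX.
have cYg : CC (fun x => gradU2 x * g x) by apply: CCMl => //; exact: continuous_gradU2.
have cH : CC (fun x => \sum_i \sum_j partial i (partial j u) x ^+ 2).
  by apply: CC_sum => i; apply: CC_sum => j; exact: CCX.
have iY : itg mu (fun x => gradU2 x * g x) by exact: CC_itg.
have ig : itg mu g by exact: CC_itg.
have iH := CC_itg mu cH.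
(* With q = 1 - a, moving the term in [Ysq u] to the left leaves the coefficient q - a q - q^2/2 =
   q^2/2; doubling gives the claim. *)
suff : q * Ysq u <= (a * q + q * q / 2) * Ysq u + b * q * grad2 u + 2 * hess2 u.
  rewrite (_ : a = 1 - q); last by rewrite /q; ring.
  rewrite /q => h; rewrite (_ : 1 - (1 - a) = a) in h; [|ring].
  nra.
rewrite {1}Y1 H2E G2E -!EXZ//; last first.
  by apply: CC_itg; apply: CC_sum => j; apply: CCD; exact: CCMl.
rewrite -!EXD//; try by do ?[apply: itgD|apply: itgZ].
apply: EX_le.
- by apply: itgZ; apply: CC_itg; apply: CC_sum => j; apply: CCD; exact: CCMl.
- by do ?[apply: itgD|apply: itgZ].
move=> x; rewrite big_split/= -mulr_suml.
have g0 : 0 <= g x by apply: sumr_ge0 => i _; exact: sqr_ge0.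
have h1 : (\sum_i ddU i i x) * g x <= (a * gradU2 x + b) * g x by rewrite ler_wpM2r.
have h2 : q * \sum_i dU i x * (\sum_i0 2 * (partial i0 u x * partial i (partial i0 u) x)) <=
    q * q / 2 * (gradU2 x * g x) + 2 * \sum_i \sum_j partial i (partial j u) x ^+ 2.
  rewrite /gradU2 mulr_suml !mulr_sumr -big_split/=; apply: ler_sum => i _.
  rewrite /g !mulr_sumr -big_split/=; apply: ler_sum => j _.
  rewrite -subr_ge0.
  rewrite (_ : _ - _ = 2^-1 * (q * dU i x * partial j u x - 2 * partial i (partial j u) x) ^+ 2); last by field.
  by rewrite mulr_ge0// sqr_ge0.
rewrite mulrDr.
rewrite -/(g x); apply: le_trans (lerD (ler_wpM2l (ltW q0) h1) h2) _.
rewrite le_eqVlt; apply/orP; left; apply/eqP; ring.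
Qed.

End elliptic.

Section L2.
Context disp (T : measurableType disp) (R : realType).

Lemma Lnorm_sqr (m : {measure set T -> \bar R}) (g : T -> \bar R) :
  ('N[m]_(2%:E)[g] ^+ 2 = \int[m]_x (`|g x| ^+ 2))%E.
Proof.
have P2 (x : \bar R) : (0 <= x)%E -> (x `^ 2 = x ^+ 2)%E.
  case: x => [x||]//; last by move=> _; rewrite poweRyr.
  by rewrite lee_fin => x0; rewrite poweR_EFin powR_mulrn// EFin_expe.
rewrite -P2 ?Lnorm_ge0// poweR_Lnorm//.
by apply: eq_integral => x _; rewrite P2.
Qed.

Lemma abse_sqr (r : R) : (`|r%:E| ^+ 2 = (r ^+ 2)%:E)%E.
Proof. by rewrite abse_EFin -EFin_expe real_normK// num_real. Qed.

Variable P : probability T R.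
Implicit Types f g h : T -> R.

Lemma Lfun2P f : f \in Lfun P 2%:E <-> measurable_fun setT f /\ itg P (fun x => f x ^+ 2).
Proof.
split=> [fL|[mf fi]].
  split; last exact: Lfun2_integrable_sqr.
  by have := sub_Lfun_mfun fL; rewrite inE.
rewrite inE; apply/andP; split; rewrite inE//=.
rewrite /finite_norm; have := Lnorm_sqr P (EFin \o f).
rewrite (eq_integral (fun x => (f x ^+ 2)%:E)); last first.
  by move=> x _; rewrite abse_sqr.
rewrite (EX_E fi) => E; have := Lnorm_ge0 P 2%:E (EFin \o f).
by move: E; case: Lnorm => // r; rewrite ltry.
Qed.

Lemma itg_sqr_mul f g : measurable_fun setT f -> measurable_fun setT g ->
  itg P (fun x => f x ^+ 2) -> itg P (fun x => g x ^+ 2) -> itg P (fun x => f x * g x).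
Proof.
move=> mf mg i1 i2; apply: (itg_dom _ (itgD i1 i2)); first exact: measurable_funM.
move=> x; rewrite normrM; have := sqr_ge0 (`|f x| - `|g x|).
rewrite -(real_normK (num_real (f x))) -(real_normK (num_real (g x))).
move: (normr_ge0 (f x)) (normr_ge0 (g x)); nra.
Qed.

Lemma itg_sqrD f g : measurable_fun setT f -> measurable_fun setT g ->
  itg P (fun x => f x ^+ 2) -> itg P (fun x => g x ^+ 2) -> itg P (fun x => (f x + g x) ^+ 2).
Proof.
move=> mf mg i1 i2; apply: (itg_dom _ (itgZ 2 (itgD i1 i2))).
  by apply: measurable_funX; exact: measurable_funD.
by move=> x; rewrite ger0_norm ?sqr_ge0//; have := sqr_ge0 (f x - g x); nra.
Qed.

Lemma L2norm_cvg0 (u : nat -> T -> R) : (forall n, measurable_fun setT (u n)) ->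
  (fun n => L2norm P (u n)) @ \oo --> 0%E ->
  forall e : R, 0 < e -> \forall n \near \oo, itg P (fun x => u n x ^+ 2) /\ EX P (fun x => u n x ^+ 2) <= e.
Proof.
move=> mu /fine_cvgP[finu /cvgrPdist_lt cu] e e0.
(* The minimum with 1 is taken because the square of a number in [0, 1] is at most that number. *)
have h := cu (Num.min 1 e); rewrite lt_min ltr01 e0 in h.
have {}h := h isT.
near=> n.
have fn : L2norm P (u n) \is a fin_num by near: n.
have : `|0 - fine (L2norm P (u n))| < Num.min 1 e by near: n.
rewrite sub0r normrN lt_min => /andP[h1 h2].
have := Lnorm_sqr P (EFin \o u n).
rewrite -/(L2norm P (u n)) -(fineK fn) -EFin_expe => E.
have E' : (\int[P]_x (u n x ^+ 2)%:E = (fine (L2norm P (u n)) ^+ 2)%:E)%E.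
  by rewrite E; apply: eq_integral => x _; rewrite abse_sqr.
have i : itg P (fun x => u n x ^+ 2).
  apply/integrableP; split; first by apply/measurable_EFinP; exact: measurable_funX.
  rewrite (eq_integral (fun x => (u n x ^+ 2)%:E)) ?E' ?ltry//.
  by move=> x _; rewrite /= ger0_norm// sqr_ge0.
split => //; rewrite /EX /Rintegral E'/=.
rewrite -(real_normK (num_real (fine _))).
move: (normr_ge0 (fine (L2norm P (u n)))); nra.
Unshelve. all: by end_near. Qed.

End L2.

(** * Approximate solutions of m u + N u = g *)

Section resolvent.
Context (R : realType) (d : nat) (U : 'rV[R]_d -> R) (mu : probability 'rV[R]_d R).
Hypothesis gU : gibbs_measure U mu.
Hypothesis U2 : is_C 2 U.
Notation dU := (fun i => partial i U).
Notation N := (Nop dU).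

Lemma pdU i : pd i U (partial i U).
Proof. by have [_ /(_ i) [h _]] := U2; exact: pd_partial. Qed.
Lemma cpdU i : continuous (partial i U).
Proof. by have [_ /(_ i) [_ []]] := U2. Qed.
Lemma contU : continuous U.
Proof. by have [] := U2. Qed.
Lemma pddU i j : pd i (partial j U) (partial i (partial j U)).
Proof. by have [_ /(_ j) [_ [_ /(_ i) [h _]]]] := U2; exact: pd_partial. Qed.
Lemma cpddU i j : continuous (partial i (partial j U)).
Proof. by have [_ /(_ j) [_ [_ /(_ i) [_ []]]]] := U2. Qed.

Lemma langevin_opE u x : langevin_op U u x = - 2^-1 * N u x.
Proof.
rewrite /langevin_op /Nop sumrB mulrBr; congr (_ + _).
  by congr (_ * _); apply: eq_bigr => i _; rewrite !mxE.
rewrite mulNr opprK; congr (_ * _); apply: eq_bigr => i _; by rewrite !mxE.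
Qed.

Lemma green_self u : smC u -> EX mu (fun x => N u x * u x) = grad2 mu u.
Proof.
move=> su; rewrite (green gU pdU cpdU contU su (smC_cont su) (fun i => smC_pd i su)).
  by apply: eq_bigr => i _; apply: EX_eq => x; rewrite expr2.
by move=> i; apply: smC_cont; exact: smC_partial.
Qed.

Lemma CC_N u : smC u -> CC (N u).
Proof. by move=> su; apply: CC_Nop => //; exact: cpdU. Qed.

Lemma grad2_ge0 u : 0 <= grad2 mu u.
Proof. by apply: sumr_ge0 => i _; apply: EX_ge0 => x; exact: sqr_ge0. Qed.

Lemma EX_sqr_split (c : R) u : smC u ->
  EX mu (fun x => (c * u x + N u x) ^+ 2) =
  c ^+ 2 * EX mu (fun x => u x ^+ 2) + 2 * c * grad2 mu u + EX mu (fun x => N u x ^+ 2).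
Proof.
move=> su; have cu := su.2; have cN := CC_N su.
rewrite -green_self// -!EXZ; try (by apply: CC_itg; apply: CCX); try (by apply: CC_itg; apply: CCMr => //; exact: cu.1).
rewrite -!EXD; try (by do ?[apply: itgD|apply: itgZ|apply: CC_itg|apply: CCX|apply: (CCMr cN cu.1)]).
by apply: EX_eq => x; ring.
Qed.

(* The spectrum of the Langevin generator is discrete and nonpositive, so it
   does not contain m / 2. *)
Lemma resolvent_approx (m : R) (g : 'rV[R]_d -> R) : 0 < m ->
  discrete_spectrum mu (langevin_closure U mu) ->
  measurable_fun setT g -> itg mu (fun x => g x ^+ 2) ->
  forall e : R, 0 < e -> exists u, smC u /\ EX mu (fun x => (m * u x + N u x - g x) ^+ 2) <= e.
Proof.
move=> m0 ds mg ig e e0.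
pose l := m / 2; have l0 : 0 < l by rewrite divr_gt0.
have mlan u : smC u -> measurable_fun setT (langevin_op U u).
  move=> su; rewrite (_ : langevin_op U u = fun x => - 2^-1 * N u x).
    by apply: measurable_funM => //; apply: continuous_rV_measurable; exact: (CC_N su).1.
  by apply/funext => x; exact: langevin_opE.
have approx f g' : langevin_closure U mu f g' -> forall eps : R, 0 < eps -> exists u, [/\ smC u,
   itg mu (fun x => (u x - f x) ^+ 2), EX mu (fun x => (u x - f x) ^+ 2) <= eps,
   itg mu (fun x => (- 2^-1 * N u x - g' x) ^+ 2) & EX mu (fun x => (- 2^-1 * N u x - g' x) ^+ 2) <= eps].
  move=> [/Lfun2P[mf _] /Lfun2P[mg' _] [u [tu c1 c2]]] eps eps0.
  have mu1 n : measurable_fun setT (u n \- f).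
    by apply: measurable_funB => //; apply: continuous_rV_measurable; exact: (smC_cont (test_smC (tu n))).
  have mu2 n : measurable_fun setT (langevin_op U (u n) \- g').
    by apply: measurable_funB => //; apply: mlan; exact: test_smC.
  have n1 := L2norm_cvg0 mu1 c1 eps0; have n2 := L2norm_cvg0 mu2 c2 eps0.
  have [n [[i1 e1] [i2 e2]]] : exists n, (itg mu (fun x => (u n \- f) x ^+ 2) /\ EX mu (fun x => (u n \- f) x ^+ 2) <= eps) /\
     (itg mu (fun x => (langevin_op U (u n) \- g') x ^+ 2) /\ EX mu (fun x => (langevin_op U (u n) \- g') x ^+ 2) <= eps).
    by near \oo => n; exists n; split; near: n.
  exists (u n); split => //; first exact: test_smC.
    by move: i2; congr (itg _ _); apply/funext => x; rewrite /= langevin_opE.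
  by move: e2; congr (EX _ _ <= _); apply/funext => x; rewrite /= langevin_opE.
(* Outside the resolvent set, discreteness yields a nonzero eigenfunction f for l > 0. Test
   functions u approximate f in such a way that (2 l + N) u is close to 0, whereas its norm is at
   least 2 l |u| because <u, N u> >= 0. *)
have [hres|/ds [_ [f [Af nf]] _]] := pselect (in_resolvent mu (langevin_closure U mu) l); last first.
  exfalso; apply: nf; have [/Lfun2P[mf if2] _ _] := Af.
  have key : EX mu (fun x => f x ^+ 2) <= 0.
    apply/ler_addgt0Pr => eps eps0; rewrite add0r.
    (* Total weight of the approximation error eps / c in [h1] and [h4]. *)
    pose c := 6 + 4 / l ^+ 2; have c0 : 0 < c by rewrite addr_gt0// divr_gt0// exprn_gt0.
    have [u [su i1 e1 i2 e2]] := approx _ _ Af (eps / c) (divr_gt0 eps0 c0).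
    have cu := su.2; have cN := CC_N su.
    have iu : itg mu (fun x => u x ^+ 2) by apply: CC_itg; exact: CCX.
    have h1 : EX mu (fun x => f x ^+ 2) <= 2 * EX mu (fun x => (u x - f x) ^+ 2) + 2 * EX mu (fun x => u x ^+ 2).
      rewrite -!EXZ// -EXD; try exact: itgZ.
      apply: EX_le => //; first by apply: itgD; exact: itgZ.
      by move=> x; have := sqr_ge0 (2 * u x - f x); nra.
    have iN : itg mu (fun x => (2 * l * u x + N u x) ^+ 2).
      apply: CC_itg; apply: CCX; apply: CCD => //; exact: CCZ.
    have h2 : (2 * l) ^+ 2 * EX mu (fun x => u x ^+ 2) <= EX mu (fun x => (2 * l * u x + N u x) ^+ 2).
      rewrite EX_sqr_split// -addrA lerDl addr_ge0//.
        by rewrite mulr_ge0 ?grad2_ge0// !mulr_ge0// ltW.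
      by apply: EX_ge0 => x; exact: sqr_ge0.
    have h3 : EX mu (fun x => (2 * l * u x + N u x) ^+ 2) <=
       8 * l ^+ 2 * EX mu (fun x => (u x - f x) ^+ 2) + 8 * EX mu (fun x => (- 2^-1 * N u x - l * f x) ^+ 2).
      rewrite -!EXZ// -EXD; try exact: itgZ.
      apply: EX_le => //; first by apply: itgD; exact: itgZ.
      move=> x; rewrite -subr_ge0.
      rewrite (_ : _ - _ = 4 * (l * (u x - f x) + (- 2^-1 * N u x - l * f x)) ^+ 2); last by field.
      by rewrite mulr_ge0// sqr_ge0.
    have h4 : EX mu (fun x => u x ^+ 2) <= 2 * (eps / c) + 2 / l ^+ 2 * (eps / c).
      have l2 : 0 < (2 * l) ^+ 2 by rewrite exprn_gt0// mulr_gt0.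
      rewrite -(ler_pM2l l2) (le_trans h2)// (le_trans h3)//.
      rewrite (_ : (2 * l) ^+ 2 * _ = 8 * l ^+ 2 * (eps / c) + 8 * (eps / c)); last by field; rewrite !gt_eqF.
      by apply: lerD; apply: ler_wpM2l => //; rewrite mulr_ge0// sqr_ge0.
    have E : (2 * (eps / c) + 2 * (2 * (eps / c) + 2 / l ^+ 2 * (eps / c))) = eps.
      rewrite /c; field; rewrite gt_eqF//= gt_eqF//.
      by rewrite addr_gt0// mulr_gt0// exprn_gt0.
    by rewrite (le_trans h1)// -[leRHS]E lerD// ler_wpM2l.
  have z : (\int[mu]_x `|(f x ^+ 2)%:E| = 0)%E.
    rewrite (eq_integral (fun x => (f x ^+ 2)%:E)); last first.
      by move=> x _; rewrite /= ger0_norm// sqr_ge0.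
    rewrite EX_E//; congr EFin; apply/eqP; rewrite eq_le key EX_ge0// => x; exact: sqr_ge0.
  have mf2 : measurable_fun setT (fun x => (f x ^+ 2)%:E) by apply/measurable_EFinP; exact: measurable_funX.
  have := (ae_eq_integral_abs mu measurableT mf2).1 z.
  apply: filterS => x /= /(_ I) [] /eqP; rewrite sqrf_eq0 => /eqP //.
(* With l = m / 2 and the generator equal to - N / 2, the operator to invert is (m + N) / 2; hence
   the datum g / 2. *)
have [_ /(_ (fun x => g x / 2))] := hres.
have Lg : (fun x => g x / 2) \in Lfun mu 2%:E.
  apply/Lfun2P; split; first exact: measurable_funM.
  rewrite (_ : (fun x => _) = fun x => 4^-1 * g x ^+ 2); first exact: itgZ.
  by apply/funext => x; field.
move=> /(_ Lg) [f [g' [Af fg]]].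
have [/Lfun2P[mf if2] /Lfun2P[mg' ig'2] _] := Af.
pose c := 8 * l ^+ 2 + 8; have c0 : 0 < c by rewrite ltr_wpDl// mulr_ge0// exprn_ge0// ltW.
have [u [su i1 e1 i2 e2]] := approx _ _ Af (e / c) (divr_gt0 e0 c0).
exists u; split => //.
have cu := su.2; have cN := CC_N su.
pose g2 x := 2 * (l * f x - g' x).
have mg2 : measurable_fun setT g2 by apply: measurable_funM => //; apply: measurable_funB => //; exact: measurable_funM.
have if2' : itg mu (fun x => (m * u x + N u x - g2 x) ^+ 2).
  rewrite (_ : (fun x => _) = fun x => 4 * (l * (u x - f x) + - (- 2^-1 * N u x - g' x)) ^+ 2).
    apply: itgZ; apply: itg_sqrD.
    - by apply: measurable_funM => //; apply: measurable_funB => //; apply: continuous_rV_measurable; exact: cu.1.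
    - apply: measurableT_comp => //; apply: measurable_funB => //; apply: measurable_funM => //.
      by apply: continuous_rV_measurable; exact: cN.1.
    - rewrite (_ : (fun x => _) = fun x => l ^+ 2 * (u x - f x) ^+ 2); first exact: itgZ.
      by apply/funext => x; rewrite exprMn.
    - by rewrite (_ : (fun x => _) = fun x => (- 2^-1 * N u x - g' x) ^+ 2)//; apply/funext => x; rewrite sqrrN.
  by apply/funext => x; rewrite /g2 /l; field.
rewrite (_ : EX _ _ = EX mu (fun x => (m * u x + N u x - g2 x) ^+ 2)); last first.
  rewrite /EX /Rintegral; congr fine; apply: ae_eq_integral => //.
  - apply/measurable_EFinP; apply: measurable_funX; apply: measurable_funB => //.
    apply: continuous_rV_measurable; apply: contD cN.1; apply: contZ; exact: cu.1.
  - by apply/measurable_EFinP; exact: itg_meas if2'.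
  by apply: filterS fg => x h _; rewrite /g2 h mulrCA divff// mulr1.
apply: (@le_trans _ _ (8 * l ^+ 2 * EX mu (fun x => (u x - f x) ^+ 2) + 8 * EX mu (fun x => (- 2^-1 * N u x - g' x) ^+ 2))).
  rewrite -!EXZ// -EXD; try exact: itgZ.
  apply: EX_le => //; first by apply: itgD; exact: itgZ.
  move=> x; rewrite -subr_ge0.
  rewrite (_ : _ - _ = 4 * (l * (u x - f x) + (- 2^-1 * N u x - g' x)) ^+ 2); last by rewrite /g2 /l; field.
  by rewrite mulr_ge0// sqr_ge0.
rewrite (_ : e = 8 * l ^+ 2 * (e / c) + 8 * (e / c)).
  by apply: lerD; apply: ler_wpM2l => //; rewrite mulr_ge0// sqr_ge0.
rewrite -mulrDl -/c; field; rewrite gt_eqF//.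
Unshelve. all: by end_near. Qed.

End resolvent.

Section smooth_lin.
Context (R : realType) (d : nat).
Implicit Types (u w : 'rV[R]_d -> R).

Lemma pd_partialE i (f g : 'rV[R]_d -> R) : pd i f g -> partial i f = g.
Proof. by move=> p; apply/funext => x; have [_ <-] := p x. Qed.

Lemma pdB i (f g df dg : 'rV[R]_d -> R) : pd i f df -> pd i g dg ->
  pd i (fun x => f x - g x) (fun x => df x - dg x).
Proof. by move=> p q; apply: pdD => //; exact: pdN. Qed.

Lemma is_CB k u w : is_C k u -> is_C k w -> is_C k (fun x => u x - w x).
Proof.
elim: k u w => [|k ih] u w [cu hu] [cw hw].
  by split=> // x; exact: (cvgB (cu x) (cw x)).
split => [x|i]; first exact: (cvgB (cu x) (cw x)).
have [du iu] := hu i; have [dw iw] := hw i.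
have p := pdB (pd_partial du) (pd_partial dw); split.
  by move=> x; have [] := p x.
by rewrite (pd_partialE p); exact: ih.
Qed.

Lemma smCB u w : smC u -> smC w -> smC (fun x => u x - w x).
Proof.
by move=> [su cu] [sw cw]; split; [move=> k; exact: is_CB|exact: CCB].
Qed.

Lemma partialB i u w : smC u -> smC w ->
  partial i (fun x => u x - w x) = (fun x => partial i u x - partial i w x).
Proof. by move=> su sw; apply: pd_partialE; apply: pdB; exact: smC_pd. Qed.

Lemma NopB (dU : 'I_d -> 'rV[R]_d -> R) u w : smC u -> smC w ->
  Nop dU (fun x => u x - w x) = (fun x => Nop dU u x - Nop dU w x).
Proof.
have R4 (a b c e : R) : a - b - (c - e) = a - c - (b - e) by ring.
move=> su sw; apply/funext => x; rewrite /Nop -sumrB; apply: eq_bigr => i _.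
rewrite partialB// partialB; try exact: smC_partial.
by rewrite mulrBr R4.
Qed.

End smooth_lin.

Section poincare_use.
Context (R : realType) (d : nat) (U : 'rV[R]_d -> R) (mu : probability 'rV[R]_d R).
Hypothesis gU : gibbs_measure U mu.
Hypothesis U2 : is_C 2 U.
Notation dU := (fun i => partial i U).
Notation N := (Nop dU).
Variable m : R.
Hypothesis m0 : 0 < m.
Hypothesis pc : poincare mu m^-1.

Lemma poincare_smC u : smC u ->
  m * (EX mu (fun x => u x ^+ 2) - (EX mu u) ^+ 2) <= grad2 mu u.
Proof.
move=> su; have cu := su.2.
have i2 : itg mu (fun x => u x ^+ 2) by apply: CC_itg; exact: CCX.
have Lu : u \in Lfun mu 2%:E.
  by apply/Lfun2P; split => //; apply: continuous_rV_measurable; exact: cu.1.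
have := pc (su.1 1%N) Lu.
rewrite varianceE// unlock.
have -> : (\int[mu]_w ((u ^+ 2)%R w)%:E = (EX mu (fun x => u x ^+ 2))%:E)%E by exact: (EX_E i2).
have -> : (\int[mu]_w (u w)%:E = (EX mu u)%:E)%E by exact: (EX_E (CC_itg mu cu)).
have cg : CC (fun x => \sum_i partial i u x ^+ 2).
  by apply: CC_sum => i; apply: CCX; exact: (smC_partial _ su).2.
have -> : (\int[mu]_x (dotv (grad u x) (grad u x))%:E = (grad2 mu u)%:E)%E.
  rewrite /grad2 -EX_sum; last by move=> i _; apply: CC_itg; apply: CCX; exact: (smC_partial _ su).2.
  rewrite -(EX_E (CC_itg mu cg)); apply: eq_integral => x _; congr EFin.
  by apply: eq_bigr => i _; rewrite !mxE expr2.
rewrite -EFin_expe -EFinB -EFinM lee_fin => h.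
rewrite -(@ler_pM2l _ m^-1) ?invr_gt0// mulrA mulVf ?gt_eqF// mul1r//.
Qed.

Lemma EX_N u : smC u -> EX mu (N u) = 0.
Proof.
move=> su; have := green gU (pdU U2) (cpdU U2) (contU U2) su (@cst_continuous 'rV[R]_d R (1 : R)) (fun i => pd_cst i (1 : R)).
move=> /(_ (fun i => @cst_continuous 'rV[R]_d R (0 : R))).
rewrite big1 => [E|i _].
  by rewrite -E; apply: EX_eq => x; rewrite mulr1.
rewrite (_ : (fun x => _) = fun=> 0) ?EX_cst//; apply/funext => x; by rewrite mulr0.
Qed.

Lemma EX_hN u : smC u ->
  EX mu (fun x => (m * u x + N u x) * N u x) = m * grad2 mu u + EX mu (fun x => N u x ^+ 2).
Proof.
move=> su; have cu := su.2; have cN := CC_N U2 su.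
rewrite -(green_self gU U2 su) -EXZ; last by apply: CC_itg; apply: (CCMr cN cu.1).
rewrite -EXD; try by do ?[apply: itgZ|apply: CC_itg|apply: CCX|apply: (CCMr cN cu.1)].
by apply: EX_eq => x; ring.
Qed.

Lemma EX_hw u : smC u ->
  EX mu (fun x => (m * u x + N u x) * u x) = m * EX mu (fun x => u x ^+ 2) + grad2 mu u.
Proof.
move=> su; have cu := su.2; have cN := CC_N U2 su.
rewrite -(green_self gU U2 su) -EXZ; last by apply: CC_itg; exact: CCX.
rewrite -EXD; try by do ?[apply: itgZ|apply: CC_itg|apply: CCX|apply: (CCMr cN cu.1)].
by apply: EX_eq => x; ring.
Qed.

(** The left side is m^2 |u|^2 + 2 m |grad u|^2 + |N u|^2. Poincare bounds m^2 |u|^2 by m |grad u|^2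
    plus the square of m times the mean of u, which is the mean of m u + N u since N u has mean
    zero. The rest is at most 3 (m |grad u|^2 + |N u|^2). *)
Lemma EX_h_le u : smC u ->
  EX mu (fun x => (m * u x + N u x) ^+ 2) <=
  3 * EX mu (fun x => (m * u x + N u x) * N u x) + EX mu (fun x => m * u x + N u x) ^+ 2.
Proof.
move=> su; have cu := su.2; have cN := CC_N U2 su.
rewrite EX_hN// EX_sqr_split// EXD; try by do ?[apply: itgZ|apply: CC_itg].
rewrite EX_N// addr0 EXZ; last exact: CC_itg.
have h := ler_wpM2l (ltW m0) (poincare_smC su).
have n0 : 0 <= EX mu (fun x => N u x ^+ 2) by apply: EX_ge0 => x; exact: sqr_ge0.
have g0 := mulr_ge0 (ltW m0) (grad2_ge0 mu u).
nra.
Qed.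

End poincare_use.

(** * The bounce kernel *)

Section half_gauss.
Context (R : realType) (d : nat).
Notation kappa := (@gaussm R d).
Notation V := 'rV[R]_d.

Definition posp (y : R) : R := Num.max y 0.
Definition negp (y : R) : R := Num.max (- y) 0.

Lemma posp_ge0 y : 0 <= posp y. Proof. by rewrite le_max lexx orbT. Qed.
Lemma negp_ge0 y : 0 <= negp y. Proof. by rewrite le_max lexx orbT. Qed.
Lemma pospBnegp y : posp y - negp y = y.
Proof.
rewrite /posp /negp; case: (leP 0 y) => y0.
  by rewrite (max_idPr _) ?subr0// oppr_le0.
by rewrite (max_idPl _) ?oppr_ge0 ?ltW// sub0r opprK.
Qed.
Lemma pospDnegp y : posp y + negp y = `|y|.
Proof.
rewrite /posp /negp; case: (leP 0 y) => y0.
  by rewrite (max_idPr _) ?oppr_le0// addr0 ger0_norm.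
by rewrite (max_idPl _) ?oppr_ge0 ?ltW// add0r ltr0_norm.
Qed.
Lemma pospN y : posp (- y) = negp y. Proof. by []. Qed.
Lemma negpN y : negp (- y) = posp y. Proof. by rewrite /negp opprK. Qed.
Lemma posp_le y : posp y <= `|y|. Proof. by rewrite -pospDnegp lerDl negp_ge0. Qed.
Lemma negp_le y : negp y <= `|y|. Proof. by rewrite -pospDnegp lerDr posp_ge0. Qed.
Lemma negp_sqr_le y : negp y ^+ 2 <= y ^+ 2.
Proof. by rewrite -(real_normK (num_real y)) ler_sqr ?nnegrE ?negp_ge0 ?negp_le. Qed.

Lemma measurable_posp : measurable_fun [set: R] posp.
Proof. by apply: measurable_maxr. Qed.
Lemma measurable_negp : measurable_fun [set: R] negp.
Proof. by apply: measurable_maxr. Qed.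

Lemma measurable_oppV : measurable_fun [set: V] (fun w : V => - w).
Proof. exact: measurable_rV_opp. Qed.

Lemma EX_gaussN (f : V -> R) : itg kappa f ->
  itg kappa (fun w => f (- w)) /\ EX kappa (fun w => f (- w)) = EX kappa f.
Proof.
move=> i; have mf := itg_meas i.
have mfN : measurable_fun [set: V] (fun w => f (- w)) by apply: measurableT_comp => //; exact: measurable_oppV.
split.
  apply/integrableP; split; first exact/measurable_EFinP.
  rewrite [X in (X < _)%E](_ : _ = \int[kappa]_w `|(f w)%:E|)%E; first by case/integrableP : i.
  rewrite -(@ge0_integral_gaussN R d (fun w => `|(f w)%:E|)%E)//.
  by apply/measurable_EFinP; exact: measurableT_comp.
rewrite /EX /Rintegral integralE [in RHS]integralE; congr (fine (_ - _)).
- rewrite -(@ge0_integral_gaussN R d (fun z => (EFin \o f)^\+ z)%E)//.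
    by apply: eq_integral => z _; rewrite !funeposE.
  by apply: measurable_funepos; exact/measurable_EFinP.
- rewrite -(@ge0_integral_gaussN R d (fun z => (EFin \o f)^\- z)%E)//.
    by apply: eq_integral => z _; rewrite !funenegE.
  by apply: measurable_funeneg; exact/measurable_EFinP.
Qed.

Variable a : V.
Let l (w : V) := posp (dotv w a).
Let b (w : V) := negp (dotv w a).

Lemma measurable_posp_dotv : measurable_fun [set: V] l.
Proof. by apply: (measurableT_comp measurable_posp); exact: measurable_dotv_cst. Qed.
Lemma measurable_negp_dotv : measurable_fun [set: V] b.
Proof. by apply: (measurableT_comp measurable_negp); exact: measurable_dotv_cst. Qed.

Lemma itg_dotv : itg kappa (fun w => `|dotv w a|).
Proof. exact: (integrable_norm (gauss_mean a).1). Qed.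

Lemma itg_posp : itg kappa l.
Proof. by apply: itg_dom measurable_posp_dotv itg_dotv _ => w; rewrite ger0_norm ?posp_ge0// posp_le. Qed.
Lemma itg_negp : itg kappa b.
Proof. by apply: itg_dom measurable_negp_dotv itg_dotv _ => w; rewrite ger0_norm ?negp_ge0// negp_le. Qed.

Lemma dotvN (w c : V) : dotv (- w) c = - dotv w c.
Proof. by rewrite /dotv -sumrN; apply: eq_bigr => i _; rewrite mxE mulNr. Qed.

Lemma EX_negp : EX kappa b = EX kappa l.
Proof.
by rewrite -(EX_gaussN itg_posp).2; apply: EX_eq => w; rewrite /l dotvN pospN.
Qed.

Lemma itg_negp_mul c : itg kappa (fun w => b w * dotv w c).
Proof.
have [i1 _] := gauss_affine_EX a 0; have [i2 _] := gauss_affine_EX c 0.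
apply: itg_dom (itgD i1 i2) _.
  by apply: measurable_funM; [exact: measurable_negp_dotv|exact: measurable_dotv_cst].
move=> w; rewrite !addr0 normrM (ger0_norm (negp_ge0 _)).
have := negp_le (dotv w a); have := negp_ge0 (dotv w a); rewrite -/(b w).
have := sqr_ge0 (`|dotv w a| - `|dotv w c|).
rewrite -(real_normK (num_real (dotv w a))) -(real_normK (num_real (dotv w c))).
move: (normr_ge0 (dotv w a)) (normr_ge0 (dotv w c)); nra.
Qed.

Lemma itg_posp_mul c : itg kappa (fun w => l w * dotv w c).
Proof.
have [i _] := EX_gaussN (itg_negp_mul c).
rewrite (_ : (fun w => _) = (fun w => - 1 * (b (- w) * dotv (- w) c))); first exact: itgZ.
by apply/funext => w; rewrite /b !dotvN negpN -/(l w) mulrN mulN1r opprK.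
Qed.

(** Under w -> -w the positive and negative parts are exchanged and w . c changes sign, so their
    pairings with w . c are opposite; their difference is the covariance a . c. *)
Lemma EX_negp_mul c : EX kappa (fun w => b w * dotv w c) = - (2^-1 * dotv a c).
Proof.
have e1 : EX kappa (fun w => l w * dotv w c) = - EX kappa (fun w => b w * dotv w c).
  rewrite -(EX_gaussN (itg_negp_mul c)).2 -mulN1r -EXZ; last exact: (EX_gaussN (itg_negp_mul c)).1.
  by apply: EX_eq => w; rewrite /b !dotvN negpN -/(l w) mulrN mulN1r opprK.
have := (gauss_cov a c).2.
rewrite (_ : (fun v => _) = (fun w => l w * dotv w c - b w * dotv w c)); last first.
  by apply/funext => w; rewrite -{1}(pospBnegp (dotv w a)) mulrBl.
rewrite EXB; [|exact: itg_posp_mul|exact: itg_negp_mul].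
rewrite e1 => <-; field => //.
Qed.

Lemma EX_posp_mul c : EX kappa (fun w => l w * dotv w c) = 2^-1 * dotv a c.
Proof.
have := (gauss_cov a c).2.
rewrite (_ : (fun v => _) = (fun w => l w * dotv w c - b w * dotv w c)); last first.
  by apply/funext => w; rewrite -{1}(pospBnegp (dotv w a)) mulrBl.
rewrite EXB; [|exact: itg_posp_mul|exact: itg_negp_mul].
rewrite EX_negp_mul; lra.
Qed.

(** The product is the quadratic form of the rank-one matrix with entries c_i e_j: trace c . e,
    squared Frobenius norm |c|^2 |e|^2. With Cauchy-Schwarz on the trace the constant is 3 = 1 +
    2. *)
Lemma gauss_prod_sqr (c e : V) : itg kappa (fun w => (dotv w c * dotv w e) ^+ 2) /\
  EX kappa (fun w => (dotv w c * dotv w e) ^+ 2) <= 3 * (dotv c c * dotv e e).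
Proof.
pose H : 'M[R]_d := \matrix_(i, j) (c ord0 i * e ord0 j).
have qE w : qform H w + 0 = dotv w c * dotv w e.
  rewrite addr0 /qform /dotv mulr_suml; apply: eq_bigr => i _.
  by rewrite mulr_sumr; apply: eq_bigr => j _; rewrite mxE; ring.
have fE : frob H = dotv c c * dotv e e.
  rewrite /frob /dotv mulr_suml; apply: eq_bigr => i _.
  by rewrite mulr_sumr; apply: eq_bigr => j _; rewrite mxE; ring.
have tE : \tr H = dotv c e by apply: eq_bigr => i _; rewrite mxE.
have [i le] := gauss_qform_EX H 0.
have E : (fun v => (qform H v + 0) ^+ 2) = (fun w => (dotv w c * dotv w e) ^+ 2).
  by apply/funext => w; rewrite qE.
rewrite E in i le; split => //; apply: le_trans le _.
rewrite fE tE addr0.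
have := (gauss_affine_EX (dotv e e *: c - dotv c e *: e) 0).2.
have [ee0|ee0] := eqVneq (dotv e e) 0.
  have e0 i0 : e ord0 i0 = 0.
    have := @psumr_eq0P _ _ _ (fun i => e ord0 i * e ord0 i) (fun i _ => sqr_ge0 (e ord0 i)) ee0 i0 isT.
    by move=> /eqP; rewrite mulf_eq0 orbb => /eqP.
  have -> : dotv c e = 0 by apply: big1 => i0 _; rewrite e0 mulr0.
  by rewrite ee0; move=> _; lra.
have egt : 0 < dotv e e by rewrite lt_neqAle eq_sym ee0 dotv_ge0.
move=> _; have := dotv_ge0 (dotv e e *: c - dotv c e *: e).
have -> : dotv (dotv e e *: c - dotv c e *: e) (dotv e e *: c - dotv c e *: e) =
    dotv e e * (dotv c c * dotv e e - dotv c e ^+ 2).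
  pose p := dotv e e; pose q := dotv c e; rewrite -/p -/q.
  rewrite {1}/dotv (eq_bigr (fun i => p ^+ 2 * (c ord0 i * c ord0 i) + (-2 * p * q) * (c ord0 i * e ord0 i) + q ^+ 2 * (e ord0 i * e ord0 i))).
    by rewrite !big_split/= -!mulr_sumr -!/(dotv _ _) -/p -/q; ring.
  by move=> i0 _; rewrite !mxE; ring.
by rewrite pmulr_rge0// subr_ge0 => h; lra.
Qed.

(* EX kappa l is half the first absolute moment. With y the absolute value of a
   centred Gaussian, y (s y - 1)^2 (s y + 2) >= 0 bounds E y from below by the
   second and fourth moments; s^-2 = 3 |a|^2 gives the constant 12. *)
Lemma EX_posp_ge : dotv a a <= 12 * EX kappa l ^+ 2.
Proof.
have [->|a0] := eqVneq (dotv a a) 0; first by rewrite mulr_ge0// sqr_ge0.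
have A0 : 0 < dotv a a by rewrite lt_neqAle eq_sym a0 dotv_ge0.
pose A := dotv a a; pose q := Num.sqrt (3 * A); pose s := q^-1.
have q0 : 0 < q by rewrite sqrtr_gt0 mulr_gt0.
have q2 : q ^+ 2 = 3 * A by rewrite sqr_sqrtr// mulr_ge0// ltW.
have [i4 e4] := gauss_prod_sqr a a.
have [i2 e2] := gauss_affine_EX a 0.
have h : EX kappa (fun w => 2^-1 * (3 * s * (dotv w a + 0) ^+ 2) - 2^-1 * (s ^+ 3 * (dotv w a * dotv w a) ^+ 2)) <= EX kappa (fun w => l w + b w).
  apply: EX_le.
  - by apply: itgB; apply: itgZ; apply: itgZ.
  - by apply: itgD; [exact: itg_posp|exact: itg_negp].
  move=> w; rewrite pospDnegp addr0.
  rewrite exprMn -(real_normK (num_real (dotv w a))).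
  set y := `|_|; have y0 : 0 <= y by exact: normr_ge0.
  rewrite -subr_ge0 (_ : _ - _ = 2^-1 * y * ((s * y - 1) ^+ 2 * (s * y + 2))); last by field.
  have s0 : 0 < s by rewrite invr_gt0.
  apply: mulr_ge0; first by rewrite mulr_ge0.
  by apply: mulr_ge0; [exact: sqr_ge0|rewrite addr_ge0// mulr_ge0// ltW].
rewrite EXB in h; try by do 2!apply: itgZ.
rewrite !EXZ// in h; try exact: itgZ.
rewrite EXD in h; [|exact: itg_posp|exact: itg_negp].
rewrite e2 EX_negp -/A expr0n/= addr0 in h.
have h' : 2^-1 * (3 * s * A) - 2^-1 * (s ^+ 3 * (3 * (A * A))) <= 2 * EX kappa l.
  have -> : 2 * EX kappa l = EX kappa l + EX kappa l by lra.
    apply: le_trans h; rewrite lerD2l lerN2.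
  by apply: ler_wpM2l; rewrite ?invr_ge0//; apply: ler_wpM2l => //; rewrite exprn_ge0// invr_ge0 ltW.
have : q <= 6 * EX kappa l.
  suff -> : q = 3 * (2^-1 * (3 * s * A) - 2^-1 * (s ^+ 3 * (3 * (A * A)))) by lra.
  have -> : A = q ^+ 2 / 3 by rewrite q2; field.
  by rewrite /s; field; rewrite gt_eqF.
move=> qle; have : q ^+ 2 <= (6 * EX kappa l) ^+ 2.
  rewrite ler_sqr// nnegrE; first exact: ltW.
  by rewrite (le_trans _ qle)// ltW.
by rewrite q2 exprMn -/A; lra.
Qed.

End half_gauss.

Section measurable_EX.
Context (R : realType) d1 d2 (T1 : measurableType d1) (T2 : measurableType d2) (P : probability T2 R).

Lemma measurable_EX (K : T1 * T2 -> R) : measurable_fun setT K ->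
  (forall x, itg P (fun w => K (x, w))) -> measurable_fun setT (fun x => EX P (fun w => K (x, w))).
Proof.
move=> mK iK.
pose Kp p := (`|K p| + K p)%:E; pose Kn p := (`|K p|)%:E.
have mKn : measurable_fun setT Kn by apply/measurable_EFinP; exact: measurableT_comp.
have mKp : measurable_fun setT Kp.
  by apply/measurable_EFinP; apply: measurable_funD => //; exact: measurableT_comp.
have -> : (fun x => EX P (fun w => K (x, w))) = (fun x => fine (fubini_F P Kp x) - fine (fubini_F P Kn x)).
  apply/funext => x; have ia : itg P (fun z => `|K (x, z)|) by exact: (integrable_norm (iK x)).
  by rewrite /fubini_F/= -!/(Rintegral _ _ _) -!/(EX _ _) EXD// addrC addKr.
apply: measurable_funB.
- apply: measurableT_comp => //.
  apply: measurable_fun_fubini_tonelli_F => //.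
  by move=> p; rewrite lee_fin; have := ler_norm (- K p); rewrite normrN; lra.
- apply: measurableT_comp => //.
  by apply: measurable_fun_fubini_tonelli_F => // p; rewrite lee_fin.
Qed.

End measurable_EX.

(** * Jump part of the generator and its adjoint *)

Section adjoint.
Context (R : realType) (d : nat) (U : 'rV[R]_d -> R) (gamma : R).
Hypothesis U2 : is_C 2 U.
Notation V := 'rV[R]_d.
Notation E := (V * V)%type.
Notation kappa := (@gaussm R d).
Notation mR := (measurableTypeR R).
Implicit Types (h : E -> R).

Definition lam (z : E) : R := posp (dotv z.2 (grad U z.1)).
Definition bet (z : E) : R := negp (dotv z.2 (grad U z.1)).
Definition Zn (x : V) : R := EX kappa (fun w => lam (x, w)).
(* At a critical point of U the normalisation Zn vanishes and Bop is 0 (junk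
   value); this is harmless, since the bounce rate lam vanishes there too. *)
Definition Bop h (x : V) : R := (Zn x)^-1 * EX kappa (fun w => bet (x, w) * h (x, w)).
(** Only the jump part of the generator; transport is accounted for by the characteristics. *)
Definition gen h (z : E) : R := lam z * Bop h z.1 + gamma * Pi h z.1 - (lam z + gamma) * h z.

Lemma measurable_dotgrad : measurable_fun [set: E] (fun z : E => dotv z.2 (grad U z.1)).
Proof.
apply: measurable_dotv; first exact: measurable_snd.
apply: measurable_fun_rV => i.
rewrite (_ : _ \o _ = (fun z : E => partial i U z.1)).
  by apply: measurableT_comp; [apply: continuous_rV_measurable; exact: cpdU|exact: measurable_fst].
by apply/funext => z; rewrite /rV_coord/= mxE.
Qed.

Lemma measurable_lam : measurable_fun [set: E] lam.
Proof. by apply: (measurableT_comp (@measurable_posp R)); exact: measurable_dotgrad. Qed.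
Lemma measurable_bet : measurable_fun [set: E] bet.
Proof. by apply: (measurableT_comp (@measurable_negp R)); exact: measurable_dotgrad. Qed.

Lemma measurable_Zn : measurable_fun [set: V] Zn.
Proof. by apply: measurable_EX; [exact: measurable_lam|move=> x; exact: (itg_posp (grad U x))]. Qed.

Lemma Zn_ge0 x : 0 <= Zn x. Proof. by apply: EX_ge0 => w; exact: posp_ge0. Qed.

Lemma dotv_CS (v w : V) : dotv v w ^+ 2 <= dotv v v * dotv w w.
Proof.
have [i le] := gauss_prod_sqr v w.
have [i0 e0] := gauss_cov v w.
have h (c : R) : 0 <= dotv v v + 2 * c * dotv v w + c ^+ 2 * dotv w w.
  rewrite (_ : _ + _ = dotv (v + c *: w) (v + c *: w)) ?dotv_ge0//.
  rewrite /dotv !mulr_sumr -!big_split/=; apply: eq_bigr => j _; rewrite !mxE; ring.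
have [w0|w0] := eqVneq (dotv w w) 0.
  rewrite w0 mulr0; case: (eqVneq (dotv v w) 0) => [->|n0]; first by rewrite expr0n.
  have := h (- (dotv v v + 1) / (2 * dotv v w)).
  rewrite w0 mulr0 addr0.
  rewrite (_ : 2 * _ * _ = - (dotv v v + 1)); first lra.
  by field.
have wgt : 0 < dotv w w by rewrite lt_neqAle eq_sym w0 dotv_ge0.
have := h (- dotv v w / dotv w w).
rewrite (_ : _ + _ = (dotv v v * dotv w w - dotv v w ^+ 2) / dotv w w); last by field.
by rewrite pmulr_lge0 ?invr_gt0// subr_ge0.
Qed.

Lemma Zn_grad x : dotv (grad U x) (grad U x) <= 12 * Zn x ^+ 2.
Proof. exact: EX_posp_ge. Qed.

(** A zero normalisation forces grad U x = 0 by [Zn_grad]. Thanks to this, identities such as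
    [Zn_Bop] hold at critical points as well. *)
Lemma Zn0_bet x w : Zn x = 0 -> bet (x, w) = 0.
Proof.
move=> Z0; have := Zn_grad x; rewrite Z0 expr0n mulr0 => a0.
have a0' : dotv (grad U x) (grad U x) = 0 by apply/eqP; rewrite eq_le a0 dotv_ge0.
have := dotv_CS w (grad U x); rewrite a0' mulr0 => h.
have /eqP : dotv w (grad U x) ^+ 2 = 0 by apply/eqP; rewrite eq_le h sqr_ge0.
by rewrite sqrf_eq0 /bet/= => /eqP ->; rewrite /negp oppr0 maxxx.
Qed.

Section point.
Variables (x : V) (H : V -> R) (C : R).
Hypothesis mH : measurable_fun setT H.
Hypothesis HC : forall w, `|H w| <= C.
Let a := grad U x.

Lemma H_bound_ge0 : 0 <= C. Proof. exact: le_trans (normr_ge0 _) (HC 0). Qed.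
Let bH : bddm H. Proof. by split => //; exists C; split; [exact: H_bound_ge0|]. Qed.

Lemma itg_H : itg kappa H. Proof. exact: bddm_itg. Qed.
Lemma itg_HM f : itg kappa f -> itg kappa (fun w => f w * H w).
Proof.
by move=> i; rewrite (_ : (fun w => _) = fun w => H w * f w); [exact: itgM|apply/funext => w; rewrite mulrC].
Qed.

Let B := Bop (fun z => H z.2) x.

Lemma Zn_Bop : EX kappa (fun w => bet (x, w) * H w) = Zn x * B.
Proof.
rewrite /B /Bop; have [Z0|Z0] := eqVneq (Zn x) 0; last by rewrite mulrA mulfV// mul1r.
rewrite Z0 mul0r -[RHS](EX_cst kappa); apply: EX_eq => w.
by rewrite Zn0_bet// mul0r.
Qed.

Lemma Bop_bound : `|B| <= C.
Proof.
have [Z0|Z0] := eqVneq (Zn x) 0.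
  by rewrite /B /Bop Z0 invr0 mul0r normr0 H_bound_ge0.
have Zgt : 0 < Zn x by rewrite lt_neqAle eq_sym Z0 Zn_ge0.
have ib : itg kappa (fun w => bet (x, w) * H w) by exact: (itg_HM (itg_negp (grad U x))).
rewrite -(ler_pM2l Zgt) -{1}(ger0_norm (Zn_ge0 x)) -normrM -Zn_Bop.
rewrite (le_trans (EX_abs ib))// mulrC /Zn -(EX_negp a) -EXZ; last exact: (itg_negp (grad U x)).
apply: EX_le; [exact: (integrable_norm ib)|exact: (itgZ C (itg_negp (grad U x)))|].
move=> w; rewrite normrM mulrC (ger0_norm (negp_ge0 _)) /bet/=.
by rewrite ler_wpM2r ?negp_ge0.
Qed.

(** The term with w . a is what transport leaves after integration by parts, and w . a = lam - bet.
    Its part lam H cancels the bounce loss, so that bet replaces lam. The constant c disappears: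
    what bounces gain, c Zn B, is what bet H loses, and refreshment balances likewise. Only the
    pairing with w . e survives, with lam evaluated by [EX_posp_mul]. *)
Lemma adjoint_point (c : R) (e : V) :
  EX kappa (fun w => gen (fun z => H z.2) (x, w) * (c + dotv w e) + H w * (dotv w a * (c + dotv w e))) =
  EX kappa (fun w => H w * (bet (x, w) * (2^-1 * dotv a e * (Zn x)^-1 - dotv w e) - gamma * dotv w e)).
Proof.
set P := EX kappa H.
have il := itg_posp a; have ib := itg_negp a.
have ile := itg_posp_mul a e; have ibe := itg_negp_mul a e.
have ie := (gauss_mean e).1.
have iHe := itg_HM ie; have iHb := itg_HM ib; have iHbe := itg_HM ibe.
have iH := itg_H.
transitivity (EX kappa (fun w => B * c * lam (x, w) + B * (lam (x, w) * dotv w e) + (gamma * P * dotv w e + gamma * P * c)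
   - (c * gamma * H w + gamma * (dotv w e * H w)) - (c * (bet (x, w) * H w) + bet (x, w) * dotv w e * H w))).
  apply: EX_eq => w; rewrite /gen /Pi -/P -/B /=.
  rewrite -{1}(pospBnegp (dotv w a)) -/(lam (x, w)) -/(bet (x, w)); ring.
transitivity (EX kappa (fun w => 2^-1 * dotv a e * (Zn x)^-1 * (bet (x, w) * H w) - bet (x, w) * dotv w e * H w - gamma * (dotv w e * H w))); last first.
  by apply: EX_eq => w; ring.
have ic : itg kappa (fun=> gamma * P * c) by exact: itg_cst.
rewrite !(EXB, EXD, EXZ, EX_cst)//; try by do ?[apply: itgB|apply: itgD|apply: itgZ|exact: itg_cst].
rewrite (EX_posp_mul a e) (gauss_mean e).2 -/P Zn_Bop -[EX kappa (fun w => lam (x, w))]/(Zn x).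
have [Z0|Z0] := eqVneq (Zn x) 0; last by field.
rewrite Z0 /B /Bop Z0 invr0; ring.
Qed.

(** After the same cancellation, completing the square bounds the bounce part by lam B^2 - bet H^2,
    whose mean is Zn B^2 minus the mean of bet H^2. This is nonpositive by Jensen's inequality for
    the bounce kernel. The refreshment part gives exactly the velocity variance. *)
Lemma energy_point : 0 <= gamma ->
  EX kappa (fun w => 2 * H w * gen (fun z => H z.2) (x, w) + H w ^+ 2 * dotv w a) <=
  2 * gamma * (EX kappa H ^+ 2 - EX kappa (fun w => H w ^+ 2)).
Proof.
move=> g0; set P := EX kappa H.
have il := itg_posp a; have ib := itg_negp a.
have iH := itg_H; have iHb := itg_HM ib; have iHl := itg_HM il.
have iH2 : itg kappa (fun w => H w ^+ 2) by exact: (itg_HM iH).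
have iHb2 : itg kappa (fun w => bet (x, w) * H w ^+ 2).
  by rewrite (_ : (fun w => _) = fun w => bet (x, w) * H w * H w); [exact: itg_HM|apply/funext => w; rewrite -mulrA].
have iHl2 : itg kappa (fun w => lam (x, w) * H w ^+ 2).
  by rewrite (_ : (fun w => _) = fun w => lam (x, w) * H w * H w); [exact: itg_HM|apply/funext => w; rewrite -mulrA].
have i1 : itg kappa (fun w => B ^+ 2 * lam (x, w) + 2 * gamma * P * H w - 2 * gamma * H w ^+ 2 - bet (x, w) * H w ^+ 2).
  by do ?[apply: itgB|apply: itgD|apply: itgZ].
have h1 : EX kappa (fun w => 2 * H w * gen (fun z => H z.2) (x, w) + H w ^+ 2 * dotv w a) <=
   EX kappa (fun w => B ^+ 2 * lam (x, w) + 2 * gamma * P * H w - 2 * gamma * H w ^+ 2 - bet (x, w) * H w ^+ 2).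
  apply: EX_le => //.
    rewrite (_ : (fun w => _) = fun w => 2 * B * (lam (x, w) * H w) + 2 * gamma * P * H w - lam (x, w) * H w ^+ 2 - 2 * gamma * H w ^+ 2 - bet (x, w) * H w ^+ 2).
      by do ?[apply: itgB|apply: itgD|apply: itgZ].
    apply/funext => w; rewrite /gen /Pi -/P -/B /=.
    rewrite -{1}(pospBnegp (dotv w a)) -/(lam (x, w)) -/(bet (x, w)); ring.
  move=> w; rewrite /gen /Pi -/P -/B /=.
  rewrite -{1}(pospBnegp (dotv w a)) -/(lam (x, w)) -/(bet (x, w)).
  have := mulr_ge0 (posp_ge0 (dotv w a)) (sqr_ge0 (H w - B)); rewrite -/(lam (x, w)); nra.
have h2 : 0 <= EX kappa (fun w => bet (x, w) * H w ^+ 2 - 2 * B * (bet (x, w) * H w) + B ^+ 2 * bet (x, w)).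
  apply: EX_ge0 => w.
  rewrite (_ : _ + _ = bet (x, w) * (H w - B) ^+ 2); last by ring.
  by rewrite mulr_ge0 ?sqr_ge0 ?negp_ge0.
move: h1 h2; set L := EX kappa (fun w => 2 * H w * _ + _).
set Q := EX kappa (fun w => H w ^+ 2).
rewrite !(EXB, EXD, EXZ)//; try by do ?[apply: itgB|apply: itgD|apply: itgZ].
rewrite -[EX kappa (fun w => lam (x, w))]/(Zn x) Zn_Bop.
rewrite (_ : EX kappa (fun w => bet (x, w)) = Zn x); last exact: (EX_negp (grad U x)).
rewrite -/P -/Q; nra.
Qed.

End point.
End adjoint.

(** * Solutions along characteristics *)

Section solution.
Context (R : realType) (d : nat) (U : 'rV[R]_d -> R) (mu : probability 'rV[R]_d R) (gamma : R).
Hypothesis U2 : is_C 2 U.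
Hypothesis gU : gibbs_measure U mu.
Notation V := 'rV[R]_d.
Notation E := (V * V)%type.
Notation kappa := (@gaussm R d).
Notation muh := (prodp mu kappa).
Notation mR := (measurableTypeR R).
Notation dU := (fun i => partial i U).
Implicit Types (F : R -> E -> R).

(* [sol_char] is the equation dF/dt = v . grad F + gen F integrated along
   r |-> (x - r v, v), so that F need not be differentiable in x. *)
Record sol (C : R) (F : R -> E -> R) : Prop := {
  sol_meas : measurable_fun [set: mR * E] (fun p : mR * E => F p.1 p.2);
  sol_bd : forall t z, `|F t z| <= C;
  sol_char : forall z (t : R), 0 <= t ->
    F t (shift_flow t z) = F 0 z + ri (fun r => gen U gamma (F r) (shift_flow r z)) 0 t }.

Section bounded_family.
Variables (C : R) (F : R -> E -> R).
Hypothesis mF : measurable_fun [set: mR * E] (fun p : mR * E => F p.1 p.2).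
Hypothesis FC : forall t z, `|F t z| <= C.

Lemma msec t : measurable_fun [set: E] (F t).
Proof. exact: (measurableT_comp mF (@measurable_pair1 _ _ mR E t)). Qed.
Lemma msec2 t x : measurable_fun [set: V] (fun w => F t (x, w)).
Proof. exact: (measurableT_comp (msec t) (@measurable_pair1 _ _ V V x)). Qed.
Lemma bddF t : bddm (F t).
Proof.
split; first exact: msec.
by exists C; split => //; exact: le_trans (normr_ge0 _) (FC 0 0).
Qed.
Lemma domF t : dom 0 (F t). Proof. exact: (dom_bdd (msec t) (FC t)). Qed.
Lemma itgF t x : itg kappa (fun w => F t (x, w)).
Proof.
apply: bddm_itg; split; first exact: msec2.
by exists C; split => //; exact: le_trans (normr_ge0 _) (FC 0 0).
Qed.

Let m3 : measurable_fun [set: (mR * V) * V] (fun p : (mR * V) * V => (p.1.1, (p.1.2, p.2)) : mR * E).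
Proof.
apply/measurable_fun_pairP; split.
  rewrite (_ : _ \o _ = (fun p : (mR * V) * V => p.1.1))//.
  by apply: (measurableT_comp measurable_fst); exact: measurable_fst.
apply/measurable_fun_pairP; split; last exact: measurable_snd.
rewrite (_ : _ \o _ = (fun p : (mR * V) * V => p.1.2))//.
by apply: (measurableT_comp measurable_snd); exact: measurable_fst.
Qed.

Lemma measurable_PiF : measurable_fun [set: mR * V] (fun q : mR * V => Pi (F q.1) q.2).
Proof.
apply: (@measurable_EX _ _ _ _ _ kappa (fun p : (mR * V) * V => F p.1.1 (p.1.2, p.2))).
  exact: (measurableT_comp mF m3).
by move=> [t x]; exact: itgF.
Qed.

Lemma measurable_BopF : measurable_fun [set: mR * V] (fun q : mR * V => Bop U (F q.1) q.2).
Proof.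
apply: measurable_funM.
  (* On nonnegative reals, 0 included, inversion is the power -1, which is measurable. *)
  rewrite (_ : (fun q : mR * V => _) = (fun q : mR * V => Zn U q.2 `^ (-1))).
    apply: (measurableT_comp (measurable_powR (-1))).
    by apply: (measurableT_comp (measurable_Zn U2)); exact: measurable_snd.
  by apply/funext => q; rewrite powR_inv1// Zn_ge0.
apply: (@measurable_EX _ _ _ _ _ kappa (fun p : (mR * V) * V => bet U (p.1.2, p.2) * F p.1.1 (p.1.2, p.2))).
  apply: measurable_funM; last exact: (measurableT_comp mF m3).
  apply: (measurableT_comp (measurable_bet U2)); apply/measurable_fun_pairP; split; last exact: measurable_snd.
  rewrite (_ : _ \o _ = (fun p : (mR * V) * V => p.1.2))//.
  by apply: (measurableT_comp measurable_snd); exact: measurable_fst.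
move=> [t x]; rewrite (_ : (fun w => _) = fun w => F t (x, w) * bet U (x, w)).
  apply: itgM; last exact: (itg_negp (grad U x)).
  by split; [exact: msec2|exists C; split => //; exact: le_trans (normr_ge0 _) (FC 0 0)].
by apply/funext => w; rewrite mulrC.
Qed.

Lemma Pi_bd t x : `|Pi (F t) x| <= C.
Proof.
apply: le_trans (EX_abs (itgF t x)) _; rewrite -[leRHS](EX_cst kappa).
by apply: EX_le => //; [exact: (integrable_norm (itgF t x))|exact: itg_cst].
Qed.
Lemma Bop_bd t x : `|Bop U (F t) x| <= C.
Proof. exact: (@Bop_bound _ _ _ x (fun w => F t (x, w)) C (msec2 t x) (fun w => FC t (x, w))). Qed.

Let m2 : measurable_fun [set: mR * E] (fun p : mR * E => (p.1, p.2.1) : mR * V).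
Proof.
apply/measurable_fun_pairP; split; first exact: measurable_fst.
rewrite (_ : _ \o _ = (fun p : mR * E => p.2.1))//.
by apply: (measurableT_comp measurable_fst); exact: measurable_snd.
Qed.

Lemma measurable_gen : measurable_fun [set: mR * E] (fun p : mR * E => gen U gamma (F p.1) p.2).
Proof.
have ml : measurable_fun [set: mR * E] (fun p : mR * E => lam U p.2).
  by apply: (measurableT_comp (measurable_lam U2)); exact: measurable_snd.
apply: measurable_funB; last by apply: measurable_funM => //; exact: measurable_funD.
apply: measurable_funD.
  by apply: measurable_funM => //; exact: (measurableT_comp measurable_BopF m2).
by apply: measurable_funM => //; exact: (measurableT_comp measurable_PiF m2).
Qed.

Lemma measurable_along z : measurable_fun [set: mR] (fun r : mR => (r, shift_flow r z) : mR * E).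
Proof.
apply/measurable_fun_pairP; split; first exact: measurable_id.
exact: (measurableT_comp (@measurable_shift_flow R d) (@measurable_pair2 _ _ mR E z)).
Qed.

Lemma lbm_F z : lbm (fun r => F r (shift_flow r z)).
Proof.
split; first exact: (measurableT_comp mF (measurable_along z)).
by move=> N; exists C; split => //; exact: le_trans (normr_ge0 _) (FC 0 0).
Qed.

Lemma continuous_along (f : V -> R) (x v : V) : continuous f -> continuous (fun r : R => f (x - r *: v)).
Proof.
have c : continuous (fun t : R => x - t *: v).
  have -> : (fun t : R => x - t *: v) = (fun t => x + t *: (- v)).
    by apply/funext => t; rewrite scalerN.
  exact: continuous_line.
by move=> cf r; apply: (cvg_comp (fun r : R => x - r *: v) f); [exact: c|exact: cf].
Qed.

Lemma lbm_sum I (r : seq I) (f : I -> R -> R) :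
  (forall i, lbm (f i)) -> lbm (fun x => \sum_(i <- r) f i x).
Proof.
move=> lf; elim: r => [|i r ih].
  by rewrite (_ : (fun x => _) = fun=> 0); [exact: lbm_cst|apply/funext => x; rewrite big_nil].
rewrite (_ : (fun x => _) = fun x => f i x + \sum_(j <- r) f j x); first exact: lbmD.
by apply/funext => x; rewrite big_cons.
Qed.

Lemma lbm_lam (z : E) : lbm (fun r => lam U (shift_flow r z)).
Proof.
have l1 : lbm (fun r => dotv z.2 (grad U (z.1 - r *: z.2))).
  rewrite (_ : (fun r => dotv z.2 (grad U (z.1 - r *: z.2))) = (fun r => \sum_i z.2 ord0 i * partial i U (z.1 - r *: z.2))); last first.
    by apply/funext => s; apply: eq_bigr => i _; rewrite mxE.
  apply: lbm_sum => i; apply: lbmM; first exact: lbm_cst.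
  by apply: continuous_lbm; apply: continuous_along; exact: cpdU.
split.
  exact: (measurableT_comp (@measurable_posp R) l1.1).
move=> N; have [M [M0 HM]] := l1.2 N; exists M; split => // r rN.
by rewrite ger0_norm ?posp_ge0// (le_trans (posp_le _))// HM.
Qed.

Lemma lbm_gen z : lbm (fun r => gen U gamma (F r) (shift_flow r z)).
Proof.
have bd (f : R -> R) : measurable_fun [set: mR] f -> (forall r, `|f r| <= C) -> lbm f.
  move=> mf fC; split => // N; exists C; split => //; exact: le_trans (normr_ge0 _) (FC 0 0).
have l1 : lbm (fun r => Bop U (F r) (shift_flow r z).1).
  apply: bd; last by move=> r; exact: Bop_bd.
  exact: (measurableT_comp measurable_BopF (measurableT_comp m2 (measurable_along z))).
have l2 : lbm (fun r => Pi (F r) (shift_flow r z).1).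
  apply: bd; last by move=> r; exact: Pi_bd.
  exact: (measurableT_comp measurable_PiF (measurableT_comp m2 (measurable_along z))).
have ll := lbm_lam z; have lF := lbm_F z; have lc := lbm_cst gamma.
rewrite (_ : (fun r => _) = fun r => lam U (shift_flow r z) * Bop U (F r) (shift_flow r z).1
   + gamma * Pi (F r) (shift_flow r z).1 + - ((lam U (shift_flow r z) + gamma) * F r (shift_flow r z)))//.
by apply: lbmD; [apply: lbmD; exact: lbmM|apply: lbmN; apply: lbmM => //; exact: lbmD].
Qed.

End bounded_family.

Lemma shift_flowD (s t : R) (z : E) : shift_flow (s + t) (flow s z) = shift_flow t z.
Proof. by rewrite /shift_flow /flow/=; congr pair; rewrite scalerDl opprD addrA addrK. Qed.

Lemma shift_flow0 (s : R) (z : E) : shift_flow s (flow s z) = z.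
Proof. by rewrite /shift_flow /flow/=; case: z => x v /=; rewrite addrK. Qed.

Lemma ri_shift (f : R -> R) (s t : R) : 0 <= t -> lbm f -> ri f s (s + t) = ri (fun r => f (s + r)) 0 t.
Proof.
move=> t0 [mf bf].
have mfs : measurable_fun [set: mR] (fun r : mR => f (s + r)).
  by apply: (measurableT_comp mf); exact: measurable_funD.
have key (g : R -> \bar R) : measurable_fun [set: mR] g -> (forall x, 0 <= g x)%E ->
   (\int[lebesgue_measure]_(x in `[s, (s + t)%R]) g x = \int[lebesgue_measure]_(x in `[0%R, t]) g (s + x)%R)%E.
  move=> mg g0.
  rewrite integral_mkcond -(@ge0_integral_lebesgueD R (g \_ `[s, (s + t)%R]) s).
  - rewrite [RHS]integral_mkcond; apply: eq_integral => x _; rewrite !patchE (addrC x).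
    have -> : (s + x \in `[s, s + t]%classic) = (x \in `[0, t]%classic).
      by apply/idP/idP; rewrite !inE/= !in_itv/= lerDl lerD2l.
    by [].
  - by apply: (measurable_restrictT _ _).1; [exact: measurable_itv|exact: measurable_funTS].
  - by move=> x; rewrite patchE; case: ifP.
rewrite /ri /Rintegral integralE [in RHS]integralE; congr (fine (_ - _)).
- rewrite key//; first by apply: eq_integral => x _; rewrite !funeposE.
  by apply: measurable_funepos; exact/measurable_EFinP.
- rewrite key//; first by apply: eq_integral => x _; rewrite !funenegE.
  by apply: measurable_funeneg; exact/measurable_EFinP.
Qed.

(** The characteristic attached to [flow s z] passes through z at time s. Subtracting its integrated
    equations at times s + t and s gives the equation of the shifted family. *)
Lemma sol_shift C F s : sol C F -> 0 <= s -> sol C (fun t => F (s + t)).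
Proof.
move=> [mF FC cF] s0; split => //.
  have mm : measurable_fun [set: mR * E] (fun p : mR * E => (s + p.1, p.2) : mR * E).
    apply/measurable_fun_pairP; split; last exact: measurable_snd.
    by apply: measurable_funD => //; exact: measurable_fst.
  exact: (measurableT_comp mF mm).
move=> z t t0.
have h1 := cF (flow s z) (s + t) (addr_ge0 s0 t0); have h2 := cF (flow s z) s s0.
have lg := lbm_gen mF FC (flow s z).
rewrite shift_flowD in h1; rewrite shift_flow0 in h2.
rewrite h1 addr0 h2 -addrA; congr (_ + _).
rewrite (ri_cat lg s0); last by rewrite lerDl.
congr (_ + _); rewrite (ri_shift _ t0 lg).
by apply: ri_eq => r _; rewrite shift_flowD.
Qed.

End solution.

Section bounded_convergence.
Context disp (T : measurableType disp) (R : realType) (P : probability T R).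

Lemma EX_dom_cvg (f_ : nat -> T -> R) (f g : T -> R) :
  (forall n, measurable_fun setT (f_ n)) -> measurable_fun setT f -> itg P g ->
  (forall n x, `|f_ n x| <= g x) -> (forall x, f_ ^~ x @ \oo --> f x) ->
  (fun n => EX P (f_ n)) @ \oo --> EX P f.
Proof.
move=> mf_ mf ig fg cf.
have cE x : (fun n => (f_ n x)%:E) @ \oo --> (f x)%:E.
  by apply: cvg_EFin; [exact: nearW|exact: cf].
have [ifl _ c] := @dominated_convergence _ _ _ P setT measurableT (fun n x => (f_ n x)%:E) (fun x => (f x)%:E) (fun x => (g x)%:E)
   (fun n => (proj2 (measurable_EFinP _ _) (mf_ n))) (proj2 (measurable_EFinP _ _) mf)
   (aeW _ (fun x _ => cE x)) ig (aeW _ (fun x n _ => fg n x)).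
have E n : (\int[P]_x (f_ n x)%:E = (EX P (f_ n))%:E)%E.
  by rewrite EX_E//; apply: itg_dom ig (fg n).
move: c; rewrite (EX_E ifl).
rewrite (_ : (fun n => _) = (fun n => (EX P (f_ n))%:E)); last by apply/funext => n; exact: E.
by move=> /fine_cvgP[].
Qed.

End bounded_convergence.

(** * Weak formulation and energy inequality *)

Section cutoff.
Context (R : realType) (d : nat).
Notation V := 'rV[R]_d.

Lemma is_derive_of_line (f : V -> R) x v D :
  is_derive (0 : R) (1 : R) (fun s : R => f (x + s *: v)) D -> is_derive x v f D.
Proof.
move=> [df dE].
have E : (fun h : R => h^-1 *: (((fun s : R => f (x + s *: v)) \o shift (0 : R)) (h *: (1 : R)) - f (x + (0 : R) *: v))) =
         (fun h => h^-1 *: ((f \o shift x) (h *: v) - f x)).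
  apply/funext => h /=; rewrite scale0r !addr0 [h *: 1]mulr1.
  by congr (_ *: (f _ - _)); rewrite addrC.
split; first by rewrite /derivable -E.
by rewrite /derive -E.
Qed.

Lemma is_derive_posp_sqr (y : R) : is_derive y (1 : R) (fun y : R => posp y ^+ 2) (2 * posp y).
Proof.
suff H : (fun h : R => h^-1 *: (((fun y : R => posp y ^+ 2) \o shift y) (h *: (1 : R)) - posp y ^+ 2)) @ 0^' --> (2 * posp y).
  by split; [apply/cvg_ex; exists (2 * posp y)|exact/cvg_lim].
have key (h : R) : `|posp (y + h) ^+ 2 - posp y ^+ 2 - 2 * posp y * h| <= h ^+ 2.
  rewrite ler_norml /posp; have := sqr_ge0 h; have := sqr_ge0 (y + h); have := sqr_ge0 y.
  case: (leP 0 (y + h)) => h1; case: (leP 0 y) => h2 q1 q2 q3; apply/andP; split; nra.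
apply/cvgrPdist_le => e e0; near=> h.
have h0 : h != 0 by near: h; exact: nbhs_dnbhs_neq.
have he : `|h| < e.
  near: h; exists e => //= z.
  by rewrite /ball_/= sub0r normrN.
rewrite /= [h *: 1]mulr1 (addrC h) /GRing.scale/=.
have -> : 2 * posp y - h^-1 * (posp (y + h) ^+ 2 - posp y ^+ 2) =
   - (h^-1 * (posp (y + h) ^+ 2 - posp y ^+ 2 - 2 * posp y * h)) by field.
rewrite normrN normrM normfV mulrC ler_pdivrMr ?normr_gt0//.
apply: le_trans (key h) _; rewrite -real_normK ?num_real// expr2 ler_wpM2r//; exact: ltW.
Unshelve. all: by end_near. Qed.

Variable n : nat.
Let s : R := (n.+1%:R ^+ 2)^-1.
Let N1 : 0 < n.+1%:R :> R. Proof. by []. Qed.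
Let s0 : 0 < s. Proof. by rewrite invr_gt0 exprn_gt0. Qed.

(** Supported in the ball of radius n + 1. The square of a positive part is C^1, which is the
    regularity asked of the position factor of test functions, and the partial derivatives are at
    most 4/(n+1). *)
Definition chi (x : V) : R := posp (1 - s * dotv x x) ^+ 2.
Definition dchi (i : 'I_d) (x : V) : R := - (4 * s * x ord0 i * posp (1 - s * dotv x x)).

Lemma pd_chi i : pd i chi (dchi i).
Proof.
move=> x; apply: is_derive_of_line.
have -> : (fun h : R => chi (x + h *: delta_mx ord0 i)) =
   (fun y : R => posp y ^+ 2) \o (fun h : R => 1 - s * (dotv x x + 2 * x ord0 i * h + h * h)).
  apply/funext => h; rewrite /chi/=; congr (posp (_ - _ * _) ^+ 2).
  rewrite /dotv (bigD1 i)//= [in RHS](bigD1 i)//= !mxE !eqxx mulr1.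
  rewrite (eq_bigr (fun j => x ord0 j * x ord0 j)) => [|j ji]; first by ring.
  by rewrite !mxE (negbTE ji) andbF mulr0 addr0.
have -> : dchi i x = 2 * posp (1 - s * (dotv x x + 2 * x ord0 i * 0 + 0 * 0)) * (- (s * (2 * x ord0 i))).
  by rewrite /dchi !mulr0 !addr0; ring.
apply: is_derive1_comp; first exact: is_derive_posp_sqr.
apply: is_derive_eq; rewrite /GRing.scale/=; ring.
Qed.

Lemma continuous_entry i : continuous (fun x : V => x ord0 i).
Proof. by move=> x; exact: coord_continuous. Qed.

Lemma continuous_dotvv : continuous (fun x : V => dotv x x).
Proof.
rewrite /dotv; elim: (index_enum _) => [|i r ih].
  by rewrite (_ : (fun x : V => _) = fun=> 0); [exact: cst_continuous|apply/funext => x; rewrite big_nil].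
rewrite (_ : (fun x : V => _) = fun x : V => x ord0 i * x ord0 i + \sum_(j <- r) x ord0 j * x ord0 j).
  by apply: contD => //; apply: contM; exact: continuous_entry.
by apply/funext => x; rewrite big_cons.
Qed.

Lemma continuous_cutarg : continuous (fun x : V => posp (1 - s * dotv x x)).
Proof.
have c1 : continuous (fun x : V => 1 - s * dotv x x).
  apply: (@contD _ _ (fun=> 1) (fun x => - (s * dotv x x))); first exact: cst_continuous.
  rewrite (_ : (fun x => _) = fun x => (- s) * dotv x x); first exact: contZ continuous_dotvv.
  by apply/funext => x; rewrite mulNr.
have cp : continuous (@posp R).
  have -> : @posp R = (fun y => 2^-1 * (y + `|y|)).
    by apply/funext => y; have := pospBnegp y; have := pospDnegp y; lra.
  move=> y; apply: cvgM; first exact: cvg_cst.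
  by apply: cvgD; [exact: cvg_id|exact: norm_continuous].
by move=> x; apply: (cvg_comp (fun x : V => 1 - s * dotv x x) (@posp R)); [exact: c1|exact: cp].
Qed.

Lemma dotv_norm (x : V) : `|x| ^+ 2 <= dotv x x.
Proof.
have : `|x| <= Num.sqrt (dotv x x).
  rewrite [`|x|](_ : _ = mx_norm x)// mx_normrE; apply/bigmax_leP; split; first exact: sqrtr_ge0.
  move=> [i j] _ /=; rewrite ord1 -sqrtr_sqr ler_wsqrtr// /dotv (bigD1 j)//= -expr2 lerDl.
  by apply: sumr_ge0 => k _; rewrite -expr2 sqr_ge0.
move=> h; rewrite -(@sqr_sqrtr _ (dotv x x)) ?dotv_ge0//.
by rewrite ler_sqr ?nnegrE ?sqrtr_ge0.
Qed.

Lemma cutarg0 (x : V) : n.+1%:R < `|x| -> posp (1 - s * dotv x x) = 0.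
Proof.
move=> nx; rewrite /posp; apply/max_idPr; rewrite subr_le0.
rewrite -(@ler_pM2l _ (n.+1%:R ^+ 2)) ?exprn_gt0// mulr1 mulrA mulfV ?mul1r; last by rewrite gt_eqF ?exprn_gt0.
apply: le_trans (dotv_norm x); rewrite ler_sqr ?nnegrE//; exact: ltW.
Qed.

Lemma CC_chi : CC chi.
Proof.
split.
  have -> : chi = (fun x => posp (1 - s * dotv x x) * posp (1 - s * dotv x x)) by apply/funext => x; exact: expr2.
  by apply: contM; exact: continuous_cutarg.
by exists n.+1%:R => x nx; rewrite /chi cutarg0// expr0n.
Qed.

Lemma CC_dchi i : CC (dchi i).
Proof.
apply: CCN; split; last by exists n.+1%:R => x nx; rewrite cutarg0// mulr0.
apply: contM; last exact: continuous_cutarg.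
by apply: (@contZ _ _ (4 * s)); exact: continuous_entry.
Qed.

Lemma chi01 x : 0 <= chi x <= 1.
Proof.
rewrite sqr_ge0/=; have p0 := posp_ge0 (1 - s * dotv x x).
have : posp (1 - s * dotv x x) <= 1.
  by rewrite /posp ge_max ler01 andbT gerBl mulr_ge0 ?dotv_ge0// ltW.
by move=> h; exact: exprn_ile1.
Qed.

Lemma dchi_le i x : `|dchi i x| <= 4 / n.+1%:R.
Proof.
rewrite /dchi normrN !normrM (ger0_norm (posp_ge0 _)) (ger0_norm (ltW s0)) ger0_norm//.
case: (leP (1 - s * dotv x x) 0) => h.
  by rewrite /posp (max_idPr h) mulr0 divr_ge0.
have p1 : posp (1 - s * dotv x x) <= 1.
  by rewrite /posp ge_max ler01 andbT gerBl mulr_ge0 ?dotv_ge0// ltW.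
have xn : `|x ord0 i| <= n.+1%:R.
  rewrite -ler_sqr ?nnegrE// real_normK ?num_real//.
  have h2 : s * dotv x x < 1 by lra.
  apply: le_trans (_ : dotv x x <= _).
    by rewrite /dotv (bigD1 i)//= -expr2 lerDl; apply: sumr_ge0 => k _; rewrite -expr2 sqr_ge0.
  move: h2; rewrite /s mulrC ltr_pdivrMr ?mul1r ?exprn_gt0//; exact: ltW.
apply: (@le_trans _ _ (4 * s * n.+1%:R * 1)).
  apply: ler_pM => //; first by rewrite !mulr_ge0// ltW.
    exact: posp_ge0.
  by rewrite ler_wpM2l// mulr_ge0// ltW.
by rewrite mulr1 /s le_eqVlt; apply/orP; left; apply/eqP; field.
Qed.

End cutoff.

Section cutoff_limit.
Context (R : realType) (d : nat) (mu : probability 'rV[R]_d R).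
Notation V := 'rV[R]_d.
Notation E := (V * V)%type.
Notation kappa := (@gaussm R d).
Notation muh := (prodp mu kappa).

Lemma chi_cvg (x : V) : (fun n => chi n x) @ \oo --> (1 : R).
Proof.
apply/cvgrPdist_le => e e0.
have [M [_ HM]] : exists M : nat, True /\ forall n, (M <= n)%N -> 2 * dotv x x / n.+1%:R <= e.
  have K0 : 0 < 2 * dotv x x + 1 by rewrite ltr_wpDl// mulr_ge0 ?dotv_ge0.
  have [M _ HM] := near_infty_natSinv_lt (PosNum (divr_gt0 e0 K0)).
  exists M; split => // n Mn; have := HM n Mn => /= /ltW h.
  apply: le_trans (_ : (2 * dotv x x + 1) * n.+1%:R^-1 <= _).
    by rewrite ler_wpM2r// lerDl.
  by rewrite mulrC -ler_pdivlMr.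
exists M => // n /= Mn; apply: le_trans (HM n Mn).
have /andP[c0 c1] := chi01 n x; rewrite ger0_norm ?subr_ge0//.
rewrite /chi; set t := _^-1 * dotv x x.
have t0 : 0 <= t by rewrite mulr_ge0 ?dotv_ge0// invr_ge0 exprn_ge0.
have tn : t <= dotv x x / n.+1%:R.
  rewrite /t mulrC ler_wpM2l ?dotv_ge0// lef_pV2 ?posrE ?exprn_gt0// expr2.
  by rewrite ler_peMr// ler1n.
have : 1 - t <= posp (1 - t) by rewrite /posp le_max lexx.
rewrite -mulrA; move: (dotv x x / _) tn => K tn; have := posp_ge0 (1 - t).
by case: (leP t 1) => t1; nra.
Qed.

(** Lets compactly supported weights tend to 1: the missing mass is small by dominated convergence,
    and the flux v . grad c is small relative to 1 + |v|^2, whose mean is finite whatever the tails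
    of mu. *)
Lemma cutoff_ex (e : R) : 0 < e -> exists (c : V -> R) (dc : 'I_d -> V -> R),
  [/\ CC c, forall i, pd i c (dc i), forall i, CC (dc i), forall x, 0 <= c x <= 1 &
      EX mu (fun x => 1 - c x) <= e /\ forall z : E, `|\sum_i z.2 ord0 i * dc i z.1| <= e * vw z.2].
Proof.
move=> e0.
have c1 : (fun n => EX mu (fun x => 1 - chi n x)) @ \oo --> (0 : R).
  have -> : 0 = EX mu (fun=> 0 : R) by rewrite EX_cst.
  apply: (@EX_dom_cvg _ _ _ mu _ _ (fun=> 1)) => //.
  - by move=> n; apply: measurable_funB => //; apply: continuous_rV_measurable; exact: (CC_chi R d n).1.
  - exact: itg_cst.
  - by move=> n x; have /andP[h0 h1] := chi01 n x; rewrite ger0_norm ?subr_ge0// gerBl.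
  - move=> x; rewrite -(subrr (1 : R)); apply: cvgB; [exact: cvg_cst|exact: chi_cvg].
move/cvgrPdist_le : c1 => /(_ e e0) [N _ HN].
have K0 : 0 < 4 * d%:R + 1 :> R by rewrite ltr_wpDl.
have [M _ HM] := near_infty_natSinv_lt (PosNum (divr_gt0 e0 K0)).
pose n := maxn N M.
exists (chi n), (dchi n); split.
- exact: CC_chi.
- exact: pd_chi.
- exact: CC_dchi.
- exact: chi01.
split.
  have := HN n (leq_maxl _ _); rewrite /= sub0r normrN; apply: le_trans; exact: ler_norm.
move=> z; have hm : (4 * d%:R + 1) / n.+1%:R <= e.
  have := HM n (leq_maxr _ _) => /= /ltW h.
  by rewrite mulrC -ler_pdivlMr.
apply: (le_trans (ler_norm_sum _ _ _)).
apply: (@le_trans _ _ (\sum_(i < d) vw z.2 * (4 / n.+1%:R))).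
  apply: ler_sum => i _; rewrite normrM ler_pM//; last exact: dchi_le.
  have := dotv_entry2 z.2 i i; rewrite -expr2 normrX /vw.
  by move: (normr_ge0 (z.2 ord0 i)) (dotv_ge0 z.2); nra.
rewrite sumr_const card_ord.
rewrite (_ : _ *+ d = 4 * d%:R / n.+1%:R * vw z.2); last by rewrite -mulr_natr; field.
rewrite ler_wpM2r ?(le_trans ler01) ?vw_ge1//; apply: le_trans hm.
by rewrite ler_wpM2r// lerDl.
Qed.

End cutoff_limit.

Section weak.
Context (R : realType) (d : nat) (U : 'rV[R]_d -> R) (mu : probability 'rV[R]_d R) (gamma : R).
Hypothesis U2 : is_C 2 U.
Hypothesis gU : gibbs_measure U mu.
Notation V := 'rV[R]_d.
Notation E := (V * V)%type.
Notation kappa := (@gaussm R d).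
Notation muh := (prodp mu kappa).
Notation mR := (measurableTypeR R).
Notation dU := (fun i => partial i U).

Lemma vdot_grad (z : E) : vdot dU z = dotv z.2 (grad U z.1).
Proof. by apply: eq_bigr => i _; rewrite mxE. Qed.

Section affine.
Variables (c : V -> R) (dc : 'I_d -> V -> R) (e : 'I_d -> V -> R) (de : 'I_d -> 'I_d -> V -> R).
Hypotheses (Cc : CC c) (pc : forall i, pd i c (dc i)) (Cdc : forall i, CC (dc i)).
Hypotheses (Ce : forall i, CC (e i)) (pe : forall i j, pd i (e j) (de i j)) (Cde : forall i j, CC (de i j)).

Definition aphi (z : E) : R := c z.1 + \sum_i z.2 ord0 i * e i z.1.
Definition adphi j (z : E) : R := dc j z.1 + \sum_i z.2 ord0 i * de j i z.1.
Definition erow x : V := \row_i e i x.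
(* The adjoint of the full generator, in L^2(mu * kappa), applied to the function
   aphi c e, which is affine in v. *)
Definition Mphi (z : E) : R :=
  bet U z * (2^-1 * dotv (grad U z.1) (erow z.1) * (Zn U z.1)^-1 - dotv z.2 (erow z.1))
  - gamma * dotv z.2 (erow z.1) - \sum_j z.2 ord0 j * adphi j z.

Lemma aphiE z : aphi z = c z.1 + dotv z.2 (erow z.1).
Proof. by congr (_ + _); apply: eq_bigr => i _; rewrite mxE. Qed.

Lemma dom_vCC f i : CC f -> dom 1 (fun z : E => z.2 ord0 i * f z.1).
Proof. by move=> cf; apply: (@domM _ _ 1 0); [exact: dom_v|exact: dom_CC]. Qed.

Lemma dom_vvCC f i j : CC f -> dom 1 (fun z : E => z.2 ord0 i * z.2 ord0 j * f z.1).
Proof.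
by move=> cf; exact: (domM (dom_vv R i j) (dom_CC cf)).
Qed.

Lemma dom_aphi : dom 1 aphi.
Proof.
apply: domD; first exact: dom_le (dom_CC Cc).
by apply: dom_sum => i; exact: dom_vCC.
Qed.

Lemma dom_ve : dom 1 (fun z : E => dotv z.2 (erow z.1)).
Proof.
rewrite (_ : (fun z : E => _) = fun z : E => \sum_i z.2 ord0 i * e i z.1).
  by apply: dom_sum => i; exact: dom_vCC.
by apply/funext => z; apply: eq_bigr => i _; rewrite mxE.
Qed.

Lemma dom_vdot_aphi : dom 1 (fun z => dotv z.2 (grad U z.1) * aphi z).
Proof.
rewrite (_ : (fun z => _) = (fun z : E => (\sum_j z.2 ord0 j * (partial j U z.1 * c z.1)) +
   \sum_j \sum_i z.2 ord0 j * z.2 ord0 i * (partial j U z.1 * e i z.1))).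
  apply: domD.
    by apply: dom_sum => j; exact: (dom_vCC j (CCMl (@cpdU _ _ _ U2 j) Cc)).
  by apply: dom_sum => j; apply: dom_sum => i; exact: (dom_vvCC j i (CCMl (@cpdU _ _ _ U2 j) (Ce i))).
apply/funext => z; rewrite -vdot_grad /vdot /aphi mulrDr; congr (_ + _).
  by rewrite mulr_suml; apply: eq_bigr => j _; rewrite mulrA.
rewrite mulr_suml; apply: eq_bigr => j _; rewrite mulr_sumr; apply: eq_bigr => i _.
ring.
Qed.

Lemma dom_ve_grad : dom 1 (fun z : E => dotv z.2 (grad U z.1) * dotv z.2 (erow z.1)).
Proof.
rewrite (_ : (fun z => _) = (fun z : E => \sum_j \sum_i z.2 ord0 j * z.2 ord0 i * (partial j U z.1 * e i z.1))).
  by apply: dom_sum => j; apply: dom_sum => i; exact: (dom_vvCC j i (CCMl (@cpdU _ _ _ U2 j) (Ce i))).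
apply/funext => z; rewrite -vdot_grad /vdot /dotv.
rewrite mulr_suml; apply: eq_bigr => j _; rewrite mulr_sumr; apply: eq_bigr => i _.
by rewrite !mxE; ring.
Qed.

Lemma dom_abs k (h g : E -> R) : measurable_fun [set: E] g -> (forall z, `|g z| <= `|h z|) -> dom k h -> dom k g.
Proof.
move=> mg gh [mh [K [K0 hK]]]; split => //; exists K; split => // z.
exact: le_trans (gh z) (hK z).
Qed.

Lemma dom_lam_aphi : dom 1 (fun z => lam U z * aphi z).
Proof.
apply: dom_abs dom_vdot_aphi.
  by apply: measurable_funM; [exact: measurable_lam|exact: dom_aphi.1].
by move=> z; rewrite !normrM ler_wpM2r// ger0_norm ?posp_ge0// posp_le.
Qed.

Lemma dom_sumd : dom 1 (fun z : E => \sum_j z.2 ord0 j * adphi j z).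
Proof.
apply: dom_sum => j.
rewrite (_ : (fun z => _) = (fun z : E => z.2 ord0 j * dc j z.1 + \sum_i z.2 ord0 j * z.2 ord0 i * de j i z.1)).
  by apply: domD; [exact: dom_vCC|apply: dom_sum => i; exact: dom_vvCC].
by apply/funext => z; rewrite mulrDr mulr_sumr; congr (_ + _); apply: eq_bigr => i _; rewrite mulrA.
Qed.

Lemma CC_dotv (f g : 'I_d -> V -> R) : (forall i, continuous (f i)) -> (forall i, CC (g i)) ->
  CC (fun x => \sum_i f i x * g i x).
Proof. by move=> cf cg; apply: CC_sum => i; exact: CCMl. Qed.

(** Contribution of the bounce kernel to the adjoint. Its velocity average is half of grad U . e,
    the other half coming from - bet (v . e). *)
Definition Wterm (z : E) := bet U z * (2^-1 * dotv (grad U z.1) (erow z.1) * (Zn U z.1)^-1).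

(** Cauchy-Schwarz bounds bet^2 by |v|^2 |grad U|^2 and the scalar product by |grad U|^2 |e|^2,
    while [Zn_grad] turns one factor |grad U|^2 / Zn^2 into 12. With the square of 1/2 the constant
    is 12 / 4 = 3. *)
Lemma Wterm_sqr (z : E) : Wterm z ^+ 2 <= 3 * (dotv z.2 z.2 * (gradU2 dU z.1 * \sum_i e i z.1 ^+ 2)).
Proof.
have g2E : gradU2 dU z.1 = dotv (grad U z.1) (grad U z.1).
  by apply: eq_bigr => i _; rewrite mxE expr2.
have e2E : \sum_i e i z.1 ^+ 2 = dotv (erow z.1) (erow z.1).
  by apply: eq_bigr => i _; rewrite mxE expr2.
rewrite g2E e2E; set A := dotv (grad U z.1) (grad U z.1); set B := dotv (erow z.1) (erow z.1).
have A0 : 0 <= A by exact: dotv_ge0. have B0 : 0 <= B by exact: dotv_ge0.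
have Q0 : 0 <= dotv z.2 z.2 by exact: dotv_ge0.
have [Z0|Z0] := eqVneq (Zn U z.1) 0.
  by rewrite /Wterm Z0 invr0 !mulr0 expr0n !mulr_ge0.
have Zgt : 0 < Zn U z.1 ^+ 2 by rewrite exprn_gt0// lt_neqAle eq_sym Z0 Zn_ge0.
have h1 := dotv_CS z.2 (grad U z.1); have h2 := dotv_CS (grad U z.1) (erow z.1).
have h3 := Zn_grad U z.1; have h4 := negp_sqr_le (dotv z.2 (grad U z.1)).
rewrite -/A -/B in h1 h2 h3.
rewrite -(ler_pM2r Zgt) /Wterm.
rewrite (_ : _ * Zn U z.1 ^+ 2 = 4^-1 * (bet U z ^+ 2 * dotv (grad U z.1) (erow z.1) ^+ 2)); last by field.
have h5 : bet U z ^+ 2 * dotv (grad U z.1) (erow z.1) ^+ 2 <= (dotv z.2 z.2 * A) * (A * B).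
  by apply: ler_pM; rewrite ?sqr_ge0//; exact: le_trans h4 h1.
have h6 : (dotv z.2 z.2 * A) * (A * B) <= (dotv z.2 z.2 * A * B) * (12 * Zn U z.1 ^+ 2).
  rewrite (_ : _ * _ = (dotv z.2 z.2 * A * B) * A); last by ring.
  by rewrite ler_wpM2l// !mulr_ge0.
move: h5 h6; nra.
Qed.

Lemma measurable_grade : measurable_fun [set: V] (fun x => dotv (grad U x) (erow x)).
Proof.
rewrite (_ : (fun x => _) = fun x => \sum_i partial i U x * e i x).
  by apply: continuous_rV_measurable; apply: (CC_dotv _ Ce).1 => i; exact: cpdU.
by apply/funext => x; apply: eq_bigr => i _; rewrite !mxE.
Qed.

Lemma measurable_Wterm : measurable_fun [set: E] Wterm.
Proof.
apply: measurable_funM; first exact: measurable_bet.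
apply: measurable_funM.
  by apply: measurable_funM => //; exact: (measurableT_comp measurable_grade measurable_fst).
rewrite (_ : (fun q : E => _) = (fun q : E => Zn U q.1 `^ (-1))).
  apply: (measurableT_comp (measurable_powR (-1))).
  exact: (measurableT_comp (measurable_Zn U2) measurable_fst).
by apply/funext => q; rewrite powR_inv1// Zn_ge0.
Qed.

Lemma dom_Wterm : dom 1 Wterm.
Proof.
have cK : CC (fun x => gradU2 dU x * \sum_i e i x ^+ 2).
  apply: CCMl; first by apply: continuous_gradU2; exact: cpdU.
  by apply: CC_sum => i; exact: CCX.
have [_ [K [K0 HK]]] := CC_bddm cK.
split; first exact: measurable_Wterm.
exists (3 * K + 1); split; first by rewrite addr_ge0// mulr_ge0.
move=> z; have h := Wterm_sqr z; have k := HK z.1; have q := dotv_ge0 z.2.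
rewrite -(real_normK (num_real (Wterm z))) in h.
have kk : gradU2 dU z.1 * \sum_i e i z.1 ^+ 2 <= K by exact: le_trans (ler_norm _) k.
have h' : `|Wterm z| ^+ 2 <= 3 * K * dotv z.2 z.2.
  by apply: le_trans h _; rewrite -mulrA ler_wpM2l// mulrC ler_wpM2r.
have y0 := normr_ge0 (Wterm z).
apply: (@le_trans _ _ (3 * K + dotv z.2 z.2)); last by rewrite /vw; nra.
rewrite -ler_sqr ?nnegrE ?addr_ge0 ?mulr_ge0//; apply: le_trans h' _; nra.
Qed.

Lemma dom_bet_ve : dom 1 (fun z : E => bet U z * dotv z.2 (erow z.1)).
Proof.
apply: dom_abs dom_ve_grad.
  by apply: measurable_funM; [exact: measurable_bet|exact: dom_ve.1].
by move=> z; rewrite !normrM ler_wpM2r// ger0_norm ?negp_ge0// negp_le.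
Qed.

Lemma MphiE : Mphi = fun z => Wterm z - bet U z * dotv z.2 (erow z.1)
  - gamma * dotv z.2 (erow z.1) - \sum_j z.2 ord0 j * adphi j z.
Proof. by apply/funext => z; rewrite /Mphi mulrBr. Qed.

Lemma dom_Mphi : dom 1 Mphi.
Proof.
rewrite MphiE; apply: domB; last exact: dom_sumd.
apply: domB; last by apply: domZ; exact: dom_ve.
by apply: domB; [exact: dom_Wterm|exact: dom_bet_ve].
Qed.

Lemma adphiE i x v : is_derive x (delta_mx ord0 i) (fun x => aphi (x, v)) (adphi i (x, v)).
Proof.
exact: (pdD (pc i) (pd_sum _ (fun j => pdZ (v ord0 j) (pe i j)))).
Qed.

(** [transport] with a = F and b = gen F moves the x-derivatives to the test function. Averaging
    over velocities at a fixed position, [adjoint_point] then moves the jump part. Test functions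
    affine in v keep every integrand within the second Gaussian moments of 1 + |v|^2. *)
Lemma weak_form C F T : sol U gamma C F -> 0 <= T ->
  EX muh (fun z => F T z * aphi z) =
  EX muh (fun z => F 0 z * aphi z) + ri (fun r => EX muh (fun z => F r z * Mphi z)) 0 T.
Proof.
move=> [mF FC cF] T0.
have C0 : 0 <= C by exact: le_trans (normr_ge0 _) (FC 0 0).
pose H t z := gen U gamma (F t) z * aphi z + F t z * (vdot dU z * aphi z - \sum_j z.2 ord0 j * adphi j z).
have [m1 [K1 [K10 k1]]] := dom_le (isT : (1 <= 2)%N) dom_lam_aphi.
have [m2 [K2 [K20 k2]]] := dom_le (isT : (1 <= 2)%N) dom_aphi.
have [m3 [K3 [K30 k3]]] := dom_le (isT : (1 <= 2)%N) dom_vdot_aphi.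
have [m4 [K4 [K40 k4]]] := dom_le (isT : (1 <= 2)%N) dom_sumd.
have mH : measurable_fun [set: mR * E] (fun p : mR * E => H p.1 p.2).
  have sn (f : E -> R) : measurable_fun [set: E] f -> measurable_fun [set: mR * E] (fun p : mR * E => f p.2).
    by move=> mf; apply: (measurableT_comp mf); exact: measurable_snd.
  apply: measurable_funD; first by apply: measurable_funM; [exact: (measurable_gen gamma U2 mF FC)|exact: sn].
  apply: (measurable_funM mF).
  apply: (sn (fun z => vdot dU z * aphi z - \sum_j z.2 ord0 j * adphi j z)).
  apply: measurable_funB m4.
  by move: m3; congr (measurable_fun _ _); apply/funext => z; rewrite vdot_grad.
pose K := C * (2 * K1 + 2 * `|gamma| * K2 + K3 + K4).
have bH t z : `|H t z| <= K * vw z.2 ^+ 2.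
  (* Regrouped so that the factors lam and v . grad U, unbounded in x, occur only multiplied by
     [aphi], whose support in x is bounded. *)
  have -> : H t z = (Bop U (F t) z.1 - F t z) * (lam U z * aphi z) +
     gamma * (Pi (F t) z.1 - F t z) * aphi z + F t z * (dotv z.2 (grad U z.1) * aphi z)
     - F t z * (\sum_j z.2 ord0 j * adphi j z).
    by rewrite /H /gen vdot_grad; ring.
  have b1 := Bop_bd U mF FC t z.1; have b2 := Pi_bd mF FC t z.1; have b3 := FC t z.
  have b4 : `|Bop U (F t) z.1 - F t z| <= 2 * C by rewrite (le_trans (ler_normB _ _))//; lra.
  have b5 : `|Pi (F t) z.1 - F t z| <= 2 * C by rewrite (le_trans (ler_normB _ _))//; lra.
  rewrite (_ : K * _ = 2 * C * (K1 * vw z.2 ^+ 2) + `|gamma| * (2 * C) * (K2 * vw z.2 ^+ 2) +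
    C * (K3 * vw z.2 ^+ 2) + C * (K4 * vw z.2 ^+ 2)); last by rewrite /K; ring.
  apply: le_trans (ler_normB _ _) _; apply: lerD; last by rewrite normrM; apply: ler_pM.
  apply: le_trans (ler_normD _ _) _; apply: lerD; last by rewrite normrM; apply: ler_pM.
  apply: le_trans (ler_normD _ _) _; apply: lerD; first by rewrite normrM; apply: ler_pM.
  by rewrite normrM; apply: ler_pM => //; rewrite normrM; apply: ler_pM.
have Hd t : dom 2 (H t).
  split; first exact: (measurableT_comp mH (@measurable_pair1 _ _ mR E t)).
  by exists K; split => //; rewrite /K mulr_ge0// !addr_ge0// !mulr_ge0.
have dF t : dom 0 (F t) := domF mF FC t.
have iFa t : itg muh (fun z => F t z * aphi z).
  by apply: (@dom_itg _ _ _ 1) => //; exact: (domM (dF t) dom_aphi).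
have dS2 := dom_le (isT : (1 <= 2)%N) dom_sumd.
have dM2 := dom_le (isT : (1 <= 2)%N) dom_Mphi.
have dFM t : dom 2 (fun z => F t z * Mphi z) by exact: (domM (dF t) dM2).
have -> := @transport R d U mu gU dU (pdU U2) (cpdU U2) (contU U2) F (fun t => gen U gamma (F t)) aphi adphi T K T0 adphiE _ _ mH (fun t z _ => bH t z) (lbm_F mF FC) (lbm_gen gamma U2 mF FC) (fun z t tT => cF z t (andP tT).1) (iFa 0) (iFa T).
- congr (_ + _); apply: ri_eq => r _; rewrite -/(H r).
  rewrite (EX_Pi mu (isT : (2 <= 2)%N) (Hd r)) (EX_Pi mu (isT : (2 <= 2)%N) (dFM r)); apply: EX_eq => x.
  have dg : dom 2 (fun z => gen U gamma (F r) z * aphi z + F r z * (dotv z.2 (grad U z.1) * aphi z)).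
    rewrite (_ : (fun z => _) = fun z => H r z + F r z * \sum_j z.2 ord0 j * adphi j z).
      by apply: domD => //; exact: (domM (dF r) dS2).
    by apply/funext => z; rewrite /H vdot_grad; ring.
  have dS := domM (dF r) dS2.
  transitivity (EX kappa (fun w => (gen U gamma (F r) (x, w) * aphi (x, w) + F r (x, w) * (dotv w (grad U x) * aphi (x, w)))
      - F r (x, w) * \sum_j w ord0 j * adphi j (x, w))).
    by apply: EX_eq => w; rewrite /H vdot_grad/=; ring.
  rewrite (EXB (dom_sec x (isT : (2 <= 2)%N) dg) (dom_sec x (isT : (2 <= 2)%N) dS)).
  have adj := adjoint_point U gamma x (msec2 mF r x) (fun w => FC r (x, w)) (c x) (erow x).
  have dM : dom 2 (fun z => F r z * (Mphi z + \sum_j z.2 ord0 j * adphi j z)).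
    by apply: (domM (dF r)); exact: domD.
  transitivity (EX kappa (fun w => F r (x, w) * (Mphi (x, w) + \sum_j w ord0 j * adphi j (x, w)) - F r (x, w) * \sum_j w ord0 j * adphi j (x, w))).
    rewrite (EXB (dom_sec x (isT : (2 <= 2)%N) dM) (dom_sec x (isT : (2 <= 2)%N) dS)); congr (_ - _).
    rewrite (_ : (fun w => _ + _) = (fun w => gen U gamma (fun z => F r (x, z.2)) (x, w) * (c x + dotv w (erow x)) + F r (x, w) * (dotv w (grad U x) * (c x + dotv w (erow x))))); last first.
      by apply/funext => w; rewrite aphiE.
    by rewrite adj; apply: EX_eq => w; rewrite /Mphi/= subrK.
  by apply: EX_eq => w; ring.
- move=> v; apply: contD; first exact: Cc.1.
  by apply: (CC_dotv _ Ce).1 => i; exact: cst_continuous.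
- move=> i v; apply: contD; first exact: (Cdc i).1.
  by apply: (CC_dotv _ (Cde i)).1 => j; exact: cst_continuous.
Qed.

End affine.
End weak.

(** * Conservation of the mean and energy inequality *)

Section conserved.
Context (R : realType) (d : nat) (U : 'rV[R]_d -> R) (mu : probability 'rV[R]_d R) (gamma : R).
Hypothesis U2 : is_C 2 U.
Hypothesis gU : gibbs_measure U mu.
Notation V := 'rV[R]_d.
Notation E := (V * V)%type.
Notation kappa := (@gaussm R d).
Notation muh := (prodp mu kappa).
Notation mR := (measurableTypeR R).
Notation dU := (fun i => partial i U).

Lemma lbm_EX_dom (K : R -> E -> R) A : measurable_fun [set: mR * E] (fun p : mR * E => K p.1 p.2) ->
  (forall r z, `|K r z| <= A * vw z.2 ^+ 2) -> lbm (fun r => EX muh (K r)).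
Proof.
move=> mK bK; apply: lbm_EX => // N; exists (`|A| * EX muh (fun z => vw z.2 ^+ 2)) => r _.
have A' z : `|K r z| <= `|A| * vw z.2 ^+ 2.
  apply: le_trans (bK r z) _; rewrite ler_wpM2r ?ler_norm//.
  by rewrite exprn_ge0// (le_trans ler01) ?vw_ge1.
have iK : itg muh (K r).
  apply: (@dom_itg _ _ _ 2) => //; split.
    exact: (measurableT_comp mK (@measurable_pair1 _ _ mR E r)).
  by exists `|A|; split.
have iv : itg muh (fun z : E => vw z.2 ^+ 2).
  apply: (@dom_itg _ _ _ 2) => //; split; last first.
    by exists 1; split => // z; rewrite mul1r ger0_norm// exprn_ge0// (le_trans ler01) ?vw_ge1.
  apply: measurable_funX; apply: (measurableT_comp (@measurable_vw R d)).
  exact: measurable_snd.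
split => //; rewrite -EXZ//; apply: EX_le => //; last exact: itgZ.
exact: (integrable_norm iK).
Qed.

Lemma dom_vw : dom 1 (fun z : E => vw z.2).
Proof.
split; first by apply: (measurableT_comp (@measurable_vw R d)); exact: measurable_snd.
by exists 1; split => // z; rewrite mul1r expr1 ger0_norm// (le_trans ler01) ?vw_ge1.
Qed.

Variables (C : R) (F : R -> E -> R).
Hypothesis sF : sol U gamma C F.
Let mF := sol_meas sF.
Let FC := sol_bd sF.
Let C0 : 0 <= C. Proof. exact: le_trans (normr_ge0 _) (FC 0 0). Qed.

Lemma lbm_EX_mul (g : E -> R) : dom 2 g -> lbm (fun r => EX muh (fun z => F r z * g z)).
Proof.
move=> [mg [K [K0 hK]]]; apply: (@lbm_EX_dom _ (C * K)).
  by apply: measurable_funM => //; apply: (measurableT_comp mg); exact: measurable_snd.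
by move=> r z; rewrite normrM -mulrA ler_pM.
Qed.

(** Jumps leave the position unchanged, so against a function of x alone the adjoint reduces to - v
    . grad c. *)
Lemma weak_pos (c : V -> R) (dc : 'I_d -> V -> R) T : CC c -> (forall i, pd i c (dc i)) ->
  (forall i, CC (dc i)) -> 0 <= T ->
  EX muh (fun z => F T z * c z.1) = EX muh (fun z => F 0 z * c z.1) -
    ri (fun r => EX muh (fun z => F r z * \sum_j z.2 ord0 j * dc j z.1)) 0 T.
Proof.
move=> cc pc cdc T0.
pose e (i : 'I_d) (x : V) : R := 0; pose de (i j : 'I_d) (x : V) : R := 0.
have := @weak_form R d U mu gamma U2 gU c dc e de cc pc cdc (fun i => CC_cst0 R d) (fun i j => pd_cst i 0)
  (fun i j => CC_cst0 R d) C F T sF T0.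
have aE z : aphi c e z = c z.1.
  by rewrite /aphi /e big1 ?addr0// => i _; rewrite mulr0.
have -> t : (fun z => F t z * aphi c e z) = (fun z => F t z * c z.1).
  by apply/funext => z; rewrite aE.
have -> : (fun z => F 0 z * aphi c e z) = (fun z => F 0 z * c z.1).
  by apply/funext => z; rewrite aE.
move=> ->; congr (_ + _).
have dS : dom 2 (fun z : E => \sum_j z.2 ord0 j * dc j z.1).
  by apply: (@dom_le _ _ 1 2) => //; apply: dom_sum => j; exact: dom_vCC.
rewrite -mulN1r -riZ; last exact: lbm_EX_mul.
apply: ri_eq => r _; rewrite -EXZ.
  apply: EX_eq => z; rewrite /Mphi.
  have -> : erow e z.1 = 0 by apply/rowP => i; rewrite !mxE.
  have d0 (v : V) : dotv v (0 : V) = 0 by apply: big1 => i _; rewrite mxE mulr0.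
  rewrite !d0 !(mulr0, mul0r, subr0) sub0r.
  rewrite (eq_bigr (fun j => z.2 ord0 j * dc j z.1)); first by ring.
  by move=> j _; rewrite /adphi /de big1 ?addr0// => i _; rewrite mulr0.
apply: (@dom_itg _ _ _ 2) => //; exact: (domM (domF mF FC r) dS).
Qed.

Let W := EX muh (fun z : E => vw z.2).
Let W0 : 0 <= W. Proof. by apply: EX_ge0 => z; rewrite (le_trans ler01) ?vw_ge1. Qed.
Let iW : itg muh (fun z : E => vw z.2). Proof. exact: (@dom_itg _ _ _ 1) dom_vw. Qed.

Let eps_le (x y K : R) : 0 <= K -> (forall e : R, 0 < e -> x <= y + K * e) -> x <= y.
Proof.
move=> K0 h; apply/ler_addgt0Pr => e e0.
have K1 : 0 < K + 1 by rewrite ltr_wpDl.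
apply: le_trans (h (e / (K + 1)) (divr_gt0 e0 K1)) _.
by rewrite lerD2l mulrA ler_pdivrMr// mulrDr mulr1 mulrC lerDl ltW.
Qed.

Let cut_err (f : E -> R) (D e : R) (c : V -> R) : measurable_fun setT f -> (forall z, `|f z| <= D) ->
  CC c -> (forall x, 0 <= c x <= 1) -> EX mu (fun x => 1 - c x) <= e -> 0 <= D ->
  `|EX muh f - EX muh (fun z => f z * c z.1)| <= D * e.
Proof.
move=> mf fD cc c01 ce D0.
have if_ : itg muh f by apply: bddm_itg; split => //; exists D.
have ic : itg muh (fun z => f z * c z.1).
  rewrite (_ : (fun z => _) = fun z => c z.1 * f z); last by apply/funext => z; rewrite mulrC.
  apply: itgM => //; split; last by exists 1; split => // z; have /andP[c0 c1] := c01 z.1; rewrite ger0_norm.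
  by apply: (measurableT_comp (continuous_rV_measurable cc.1)); exact: measurable_fst.
have i1c : itg muh (fun z => D * (1 - c z.1)).
  apply: itgZ; apply: itgB; first exact: itg_cst.
  exact: (dom_itg _ (isT : (0 <= 2)%N) (dom_CC cc)).
rewrite -EXB//; have ib := itgB if_ ic.
apply: le_trans (EX_abs ib) _.
apply: (@le_trans _ _ (EX muh (fun z => D * (1 - c z.1)))).
  apply: EX_le => //; first exact: (integrable_norm ib).
  move=> z; have /andP[c0 c1] := c01 z.1.
  rewrite (_ : _ - _ = f z * (1 - c z.1)); last by ring.
  by rewrite normrM (ger0_norm (_ : 0 <= 1 - c z.1)) ?subr_ge0// ler_wpM2r ?subr_ge0.
rewrite EXZ; last first.
  apply: itgB; first exact: itg_cst.
  exact: (dom_itg _ (isT : (0 <= 2)%N) (dom_CC cc)).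
rewrite (@EX_x R d mu (fun x => 1 - c x)); first by rewrite ler_wpM2l.
split; first by apply: measurable_funB => //; exact: continuous_rV_measurable cc.1.
exists 1; split => // x; have /andP[c0 c1] := c01 x.
by rewrite ger0_norm ?subr_ge0// gerBl.
Qed.

Let vw_err (f : E -> R) (D e : R) (dc : 'I_d -> V -> R) : measurable_fun setT f -> (forall z, `|f z| <= D) ->
  (forall i, CC (dc i)) -> (forall z : E, `|\sum_i z.2 ord0 i * dc i z.1| <= e * vw z.2) ->
  itg muh (fun z => f z * \sum_j z.2 ord0 j * dc j z.1) /\
  `|EX muh (fun z => f z * \sum_j z.2 ord0 j * dc j z.1)| <= D * e * W.
Proof.
move=> mf fD cdc he.
have dS : dom 1 (fun z : E => \sum_j z.2 ord0 j * dc j z.1).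
  by apply: dom_sum => j; exact: dom_vCC.
have i : itg muh (fun z => f z * \sum_j z.2 ord0 j * dc j z.1).
  apply: (@dom_itg _ _ _ 1) => //; exact: (domM (dom_bdd mf fD) dS).
split => //; apply: le_trans (EX_abs i) _; rewrite -EXZ//.
apply: EX_le; [exact: (integrable_norm i)|exact: itgZ|].
by move=> z; rewrite normrM -mulrA ler_pM.
Qed.

(** [weak_pos] against cutoffs tending to 1: F is bounded and the flux v . grad c is at most e (1 +
    |v|^2), so the time integral vanishes in the limit. *)
Lemma mean_conserved T : 0 <= T -> EX muh (F T) = EX muh (F 0).
Proof.
move=> T0; apply/eqP; rewrite -subr_eq0 -normr_le0.
apply: (@eps_le _ 0 (2 * C + C * W * T)).
  by rewrite addr_ge0// !mulr_ge0.
move=> e e0; have [c [dc [cc pc cdc c01 [ce he]]]] := cutoff_ex mu e0.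
have h := weak_pos cc pc cdc T0.
have h1 := cut_err (msec mF T) (FC T) cc c01 ce C0.
have h2 := cut_err (msec mF 0) (FC 0) cc c01 ce C0.
have dS : dom 2 (fun z : E => \sum_j z.2 ord0 j * dc j z.1).
  by apply: (@dom_le _ _ 1 2) => //; apply: dom_sum => j; exact: dom_vCC.
have h3 : `|ri (fun r => EX muh (fun z => F r z * \sum_j z.2 ord0 j * dc j z.1)) 0 T| <= C * e * W * (T - 0).
  apply: ri_bound => //; first exact: lbm_EX_mul.
  by move=> r _; exact: (vw_err (msec mF r) (FC r) cdc he).2.
rewrite h in h1; rewrite subr0 in h3; move: h1 h2 h3.
set I := ri _ _ _; set a := EX muh (F T); set b := EX muh (F 0); set q := EX muh (fun z => F 0 z * c z.1).
rewrite !ler_norml => /andP[a1 a2] /andP[a3 a4] /andP[a5 a6]; apply/andP; split; nra.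
Qed.

Hypothesis g0 : 0 <= gamma.

Lemma var_ge0 r x : 0 <= Pi (fun z => F r z ^+ 2) x - Pi (F r) x ^+ 2 <= C ^+ 2.
Proof.
have i1 := itgF mF FC r x.
have m1 := msec2 mF r x.
have i2 : itg kappa (fun w => F r (x, w) ^+ 2).
  apply: bddm_itg; split; first exact: measurable_funX.
  exists (C ^+ 2); split; first exact: sqr_ge0.
  by move=> w; rewrite normrX ler_sqr ?nnegrE.
set P := Pi (F r) x; apply/andP; split.
  have : 0 <= EX kappa (fun w => F r (x, w) ^+ 2 - 2 * P * F r (x, w) + P ^+ 2).
    by apply: EX_ge0 => w; rewrite (_ : _ + _ = (F r (x, w) - P) ^+ 2) ?sqr_ge0//; ring.
  rewrite EXD ?EXB ?EXZ ?EX_cst//; try by do ?[apply: itgB|apply: itgZ|exact: itg_cst].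
  rewrite -/(Pi (F r) x) -/P -/(Pi (fun z => F r z ^+ 2) x); nra.
have : Pi (fun z => F r z ^+ 2) x <= C ^+ 2.
  rewrite -[leRHS](EX_cst kappa); apply: EX_le => //; first exact: itg_cst.
  by move=> w; rewrite -(real_normK (num_real (F r (x, w)))) ler_sqr ?nnegrE.
by have := sqr_ge0 P; lra.
Qed.

Lemma measurable_F2 : measurable_fun [set: mR * E] (fun p : mR * E => F p.1 p.2 ^+ 2).
Proof. exact: measurable_funX. Qed.
Lemma msecF2 r : measurable_fun [set: E] (fun z => F r z ^+ 2).
Proof. by apply: measurable_funX; exact: msec. Qed.
Lemma F2_bd r z : `|F r z ^+ 2| <= C ^+ 2.
Proof. by rewrite normrX ler_sqr ?nnegrE. Qed.

Definition nrm r := EX muh (fun z => F r z ^+ 2).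
Definition nrmPi r := EX mu (fun x => Pi (F r) x ^+ 2).

Lemma bddm_Pi r : bddm (Pi (F r)).
Proof. by apply: (@Pi_bddm _ _ mu 0) => //; exact: domF. Qed.

Lemma bddm_Pi2 r : bddm (fun x => Pi (F r) x ^+ 2).
Proof.
have [m _] := bddm_Pi r; split; first exact: measurable_funX.
exists (C ^+ 2); split; first exact: sqr_ge0.
by move=> x; rewrite normrX ler_sqr ?nnegrE// (Pi_bd mF FC).
Qed.

Lemma nrm_Pi r : nrm r = EX mu (Pi (fun z => F r z ^+ 2)).
Proof. exact: (EX_Pi mu (isT : (0 <= 2)%N) (domF measurable_F2 F2_bd r)). Qed.

Lemma bddm_PiF2 r : bddm (Pi (fun z => F r z ^+ 2)).
Proof. by apply: (@Pi_bddm _ _ mu 0) => //; exact: (domF measurable_F2 F2_bd r). Qed.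

Lemma lbm_nrm : lbm nrm.
Proof.
apply: (@lbm_EX_dom _ (C ^+ 2)); first exact: measurable_F2.
move=> r z; apply: le_trans (F2_bd r z) _; rewrite ler_peMr ?sqr_ge0//.
exact: vwX_ge1.
Qed.

Lemma lbm_nrmPi : lbm nrmPi.
Proof.
apply: lbm_EX.
  apply: measurable_funX; exact: (measurable_PiF mF FC).
move=> N; exists (C ^+ 2) => r _; have b := bddm_Pi2 r; split; first exact: bddm_itg.
rewrite -[leRHS](EX_cst mu); apply: EX_le; [exact: (integrable_norm (bddm_itg mu b))|exact: itg_cst|].
by move=> x; rewrite normrX ler_sqr ?nnegrE// (Pi_bd mF FC).
Qed.

(** [transport] for F^2, whose derivative along characteristics is 2 F gen F by [ri_mul], tested
    against the cutoff; [energy_point] is applied at each position. The summand with e collects the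
    cost of removing c from the dissipation and the flux through v . grad c. *)
Lemma energy_cut (c : V -> R) (dc : 'I_d -> V -> R) e T : CC c -> (forall i, pd i c (dc i)) ->
  (forall i, CC (dc i)) -> (forall x, 0 <= c x <= 1) -> EX mu (fun x => 1 - c x) <= e ->
  (forall z : E, `|\sum_i z.2 ord0 i * dc i z.1| <= e * vw z.2) -> 0 <= e -> 0 <= T ->
  EX muh (fun z => F T z ^+ 2 * c z.1) <= EX muh (fun z => F 0 z ^+ 2 * c z.1)
   + ri (fun r => - 2 * gamma * (nrm r - nrmPi r) + (2 * gamma * C ^+ 2 + C ^+ 2 * W) * e) 0 T.
Proof.
move=> cc pc cdc c01 ce he e0 T0.
pose a t z := F t z ^+ 2; pose b t z := 2 * F t z * gen U gamma (F t) z.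
pose H t z := b t z * c z.1 + a t z * (vdot dU z * c z.1 - \sum_j z.2 ord0 j * dc j z.1).
have sn (f : E -> R) : measurable_fun [set: E] f -> measurable_fun [set: mR * E] (fun p : mR * E => f p.2).
  by move=> mf; apply: (measurableT_comp mf); exact: measurable_snd.
have dS : dom 2 (fun z : E => \sum_j z.2 ord0 j * dc j z.1).
  by apply: (@dom_le _ _ 1 2) => //; apply: dom_sum => j; exact: dom_vCC.
have dC : dom 2 (fun z : E => c z.1) by apply: (@dom_le _ _ 0 2) => //; exact: dom_CC.
have dVc : dom 2 (fun z : E => dotv z.2 (grad U z.1) * c z.1).
  apply: (@dom_le _ _ 1 2) => //.
  rewrite (_ : (fun z : E => _) = fun z : E => \sum_j z.2 ord0 j * (partial j U z.1 * c z.1)).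
    by apply: dom_sum => j; exact: (dom_vCC j (CCMl (@cpdU _ _ _ U2 j) cc)).
  by apply/funext => z; rewrite -vdot_grad mulr_suml; apply: eq_bigr => j _; rewrite mulrA.
have dL : dom 2 (fun z : E => lam U z * c z.1).
  apply: dom_abs dVc.
    apply: measurable_funM; first exact: measurable_lam.
    by apply: (measurableT_comp (continuous_rV_measurable cc.1)); exact: measurable_fst.
  by move=> z; rewrite !normrM ler_wpM2r// ger0_norm ?posp_ge0// posp_le.
have [m1 [K1 [K10 k1]]] := dL; have [m2 [K2 [K20 k2]]] := dC.
have [m3 [K3 [K30 k3]]] := dVc; have [m4 [K4 [K40 k4]]] := dS.
have mH : measurable_fun [set: mR * E] (fun p : mR * E => H p.1 p.2).
  apply: measurable_funD.
    apply: measurable_funM; last exact: (sn (fun z => c z.1)).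
    apply: measurable_funM; last exact: (measurable_gen gamma U2 mF FC).
    by apply: measurable_funM.
  apply: (measurable_funM measurable_F2).
  apply: (sn (fun z => vdot dU z * c z.1 - \sum_j z.2 ord0 j * dc j z.1)).
  apply: measurable_funB m4.
  by move: m3; congr (measurable_fun _ _); apply/funext => z; rewrite vdot_grad.
pose K := C ^+ 2 * (4 * K1 + 4 * gamma * K2 + K3 + K4).
have bH t z : `|H t z| <= K * vw z.2 ^+ 2.
  have -> : H t z = 2 * F t z * (Bop U (F t) z.1 - F t z) * (lam U z * c z.1) +
     gamma * (2 * F t z * (Pi (F t) z.1 - F t z)) * c z.1 + F t z ^+ 2 * (dotv z.2 (grad U z.1) * c z.1)
     - F t z ^+ 2 * (\sum_j z.2 ord0 j * dc j z.1).
    by rewrite /H /a /b /gen vdot_grad; ring.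
  have b1 := Bop_bd U mF FC t z.1; have b2 := Pi_bd mF FC t z.1; have b3 := FC t z.
  have b4 : `|2 * F t z * (Bop U (F t) z.1 - F t z)| <= 4 * C ^+ 2.
    rewrite (_ : 4 * C ^+ 2 = 2 * C * (C + C)); last by ring.
    rewrite normrM; apply: ler_pM => //; first by rewrite normrM ger0_norm// ler_wpM2l.
    by rewrite (le_trans (ler_normB _ _))// lerD.
  have b5 : `|2 * F t z * (Pi (F t) z.1 - F t z)| <= 4 * C ^+ 2.
    rewrite (_ : 4 * C ^+ 2 = 2 * C * (C + C)); last by ring.
    rewrite normrM; apply: ler_pM => //; first by rewrite normrM ger0_norm// ler_wpM2l.
    by rewrite (le_trans (ler_normB _ _))// lerD.
  have b6 := F2_bd t z.
  rewrite (_ : K * _ = 4 * C ^+ 2 * (K1 * vw z.2 ^+ 2) + gamma * (4 * C ^+ 2) * (K2 * vw z.2 ^+ 2) +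
    C ^+ 2 * (K3 * vw z.2 ^+ 2) + C ^+ 2 * (K4 * vw z.2 ^+ 2)); last by rewrite /K; ring.
  apply: le_trans (ler_normB _ _) _; apply: lerD; last by rewrite normrM; apply: ler_pM.
  apply: le_trans (ler_normD _ _) _; apply: lerD; last by rewrite normrM; apply: ler_pM.
  apply: le_trans (ler_normD _ _) _; apply: lerD; first by rewrite normrM; apply: ler_pM.
  by rewrite normrM; apply: ler_pM => //; rewrite normrM (ger0_norm g0); apply: ler_wpM2l.
have Hd t : dom 2 (H t).
  split; first exact: (measurableT_comp mH (@measurable_pair1 _ _ mR E t)).
  by exists K; split => //; rewrite /K mulr_ge0 ?sqr_ge0// !addr_ge0// !mulr_ge0.
have dF2 t : dom 0 (a t) := domF measurable_F2 F2_bd t.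
have iFa t : itg muh (fun z => a t z * c z.1).
  by apply: (@dom_itg _ _ _ 2) => //; exact: (domM (dF2 t) dC).
have lF := lbm_F mF FC; have lG := lbm_gen gamma U2 mF FC.
have chr z t : 0 <= t <= T -> a t (shift_flow t z) = a 0 z + ri (fun r => b r (shift_flow r z)) 0 t.
  move=> /andP[t0 _].
  have s0 : shift_flow 0 z = z by rewrite /shift_flow scale0r subr0; case: (z).
  have ch s : 0 <= s <= t -> F s (shift_flow s z) = F 0 (shift_flow 0 z) + ri (fun r => gen U gamma (F r) (shift_flow r z)) 0 s.
    by move=> /andP[s0' _]; rewrite s0; exact: (sol_char sF).
  have := ri_mul t0 (lF z) (lF z) (lG z) (lG z) ch ch.
  rewrite s0 /a !expr2 => ->; congr (_ + _); apply: ri_eq => r _; rewrite /b; ring.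
have -> := @transport R d U mu gU dU (pdU U2) (@cpdU _ _ _ U2) (contU U2) a b (fun z => c z.1) (fun j z => dc j z.1) T K T0
  (fun i x v => pc i x) (fun v => cc.1) (fun i v => (cdc i).1) mH (fun t z _ => bH t z)
  (fun z => lbmM (lF z) (lF z)) (fun z => lbmM (lbmM (lbm_cst 2) (lF z)) (lG z)) chr (iFa 0) (iFa T).
rewrite lerD2l; apply: ri_le.
- exact: (lbm_EX_dom mH bH).
- apply: lbmD; last exact: lbm_cst.
  by apply: lbmM; [exact: lbm_cst|apply: lbmD; [exact: lbm_nrm|apply: lbmN; exact: lbm_nrmPi]].
move=> r _; rewrite -/(H r).
have [iv ve] := vw_err (msecF2 r) (F2_bd r) cdc he.
have dg : dom 2 (fun z => b r z * c z.1 + a r z * (dotv z.2 (grad U z.1) * c z.1)).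
  rewrite (_ : (fun z => _) = fun z => H r z + a r z * \sum_j z.2 ord0 j * dc j z.1).
    by apply: domD => //; exact: (domM (dF2 r) dS).
  by apply/funext => z; rewrite /H vdot_grad; ring.
rewrite (_ : EX muh (H r) = EX muh (fun z => (b r z * c z.1 + a r z * (dotv z.2 (grad U z.1) * c z.1)) - F r z ^+ 2 * \sum_j z.2 ord0 j * dc j z.1)); last first.
  by apply: EX_eq => z; rewrite /H vdot_grad /a; ring.
rewrite EXB//; last exact: (@dom_itg _ _ _ 2).
pose q x := Pi (fun z => F r z ^+ 2) x - Pi (F r) x ^+ 2.
have bq : bddm q.
  have [ma _] := bddm_PiF2 r; have [mb _] := bddm_Pi2 r.
  split; first exact: measurable_funB.
  exists (C ^+ 2); split; first exact: sqr_ge0.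
  by move=> x; have /andP[q0 q1] := var_ge0 r x; rewrite ger0_norm.
have iq := bddm_itg mu bq.
have icq : itg mu (fun x => c x * q x) by apply: itgM iq; exact: CC_bddm.
have h1 : EX muh (fun z => b r z * c z.1 + a r z * (dotv z.2 (grad U z.1) * c z.1)) <= EX mu (fun x => - 2 * gamma * (c x * q x)).
  rewrite (EX_Pi mu (isT : (2 <= 2)%N) dg); apply: EX_le.
  - exact: (bddm_itg mu (Pi_bddm mu (isT : (2 <= 2)%N) dg)).
  - exact: itgZ.
  move=> x; have /andP[c0 _] := c01 x.
  have ep := energy_point U x (msec2 mF r x) (fun w => FC r (x, w)) g0.
  have dg' : itg kappa (fun w => c x * (2 * F r (x, w) * gen U gamma (fun z => F r (x, z.2)) (x, w) + F r (x, w) ^+ 2 * dotv w (grad U x))).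
    move: (dom_sec x (isT : (2 <= 2)%N) dg); congr (itg _ _); apply/funext => w.
    by rewrite /a /b/=; ring.
  rewrite /Pi (_ : (fun w => _) = (fun w => c x * (2 * F r (x, w) * gen U gamma (fun z => F r (x, z.2)) (x, w) + F r (x, w) ^+ 2 * dotv w (grad U x)))); last first.
    by apply/funext => w; rewrite /a /b/=; ring.
  have [cz|cz] := eqVneq (c x) 0.
    by rewrite cz mul0r mulr0 (_ : (fun w => _) = fun=> 0) ?EX_cst//; apply/funext => w; rewrite mul0r.
  have ig' : itg kappa (fun w => 2 * F r (x, w) * gen U gamma (fun z => F r (x, z.2)) (x, w) + F r (x, w) ^+ 2 * dotv w (grad U x)).
    move: (itgZ (c x)^-1 dg'); congr (itg _ _); apply/funext => w.
    by rewrite mulrA mulVf// mul1r.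
  rewrite EXZ//; apply: le_trans (ler_wpM2l c0 ep) _.
  by rewrite /q /Pi le_eqVlt; apply/orP; left; apply/eqP; ring.
rewrite EXZ// in h1.
have h2 : EX mu q - C ^+ 2 * e <= EX mu (fun x => c x * q x).
  have i1c : itg mu (fun x => 1 - c x) by apply: itgB; [exact: itg_cst|exact: CC_itg].
  apply: (@le_trans _ _ (EX mu q - C ^+ 2 * EX mu (fun x => 1 - c x))).
    by rewrite lerD2l lerN2 ler_wpM2l// sqr_ge0.
  rewrite -EXZ// -EXB//; last exact: itgZ.
  apply: EX_le => //; first by apply: itgB => //; exact: itgZ.
  move=> x; have /andP[c0 c1] := c01 x; have /andP[q0 q1] := var_ge0 r x.
  rewrite -/(q x) in q0 q1; nra.
have h3 : EX mu q = nrm r - nrmPi r.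
  by rewrite nrm_Pi /nrmPi -EXB//; [exact: (bddm_itg mu (bddm_PiF2 r))|exact: (bddm_itg mu (bddm_Pi2 r))].
move: ve; rewrite ler_norml => /andP[v1 v2].
have h4 := ler_wpM2l g0 h2; rewrite h3 in h4.
move: h1 h4 v1; set X := EX mu (fun x => c x * q x); nra.
Qed.

Lemma energy T : 0 <= T -> nrm T <= nrm 0 - 2 * gamma * ri (fun r => nrm r - nrmPi r) 0 T.
Proof.
move=> T0; apply: (@eps_le _ _ (C ^+ 2 + C ^+ 2 + (2 * gamma * C ^+ 2 + C ^+ 2 * W) * T)).
  by rewrite !addr_ge0 ?mulr_ge0 ?addr_ge0 ?mulr_ge0 ?sqr_ge0.
move=> e e0; have [c [dc [cc pc cdc c01 [ce he]]]] := cutoff_ex mu e0.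
have h := energy_cut cc pc cdc c01 ce he (ltW e0) T0.
have h1 := cut_err (msecF2 T) (F2_bd T) cc c01 ce (sqr_ge0 _).
have h2 := cut_err (msecF2 0) (F2_bd 0) cc c01 ce (sqr_ge0 _).
have l1 : lbm (fun r => nrm r - nrmPi r).
  by apply: lbmD; [exact: lbm_nrm|apply: lbmN; exact: lbm_nrmPi].
move: h; rewrite (riD 0 T (lbmM (lbm_cst (- 2 * gamma)) l1) (lbm_cst _)).
rewrite riZ// ri_cst// subr0.
move: h1 h2; rewrite -/(nrm T) -/(nrm 0) !ler_norml => /andP[a1 a2] /andP[a3 a4].
set I := ri _ 0 T; nra.
Qed.

End conserved.

Section cauchy_schwarz.
Context disp (T : measurableType disp) (R : realType) (P : probability T R).

Lemma EX_CS (f g : T -> R) : measurable_fun setT f -> measurable_fun setT g ->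
  itg P (fun x => f x ^+ 2) -> itg P (fun x => g x ^+ 2) ->
  (EX P (fun x => f x * g x)) ^+ 2 <= EX P (fun x => f x ^+ 2) * EX P (fun x => g x ^+ 2).
Proof.
move=> mf mg i1 i2; have i12 := itg_sqr_mul mf mg i1 i2.
set A := EX P (fun x => f x ^+ 2); set B := EX P (fun x => g x ^+ 2); set X := EX P _.
have A0 : 0 <= A by apply: EX_ge0 => x; exact: sqr_ge0.
have h (c : R) : 0 <= A + 2 * c * X + c ^+ 2 * B.
  rewrite /A /B /X -!EXZ// -!EXD//; try by do ?[apply: itgD|apply: itgZ].
  apply: EX_ge0 => x; rewrite (_ : _ + _ = (f x + c * g x) ^+ 2) ?sqr_ge0//; ring.
have [B0|B0] := eqVneq B 0.
  rewrite B0 mulr0; case: (eqVneq X 0) => [->|n0]; first by rewrite expr0n.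
  have := h (- (A + 1) / (2 * X)).
  rewrite B0 mulr0 addr0 (_ : 2 * _ * _ = - (A + 1)); first lra.
  by field.
have Bgt : 0 < B by rewrite lt_neqAle eq_sym B0 EX_ge0// => x; exact: sqr_ge0.
have := h (- X / B).
rewrite (_ : _ + _ = (A * B - X ^+ 2) / B); last by field.
by rewrite pmulr_lge0 ?invr_gt0// subr_ge0.
Qed.

End cauchy_schwarz.

Lemma sqr_split4 (R : realFieldType) (W b g q t X Y : R) : W ^+ 2 <= X -> b ^+ 2 <= Y ->
  (W - b - g - q + t) ^+ 2 <= 3 * (q - t) ^+ 2 + 6 * X + 6 * Y + 3 * g ^+ 2.
Proof.
move=> h1 h2.
have h : (W - b - g - q + t) ^+ 2 <= 3 * (q - t) ^+ 2 + 3 * (W - b) ^+ 2 + 3 * g ^+ 2.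
  rewrite -subr_ge0 (_ : _ - _ = ((q - t) + (W - b)) ^+ 2 + ((W - b) + g) ^+ 2 + ((q - t) - g) ^+ 2); last by ring.
  by rewrite !addr_ge0 ?sqr_ge0.
have h3 : (W - b) ^+ 2 <= 2 * W ^+ 2 + 2 * b ^+ 2.
  rewrite -subr_ge0 (_ : _ - _ = (W + b) ^+ 2); last by ring.
  exact: sqr_ge0.
lra.
Qed.

Lemma sqr_split_arith (R : realFieldType) (A FR r X P G : R) :
  A <= 2 * FR -> r <= 3 * X -> P <= 3 * X ->
  3 * A + 6 * r + 6 * P + 3 * G <= 3 * (2 * FR + 12 * X + G).
Proof. lra. Qed.

(** * The test function v . grad u *)

Section velocity.
Context (R : realType) (d : nat) (U : 'rV[R]_d -> R) (mu : probability 'rV[R]_d R) (gamma : R).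
Hypothesis U2 : is_C 2 U.
Hypothesis gU : gibbs_measure U mu.
Notation V := 'rV[R]_d.
Notation E := (V * V)%type.
Notation kappa := (@gaussm R d).
Notation muh := (prodp mu kappa).
Notation mR := (measurableTypeR R).
Notation dU := (fun i => partial i U).
Notation N := (Nop dU).

Section testfun.
Variable u : V -> R.
Hypothesis su : smC u.
Let e (i : 'I_d) := partial i u.
Let de (i j : 'I_d) := partial i (partial j u).
Let z0 (i : 'I_d) (x : V) : R := 0.
Let Ce i : CC (e i). Proof. exact: (smC_partial i su).2. Qed.
Let Cde i j : CC (de i j). Proof. exact: (smC_partial i (smC_partial j su)).2. Qed.
Let Cz i : CC (z0 i). Proof. exact: CC_cst0. Qed.

Definition vgrad (z : E) : R := \sum_i z.2 ord0 i * partial i u z.1.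
Definition Mop (z : E) : R := Mphi U gamma z0 e de z.
(** The quadratic form of the Hessian has velocity average Delta u; adding Delta u centres it. Its
    variance then costs 2 |Hess u|^2 and no square of the Laplacian, which keeps the estimates
    independent of the dimension. The addition is free against F - Pi F, which averages to zero over
    v. *)
Definition Mcent (z : E) : R := Mop z + laplacian u z.1.

Lemma vgradE z : vgrad z = dotv z.2 (erow e z.1).
Proof. by apply: eq_bigr => i _; rewrite mxE. Qed.

Lemma dom_vgrad : dom 1 vgrad.
Proof. by apply: dom_sum => i; exact: (dom_vCC i (Ce i)). Qed.

Lemma dom_Mop : dom 1 Mop. Proof. exact: dom_Mphi. Qed.

Lemma CC_lap : CC (laplacian u).
Proof.
rewrite (_ : laplacian u = fun x => \sum_i de i i x); first exact: CC_sum.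
by apply/funext => x; apply: eq_bigr => i _; rewrite mxE.
Qed.

Lemma dom_Mcent : dom 1 Mcent.
Proof.
apply: domD; first exact: dom_Mop.
by apply: (@dom_le _ _ 0 1) => //; apply: dom_CC; exact: CC_lap.
Qed.

Lemma MopE z : Mop z = Wterm U e z - bet U z * vgrad z - gamma * vgrad z - qform (hess u z.1) z.2.
Proof.
rewrite /Mop MphiE !vgradE; congr (_ - _).
apply: eq_bigr => i _; rewrite /adphi /z0 add0r mulr_sumr; apply: eq_bigr => j _.
by rewrite mxE /de; ring.
Qed.

Lemma Pi_vgrad x : Pi vgrad x = 0.
Proof.
have [_ h] := gauss_mean (erow e x).
by rewrite -h; apply: EX_eq => w; rewrite vgradE.
Qed.

Lemma EX_vgrad2 : EX muh (fun z => vgrad z ^+ 2) = grad2 mu u.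
Proof.
rewrite (EX_Pi mu (isT : (2 <= 2)%N) (domM dom_vgrad dom_vgrad)) /grad2 -EX_sum; last first.
  by move=> i _; apply: CC_itg; exact: (CCX (Ce i)).
apply: EX_eq => x; have [_ h] := gauss_cov (erow e x) (erow e x).
rewrite (_ : \sum_i _ = dotv (erow e x) (erow e x)); last first.
  by apply: eq_bigr => i _; rewrite !mxE expr2.
by rewrite -h; apply: EX_eq => w; rewrite vgradE.
Qed.

Lemma gauss_entry i j : itg kappa (fun w : V => w ord0 i * w ord0 j) /\
  EX kappa (fun w : V => w ord0 i * w ord0 j) = (i == j)%:R.
Proof.
have dE (w : V) k : dotv w (delta_mx ord0 k) = w ord0 k.
  rewrite /dotv (bigD1 k)//= big1 => [|l lk]; first by rewrite mxE !eqxx mulr1 addr0.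
  by rewrite mxE (negbTE lk) andbF mulr0.
have [i1 e1] := gauss_cov (delta_mx ord0 i : V) (delta_mx ord0 j).
have E : (fun v => dotv v (delta_mx ord0 i) * dotv v (delta_mx ord0 j)) = (fun w : V => w ord0 i * w ord0 j).
  by apply/funext => w; rewrite !dE.
rewrite E in i1 e1; split => //; by rewrite e1 dE mxE eqxx/= eq_sym.
Qed.

Lemma gauss_qform (H : 'M[R]_d) : itg kappa (qform H) /\ EX kappa (qform H) = \tr H.
Proof.
have i1 i j : itg kappa (fun w : V => H i j * (w ord0 i * w ord0 j)).
  by apply: itgZ; exact: (gauss_entry i j).1.
have E : qform H = fun w => \sum_i \sum_j H i j * (w ord0 i * w ord0 j).
  by apply/funext => w; apply: eq_bigr => i _; apply: eq_bigr => j _; ring.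
rewrite E; split; first by apply: itg_sum => i _; apply: itg_sum => j _; exact: i1.
rewrite EX_sum => [|i _]; last by apply: itg_sum => j _; exact: i1.
apply: eq_bigr => i _; rewrite EX_sum => [|j _]; last exact: i1.
rewrite (bigD1 i)//= big1 => [|j ji]; rewrite EXZ ?(gauss_entry _ _).2 ?(gauss_entry _ _).1//.
  by rewrite eqxx mulr1 addr0.
by rewrite eq_sym (negbTE ji) mulr0.
Qed.

(** The bounce term [Wterm] and - bet (v . grad u) each average to half of grad U . grad u, the
    refreshment term averages to 0, and the Hessian gives - Delta u. This identity makes <F, v .
    grad u> control Pi F. *)
Lemma Pi_Mop x : Pi Mop x = N u x.
Proof.
have [iq eq_] := gauss_qform (hess u x).
have iW : itg kappa (fun w => Wterm U e (x, w)) := dom_sec x (isT : (1 <= 2)%N) (dom_Wterm U2 Ce).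
have ib := itg_negp_mul (grad U x) (erow e x).
have iv := (gauss_mean (erow e x)).1.
rewrite /Pi (_ : (fun w => _) = fun w => Wterm U e (x, w) - bet U (x, w) * dotv w (erow e x) - gamma * dotv w (erow e x) - qform (hess u x) w); last first.
  by apply/funext => w; rewrite MopE vgradE.
rewrite !EXB//; try by do ?[apply: itgB|apply: itgZ].
rewrite EXZ// (gauss_mean _).2 (EX_negp_mul (grad U x) (erow e x)) eq_.
have -> : EX kappa (fun w => Wterm U e (x, w)) = 2^-1 * dotv (grad U x) (erow e x).
  rewrite /Wterm/= (_ : (fun w => _) = fun w => 2^-1 * dotv (grad U x) (erow e x) * (Zn U x)^-1 * bet U (x, w)).
    rewrite EXZ; last exact: (itg_negp (grad U x)).
    rewrite (_ : EX kappa _ = Zn U x); last exact: (EX_negp (grad U x)).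
    have [Z0|Z0] := eqVneq (Zn U x) 0; last by rewrite mulfVK.
    have := Zn_grad U x; rewrite Z0 expr0n mulr0 mulr0 => a0.
    have /eqP a0' : dotv (grad U x) (grad U x) == 0 by rewrite eq_le a0 dotv_ge0.
    have := dotv_CS (grad U x) (erow e x); rewrite a0' mul0r => h.
    have /eqP : dotv (grad U x) (erow e x) ^+ 2 == 0 by rewrite eq_le h sqr_ge0.
    by move=> /eqP; rewrite sqrf_eq0 => /eqP ->; rewrite mulr0.
  by apply/funext => w; rewrite mulrC.
have -> : dotv (grad U x) (erow e x) = \sum_i partial i U x * partial i u x.
  by apply: eq_bigr => i _; rewrite !mxE.
have -> : \tr (hess u x) = \sum_i partial i (partial i u) x by apply: eq_bigr => i _; rewrite mxE.
rewrite /Nop sumrB; field => //.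
Qed.

(** [sqr_split4] separates the terms. The variance of the Hessian form gives 3 * 2; the two bounce
    terms, each at most 3 |grad U|^2 |grad u|^2 in mean, give 6 * 3 + 6 * 3 = 36; refreshment gives
    3 gamma^2. *)
Lemma Mcent_point x : EX kappa (fun w => Mcent (x, w) ^+ 2) <=
  3 * (2 * frob (hess u x) + 12 * (gradU2 dU x * \sum_i partial i u x ^+ 2) + gamma ^+ 2 * \sum_i partial i u x ^+ 2).
Proof.
pose H := hess u x; pose a := grad U x; pose f := erow e x.
have g2E : gradU2 dU x = dotv a a by apply: eq_bigr => i _; rewrite mxE expr2.
have e2E : \sum_i partial i u x ^+ 2 = dotv f f by apply: eq_bigr => i _; rewrite mxE expr2.
have [iq eq_] := gauss_qform_EX H (- \tr H).
rewrite addrN expr0n add0r in eq_.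
have [ic ec] := gauss_affine_EX f 0; have [ia ea] := gauss_affine_EX a 0.
rewrite expr0n/= addr0 in ec; rewrite expr0n/= addr0 in ea.
have [ip ep] := gauss_prod_sqr a f.
have lin (f1 f2 f3 f4 : V -> R) (c1 c2 c3 : R) :
    itg kappa f1 -> itg kappa f2 -> itg kappa f3 -> itg kappa f4 ->
    EX kappa (fun w => c1 * f1 w + c2 * f2 w + c3 * f3 w + c1 * f4 w) =
    c1 * EX kappa f1 + c2 * EX kappa f2 + c3 * EX kappa f3 + c1 * EX kappa f4.
  move=> i1 i2 i3 i4; have [j1 j2] := (itgZ c1 i1, itgZ c2 i2).
  have [j3 j4] := (itgZ c3 i3, itgZ c1 i4).
  by rewrite (EXD (itgD (itgD j1 j2) j3) j4) (EXD (itgD j1 j2) j3) (EXD j1 j2) !EXZ.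
pose r := (2^-1 * dotv a f * (Zn U x)^-1) ^+ 2.
have iR : itg kappa (fun w => 3 * (qform H w - \tr H) ^+ 2 + 6 * (r * (dotv w a + 0) ^+ 2) + 6 * (dotv w a * dotv w f) ^+ 2 + 3 * (gamma ^+ 2 * (dotv w f + 0) ^+ 2)).
  exact: (itgD (itgD (itgD (itgZ _ iq) (itgZ _ (itgZ _ ia))) (itgZ _ ip)) (itgZ _ (itgZ _ ic))).
apply: (@le_trans _ _ (EX kappa (fun w => 3 * (qform H w - \tr H) ^+ 2 + 6 * (r * (dotv w a + 0) ^+ 2) + 6 * (dotv w a * dotv w f) ^+ 2 + 3 * (gamma ^+ 2 * (dotv w f + 0) ^+ 2)))).
  apply: EX_le => //.
    exact: (dom_sec x (isT : (2 <= 2)%N) (domM dom_Mcent dom_Mcent)).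
  move=> w; rewrite !addr0 /Mcent MopE vgradE /laplacian/= -/H -/f.
  have b2 : bet U (x, w) ^+ 2 <= dotv w a ^+ 2 by exact: negp_sqr_le.
  have W2 : Wterm U e (x, w) ^+ 2 <= r * dotv w a ^+ 2.
    by rewrite /Wterm exprMn mulrC ler_wpM2l// sqr_ge0.
  have v2 : (bet U (x, w) * dotv w f) ^+ 2 <= (dotv w a * dotv w f) ^+ 2.
    by rewrite !exprMn ler_wpM2r// sqr_ge0.
  apply: le_trans (sqr_split4 (gamma * dotv w f) (qform H w) (\tr H) W2 v2) _.
  by rewrite (exprMn _ gamma).
have rA : r * dotv a a <= 3 * (dotv a a * dotv f f).
  have A0 := dotv_ge0 a; have B0 := dotv_ge0 f; have cs := dotv_CS a f; have zg := Zn_grad U x.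
  have [Z0|Z0] := eqVneq (Zn U x) 0.
    by rewrite /r Z0 invr0 mulr0 expr0n mul0r !mulr_ge0.
  have Zgt : 0 < Zn U x ^+ 2 by rewrite exprn_gt0// lt_neqAle eq_sym Z0 Zn_ge0.
  rewrite -(ler_pM2r Zgt) (_ : _ * Zn U x ^+ 2 = 4^-1 * (dotv a f ^+ 2 * dotv a a)); last by rewrite /r; field.
  have h5 := ler_wpM2r A0 cs.
  have h6 : (dotv a a * dotv f f) * dotv a a <= (dotv a a * dotv f f) * (12 * Zn U x ^+ 2).
    by rewrite ler_wpM2l// mulr_ge0.
  have q4 : 0 <= 4^-1 :> R by rewrite invr_ge0.
  apply: le_trans (ler_wpM2l q4 (le_trans h5 h6)) _.
  by rewrite le_eqVlt; apply/orP; left; apply/eqP; field.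
rewrite (lin _ _ _ _ _ _ _ iq (itgZ _ ia) ip (itgZ _ ic)) (EXZ _ ia) (EXZ _ ic) ea ec g2E e2E -/H.
exact: sqr_split_arith eq_ rA ep.
Qed.

Lemma Mcent_le : EX muh (fun z => Mcent z ^+ 2) <=
  6 * hess2 mu u + 36 * Ysq mu dU u + 3 * gamma ^+ 2 * grad2 mu u.
Proof.
have dM2 : dom 2 (fun z => Mcent z ^+ 2) := domM dom_Mcent dom_Mcent.
rewrite (EX_Pi mu (isT : (2 <= 2)%N) dM2).
have cg : CC (fun x => \sum_i partial i u x ^+ 2) by apply: CC_sum => i; exact: (CCX (Ce i)).
have ig : itg mu (fun x => \sum_i partial i u x ^+ 2) by exact: CC_itg.
have iY : itg mu (fun x => gradU2 dU x * \sum_i partial i u x ^+ 2).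
  by apply: CC_itg; apply: CCMl => //; apply: continuous_gradU2; exact: cpdU.
have fE x : frob (hess u x) = \sum_i \sum_j partial i (partial j u) x ^+ 2.
  by apply: eq_bigr => i _; apply: eq_bigr => j _; rewrite mxE.
have iH : itg mu (fun x => frob (hess u x)).
  rewrite (_ : (fun x => _) = fun x => \sum_i \sum_j partial i (partial j u) x ^+ 2); last exact/funext.
  by apply: CC_itg; apply: CC_sum => i; apply: CC_sum => j; apply: CCX; exact: (Cde i j).
have H2E : hess2 mu u = EX mu (fun x => frob (hess u x)).
  rewrite (_ : (fun x => _) = fun x => \sum_i \sum_j partial i (partial j u) x ^+ 2); last exact/funext.
  rewrite EX_sum; last by move=> i _; apply: CC_itg; apply: CC_sum => j; apply: CCX; exact: (Cde i j).
  by apply: eq_bigr => i _; rewrite EX_sum// => j _; apply: CC_itg; apply: CCX; exact: (Cde i j).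
have G2E : grad2 mu u = EX mu (fun x => \sum_i partial i u x ^+ 2).
  by rewrite EX_sum// => i _; apply: CC_itg; exact: (CCX (Ce i)).
have iR : itg mu (fun x => 6 * frob (hess u x) + 36 * (gradU2 dU x * \sum_i partial i u x ^+ 2) + 3 * gamma ^+ 2 * \sum_i partial i u x ^+ 2).
  by do ?[apply: itgD|apply: itgZ].
apply: (@le_trans _ _ (EX mu (fun x => 6 * frob (hess u x) + 36 * (gradU2 dU x * \sum_i partial i u x ^+ 2) + 3 * gamma ^+ 2 * \sum_i partial i u x ^+ 2))).
  apply: EX_le => //; first exact: (bddm_itg mu (Pi_bddm mu (isT : (2 <= 2)%N) dM2)).
  move=> x; apply: le_trans (Mcent_point x) _.
  rewrite le_eqVlt; apply/orP; left; apply/eqP; ring.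
rewrite !EXD//; try by do ?[apply: itgD|apply: itgZ].
by rewrite !EXZ// H2E G2E.
Qed.

Variables (C : R) (F : R -> E -> R).
Hypothesis sF : sol U gamma C F.
Let mF := sol_meas sF.
Let FC := sol_bd sF.

Lemma weak_vel T : 0 <= T ->
  EX muh (fun z => F T z * vgrad z) = EX muh (fun z => F 0 z * vgrad z) +
    ri (fun r => EX muh (fun z => F r z * Mop z)) 0 T.
Proof.
move=> T0.
have := weak_form U2 gU (CC_cst0 R d) (fun i => pd_cst i 0) Cz Ce (fun i j => smC_pd i (smC_partial j su)) Cde sF T0.
by have -> : aphi (fun=> 0) e = vgrad by apply/funext => z; rewrite /aphi add0r.
Qed.

Definition Dsq (r : R) := nrm mu F r - nrmPi mu F r.
Definition Fperp r (z : E) := F r z - Pi (F r) z.1.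

Lemma dom_Fperp r : dom 0 (Fperp r).
Proof. by apply: domB; [exact: (domF mF FC)|apply: dom_x; exact: (bddm_Pi mu sF)]. Qed.

Lemma Pi_Fperp r x : Pi (Fperp r) x = 0.
Proof.
rewrite /Pi /Fperp/= EXB; [|exact: (itgF mF FC)|exact: itg_cst].
by rewrite EX_cst subrr.
Qed.

Lemma EX_Fperp2 r : EX muh (fun z => Fperp r z ^+ 2) = Dsq r.
Proof.
have bP := bddm_Pi mu sF r.
have dF := domF mF FC r.
have i0 : itg muh (fun z => F r z ^+ 2) by apply: (@dom_itg _ _ _ 0) => //; exact: (domM dF dF).
have dP := dom_x bP.
have iPF : itg muh (fun z => Pi (F r) z.1 * F r z) by apply: (@dom_itg _ _ _ 0) => //; exact: (domM dP dF).
have iPP : itg muh (fun z => Pi (F r) z.1 ^+ 2) by apply: (@dom_itg _ _ _ 0) => //; exact: (domM dP dP).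
rewrite (_ : (fun z => _) = fun z => F r z ^+ 2 - 2 * (Pi (F r) z.1 * F r z) + Pi (F r) z.1 ^+ 2); last first.
  by apply/funext => z; rewrite /Fperp; ring.
rewrite EXD ?EXB ?EXZ//; try by do ?[apply: itgB|apply: itgZ].
rewrite (EX_Pi_mul mu (isT : (0 <= 2)%N) dF bP) (EX_x mu (bddm_Pi2 mu sF r)).
rewrite /Dsq /nrm /nrmPi (EX_eq _ (fun x => expr2 (Pi (F r) x))); ring.
Qed.

Lemma Dsq_ge0 r : 0 <= Dsq r.
Proof. by rewrite -EX_Fperp2; apply: EX_ge0 => z; exact: sqr_ge0. Qed.

(** v . grad u averages to zero over v, so F may be replaced by F - Pi F before Cauchy-Schwarz. *)
Lemma pair_v r : (EX muh (fun z => F r z * vgrad z)) ^+ 2 <= Dsq r * grad2 mu u.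
Proof.
have dF := domF mF FC r; have dv := dom_vgrad; have dp := dom_Fperp r.
have bP := bddm_Pi mu sF r.
have i1 : itg muh (fun z => Fperp r z * vgrad z) by apply: (@dom_itg _ _ _ 1) => //; exact: (domM dp dv).
have i2 : itg muh (fun z => Pi (F r) z.1 * vgrad z) by apply: (@dom_itg _ _ _ 1) => //; exact: (domM (dom_x bP) dv).
have -> : EX muh (fun z => F r z * vgrad z) = EX muh (fun z => Fperp r z * vgrad z).
  rewrite (_ : (fun z => F r z * vgrad z) = fun z => Fperp r z * vgrad z + Pi (F r) z.1 * vgrad z); last first.
    by apply/funext => z; rewrite /Fperp; ring.
  rewrite EXD// (EX_Pi_mul mu (isT : (1 <= 2)%N) dv bP) [X in _ + X](_ : _ = 0) ?addr0//.
  by rewrite -[RHS](EX_cst mu); apply: EX_eq => x; rewrite Pi_vgrad mulr0.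
rewrite -EX_Fperp2 -EX_vgrad2; apply: EX_CS; [exact: dp.1|exact: dv.1| |].
- by apply: (@dom_itg _ _ _ 0) => //; exact: (domM dp dp).
- by apply: (@dom_itg _ _ _ 2) => //; exact: (domM dv dv).
Qed.

(** Along Pi F only the velocity average of [Mop] counts, and it is N u. The orthogonal part is
    paired with the centred function [Mcent], the added Laplacian being invisible to it. *)
Lemma pair_M r : (EX muh (fun z => F r z * Mop z) - EX mu (fun x => Pi (F r) x * N u x)) ^+ 2 <=
  Dsq r * (6 * hess2 mu u + 36 * Ysq mu dU u + 3 * gamma ^+ 2 * grad2 mu u).
Proof.
have dF := domF mF FC r; have dM := dom_Mcent; have dp := dom_Fperp r; have dMo := dom_Mop.
have bP := bddm_Pi mu sF r; have dL : dom 0 (fun z : E => laplacian u z.1) by apply: dom_CC; exact: CC_lap.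
have bL := CC_bddm CC_lap.
have i1 : itg muh (fun z => F r z * Mop z) by apply: (@dom_itg _ _ _ 1) => //; exact: (domM dF dMo).
have i2 : itg muh (fun z => Pi (F r) z.1 * Mop z) by apply: (@dom_itg _ _ _ 1) => //; exact: (domM (dom_x bP) dMo).
have i3 : itg muh (fun z => laplacian u z.1 * Fperp r z) by apply: (@dom_itg _ _ _ 0) => //; exact: (domM dL dp).
have -> : EX muh (fun z => F r z * Mop z) - EX mu (fun x => Pi (F r) x * N u x) = EX muh (fun z => Fperp r z * Mcent z).
  rewrite (_ : (fun z => Fperp r z * Mcent z) = fun z => F r z * Mop z - Pi (F r) z.1 * Mop z + laplacian u z.1 * Fperp r z); last first.
    by apply/funext => z; rewrite /Fperp /Mcent; ring.
  rewrite EXD ?EXB//; last exact: itgB.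
  rewrite (EX_Pi_mul mu (isT : (1 <= 2)%N) dMo bP) (EX_Pi_mul mu (isT : (0 <= 2)%N) dp bL).
  rewrite [X in _ = _ + X](_ : _ = 0) ?addr0; last first.
    by rewrite -[RHS](EX_cst mu); apply: EX_eq => x; rewrite Pi_Fperp mulr0.
  by congr (_ - _); apply: EX_eq => x; rewrite Pi_Mop.
apply: (@le_trans _ _ (Dsq r * EX muh (fun z => Mcent z ^+ 2))); last first.
  by rewrite ler_wpM2l ?Dsq_ge0// Mcent_le.
rewrite -EX_Fperp2; apply: EX_CS; [exact: dp.1|exact: dM.1| |].
- by apply: (@dom_itg _ _ _ 0) => //; exact: (domM dp dp).
- by apply: (@dom_itg _ _ _ 2) => //; exact: (domM dM dM).
Qed.

End testfun.
End velocity.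

Lemma abs_le_of_sqr (R : realFieldType) (x A B : R) : 0 <= A -> 0 <= B -> x ^+ 2 <= 4 * (A * B) -> `|x| <= A + B.
Proof.
move=> A0 B0 h; rewrite -ler_sqr ?nnegrE ?addr_ge0// real_normK ?num_real//.
by have := sqr_ge0 (A - B); nra.
Qed.

Lemma sqrB_le2 (R : realDomainType) (x y : R) : (x - y) ^+ 2 <= 2 * x ^+ 2 + 2 * y ^+ 2.
Proof. by have := sqr_ge0 (x + y); nra. Qed.

Lemma EX_jensen disp (T : measurableType disp) (R : realType) (P : probability T R) (f : T -> R) :
  itg P f -> itg P (fun x => f x ^+ 2) -> EX P f ^+ 2 <= EX P (fun x => f x ^+ 2).
Proof.
move=> i1 i2; have : 0 <= EX P (fun x => f x ^+ 2 - 2 * EX P f * f x + EX P f ^+ 2).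
  apply: EX_ge0 => x; rewrite (_ : _ + _ = (f x - EX P f) ^+ 2) ?sqr_ge0//; ring.
rewrite EXD ?EXB ?EXZ ?EX_cst//; try by do ?[apply: itgB|apply: itgZ|exact: itg_cst].
by rewrite -mulrA -expr2; lra.
Qed.

(** * One time step *)

Section step.
Context (R : realType) (d : nat) (U : 'rV[R]_d -> R) (mu : probability 'rV[R]_d R) (gamma : R).
Hypothesis U2 : is_C 2 U.
Hypothesis gU : gibbs_measure U mu.
Notation V := 'rV[R]_d.
Notation E := (V * V)%type.
Notation kappa := (@gaussm R d).
Notation muh := (prodp mu kappa).
Notation mR := (measurableTypeR R).
Notation dU := (fun i => partial i U).
Notation N := (Nop dU).
Variables (m K a b : R).
Hypothesis m0 : 0 < m.
Hypothesis pc : poincare mu m^-1.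
Hypothesis K0 : 0 <= K.
Hypothesis hK : forall x v : V, - (K * m) * dotv v v <= (v *m hess U x *m v^T) ord0 ord0.
Hypothesis a01 : 0 <= a < 1.
Hypothesis b0 : 0 <= b.
Hypothesis hab : forall x, laplacian U x <= a * dotv (grad U x) (grad U x) + b.

(* The paper's rate is gamma / Gam2 up to a universal constant. *)
Definition Gam2 : R := ((m * (1 + K) + b) / (1 - a) ^+ 2 + gamma ^+ 2) / m.
(** Equals <m u + N u, N u>, the gain in the derivative of <F, v . grad u> when m u + N u is Pi
    F. *)
Definition qu (u : V -> R) : R := m * grad2 mu u + EX mu (fun x => N u x ^+ 2).

Lemma Gam2_ge1 : 1 <= Gam2.
Proof.
have [a0 a1] := andP a01.
rewrite /Gam2 ler_pdivlMr// mul1r.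
apply: (@le_trans _ _ ((m * (1 + K) + b) / (1 - a) ^+ 2)); last by rewrite lerDl sqr_ge0.
have q1 : 0 < (1 - a) ^+ 2 by rewrite exprn_gt0// subr_gt0.
rewrite ler_pdivlMr//.
have : (1 - a) ^+ 2 <= 1 by apply: exprn_ile1; rewrite ?subr_ge0 ?gerBl// ltW.
move=> p1; have := ler_wpM2l (ltW m0) p1; rewrite mulr1 mulrDr mulr1; have := mulr_ge0 (ltW m0) K0.
by move: b0; move: (m * (1 - a) ^+ 2) (m * K) => *; lra.
Qed.

Lemma qu_ge u : smC u -> m * grad2 mu u <= qu u /\ EX mu (fun x => N u x ^+ 2) <= qu u.
Proof.
move=> su; have g := mulr_ge0 (ltW m0) (grad2_ge0 mu u).
have n0 : 0 <= EX mu (fun x => N u x ^+ 2) by apply: EX_ge0 => x; exact: sqr_ge0.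
by rewrite /qu; split; lra.
Qed.

Lemma qu_ge0 u : smC u -> 0 <= qu u.
Proof. by move=> su; apply: le_trans (qu_ge su).1; rewrite mulr_ge0 ?grad2_ge0// ltW. Qed.

(** With q = [qu u], Bochner gives |Hess u|^2 <= (1 + K) q, and [Ysq_le] then gives (1 - a)^2 Ysq <=
    (2 b/m + 4 (1 + K)) q. The constant 150 = 6 + 36 * 4 is the weight of 1 + K. *)
Lemma M_bound u : smC u ->
  6 * hess2 mu u + 36 * Ysq mu dU u + 3 * gamma ^+ 2 * grad2 mu u <= 150 * Gam2 * qu u.
Proof.
move=> su; have [a0 a1] := andP a01.
have h1 : hess2 mu u <= EX mu (fun x => N u x ^+ 2) + K * m * grad2 mu u.
  apply: (bochner_le gU (pdU U2) (@cpdU _ _ _ U2) (contU U2) (pddU U2) (@cpddU _ _ _ U2) su) => x v.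
  apply: le_trans (hK x v) _; rewrite le_eqVlt; apply/orP; left; apply/eqP.
  rewrite mxE exchange_big/=; apply: eq_bigr => j _; rewrite !mxE mulr_suml.
  by apply: eq_bigr => i _; rewrite !mxE; ring.
have h2 : (1 - a) ^+ 2 * Ysq mu dU u <= 2 * b * (1 - a) * grad2 mu u + 4 * hess2 mu u.
  apply: (Ysq_le gU (pdU U2) (@cpdU _ _ _ U2) (contU U2) (pddU U2) (@cpddU _ _ _ U2) su) => // x.
  have := hab x; rewrite /laplacian (_ : \tr _ = \sum_i partial i (partial i U) x); last by apply: eq_bigr => i _; rewrite mxE.
  by rewrite (_ : dotv _ _ = gradU2 dU x)//; apply: eq_bigr => i _; rewrite !mxE expr2.
have [q1 q2] := qu_ge su; have g0 := grad2_ge0 mu u; have q0 := qu_ge0 su.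
pose p := (1 - a) ^+ 2; have p0 : 0 < p by rewrite exprn_gt0// subr_gt0.
have p1 : p <= 1 by apply: exprn_ile1; rewrite ?subr_ge0 ?gerBl// ltW.
pose g := m * grad2 mu u.
have S : hess2 mu u <= (1 + K) * qu u.
  apply: le_trans h1 _; rewrite /qu mulrDl mul1r -/g (_ : K * m * _ = K * g); last by rewrite /g; ring.
  have g' : 0 <= g by rewrite mulr_ge0// ltW.
  have n0 : 0 <= EX mu (fun x => N u x ^+ 2) by apply: EX_ge0 => x; exact: sqr_ge0.
  have := mulr_ge0 K0 n0; set n := EX _ _; nra.
have gb : b * grad2 mu u <= b / m * qu u.
  rewrite -mulrA ler_wpM2l// ler_pdivlMl//.
have Y : p * Ysq mu dU u <= (2 * (b / m) + 4 * (1 + K)) * qu u.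
  apply: le_trans h2 _; rewrite [leRHS]mulrDl; apply: lerD; last by rewrite -mulrA ler_wpM2l.
  apply: le_trans (_ : 2 * (b * grad2 mu u) <= _); last by rewrite -mulrA ler_wpM2l.
  rewrite (_ : 2 * b * (1 - a) * _ = (2 * (b * grad2 mu u)) * (1 - a)); last by ring.
  by rewrite ler_piMr ?gerBl// mulr_ge0// mulr_ge0.
have GE : Gam2 * qu u = ((1 + K) + b / m) * qu u / p + gamma ^+ 2 / m * qu u.
  by rewrite /Gam2 -/p; field; rewrite !gt_eqF.
have Y' : Ysq mu dU u <= (2 * (b / m) + 4 * (1 + K)) * qu u / p by rewrite ler_pdivlMr// mulrC.
have S' : hess2 mu u <= ((1 + K) + b / m) * qu u / p.
  rewrite ler_pdivlMr//.
  have Kq : 0 <= (1 + K) * qu u by rewrite mulr_ge0// addr_ge0.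
  have bq : 0 <= b / m * qu u by rewrite mulr_ge0// divr_ge0// ltW.
  have h0 : hess2 mu u * p <= (1 + K) * qu u.
    have hh0 : 0 <= hess2 mu u.
      by apply: sumr_ge0 => i _; apply: sumr_ge0 => j _; apply: EX_ge0 => x; exact: sqr_ge0.
    by apply: le_trans S; rewrite ler_piMr.
  by rewrite mulrDl; lra.
have G' : gamma ^+ 2 * grad2 mu u <= gamma ^+ 2 / m * qu u.
  by rewrite -mulrA ler_wpM2l ?sqr_ge0// ler_pdivlMl.
rewrite -(mulrA 150) GE.
have bq : 0 <= b / m * qu u / p by rewrite !mulr_ge0// ?invr_ge0; apply: ltW.
have Kq : 0 <= (1 + K) * qu u / p by apply: divr_ge0 (ltW p0); apply: mulr_ge0 => //; exact: addr_ge0.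
have gq : 0 <= gamma ^+ 2 / m * qu u by apply: mulr_ge0 => //; apply: divr_ge0 (ltW m0); exact: sqr_ge0.
move: Y' S' G' bq Kq gq.
rewrite (_ : (2 * (b / m) + 4 * (1 + K)) * qu u / p = 2 * (b / m * qu u / p) + 4 * ((1 + K) * qu u / p)); last by ring.
rewrite (_ : ((1 + K) + b / m) * qu u / p = (1 + K) * qu u / p + b / m * qu u / p); last by ring.
rewrite -(mulrA 3).
move: (Ysq _ _ _) (hess2 _ _) (gamma ^+ 2 * _) (b / m * _ / p) ((1 + K) * _ / p) (gamma ^+ 2 / m * _) => *.
lra.
Qed.

Variables (C L : R) (F : R -> E -> R).
Hypothesis sF : sol U gamma C F.
Hypothesis L0 : 0 <= L.
Hypothesis lipF : forall s t z, 0 <= s -> s <= t -> `|F t z - F s z| <= L * (t - s).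
Let mF := sol_meas sF.
Let FC := sol_bd sF.
Notation D := (Dsq mu F).

Lemma Pi_lip s t x : 0 <= s -> s <= t -> `|Pi (F t) x - Pi (F s) x| <= L * (t - s).
Proof.
move=> s0 st; rewrite /Pi -EXB; [|exact: (itgF mF FC)|exact: (itgF mF FC)].
have i := itgB (itgF mF FC t x) (itgF mF FC s x).
apply: le_trans (EX_abs i) _; rewrite -[leRHS](EX_cst kappa).
apply: EX_le; [exact: (integrable_norm i)|exact: itg_cst|].
by move=> w; exact: lipF.
Qed.

Lemma Dsq_lip s t : 0 <= s -> s <= t -> D t <= 2 * D s + 8 * (L * (t - s)) ^+ 2 /\
  D s <= 2 * D t + 8 * (L * (t - s)) ^+ 2.
Proof.
move=> s0 st; have e0 : 0 <= L * (t - s) by rewrite mulr_ge0// subr_ge0.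
have diff z : `|Fperp F t z - Fperp F s z| <= 2 * (L * (t - s)).
  rewrite /Fperp (_ : _ - _ = (F t z - F s z) - (Pi (F t) z.1 - Pi (F s) z.1)); last by ring.
  by apply: le_trans (ler_normB _ _) _; rewrite mulrDl mul1r lerD// ?Pi_lip ?lipF.
have i r : itg muh (fun z => Fperp F r z ^+ 2).
  by apply: (@dom_itg _ _ _ 0) => //; exact: (domM (dom_Fperp mu sF r) (dom_Fperp mu sF r)).
have key p r : (forall z, `|Fperp F p z - Fperp F r z| <= 2 * (L * (t - s))) -> D p <= 2 * D r + 8 * (L * (t - s)) ^+ 2.
  move=> h; rewrite -!(EX_Fperp2 mu sF) -(EX_cst muh (8 * _)) -EXZ// -EXD; [|exact: itgZ|exact: itg_cst].
  apply: EX_le => //; first by apply: itgD; [exact: itgZ|exact: itg_cst].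
  move=> z; have := h z; have := sqr_ge0 (Fperp F p z - 2 * Fperp F r z).
  set x := Fperp F p z; set y := Fperp F r z; set e := L * _ => h1 h2.
  have e0' : 0 <= e by exact: e0.
  have : (x - y) ^+ 2 <= (2 * e) ^+ 2.
    rewrite -(real_normK (num_real (x - y))) ler_sqr ?nnegrE//.
    by rewrite mulr_ge0.
  nra.
split; apply: key => // z; rewrite distrC; exact: diff.
Qed.

Lemma lbm_D : lbm D.
Proof. by apply: lbmD; [exact: (lbm_nrm mu sF)|apply: lbmN; exact: (lbm_nrmPi mu sF)]. Qed.

Variables (dl e : R).
Hypothesis dl0 : 0 < dl.
Hypothesis e0 : 0 <= e.
Notation I := (ri D 0 dl).

(** The Lipschitz bound replaces a value at an end of the time step by the average over the step,
    with an error cubic in dl. The energy inequality controls D only through its integral. *)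
Lemma D0_int : dl * D 0 <= 2 * I + 8 * L ^+ 2 * dl ^+ 3.
Proof.
have l1 : lbm (fun r => 2 * D r) by apply: lbmM; [exact: lbm_cst|exact: lbm_D].
have := @ri_le R (fun=> D 0) (fun r => 2 * D r + 8 * (L * dl) ^+ 2) 0 dl (lbm_cst _) (lbmD l1 (lbm_cst _)).
have -> : ri (fun=> D 0) 0 dl = D 0 * dl by rewrite (ri_cst (D 0) (ltW dl0)) subr0.
have -> : ri (fun r => 2 * D r + 8 * (L * dl) ^+ 2) 0 dl = 2 * I + 8 * (L * dl) ^+ 2 * dl.
  by rewrite (riD _ _ l1 (lbm_cst _)) (riZ _ _ _ lbm_D) (ri_cst _ (ltW dl0)) subr0.
move=> h.
have : D 0 * dl <= 2 * I + 8 * (L * dl) ^+ 2 * dl.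
  apply: h => r /andP[r0 rd]; have [_ h] := Dsq_lip (lexx 0) r0.
  apply: le_trans h _; rewrite lerD2l ler_wpM2l// ler_sqr ?nnegrE ?mulr_ge0// ?subr_ge0//; last exact: ltW.
  by rewrite subr0 ler_wpM2l.
by rewrite mulrC => /le_trans; apply; rewrite lerD2l le_eqVlt; apply/orP; left; apply/eqP; ring.
Qed.

Lemma Dd_int : dl * D dl <= 2 * I + 8 * L ^+ 2 * dl ^+ 3.
Proof.
have l1 : lbm (fun r => 2 * D r) by apply: lbmM; [exact: lbm_cst|exact: lbm_D].
have := @ri_le R (fun=> D dl) (fun r => 2 * D r + 8 * (L * dl) ^+ 2) 0 dl (lbm_cst _) (lbmD l1 (lbm_cst _)).
have -> : ri (fun=> D dl) 0 dl = D dl * dl by rewrite (ri_cst (D dl) (ltW dl0)) subr0.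
have -> : ri (fun r => 2 * D r + 8 * (L * dl) ^+ 2) 0 dl = 2 * I + 8 * (L * dl) ^+ 2 * dl.
  by rewrite (riD _ _ l1 (lbm_cst _)) (riZ _ _ _ lbm_D) (ri_cst _ (ltW dl0)) subr0.
move=> h.
have : D dl * dl <= 2 * I + 8 * (L * dl) ^+ 2 * dl.
  apply: h => r /andP[r0 rd]; have [h _] := Dsq_lip r0 rd.
  apply: le_trans h _; rewrite lerD2l ler_wpM2l// ler_sqr ?nnegrE ?mulr_ge0// ?subr_ge0//; last exact: ltW.
  by rewrite ler_wpM2l// gerBl.
by rewrite mulrC => /le_trans; apply; rewrite lerD2l le_eqVlt; apply/orP; left; apply/eqP; ring.
Qed.

Variables (u u' : V -> R).
Hypotheses (su : smC u) (su' : smC u').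
Let h x := m * u x + N u x.
Let h' x := m * u' x + N u' x.
Hypothesis hu : EX mu (fun x => (h x - Pi (F 0) x) ^+ 2) <= e.
Hypothesis hu' : EX mu (fun x => (h' x - Pi (F dl) x) ^+ 2) <= e.

Let mh w : smC w -> measurable_fun setT (fun x => m * w x + N w x).
Proof.
move=> sw; apply: continuous_rV_measurable; apply: contD (CC_N U2 sw).1.
by apply: contZ; exact: smC_cont.
Qed.
Let bh w : smC w -> bddm (fun x => m * w x + N w x).
Proof. by move=> sw; apply: CC_bddm; apply: CCD; [apply: CCZ; exact: sw.2|exact: CC_N]. Qed.
Let bhg w r : smC w -> bddm (fun x => m * w x + N w x - Pi (F r) x).
Proof.
move=> sw; have [m1 [K1 [K10 k1]]] := bh sw; have [m2 [K2 [K20 k2]]] := bddm_Pi mu sF r.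
split; first exact: measurable_funB.
exists (K1 + K2); split; first exact: addr_ge0.
by move=> x; rewrite (le_trans (ler_normB _ _))// lerD.
Qed.
Let bsq (f : V -> R) : bddm f -> itg mu (fun x => f x ^+ 2).
Proof. by move=> bf; rewrite (_ : (fun x => _) = fun x => f x * f x)//; apply: itgM => //; exact: bddm_itg. Qed.

(** u is frozen at the value adapted to time 0. [pair_M] replaces [Mop] by N u, and Pi F_r differs
    from m u + N u by the approximation error and by the motion of Pi F since time 0. Young's
    inequality spends q/4 + q/8 + q/8 of q = [qu u] on the three errors, which leaves q/2. *)
Lemma vel_rate r : 0 <= r <= dl -> qu u / 2 - 2 * e - 2 * (L * dl) ^+ 2 - 150 * Gam2 * D r <=
  EX muh (fun z => F r z * Mop U gamma u z).
Proof.
move=> /andP[r0 rd].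
have q0 := qu_ge0 su; have [_ qN] := qu_ge su.
have p := pair_M mu U2 su sF r; have Mb := M_bound su.
have G1 := Gam2_ge1; have D0 := Dsq_ge0 mu sF r.
have cN := CC_N U2 su; have bN := CC_bddm cN.
set X := EX muh _; set Y := EX mu (fun x => Pi (F r) x * N u x) in p.
have h1 : `|X - Y| <= qu u / 4 + 150 * Gam2 * D r.
  apply: abs_le_of_sqr; first by rewrite divr_ge0.
    by exact: mulr_ge0 (mulr_ge0 (ler0n _ _) (le_trans ler01 G1)) D0.
  apply: le_trans p _; apply: le_trans (ler_wpM2l D0 Mb) _.
  by rewrite le_eqVlt; apply/orP; left; apply/eqP; field.
have iN2 := bsq bN.
have be := bhg 0 su; have ie := bsq be.
have igr := bddm_Pi mu sF r; have ig0 := bddm_Pi mu sF 0.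
pose dg x := Pi (F r) x - Pi (F 0) x.
have bdg : bddm dg.
  have [m1 [K1 [K10 k1]]] := igr; have [m2 [K2 [K20 k2]]] := ig0.
  split; first exact: measurable_funB.
  exists (K1 + K2); split; first exact: addr_ge0.
  by move=> x; rewrite (le_trans (ler_normB _ _))// lerD.
have YE : Y = qu u - EX mu (fun x => (h x - Pi (F 0) x) * N u x) + EX mu (fun x => dg x * N u x).
  rewrite /qu -(EX_hN gU U2 m su) -EXB; [|by apply: itgM; [exact: bh|exact: CC_itg]|by apply: itgM; [exact: be|exact: CC_itg]].
  rewrite -EXD; [|by apply: itgB; (apply: itgM; last exact: CC_itg); [exact: bh|exact: be]|by apply: itgM => //; exact: CC_itg].
  by apply: EX_eq => x; rewrite /h /dg; ring.
have h2 : `|EX mu (fun x => (h x - Pi (F 0) x) * N u x)| <= qu u / 8 + 2 * e.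
  apply: abs_le_of_sqr; [by rewrite divr_ge0|by rewrite mulr_ge0|].
  apply: le_trans (EX_CS be.1 bN.1 ie iN2) _.
  have : EX mu (fun x => (h x - Pi (F 0) x) ^+ 2) * EX mu (fun x => N u x ^+ 2) <= e * qu u.
    by apply: (ler_pM _ _ hu qN); apply: EX_ge0 => x; exact: sqr_ge0.
  by move/le_trans; apply; rewrite le_eqVlt; apply/orP; left; apply/eqP; field.
have h3 : `|EX mu (fun x => dg x * N u x)| <= qu u / 8 + 2 * (L * dl) ^+ 2.
  apply: abs_le_of_sqr; [by rewrite divr_ge0|by rewrite mulr_ge0// sqr_ge0|].
  apply: le_trans (EX_CS bdg.1 bN.1 (bsq bdg) iN2) _.
  have dgle : EX mu (fun x => dg x ^+ 2) <= (L * dl) ^+ 2.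
    rewrite -[leRHS](EX_cst mu); apply: EX_le; [exact: bsq|exact: itg_cst|].
    move=> x; rewrite -(real_normK (num_real (dg x))) ler_sqr ?nnegrE//; last by rewrite mulr_ge0// ltW.
    apply: le_trans (Pi_lip x (lexx 0) r0) _; by rewrite subr0 ler_wpM2l.
  have : EX mu (fun x => dg x ^+ 2) * EX mu (fun x => N u x ^+ 2) <= (L * dl) ^+ 2 * qu u.
    by apply: ler_pM => //; apply: EX_ge0 => x; exact: sqr_ge0.
  by move/le_trans; apply; rewrite le_eqVlt; apply/orP; left; apply/eqP; field.
move: h1 h2 h3; rewrite !ler_norml => /andP[a1 _] /andP[_ a2] /andP[a3 _].
rewrite YE in a1; move: a1 a2 a3.
move: (EX mu (fun x => (h x - _) * _)) (EX mu (fun x => dg x * _)) (qu u) (150 * Gam2 * D r) X ((L * dl) ^+ 2) => *.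
lra.
Qed.

Let w x := u' x - u x.
Let sw : smC w. Proof. exact: smCB. Qed.
Let W := grad2 mu w.

(** m w + N w is the increment of Pi F up to approximation errors. Tested against w, this increment
    is minus the time integral of <F, v . grad w> by [weak_pos], and [pair_v] bounds it by D and W.
    Young's inequality absorbs half of W and all of m |w|^2. *)
Lemma grad_incr : W <= dl * I + 2 * e / m.
Proof.
have cw := sw.2; have bw := CC_bddm cw.
have iw2 := bsq bw.
have hE x : m * w x + N w x = h' x - h x.
  have R4 (p q r s : R) : p - q + (r - s) = p + r - (q + s) by ring.
  by rewrite /h /h' /w NopB// mulrBr R4.
have g1 := (@EX_Pi_mul R d mu 0 _ _ isT (domF mF FC dl) bw).
have g2 := (@EX_Pi_mul R d mu 0 _ _ isT (domF mF FC 0) bw).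
have dvw := dom_vgrad sw.
have wp := weak_pos U2 gU sF cw (fun i => smC_pd i sw) (fun i => (smC_partial i sw).2) (ltW dl0).
have b1 := bhg dl su'; have b2 := bhg 0 su.
pose de x := (h' x - Pi (F dl) x) - (h x - Pi (F 0) x).
have bde : bddm de.
  have [m1 [K1 [K10 k1]]] := b1; have [m2 [K2 [K20 k2]]] := b2.
  split; first exact: measurable_funB.
  exists (K1 + K2); split; first exact: addr_ge0.
  by move=> x; rewrite (le_trans (ler_normB _ _))//; exact: (lerD (k1 x) (k2 x)).
have igw r : itg mu (fun x => w x * Pi (F r) x).
  by apply: itgM => //; apply: bddm_itg; exact: (bddm_Pi mu sF r).
have idw : itg mu (fun x => w x * de x) by apply: itgM => //; exact: bddm_itg.
have key : m * EX mu (fun x => w x ^+ 2) + W =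
   - ri (fun r => EX muh (fun z => F r z * vgrad w z)) 0 dl + EX mu (fun x => w x * de x).
  rewrite -(EX_hw gU U2 m sw).
  have -> : EX mu (fun x => (m * w x + N w x) * w x) = EX mu (fun x => w x * Pi (F dl) x) - EX mu (fun x => w x * Pi (F 0) x) + EX mu (fun x => w x * de x).
    rewrite -EXB// -EXD//; last exact: itgB.
    by apply: EX_eq => x; rewrite hE /de; ring.
  congr (_ + _); rewrite -g1 -g2.
  rewrite (_ : EX muh (fun z => w z.1 * F dl z) = EX muh (fun z => F dl z * w z.1)); last by apply: EX_eq => z; rewrite mulrC.
  rewrite (_ : EX muh (fun z => w z.1 * F 0 z) = EX muh (fun z => F 0 z * w z.1)); last by apply: EX_eq => z; rewrite mulrC.
  by rewrite wp; set A := EX _ _; rewrite addrAC subrr add0r.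
have lv : lbm (fun r => EX muh (fun z => F r z * vgrad w z)).
  by apply: (lbm_EX_mul mu sF); exact: dom_le dvw.
have W0 : 0 <= W by exact: grad2_ge0.
have h1 : `|ri (fun r => EX muh (fun z => F r z * vgrad w z)) 0 dl| <= dl / 2 * I + W / 2.
  apply: le_trans (ri_abs _ _ lv) _.
  have l1 : lbm (fun r => dl / 2 * D r) by apply: lbmM; [exact: lbm_cst|exact: lbm_D].
  apply: (@le_trans _ _ (ri (fun r => dl / 2 * D r + W / (2 * dl)) 0 dl)).
    apply: ri_le; [exact: lbm_abs|exact: (lbmD l1 (lbm_cst _))|].
    move=> r _; have D0 := Dsq_ge0 mu sF r.
    apply: abs_le_of_sqr; [by rewrite mulr_ge0// divr_ge0// ltW|by rewrite divr_ge0// mulr_ge0// ltW|].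
    apply: le_trans (pair_v mu sw sF r) _.
    by rewrite le_eqVlt; apply/orP; left; apply/eqP; rewrite -/W; field; rewrite gt_eqF.
  rewrite (riD _ _ l1 (lbm_cst _)) (riZ _ _ _ lbm_D) (ri_cst _ (ltW dl0)) subr0 lerD2l.
  by rewrite le_eqVlt; apply/orP; left; apply/eqP; field; rewrite gt_eqF.
have de2 : EX mu (fun x => de x ^+ 2) <= 4 * e.
  apply: (@le_trans _ _ (2 * EX mu (fun x => (h' x - Pi (F dl) x) ^+ 2) + 2 * EX mu (fun x => (h x - Pi (F 0) x) ^+ 2))).
    rewrite -!EXZ; [|exact: bsq|exact: bsq]; rewrite -EXD; [|by apply: itgZ; exact: bsq|by apply: itgZ; exact: bsq].
    apply: EX_le; [exact: bsq|by apply: itgD; apply: itgZ; exact: bsq|].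
    by move=> x; exact: sqrB_le2.
  rewrite (_ : 4 * e = 2 * e + 2 * e); last by ring.
  exact: lerD (ler_wpM2l (ler0n _ 2) hu') (ler_wpM2l (ler0n _ 2) hu).
have h2 : `|EX mu (fun x => w x * de x)| <= m * EX mu (fun x => w x ^+ 2) + e / m.
  have w20 : 0 <= EX mu (fun x => w x ^+ 2) by apply: EX_ge0 => x; exact: sqr_ge0.
  apply: abs_le_of_sqr; [by rewrite mulr_ge0// ltW|by rewrite divr_ge0// ltW|].
  apply: le_trans (EX_CS bw.1 bde.1 iw2 (bsq bde)) _.
  apply: le_trans (ler_wpM2l w20 de2) _.
  by rewrite le_eqVlt; apply/orP; left; apply/eqP; field; rewrite gt_eqF.
move: h1 h2; rewrite !ler_norml => /andP[a1 a2] /andP[a3 a4].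
rewrite (mulrAC dl) in a1; rewrite -(mulrA 2); move: key a1 a4.
move: (ri _ 0 dl) (EX mu (fun x => w x * _)) (m * EX mu _) W (dl * I) (e / m) => *.
lra.
Qed.

(** The increment is split into the motion of F with u frozen, treated by [vel_rate], and the motion
    of the test function, <F_dl, v . grad w>. The latter is at most dl D(dl) / 2 + W / (2 dl), which
    [Dd_int] and [grad_incr] turn into 3/2 of the integral of D plus errors. *)
Lemma step_le :
  dl * (qu u / 2 - 2 * e - 2 * (L * dl) ^+ 2) - (150 * Gam2 + 3 / 2) * I - 4 * L ^+ 2 * dl ^+ 3 - e / (m * dl) <=
  EX muh (fun z => F dl z * vgrad u' z) - EX muh (fun z => F 0 z * vgrad u z).
Proof.
have dvu := dom_vgrad su; have dvu' := dom_vgrad su'; have dvw := dom_vgrad sw.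
have dF := domF mF FC dl.
have vE z : vgrad u' z = vgrad u z + vgrad w z.
  rewrite /vgrad -big_split/=; apply: eq_bigr => i _.
  by rewrite /w partialB//; ring.
have -> : EX muh (fun z => F dl z * vgrad u' z) = EX muh (fun z => F dl z * vgrad u z) + EX muh (fun z => F dl z * vgrad w z).
  rewrite -EXD; [|by apply: (@dom_itg _ _ _ 1) => //; exact: (domM dF dvu)|by apply: (@dom_itg _ _ _ 1) => //; exact: (domM dF dvw)].
  by apply: EX_eq => z; rewrite vE mulrDr.
rewrite (weak_vel U2 gU su sF (ltW dl0)).
have lM : lbm (fun r => EX muh (fun z => F r z * Mop U gamma u z)).
  by apply: (lbm_EX_mul mu sF); exact: dom_le (dom_Mop gamma U2 su).
have l1 : lbm (fun r => 150 * Gam2 * D r) by apply: lbmM; [exact: lbm_cst|exact: lbm_D].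
have h1 : dl * (qu u / 2 - 2 * e - 2 * (L * dl) ^+ 2) - 150 * Gam2 * I <= ri (fun r => EX muh (fun z => F r z * Mop U gamma u z)) 0 dl.
  have := @ri_le R (fun r => (qu u / 2 - 2 * e - 2 * (L * dl) ^+ 2) - 150 * Gam2 * D r) _ 0 dl (lbmD (lbm_cst _) (lbmN l1)) lM vel_rate.
  by rewrite (riB _ _ (lbm_cst _) l1) (riZ _ _ _ lbm_D) (ri_cst _ (ltW dl0)) subr0 mulrC.
have h2 : `|EX muh (fun z => F dl z * vgrad w z)| <= dl / 2 * D dl + W / (2 * dl).
  have D0 := Dsq_ge0 mu sF dl; have W0 : 0 <= W by exact: grad2_ge0.
  apply: abs_le_of_sqr; [by rewrite mulr_ge0// divr_ge0// ltW|by rewrite divr_ge0// mulr_ge0// ltW|].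
  apply: le_trans (pair_v mu sw sF dl) _.
  by rewrite le_eqVlt; apply/orP; left; apply/eqP; rewrite -/W; field; rewrite gt_eqF.
have h3 : W / (2 * dl) <= I / 2 + e / (m * dl).
  rewrite ler_pdivrMr ?mulr_gt0//; apply: le_trans grad_incr _.
  by rewrite le_eqVlt; apply/orP; left; apply/eqP; field; rewrite !gt_eqF.
have h4 := Dd_int.
move: h2; rewrite ler_norml => /andP[h2 _].
rewrite (_ : dl / 2 * D dl = (dl * D dl) / 2) in h2; last by ring.
have A : (150 * Gam2 + 3 / 2) * I = 150 * Gam2 * I + 3 / 2 * I by ring.
rewrite A; move: h1 h2 h3 h4.
move: (ri (fun r => EX _ _) 0 dl) (EX muh (fun z => F dl z * _)) (EX muh (fun z => F 0 z * _)) (150 * Gam2 * I) (dl * D dl) (W / (2 * dl)) (e / (m * dl))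
  (dl * (qu u / 2 - 2 * e - 2 * (L * dl) ^+ 2)) I => *.
lra.
Qed.

(** F_0 has mean zero, so the mean of h is an approximation error and [EX_h_le] gives |h|^2 <= 3 q +
    e; moreover |Pi F_0|^2 <= 2 |h|^2 + 2 e. Hence the factor 6. *)
Lemma q_lower : EX muh (F 0) = 0 -> nrmPi mu F 0 / 6 - e <= qu u.
Proof.
move=> mean0; have be := bhg 0 su; have bg := bddm_Pi mu sF 0.
have hle := EX_h_le gU U2 m0 pc su; rewrite (EX_hN gU U2 m su) -/(qu u) in hle.
have eh : EX mu h = EX mu (fun x => h x - Pi (F 0) x).
  rewrite EXB; [|exact: (bddm_itg mu (bh su))|exact: (bddm_itg mu bg)].
  by rewrite -(EX_Pi mu (isT : (0 <= 2)%N) (domF mF FC 0)) mean0 subr0.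
have e1 : EX mu h ^+ 2 <= e.
  rewrite eh; apply: le_trans hu.
  exact: EX_jensen (bddm_itg mu be) (bsq be).
have g2 : nrmPi mu F 0 <= 2 * EX mu (fun x => h x ^+ 2) + 2 * e.
  apply: (@le_trans _ _ (2 * EX mu (fun x => h x ^+ 2) + 2 * EX mu (fun x => (h x - Pi (F 0) x) ^+ 2))); last by exact: lerD (lexx _) (ler_wpM2l (ler0n _ 2) hu).
  rewrite -!EXZ; [|exact: bsq|exact: (bsq (bh su))]; rewrite -EXD; [|by apply: itgZ; exact: (bsq (bh su))|by apply: itgZ; exact: bsq].
  apply: EX_le; [exact: (bddm_itg mu (bddm_Pi2 mu sF 0))|by apply: itgD; apply: itgZ; [exact: (bsq (bh su))|exact: bsq]|].
  by move=> x; set g := Pi _ _; have := sqr_ge0 (2 * h x - g); nra.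
have hle' : EX mu (fun x => h x ^+ 2) <= 3 * qu u + EX mu h ^+ 2 := hle.
move: hle' e1 g2 e0; move: (EX mu (fun x => h x ^+ 2)) (qu u) (EX mu h ^+ 2) (nrmPi _ _ _) => *; lra.
Qed.

(** From <h, u> = m |u|^2 + |grad u|^2 follows |grad u|^2 <= |h|^2 / (4 m), and 1/m = T^2. The
    parameter lm stays free so that the multiple of |F|^2 can be made small at the expense of D. *)
Lemma B_bound T lm : 0 < T -> T ^+ 2 * m = 1 -> 0 < lm ->
  `|EX muh (fun z => F 0 z * vgrad u z)| <= T / 2 * (D 0 / lm + lm * (nrm mu F 0 + e)).
Proof.
move=> T0 Tm lm0; have be := bhg 0 su; have bg := bddm_Pi mu sF 0; have D0 := Dsq_ge0 mu sF 0.
have cu := su.2; have bu := CC_bddm cu.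
have h2 : EX mu (fun x => h x ^+ 2) <= 2 * nrmPi mu F 0 + 2 * e.
  apply: (@le_trans _ _ (2 * nrmPi mu F 0 + 2 * EX mu (fun x => (h x - Pi (F 0) x) ^+ 2))); last by exact: lerD (lexx _) (ler_wpM2l (ler0n _ 2) hu).
  rewrite /nrmPi -!EXZ; [|exact: bsq|exact: (bddm_itg mu (bddm_Pi2 mu sF 0))]; rewrite -EXD; [|by apply: itgZ; exact: (bddm_itg mu (bddm_Pi2 mu sF 0))|by apply: itgZ; exact: bsq].
  apply: EX_le; [exact: (bsq (bh su))|by apply: itgD; apply: itgZ; [exact: (bddm_itg mu (bddm_Pi2 mu sF 0))|exact: bsq]|].
  by move=> x; set g := Pi _ _; have := sqr_ge0 (h x - 2 * g); nra.
have hw := EX_hw gU U2 m su.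
have u20 : 0 <= EX mu (fun x => u x ^+ 2) by apply: EX_ge0 => x; exact: sqr_ge0.
have h3 : `|EX mu (fun x => h x * u x)| <= EX mu (fun x => h x ^+ 2) / (4 * m) + m * EX mu (fun x => u x ^+ 2).
  apply: abs_le_of_sqr; [|by rewrite mulr_ge0// ltW|].
    by rewrite divr_ge0 ?EX_ge0// => [x|]; [exact: sqr_ge0|rewrite mulr_ge0// ltW].
  apply: le_trans (EX_CS (bh su).1 bu.1 (bsq (bh su)) (bsq bu)) _.
  by rewrite le_eqVlt; apply/orP; left; apply/eqP; field; rewrite gt_eqF.
rewrite hw in h3.
have G : grad2 mu u <= (nrm mu F 0 + e) / (2 * m).
  have d1 : nrmPi mu F 0 <= nrm mu F 0 by move: D0; rewrite /Dsq subr_ge0.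
  have h4 : EX mu (fun x => h x ^+ 2) / (4 * m) <= (nrm mu F 0 + e) / (2 * m).
    rewrite ler_pdivrMr ?mulr_gt0//; apply: le_trans h2 _.
    rewrite (_ : _ / _ * _ = 2 * (nrm mu F 0 + e)); last by field; rewrite gt_eqF.
    by rewrite mulrDr lerD2r ler_wpM2l.
  move: h3; rewrite ler_norml => /andP[_]; move: h4.
  move: (grad2 _ _) (m * EX _ _) (EX mu _ / _) ((nrm _ _ _ + e) / _) => *; lra.
have P0 : 0 <= nrm mu F 0 + e by rewrite addr_ge0// EX_ge0// => z; exact: sqr_ge0.
rewrite mulrDr; apply: abs_le_of_sqr.
- by rewrite mulr_ge0// divr_ge0// ltW.
- by rewrite mulr_ge0 ?divr_ge0 ?mulr_ge0// ltW.
apply: le_trans (pair_v mu su sF 0) _; apply: le_trans (ler_wpM2l D0 G) _.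
have im : m^-1 = T ^+ 2 by rewrite -[LHS]mul1r -Tm mulfK// gt_eqF.
have -> : (nrm mu F 0 + e) / (2 * m) = T ^+ 2 * (nrm mu F 0 + e) / 2 by rewrite -im; field; rewrite gt_eqF.
rewrite (_ : 4 * (_ * (_ * (_ * _))) = T ^+ 2 * (D 0 * (nrm mu F 0 + e))); last by field; rewrite gt_eqF.
rewrite (_ : D 0 * (T ^+ 2 * _ / 2) = T ^+ 2 * (D 0 * (nrm mu F 0 + e)) / 2); last by field.
have : 0 <= T ^+ 2 * (D 0 * (nrm mu F 0 + e)) by apply: mulr_ge0; [exact: sqr_ge0|exact: mulr_ge0].
by move: (T ^+ 2 * _) => y; lra.
Qed.

End step.

(** * Decay over one period *)

Lemma sum_parabola (R : realFieldType) (N : R) k :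
  \sum_(i < k) (i.+1%:R * (N - i.+1%:R)) =
  N * k%:R * (k%:R + 1) / 2 - k%:R * (k%:R + 1) * (2 * k%:R + 1) / 6 :> R.
Proof.
elim: k => [|k IH]; first by rewrite big_ord0; field.
by rewrite big_ord_recr/= IH -natr1; field.
Qed.

Lemma grid_arith (R : realFieldType) (x T c j r p u : R) : x * (c * j + r) <= T * (c * j + r) ->
  p / 12 * (u * x) - c * T * j - T * r <= x * (u * (p / 12) - c * j - r).
Proof. by move=> *; lra. Qed.

(* Summation by parts against the weights T (i / n) (1 - i / n), which vanish at
   both ends, so that no boundary value of B survives. *)
Lemma grid_sum (R : realFieldType) (T phi c1 rr S : R) (n : nat) (B J X : nat -> R) : 0 < T -> (1 < n)%N ->
  0 <= phi -> 0 <= c1 -> 0 <= rr -> (forall i, 0 <= J i) ->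
  (forall i, (i < n)%N -> T / n%:R * (phi / 12) - c1 * J i - rr <= B i.+1 - B i) ->
  (forall i, (i < n)%N -> `|B i| <= X i) ->
  \sum_(i < n) T / n%:R * X i <= S ->
  phi * T ^+ 2 / 96 <= c1 * T * \sum_(i < n) J i + T * n%:R * rr + S.
Proof.
move=> T0 n1 p0 c0 r0 J0 h1 h2 h3.
have N2 : 2 <= n%:R :> R by rewrite ler_nat.
have N0 : 0 < n%:R :> R by apply: lt_le_trans N2.
pose N : R := n%:R; rewrite -/N in N2 N0 h1 h3 *.
pose et (i : nat) : R := T * (i%:R * (N - i%:R)) / N ^+ 2.
have N20 : 0 < N ^+ 2 by rewrite exprn_gt0.
have iN (i : nat) : (i <= n)%N -> 0 <= (i%:R : R) <= N by move=> le; rewrite ler0n /= ler_nat.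
have et0 i : (i <= n)%N -> 0 <= et i.
  move=> le; have /andP[a1 a2] := iN i le; rewrite /et; apply: divr_ge0; last exact: ltW.
  apply: mulr_ge0; first exact: ltW.
  by apply: mulr_ge0 => //; rewrite subr_ge0.
have etT i : (i <= n)%N -> et i <= T.
  move=> le; have /andP[a1 a2] := iN i le; rewrite /et ler_pdivrMr// ler_wpM2l//; first exact: ltW.
  by rewrite expr2; apply: ler_pM; rewrite ?subr_ge0// gerBl.
have etd i : (i < n)%N -> `|et i.+1 - et i| <= T / N.
  move=> li; have /andP[a1 a2] := iN i (ltnW li); have /andP[_] := iN _ li; rewrite -natr1 => a3.
  have -> : et i.+1 - et i = T / N * ((N - 2 * i%:R - 1) / N) by rewrite /et -natr1; field; rewrite gt_eqF.
  have TN : 0 <= T / N by rewrite divr_ge0// ltW.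
  rewrite normrM ger0_norm// ler_piMr// normrM (ger0_norm (_ : 0 <= N^-1)); last by rewrite invr_ge0 ltW.
  by rewrite ler_pdivrMr// mul1r ler_norml; apply/andP; split; lra.
have tele : \sum_(i < n) et i.+1 * (B i.+1 - B i) = - \sum_(i < n) (et i.+1 - et i) * B i.
  apply/eqP; rewrite -subr_eq0 opprK -big_split/=.
  rewrite (eq_bigr (fun i : 'I_n => et i.+1 * B i.+1 - et i * B i)); last by move=> i _; ring.
  rewrite -(big_mkord xpredT (fun i => et i.+1 * B i.+1 - et i * B i)) (telescope_sumr (fun i => et i * B i))//.
  by rewrite /et -/N subrr mulr0 mulr0 !mul0r mulr0 !mul0r subrr.
have up : - \sum_(i < n) (et i.+1 - et i) * B i <= S.
  apply: le_trans h3; rewrite -sumrN; apply: ler_sum => i _.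
  apply: le_trans (ler_norm _) _; rewrite normrN normrM.
  by apply: ler_pM; rewrite ?normr_ge0// ?etd// h2.
have lo : phi / 12 * (T / N * \sum_(i < n) et i.+1) - c1 * T * \sum_(i < n) J i - T * N * rr <=
   \sum_(i < n) et i.+1 * (B i.+1 - B i).
  have -> : T * N * rr = \sum_(i < n) T * rr.
    by rewrite sumr_const card_ord -mulr_natr -/N; ring.
  rewrite !mulr_sumr -!sumrB; apply: ler_sum => i _.
  have e0 := et0 i.+1 (ltn_ord i); have eT := etT i.+1 (ltn_ord i).
  apply: le_trans (ler_wpM2l e0 (h1 i (ltn_ord i))).
  have : et i.+1 * (c1 * J i + rr) <= T * (c1 * J i + rr).
    by rewrite ler_wpM2r// addr_ge0// mulr_ge0.
  exact: grid_arith.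
(* The sum of i (n - i) is n (n^2 - 1) / 6, and 1 - 1/n^2 >= 3/4 because n >= 2. *)
have sumE : T ^+ 2 / 8 <= T / N * \sum_(i < n) et i.+1.
  rewrite /et -mulr_suml -mulr_sumr sum_parabola -/N.
  rewrite (_ : T / N * _ = T ^+ 2 * (1 - N ^- 2) / 6); last by field; rewrite gt_eqF.
  have N4 : N ^- 2 <= 4^-1.
    rewrite lef_pV2 ?posrE//; have : 2 * 2 <= N ^+ 2 by rewrite expr2 ler_pM.
    by lra.
  by have := ler_wpM2l (sqr_ge0 T) N4; move: (T ^+ 2) (N ^- 2) => *; lra.
have := ler_wpM2l (_ : 0 <= phi / 12) sumE; rewrite divr_ge0// => /(_ isT).
rewrite tele in lo; move: lo up; rewrite (_ : phi / 12 * (T ^+ 2 / 8) = phi * T ^+ 2 / 96); last by field.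
set Z := - \sum_(_ < _) _.
by move: (phi / 12 * _) (c1 * T * _) (T * N * rr) Z => *; lra.
Qed.

Lemma le_of_invn (R : archiRealFieldType) (x y c : R) :
  (forall n, (1 < n)%N -> x <= y + c / n%:R) -> x <= y.
Proof.
move=> h; rewrite leNgt; apply/negP => yx.
have xy0 : 0 < x - y by rewrite subr_gt0.
have [n0 n0P] : exists n : nat, `|c| / (x - y) < n%:R.
  by exists (Num.bound (`|c| / (x - y))); apply: archi_boundP; rewrite divr_ge0// ltW.
have n2 : `|c| / (x - y) < n0.+2%:R by apply: lt_trans n0P _; rewrite ltr_nat ltnS leqnSn.
have := h n0.+2 isT; have N0 : 0 < n0.+2%:R :> R by rewrite ltr0n.
move: n2; rewrite ltr_pdivrMr// => n2.
rewrite -lerBlDl ler_pdivlMr// mulrC.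
by have := ler_norm c; move: n2; move: (_ * (x - y)) => *; lra.
Qed.

(** 152 exceeds 150 + 3/2 + 1/6, where 1/6 is the price of replacing |Pi F|^2 by |F|^2 - D; G >= 1
    enters as J <= G J. *)
Lemma step_arith (R : realFieldType) (dl pT Ds e q L J G T : R) :
  dl * ((pT - Ds) / 6 - e) <= dl * q -> dl * Ds <= 2 * J + 8 * L ^+ 2 * dl ^+ 3 -> 0 <= J -> J <= G * J ->
  dl * (pT / 12) - 152 * G * J - (dl * (5 / 2 * e + 2 * L ^+ 2 * dl ^+ 2) + 14 / 3 * L ^+ 2 * dl ^+ 3 + T ^+ 2 * dl ^+ 2) <=
  dl * (q / 2 - 2 * e - 2 * (L * dl) ^+ 2) - (150 * G + 3 / 2) * J - 4 * L ^+ 2 * dl ^+ 3 - T ^+ 2 * dl ^+ 2.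
Proof. by move=> *; lra. Qed.

(** Every discretisation error is brought to the form constant / N. The factor 248 = 152 + 96 adds
    the step estimate and the boundary term, where D has weight 96. *)
Lemma final_arith (R : realFieldType) (T N p0 G L I : R) : let dl := T / N in let e := dl ^+ 3 in
  0 < T -> 1 <= N -> 0 <= I -> I <= G * I ->
  152 * G * T * I + T * N * (dl * (5 / 2 * e + 2 * L ^+ 2 * dl ^+ 2) + 14 / 3 * L ^+ 2 * dl ^+ 3 + T ^+ 2 * dl ^+ 2) +
  T / 2 * (96 * (2 * I + 8 * L ^+ 2 * dl ^+ 2 * T) + T * (p0 + e) / 96) <=
  p0 * T ^+ 2 / 192 + 248 * G * T * I +
  (T ^+ 2 * (5 / 2 * T ^+ 2 + 14 * L ^+ 2 * T + T ^+ 2) * T + T / 2 * (96 * (8 * L ^+ 2 * T ^+ 2) + T ^+ 3 / 96) * T) / N.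
Proof.
move=> dl e T0 N1 I0 GI.
have N0 : 0 < N by apply: lt_le_trans N1.
have dl0 : 0 <= dl by rewrite divr_ge0// ltW.
have dT : dl <= T by rewrite ler_pdivrMr// ler_peMr// ltW.
have TN : T * N * dl = T ^+ 2 by rewrite /dl; field; rewrite gt_eqF.
have TI : T * I <= T * (G * I) by rewrite ler_wpM2l// ltW.
have d2 : dl ^+ 2 <= T * dl by rewrite expr2 ler_wpM2r.
have d2' : dl ^+ 2 <= T ^+ 2 by rewrite ler_sqr ?nnegrE// ltW.
have d3 : dl ^+ 3 <= T ^+ 2 * dl by rewrite exprSr ler_wpM2r.
have L2 := sqr_ge0 L; have T2 := sqr_ge0 T.
have TL : 0 <= T ^+ 2 * L ^+ 2 by exact: mulr_ge0.
have -> : T * N * (dl * (5 / 2 * e + 2 * L ^+ 2 * dl ^+ 2) + 14 / 3 * L ^+ 2 * dl ^+ 3 + T ^+ 2 * dl ^+ 2) =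
  5 / 2 * (T ^+ 2 * dl ^+ 3) + 20 / 3 * (T ^+ 2 * L ^+ 2 * dl ^+ 2) + T ^+ 2 * T ^+ 2 * dl.
  by rewrite -TN /e; field.
have -> x y : (x * T + y * T) / N = x * dl + y * dl by rewrite /dl; field; rewrite gt_eqF.
have h1 : T ^+ 2 * dl ^+ 3 <= T ^+ 2 * (T ^+ 2 * dl) by rewrite ler_wpM2l.
have h2 : T ^+ 2 * L ^+ 2 * dl ^+ 2 <= T ^+ 2 * L ^+ 2 * (T * dl) by rewrite ler_wpM2l.
have h3 : 0 <= T ^+ 2 * L ^+ 2 * (T * dl) by apply: mulr_ge0 => //; apply: mulr_ge0 => //; exact: ltW.
rewrite /e; move: TI h1 h2 h3 => *; lra.
Qed.

Section grid.
Context (R : realType) (d : nat) (U : 'rV[R]_d -> R) (mu : probability 'rV[R]_d R) (gamma : R).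
Hypothesis U2 : is_C 2 U.
Hypothesis gU : gibbs_measure U mu.
Notation V := 'rV[R]_d.
Notation E := (V * V)%type.
Notation kappa := (@gaussm R d).
Notation muh := (prodp mu kappa).
Notation dU := (fun i => partial i U).
Notation N := (Nop dU).
Variables (m K a b : R).
Hypothesis m0 : 0 < m.
Hypothesis pc : poincare mu m^-1.
Hypothesis ds : discrete_spectrum mu (langevin_closure U mu).
Hypothesis K0 : 0 <= K.
Hypothesis hK : forall x v : V, - (K * m) * dotv v v <= (v *m hess U x *m v^T) ord0 ord0.
Hypothesis a01 : 0 <= a < 1.
Hypothesis b0 : 0 <= b.
Hypothesis hab : forall x, laplacian U x <= a * dotv (grad U x) (grad U x) + b.
Hypothesis g0 : 0 < gamma.
Notation G2 := (Gam2 gamma m K a b).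

Section lipschitz.
Variables (C L : R) (F : R -> E -> R).
Hypothesis sF : sol U gamma C F.
Hypothesis L0 : 0 <= L.
Hypothesis lipF : forall s t z, 0 <= s -> s <= t -> `|F t z - F s z| <= L * (t - s).
Hypothesis mean0 : EX muh (F 0) = 0.
Variable T : R.
Hypothesis T0 : 0 < T.
Hypothesis Tm : T ^+ 2 * m = 1.
Notation D := (Dsq mu F).

Lemma nrm_noninc s t : 0 <= s -> s <= t -> nrm mu F t <= nrm mu F s.
Proof.
move=> s0 st; have sF' := sol_shift U2 sF s0.
have h := energy U2 gU sF' (ltW g0) (_ : 0 <= t - s); rewrite subr_ge0 st in h.
have := h isT; rewrite /nrm addr0 addrC subrK => /le_trans; apply.
rewrite gerBl mulr_ge0//; first by rewrite mulr_ge0// ltW.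
have lD := lbm_D mu sF'.
have := ri_le (s := 0) (t := t - s) (lbm_cst 0) lD (fun r _ => Dsq_ge0 mu sF' r).
by rewrite ri_cst ?subr_ge0// mul0r.
Qed.

(** [grid_sum] for the pairings at n + 1 equidistant times, with an approximate solution chosen
    separately at each time; neighbouring ones are compared only through the equations they nearly
    solve. The Lipschitz constant L enters only the errors of order 1/n and disappears in the
    limit. *)
Lemma grid_bound n : (1 < n)%N -> nrm mu F T * T ^+ 2 / 96 <=
  nrm mu F 0 * T ^+ 2 / 192 + 248 * G2 * T * ri D 0 T +
  (T ^+ 2 * (5 / 2 * T ^+ 2 + 14 * L ^+ 2 * T + T ^+ 2) * T + T / 2 * (96 * (8 * L ^+ 2 * T ^+ 2) + T ^+ 3 / 96) * T) / n%:R.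
Proof.
(* The tolerance e = dl^3 is chosen so that the error e / (m dl) of one step is T^2 dl^2, which
   stays of order 1/n after summation over the n steps. *)
move=> n1; have N0 : 0 < n%:R :> R by rewrite ltr0n; apply: ltnW.
pose dl := T / n%:R; pose s (i : nat) := dl * i%:R; pose e := dl ^+ 3.
have dl0 : 0 < dl by rewrite divr_gt0.
have e0 : 0 < e by rewrite exprn_gt0.
have dT : dl <= T by rewrite ler_pdivrMr// ler_peMr ?(ltW T0)// ler1n ltnW.
have sn : s n = T by rewrite /s /dl divfK// gt_eqF.
have s0 i : 0 <= s i by rewrite mulr_ge0// ltW.
have sS i : s i.+1 = s i + dl by rewrite /s -natr1 mulrDr mulr1.
have /(_ _)/cid-/all_sig[u hu] : forall i, exists u, smC u /\ EX mu (fun x => (m * u x + N u x - Pi (F (s i)) x) ^+ 2) <= e.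
  move=> i; have [mg _] := bddm_Pi mu sF (s i).
  apply: resolvent_approx => //; exact: (bddm_itg mu (bddm_Pi2 mu sF (s i))).
pose B i := EX muh (fun z => F (s i) z * vgrad (u i) z).
pose J i := ri D (s i) (s i.+1).
have lD := lbm_D mu sF.
have Fn i : (fun t => F (s i + t)) 0 = F (s i) by rewrite addr0.
pose Fi i t := F (s i + t).
have sFi i : sol U gamma C (Fi i) := sol_shift U2 sF (s0 i).
have lip i p q z : 0 <= p -> p <= q -> `|Fi i q z - Fi i p z| <= L * (q - p).
  move=> p0 pq; apply: le_trans (lipF _ _ _) _; rewrite ?addr_ge0 ?lerD2l//.
  by rewrite le_eqVlt; apply/orP; left; apply/eqP; ring.
have JE i : J i = ri (Dsq mu (Fi i)) 0 dl by rewrite /J sS (ri_shift _ (ltW dl0) lD).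
have J0 i : 0 <= J i.
  rewrite JE; have := ri_le (s := 0) (t := dl) (lbm_cst 0) (lbm_D mu (sFi i)) (fun r _ => Dsq_ge0 mu (sFi i) r).
  by rewrite (ri_cst _ (ltW dl0)) mul0r.
have Jsum k : \sum_(i < k) J i = ri D 0 (s k).
  elim: k => [|k IH]; first by rewrite big_ord0 /s mulr0 ri_pt.
  by rewrite big_ord_recr/= IH -ri_cat// sS lerDl ltW.
have D0 i : dl * D (s i) <= 2 * J i + 8 * L ^+ 2 * dl ^+ 3.
  rewrite JE; have := D0_int mu (sFi i) L0 (lip i) dl0.
  by rewrite /Dsq /nrm /nrmPi /Fi addr0.
have mean i : EX muh (Fi i 0) = 0.
  by rewrite /Fi addr0 (mean_conserved U2 gU sF)//.
have phimon i : (i <= n)%N -> nrm mu F T <= nrm mu F (s i) /\ nrm mu F (s i) <= nrm mu F 0.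
  by move=> le; split; apply: nrm_noninc => //; rewrite -sn /s ler_pM2l// ler_nat.
have G1 := Gam2_ge1 gamma m0 K0 a01 b0.
have phi0 t : 0 <= nrm mu F t by apply: EX_ge0 => z; exact: sqr_ge0.
pose rr := dl * (5 / 2 * e + 2 * L ^+ 2 * dl ^+ 2) + 14 / 3 * L ^+ 2 * dl ^+ 3 + T ^+ 2 * dl ^+ 2.
have mi : m^-1 = T ^+ 2 by rewrite -[LHS]mul1r -Tm mulfK// gt_eqF.
have hi i : EX mu (fun x => (m * u i x + N (u i) x - Pi (Fi i 0) x) ^+ 2) <= e by rewrite /Fi addr0; exact: (hu i).2.
have step i : (i < n)%N -> T / n%:R * (nrm mu F T / 12) - (152 * G2) * J i - rr <= B i.+1 - B i.
  move=> li.
  have hi' : EX mu (fun x => (m * u i.+1 x + N (u i.+1) x - Pi (Fi i dl) x) ^+ 2) <= e.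
    by rewrite /Fi -sS; exact: (hu i.+1).2.
  have := step_le U2 gU m0 K0 hK a01 b0 hab (sFi i) L0 (lip i) dl0 (ltW e0) (hu i).1 (hu i.+1).1 (hi i) hi'.
  have := q_lower U2 gU m0 pc (sFi i) (ltW e0) (hu i).1 (hi i) (mean i).
  rewrite -JE (_ : EX muh (fun z => Fi i dl z * _) = B i.+1); last by rewrite /Fi -sS.
  rewrite (_ : EX muh (fun z => Fi i 0 z * _) = B i); last by rewrite /Fi addr0.
  have -> : nrmPi mu (Fi i) 0 = nrm mu F (s i) - D (s i) by rewrite /Dsq /nrm /nrmPi /Fi addr0 opprB addrC subrK.
  have [pm _] := phimon i (ltnW li); rewrite -/dl => q1.
  have emd : e / (m * dl) = T ^+ 2 * dl ^+ 2 by rewrite invfM mi /e; field; rewrite gt_eqF.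
  rewrite emd => h; apply: le_trans h.
  have : dl * ((nrm mu F T - D (s i)) / 6 - e) <= dl * qu U mu m (u i).
    rewrite ler_wpM2l ?(ltW dl0)//; apply: le_trans q1.
    by move: pm; move: (nrm _ _ _) (nrm _ _ _) (D _) => *; lra.
  have GJ : J i <= G2 * J i by rewrite ler_peMl.
  have := D0 i; have := J0 i.
  by move=> J0' hD h; exact: step_arith h hD J0' GJ.
have bnd i : (i < n)%N -> `|B i| <= T / 2 * (96 * D (s i) + (nrm mu F 0 + e) / 96).
  (* With weight 1/96 the boundary contribution of |F_0|^2 becomes T^2 / 192, half the coefficient
     T^2 / 96 of |F_T|^2 on the left. *)
  move=> li; have lm0 : 0 < 96^-1 :> R by [].
  have := B_bound U2 gU m0 (sFi i) (ltW e0) (hu i).1 (hi i) T0 Tm lm0.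
  rewrite (_ : EX muh (fun z => Fi i 0 z * _) = B i); last by rewrite /Fi addr0.
  move/le_trans; apply; rewrite invrK.
  have -> : nrm mu (Fi i) 0 = nrm mu F (s i) by rewrite /nrm /Fi addr0.
  have -> : Dsq mu (Fi i) 0 = D (s i) by rewrite /Dsq /nrm /nrmPi /Fi addr0.
  rewrite ler_wpM2l ?divr_ge0 ?(ltW T0)// mulrC lerD2l mulrC ler_wpM2r// lerD2r.
  by have [] := phimon i (ltnW li).
have e2 : dl * n%:R = T by rewrite /dl divfK// gt_eqF.
have rr0 : 0 <= rr.
  have p3 : 0 <= dl ^+ 3 by rewrite exprn_ge0// ltW.
  rewrite /rr; apply: addr_ge0; last by apply: mulr_ge0; exact: sqr_ge0.
  apply: addr_ge0; last by apply: mulr_ge0 => //; apply: mulr_ge0 => //; exact: sqr_ge0.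
  apply: mulr_ge0; first exact: ltW.
  apply: addr_ge0; first by rewrite mulr_ge0// ltW.
  by apply: mulr_ge0; [apply: mulr_ge0 => //; exact: sqr_ge0|exact: sqr_ge0].
have SX : \sum_(i < n) dl * (T / 2 * (96 * D (s i) + (nrm mu F 0 + e) / 96)) <=
    T / 2 * (96 * (2 * ri D 0 T + 8 * L ^+ 2 * dl ^+ 2 * T) + T * (nrm mu F 0 + e) / 96).
  apply: (@le_trans _ _ (\sum_(i < n) T / 2 * (96 * (2 * J i + 8 * L ^+ 2 * dl ^+ 3) + dl * (nrm mu F 0 + e) / 96))).
    apply: ler_sum => i _; rewrite mulrCA ler_wpM2l ?divr_ge0 ?(ltW T0)//.
    by move: (D0 i); move: (D _) (J i) (nrm _ _ _) => *; lra.
  rewrite -mulr_sumr big_split/= -mulr_sumr big_split/= -mulr_sumr Jsum sn !sumr_const card_ord.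
  rewrite -[_ *+ n]mulr_natr -[(dl * _ / _) *+ n]mulr_natr le_eqVlt; apply/orP; left; apply/eqP.
  have -> : 8 * L ^+ 2 * dl ^+ 3 * n%:R = 8 * L ^+ 2 * dl ^+ 2 * T by rewrite -e2; ring.
  by rewrite (_ : dl * _ / 96 * n%:R = T * (nrm mu F 0 + e) / 96)// -e2; field.
have G0 : 0 <= 152 * G2 by rewrite mulr_ge0// (le_trans ler01 G1).
have I0 : 0 <= ri D 0 T by rewrite -sn -Jsum sumr_ge0.
have := grid_sum T0 n1 (phi0 T) G0 rr0 J0 step bnd SX; rewrite Jsum sn => h; apply: le_trans h _.
have fa := @final_arith R T n%:R (nrm mu F 0) G2 L (ri D 0 T) T0 _ I0.
by apply: fa; rewrite ?ler1n ?(ltnW n1)// ler_peMl.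
Qed.

(** The energy inequality bounds the integral of D by (|F_0|^2 - |F_T|^2) / (2 gamma). Inserted into
    the limit of [grid_bound], it gives a linear inequality between |F_0|^2 and |F_T|^2. *)
Lemma decay_lip : nrm mu F T <= (1 - T * (gamma / ((160 * 160) * G2))) * nrm mu F 0.
Proof.
have G1 := Gam2_ge1 gamma m0 K0 a01 b0; have G0 : 0 < G2 by apply: lt_le_trans G1.
have h : nrm mu F T * T ^+ 2 / 96 <= nrm mu F 0 * T ^+ 2 / 192 + 248 * G2 * T * ri D 0 T.
  by apply: le_of_invn => n n1; exact: grid_bound.
have en := energy U2 gU sF (ltW g0) (ltW T0); rewrite -/(Dsq mu F) in en.
(* As T^2 m = 1, [Gam2] is at least 1 + (gamma T)^2. *)
have gG : gamma * T <= G2.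
  have q : G2 = (m * (1 + K) + b) / (1 - a) ^+ 2 / m + gamma ^+ 2 * T ^+ 2.
    by rewrite /Gam2 mulrDl; congr (_ + _); rewrite -[LHS]mulr1 -Tm; field; rewrite gt_eqF.
  have q1 := Gam2_ge1 0 m0 K0 a01 b0; rewrite /Gam2 expr0n/= addr0 in q1.
  have : 0 <= (gamma * T - 1) ^+ 2 by exact: sqr_ge0.
  rewrite q -exprMn; move: (gamma * T) q1 => x; nra.
have p0 : 0 <= nrm mu F 0 by apply: EX_ge0 => z; exact: sqr_ge0.
have p01 := nrm_noninc (lexx 0) (ltW T0).
have I1 : 2 * gamma * ri D 0 T <= nrm mu F 0 - nrm mu F T by rewrite lerBrDl -lerBrDr.
have h1 : gamma * T * (nrm mu F 0) <= 2 * (gamma * T + (93 * 128) * G2) * (nrm mu F 0 - nrm mu F T).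
  have h2 := ler_wpM2l (_ : 0 <= 192 * gamma / T) h; rewrite divr_ge0 ?mulr_ge0 ?(ltW g0) ?(ltW T0)// in h2.
  move: (h2 isT); rewrite mulrDr.
  have -> : 192 * gamma / T * (nrm mu F T * T ^+ 2 / 96) = 2 * (gamma * T * nrm mu F T) by field; rewrite gt_eqF.
  have -> : 192 * gamma / T * (nrm mu F 0 * T ^+ 2 / 192) = gamma * T * nrm mu F 0 by field; rewrite gt_eqF.
  have -> : 192 * gamma / T * (248 * G2 * T * ri D 0 T) = (186 * 128) * (G2 * (2 * gamma * ri D 0 T)) by field; rewrite gt_eqF.
  have := ler_wpM2l (ltW G0) I1.
  move: (G2) (gamma * T) (2 * gamma * _) (nrm mu F 0) (nrm mu F T) => *; nra.
(* 2 (1 + 93 * 128) = 23810 is at most 160 * 160, a round square. *)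
have h3 : gamma * T * nrm mu F 0 <= (160 * 160) * G2 * (nrm mu F 0 - nrm mu F T).
  apply: le_trans h1 _; rewrite ler_wpM2r ?subr_ge0//.
  by move: gG G0; move: (gamma * T) (G2) => *; lra.
have M0 : 0 < 160 * 160 * G2 by exact: mulr_gt0 (mulr_gt0 (ltr0Sn _ _) (ltr0Sn _ _)) G0.
have h4 : T * (gamma / (160 * 160 * G2)) * nrm mu F 0 <= nrm mu F 0 - nrm mu F T.
  rewrite (_ : _ * _ * _ = gamma * T * nrm mu F 0 / (160 * 160 * G2)); last by ring.
  by rewrite ler_pdivrMr// [leRHS]mulrC.
by rewrite mulrBl mul1r; move: h4; move: (T * _ * _) => *; lra.
Qed.

End lipschitz.
End grid.

(** * Exponential decay of time averages *)

Section decay.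
Context (R : realType).

(** The hypothesis is iterated over n steps of length t/n; with x = k t, (1 + x/n)^n >= exp(x -
    x^2/n), and n tends to infinity. No continuity of f is involved. *)
Lemma exp_decay (f : R -> R) (k : R) : 0 <= k -> (forall t, 0 <= t -> 0 <= f t) ->
  (forall s t, 0 <= s -> s <= t -> f t * (1 + k * (t - s)) <= f s) ->
  forall t, 0 <= t -> f t <= expR (- (k * t)) * f 0.
Proof.
move=> k0 f0 h t t0.
suff : f t * expR (k * t) <= f 0.
  by rewrite -ler_pdivlMr ?expR_gt0// expRN mulrC.
pose x := k * t; have x0 : 0 <= x by rewrite mulr_ge0.
apply: (@le_of_invn _ _ _ (f t * expR x * x ^+ 2)) => n n1.
have N0 : 0 < n%:R :> R by rewrite ltr0n ltnW.
pose y := x / n%:R; have y0 : 0 <= y by rewrite divr_ge0// ltW.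
have y1 : 0 < 1 + y by rewrite ltr_pwDl.
have iter (i : nat) : f (t / n%:R * i%:R) * (1 + y) ^+ i <= f 0.
  elim: i => [|i IH]; first by rewrite mulr0 expr0 mulr1.
  apply: le_trans IH; rewrite exprSr mulrA mulrAC ler_wpM2r ?exprn_ge0 ?(ltW y1)//.
  have tn : 0 <= t / n%:R by rewrite divr_ge0// ltW.
  have := h (t / n%:R * i%:R) (t / n%:R * i.+1%:R); rewrite !mulr_ge0// ler_wpM2l ?ler_nat// => /(_ isT isT).
  rewrite (_ : k * _ = y)//; rewrite /y /x -natr1; ring.
have := iter n; rewrite divfK ?gt_eqF// => hn.
have e1 : expR (x - x ^+ 2 / n%:R) <= (1 + y) ^+ n.
  have e2 : expR (y / (1 + y)) <= 1 + y.
    have := expR_ge1Dx (- (y / (1 + y))); rewrite expRN => e3.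
    rewrite -[leLHS]invrK -[leRHS]invrK lef_pV2 ?posrE ?invr_gt0 ?expR_gt0//.
    by apply: le_trans e3; rewrite le_eqVlt; apply/orP; left; apply/eqP; field; rewrite gt_eqF.
  have e4 := @lerXn2r R n _ _ (expR_ge0 _) (ltW y1) e2.
  apply: le_trans e4; rewrite -expRM_natr ler_expR.
  have xy : x = y * n%:R by rewrite /y divfK// gt_eqF.
  have -> : x ^+ 2 / n%:R = y ^+ 2 * n%:R by rewrite /y; field; rewrite gt_eqF.
  rewrite xy -mulrBl ler_wpM2r ?(ltW N0)// ler_pdivlMr//.
  have := exprn_ge0 3 y0; rewrite -subr_ge0 => y3; rewrite -subr_ge0 (_ : _ - _ = y ^+ 3); last by ring.
  exact: exprn_ge0.
have e5 : f t * expR (x - x ^+ 2 / n%:R) <= f 0 by apply: le_trans hn; rewrite ler_wpM2l// f0.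
have e6 : 1 - x ^+ 2 / n%:R <= expR (- (x ^+ 2 / n%:R)) by exact: expR_ge1Dx.
have p : 0 <= f t * expR x by rewrite mulr_ge0 ?expR_ge0// f0.
have := ler_wpM2l p e6; rewrite -[in leRHS](mulrA (f t)) -expRD => e7.
have := le_trans e7 e5; rewrite mulrBr mulr1 -/x -mulrA.
by rewrite lerBlDr !mulrA.
Qed.

(** Let A(t) be the integral over [t, t + T]. Cutting [s, u + T] in two ways shows that A(s) - A(u)
    is the integral over [s, u] minus the one over [s + T, u + T], hence at least T k times the
    integral over [s, u]. By monotonicity the latter is at least (u - s) phi(u), and T phi(u) >=
    A(u). This is the hypothesis of [exp_decay]. *)
Lemma average_decay (phi : R -> R) (T k : R) : 0 < T -> 0 <= k -> lbm phi ->
  (forall t, 0 <= phi t) ->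
  (forall s t, 0 <= s -> s <= t -> phi t <= phi s) ->
  (forall s t, 0 <= s -> s <= t -> ri phi (s + T) (t + T) <= (1 - T * k) * ri phi s t) ->
  forall t, 0 <= t -> ri phi t (t + T) <= expR (- (k * t)) * ri phi 0 T.
Proof.
move=> T0 k0 lp p0 mon dec t t0.
have r0 s u : s <= u -> 0 <= ri phi s u.
  by move=> su; have := ri_le (s := s) (t := u) (lbm_cst 0) lp (fun r _ => p0 r); rewrite ri_cst// mul0r.
have := @exp_decay (fun t => ri phi t (t + T)) k k0 _ _ t t0; rewrite add0r; apply.
  by move=> s s0; apply: r0; rewrite lerDl ltW.
move=> s u s0 su.
have c1 : ri phi s (s + T) + ri phi (s + T) (u + T) = ri phi s u + ri phi u (u + T).
  by rewrite -!ri_cat// ?lerD2r// ?lerDl ?(ltW T0)//; apply: le_trans su _; rewrite lerDl ltW.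
have u0 : 0 <= u by apply: le_trans su.
have h1 : ri phi u (u + T) <= T * phi u.
  apply: (@le_trans _ _ (ri (fun=> phi u) u (u + T))).
    by apply: ri_le => // [|x /andP[ux _]]; [exact: lbm_cst|exact: mon].
  by rewrite ri_cst ?lerDl ?(ltW T0)// [u + T]addrC addrK mulrC.
have h2 : (u - s) * phi u <= ri phi s u.
  apply: (@le_trans _ _ (ri (fun=> phi u) s u)); first by rewrite ri_cst// mulrC.
  by apply: ri_le => // [|x /andP[ux xu]]; [exact: lbm_cst|apply: mon => //; exact: le_trans ux].
have h3 := dec s u s0 su.
have h4 : k * (u - s) * ri phi u (u + T) <= T * k * ri phi s u.
  apply: le_trans (ler_wpM2l _ h1) _; first by rewrite mulr_ge0// subr_ge0.
  rewrite (_ : _ * (T * _) = T * k * ((u - s) * phi u)); last by ring.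
  by rewrite ler_wpM2l// mulr_ge0// ltW.
have -> : ri phi u (u + T) * (1 + k * (u - s)) = ri phi u (u + T) + k * (u - s) * ri phi u (u + T) by ring.
move: c1 h3 h4; rewrite mulrBl mul1r.
by move: (ri phi s (s + T)) (ri phi (s + T) _) (ri phi s u) (T * k * _) (ri phi u _) (k * _ * _) => *; lra.
Qed.

End decay.

Lemma measurable_comp2 d1 d2 d3 d4 (T : measurableType d1) (T1 : measurableType d2) (T2 : measurableType d3)
  (T3 : measurableType d4) (K : T1 -> T2 -> T3) (f : T -> T1) (g : T -> T2) :
  measurable_fun [set: T1 * T2] (fun p : T1 * T2 => K p.1 p.2) ->
  measurable_fun [set: T] f -> measurable_fun [set: T] g -> measurable_fun [set: T] (fun x => K (f x) (g x)).
Proof.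
move=> mK mf mg; apply: (measurableT_comp mK (f := fun p => K p.1 p.2) (g := fun x => (f x, g x))).
exact/measurable_fun_pairP.
Qed.

(** * Time windows: differentiation, measurability and exchange *)

Section averages.
Context (R : realType).
Notation mR := (measurableTypeR R).
Notation leb := (@lebesgue_measure R).

Lemma lbm_bd (f : R -> R) M : measurable_fun [set: mR] f -> (forall r, `|f r| <= M) -> lbm f.
Proof.
move=> mf fM; split => // N; exists M; split => //.
exact: le_trans (normr_ge0 _) (fM 0).
Qed.

Lemma ri_dom_cvg (f_ : nat -> R -> R) (f : R -> R) (M s t : R) : (forall n, lbm (f_ n)) -> lbm f ->
  (forall n x, s <= x <= t -> `|f_ n x| <= M) -> {ae leb, forall x, s <= x <= t -> f_ ^~ x @ \oo --> f x} ->
  (fun n => ri (f_ n) s t) @ \oo --> ri f s t.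
Proof.
move=> lf_ lf fM cf; pose D := `[s, t]%classic.
have mD : measurable (D : set mR) by exact: measurable_itv.
have [] := @dominated_convergence _ mR _ leb D mD (fun n x => (f_ n x)%:E) (fun x => (f x)%:E) (fun=> M%:E).
- by move=> n; apply/measurable_EFinP; apply: measurable_funTS; exact: (lf_ n).1.
- by apply/measurable_EFinP; apply: measurable_funTS; exact: lf.1.
- apply: (@filterS _ _ (ae_filter_ringOfSetsType leb) _ _ _ cf) => x h; rewrite /D/= in_itv/= => /h c.
  by apply: cvg_EFin; [exact: nearW|exact: c].
- exact: (lbm_integrable s t (lbm_cst M)).
- by apply: aeW => x n; rewrite /D/= in_itv/= => h; rewrite lee_fin; exact: fM.
move=> ifl _; have E g : lbm g -> (\int[leb]_(x in D) (g x)%:E = (ri g s t)%:E)%E.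
  by move=> lg; rewrite /ri /Rintegral fineK// integrable_fin_num//; exact: lbm_integrable.
rewrite E// (_ : (fun n => _) = (fun n => (ri (f_ n) s t)%:E)); last by apply/funext => n; exact: E.
by move=> /fine_cvgP[].
Qed.

Lemma ri_window (f : R -> R) (t e : R) : 0 <= t -> 0 <= e -> lbm f ->
  ri (fun r => f (t + r)) 0 e = ri f 0 (t + e) - ri f 0 t.
Proof.
move=> t0 e0 lf; rewrite -(ri_shift _ e0 lf).
by rewrite (ri_cat (s := 0) (t := t) lf t0) ?lerDl// [RHS]addrC addKr.
Qed.

Lemma lbm_shiftl (f : R -> R) t : lbm f -> lbm (fun r => f (t + r)).
Proof.
move=> [mf bf]; split.
  by apply: (measurableT_comp mf); apply: measurable_funD => //; exact: measurable_id.
move=> N; have [M [M0 HM]] := bf (`|t| + N); exists M; split => // x xN; apply: HM.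
by rewrite (le_trans (ler_normD _ _))// lerD2l.
Qed.

Lemma ri_shiftl (f : R -> R) (T p q : R) : lbm f -> 0 <= T -> 0 <= p -> p <= q ->
  ri f (T + p) (T + q) = ri (fun r => f (T + r)) p q.
Proof.
move=> lf T0 p0 pq; have q0 := le_trans p0 pq; have ls := lbm_shiftl T lf.
have h1 := ri_window T0 p0 lf; have h2 := ri_window T0 q0 lf.
have h3 := ri_cat ls p0 pq; rewrite h1 h2 in h3.
have Tp : 0 <= T + p by rewrite addr_ge0.
have h4 := ri_cat (s := 0) lf Tp (_ : T + p <= T + q); rewrite lerD2l in h4.
move: h3 (h4 pq); move: (ri _ _ _) (ri _ _ _) (ri _ _ _) (ri _ _ _) (ri _ _ _) => *; lra.
Qed.

(** Lebesgue differentiation for the primitive from 0, along the windows [x, x + 1/(n+1)]. *)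
Lemma steklov_cvg (f : R -> R) : lbm f ->
  {ae leb, forall x, 0 < x -> (fun n => n.+1%:R * ri (fun r => f (x + r)) 0 n.+1%:R^-1) @ \oo --> f x}.
Proof.
move=> lf.
have loc : locally_integrable setT f.
  split; [exact: lf.1|exact: openT|move=> K _ cK].
  have mK : measurable K by exact: compact_measurable.
  have [N [_ NK]] := compact_bounded cK.
  have [M [M0 HM]] := lf.2 (`|N| + 1).
  have : leb.-integrable K (EFin \o f).
    apply: measurable_bounded_integrable => //; [exact: compact_finite_measure|by apply: measurable_funTS; exact: lf.1|].
    exists M; split; first exact: num_real.
    move=> y My x Kx; apply: le_trans (ltW My); apply: HM.
    by apply: NK => //; rewrite ltr_pwDr// ler_norm.
  by move=> /integrableP[].
have ft := @FTC1 R f (BLeft 0) (fun y => lbm_integrable 0 y lf) loc.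
apply: (@filterS _ _ (ae_filter_ringOfSetsType leb) _ _ _ ft) => x h x0.
pose F := fun x => ri f 0 x.
have [dF' FE] : derivable (F : R -> R) x (1 : R) /\ (F : R -> R)^`()%classic x = f x by apply: h; rewrite lte_fin.
have FE' : 'D_1 F x = f x by rewrite -derive1E -FE.
have cl : (fun h : R => h^-1 *: ((F \o shift x) (h *: (1 : R)) - F x)) @ (0 : R)^' --> ('D_1 F x : R) by exact: dF'.
rewrite FE' in cl.
have en : (fun n : nat => n.+1%:R^-1 : R) @ \oo --> (0 : R)^'.
  move=> A [e /= e0 eA]; have := near_infty_natSinv_lt (PosNum e0).
  apply: filterS => n /= ne; apply: eA; last by rewrite gt_eqF// invr_gt0.
  by rewrite /ball/= sub0r normrN ger0_norm// invr_ge0.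
have c := cvg_comp _ _ en cl.
apply: cvg_trans c; apply: near_eq_cvg; apply: nearW => n /=.
rewrite invrK ri_window ?(ltW x0) ?invr_ge0// /F [_ *: (1 : R)]mulr1.
by rewrite (addrC x).
Qed.

(** Adding the bound C makes the integrand nonnegative, so that Tonelli's measurability statement
    applies; the added C e is subtracted afterwards. *)
Lemma measurable_ri disp (T : measurableType disp) (K : R -> T -> R) (C e : R) : 0 < e ->
  measurable_fun [set: mR * T] (fun p : mR * T => K p.1 p.2) -> (forall r z, `|K r z| <= C) ->
  measurable_fun [set: T] (fun z => ri (K ^~ z) 0 e).
Proof.
move=> e0 mK KC.
pose D := `[0, e]%classic.
have mD : measurable (D : set mR) by exact: measurable_itv.
have lK z : lbm (K ^~ z) by apply: (@lbm_bd _ C) => //; exact: (measurableT_comp mK (@measurable_pair2 _ _ mR T z)).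
pose KD (p : mR * T) : \bar R := ((K p.1 p.2 + C) * \1_D (p.1 : R))%:E.
have mI : measurable_fun [set: mR * T] (fun p : mR * T => \1_D (p.1 : R) : R).
  rewrite (_ : (fun p : mR * T => _) = (\1_D : mR -> R) \o fst)//.
  by apply: measurableT_comp; [exact: measurable_indic|exact: measurable_fst].
have mKD : measurable_fun [set: mR * T] KD.
  by apply/measurable_EFinP; apply: measurable_funM => //; exact: measurable_funD.
have KD0 p : (0 <= KD p)%E.
  rewrite lee_fin mulr_ge0//.
  by have := KC p.1 p.2; rewrite ler_norml => /andP[h _]; rewrite -lerBlDr sub0r.
have h z : fine (fubini_G (@lebesgue_measure R) KD z) = ri (K ^~ z) 0 e + C * e.
  rewrite -[in RHS](subr0 e) -ri_cst ?(ltW e0)// subr0 -(riD _ _ (lK z) (lbm_cst _)) /ri /Rintegral.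
  rewrite /fubini_G; congr fine; rewrite [RHS]integral_mkcond; apply: eq_integral => r _.
  by rewrite /KD/= indicE patchE; case: ifP; rewrite ?mulr1 ?mulr0.
rewrite (_ : (fun z => _) = (fun z => fine (fubini_G (@lebesgue_measure R) KD z) - C * e)); last first.
  by apply/funext => z; rewrite h addrK.
apply: measurable_funB => //; apply: measurableT_comp => //.
exact: measurable_fun_fubini_tonelli_G.
Qed.

Lemma measurable_ri_le disp (T : measurableType disp) (K : R -> T -> R) (C e : R) : 0 <= e ->
  measurable_fun [set: mR * T] (fun p : mR * T => K p.1 p.2) -> (forall r z, `|K r z| <= C) ->
  measurable_fun [set: T] (fun z => ri (K ^~ z) 0 e).
Proof.
rewrite le_eqVlt => /predU1P[<- _ _|]; last exact: measurable_ri.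
by rewrite (_ : (fun z => _) = cst 0)//; apply/funext => z; rewrite ri_pt.
Qed.

Lemma EX_uniform (f : R -> R) (M t : R) (t0 : 0 < t) : lbm f -> (forall x, `|f x| <= M) ->
  EX (uniform_prob t0) f = t^-1 * ri f 0 t.
Proof.
move=> lf fM.
have if_ : itg (uniform_prob t0) f.
  apply: bddm_itg; split; first exact: lf.1.
  by exists M; split => //; exact: le_trans (normr_ge0 _) (fM 0).
have fM0 x : 0 <= f x + M.
  by have := fM x; rewrite ler_norml => /andP[h _]; rewrite -lerBlDr sub0r.
have h : EX (uniform_prob t0) (fun x => f x + M) = t^-1 * ri (fun x => f x + M) 0 t.
  have lfM := lbmD lf (lbm_cst M).
  rewrite /EX /Rintegral (@integral_uniform R 0 t t0 (fun x => (f x + M)%:E)).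
  - by rewrite subr0 fineM// integrable_fin_num//; exact: lbm_integrable.
  - by apply/measurable_EFinP; exact: lfM.1.
  - by move=> x; rewrite lee_fin.
move: h; rewrite EXD//; last exact: itg_cst.
rewrite EX_cst (riD _ _ lf (lbm_cst _)) (ri_cst _ (ltW t0)) subr0 mulrDr (mulrC M) mulKf ?gt_eqF//.
exact: addIr.
Qed.

(** One of the two time integrals is read as an expectation under the uniform law on [0, t], which
    reduces the exchange to [EX_ri]. *)
Lemma ri_swap (K : R -> R -> R) (M e t : R) : 0 < e -> 0 <= t ->
  measurable_fun [set: mR * mR] (fun p : mR * mR => K p.1 p.2) ->
  (forall r q, `|K r q| <= M) ->
  ri (fun q => ri (K ^~ q) 0 e) 0 t = ri (fun r => ri (K r) 0 t) 0 e.
Proof.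
move=> e0; rewrite le_eqVlt => /predU1P[<-|t0] mK KM.
  rewrite ri_pt (_ : (fun r => _) = fun=> 0); first by rewrite (ri_cst _ (ltW e0)) mul0r.
  by apply/funext => r; rewrite ri_pt.
have M0 : 0 <= M := le_trans (normr_ge0 _) (KM 0 0).
have l1 r : lbm (K r) by apply: (@lbm_bd _ M) => //; exact: (measurableT_comp mK (@measurable_pair1 _ _ mR mR r)).
have l2 q : lbm (K ^~ q) by apply: (@lbm_bd _ M) => //; exact: (measurableT_comp mK (@measurable_pair2 _ _ mR mR q)).
have iK r : itg (uniform_prob t0) (K r) by apply: bddm_itg; split; [exact: (l1 r).1|exists M].
have bK r : EX (uniform_prob t0) (fun q => `|K r q|) <= M.
  by apply: le_trans (EX_le (integrable_norm (iK r)) (itg_cst _ M) (KM r)) _; rewrite EX_cst.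
have [i E] := @EX_ri R _ mR (uniform_prob t0) K 0 e M (ltW e0) mK l2 (fun r _ => conj (iK r) (bK r)).
have lg : lbm (fun q => ri (K ^~ q) 0 e).
  apply: (@lbm_bd _ (M * e)); first exact: (itg_meas i).
  by move=> q; have := ri_bound (ltW e0) (l2 q) (fun x _ => KM x q); rewrite subr0.
have gM q : `|ri (K ^~ q) 0 e| <= M * e.
  by have := ri_bound (ltW e0) (l2 q) (fun x _ => KM x q); rewrite subr0.
move: E; rewrite (EX_uniform t0 lg gM).
rewrite (_ : (fun r => EX _ _) = (fun r => t^-1 * ri (K r) 0 t)); last first.
  by apply/funext => r; rewrite (EX_uniform t0 (l1 r) (KM r)).
rewrite riZ; first by move/mulfI; apply; rewrite invr_neq0// gt_eqF.
have mT : measurable_fun [set: mR * mR] (fun p : mR * mR => K p.1 p.2) by [].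
rewrite (_ : (fun r => ri _ _ _) = (fun r => t * EX (uniform_prob t0) (K r))); last first.
  by apply/funext => r; rewrite (EX_uniform t0 (l1 r) (KM r)) mulVKf// gt_eqF.
apply: lbmM; first exact: lbm_cst.
by apply: lbm_EX => // N; exists M => r _.
Qed.

End averages.

(** * Steklov averages of a solution *)

Section steklov.
Context (R : realType) (d : nat) (U : 'rV[R]_d -> R) (mu : probability 'rV[R]_d R) (gamma : R).
Hypothesis U2 : is_C 2 U.
Hypothesis gU : gibbs_measure U mu.
Notation V := 'rV[R]_d.
Notation E := (V * V)%type.
Notation kappa := (@gaussm R d).
Notation muh := (prodp mu kappa).
Notation mR := (measurableTypeR R).
Variables (C : R) (F : R -> E -> R).
Hypothesis sF : sol U gamma C F.
Let mF := sol_meas sF.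
Let FC := sol_bd sF.

Lemma lbm_Fz z : lbm (F ^~ z).
Proof. apply: (@lbm_bd _ _ C) => //; exact: (measurableT_comp mF (@measurable_pair2 _ _ mR E z)). Qed.

Lemma C_ge0 : 0 <= C. Proof. exact: le_trans (normr_ge0 _) (FC 0 0). Qed.

Variable e : R.
Hypothesis e0 : 0 < e.

(* Steklov average: again a solution, and Lipschitz in time. *)
Definition stek (t : R) (z : E) : R := e^-1 * ri (fun r => F (t + r) z) 0 e.

Let ei : 0 <= e^-1. Proof. by rewrite invr_ge0 ltW. Qed.

Lemma stek_bd t z : `|stek t z| <= C.
Proof.
rewrite /stek normrM (ger0_norm ei) ler_pdivrMl//.
have := ri_bound (ltW e0) (lbm_shiftl t (lbm_Fz z)) (fun x _ => FC (t + x) z).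
by rewrite subr0 mulrC.
Qed.

Let measurable_F2 disp (T : measurableType disp) (f : T -> mR) (g : T -> E) :=
  @measurable_comp2 _ _ _ _ T mR E mR F f g mF.

Lemma stek_meas : measurable_fun [set: mR * E] (fun p : mR * E => stek p.1 p.2).
Proof.
apply: measurable_funM => //.
apply: (@measurable_ri _ _ (mR * E)%type (fun r p => F (p.1 + r) p.2) C) => //.
apply: measurable_F2.
  apply: measurable_funD; last exact: measurable_fst.
  by apply: (measurableT_comp measurable_fst); exact: measurable_snd.
by apply: (measurableT_comp measurable_snd); exact: measurable_snd.
Qed.

Lemma EX_stek disp (T : measurableType disp) (P : probability T R) (g : T -> R) (h : T -> E) t :
  itg P g -> measurable_fun [set: T] h ->
  lbm (fun r => EX P (fun y => g y * F (t + r) (h y))) /\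
  EX P (fun y => g y * stek t (h y)) = e^-1 * ri (fun r => EX P (fun y => g y * F (t + r) (h y))) 0 e.
Proof.
move=> ig mh; have mg := itg_meas ig.
have ms : measurable_fun [set: mR * T] (fun p : mR * T => g p.2 * F (t + p.1) (h p.2)).
  apply: measurable_funM; first by apply: (measurableT_comp mg); exact: measurable_snd.
  apply: measurable_F2; first by apply: measurable_funD => //; exact: measurable_fst.
  by apply: (measurableT_comp mh); exact: measurable_snd.
have lz y : lbm (fun r => g y * F (t + r) (h y)).
  by apply: (lbmM (lbm_cst _)); exact: (lbm_shiftl t (lbm_Fz (h y))).
have bd r y : `|g y * F (t + r) (h y)| <= C * `|g y|.
  by rewrite normrM mulrC ler_wpM2r.
have iC : itg P (fun y => C * `|g y|) by apply: itgZ; exact: (integrable_norm ig).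
have iF r : itg P (fun y => g y * F (t + r) (h y)).
  by apply: itg_dom iC (bd r); exact: (measurableT_comp ms (@measurable_pair1 _ _ mR T r)).
have [i E] := @EX_ri R _ T P (fun r y => g y * F (t + r) (h y)) 0 e (EX P (fun y => C * `|g y|)) (ltW e0) ms lz
  (fun r _ => conj (iF r) (EX_le (integrable_norm (iF r)) iC (bd r))).
split.
  apply: lbm_EX ms _ => N; exists (EX P (fun y => C * `|g y|)) => r _; split; first exact: iF.
  exact: EX_le (integrable_norm (iF r)) iC (bd r).
rewrite -E -EXZ//; apply: EX_eq => y.
by rewrite (riZ _ _ _ (lbm_shiftl t (lbm_Fz (h y)))) /stek mulrCA.
Qed.

Lemma Pi_stek t x : lbm (fun r => Pi (F (t + r)) x) /\ Pi (stek t) x = e^-1 * ri (fun r => Pi (F (t + r)) x) 0 e.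
Proof.
have E h : Pi h x = EX kappa (fun w => 1 * h (x, w)) by apply: EX_eq => w; rewrite mul1r.
have := @EX_stek _ V kappa (fun=> 1) (fun w => (x, w)) t (itg_cst _ _) (@measurable_pair1 _ _ V V x).
by rewrite E (_ : (fun r => Pi _ _) = fun r => EX kappa (fun w => 1 * F (t + r) (x, w)))//; apply/funext => r; exact: E.
Qed.

Lemma Bop_stek t x : lbm (fun r => Bop U (F (t + r)) x) /\
  Bop U (stek t) x = e^-1 * ri (fun r => Bop U (F (t + r)) x) 0 e.
Proof.
have [l h] := @EX_stek _ V kappa (fun w => bet U (x, w)) (fun w => (x, w)) t (itg_negp (grad U x)) (@measurable_pair1 _ _ V V x).
split; first exact: (lbmM (lbm_cst _) l).
by rewrite /Bop h mulrCA (riZ _ _ _ l).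
Qed.

Lemma gen_stek t z : gen U gamma (stek t) z = e^-1 * ri (fun r => gen U gamma (F (t + r)) z) 0 e.
Proof.
have [l1 h1] := Bop_stek t z.1; have [l2 h2] := Pi_stek t z.1; have l3 := lbm_shiftl t (lbm_Fz z).
have l1' := lbmM (lbm_cst (lam U z)) l1; have l2' := lbmM (lbm_cst gamma) l2.
have l3' := lbmM (lbm_cst (lam U z + gamma)) l3.
rewrite /gen (riB _ _ (lbmD l1' l2') l3') (riD _ _ l1' l2') (riZ _ _ _ l1) (riZ _ _ _ l2) (riZ _ _ _ l3).
by rewrite h1 h2 /stek; move: (ri _ _ _) (ri _ _ _) (ri _ _ _) => p q r; ring.
Qed.

(** The equation is linear and invariant under time shifts, and [gen] commutes with averaging in
    time. It remains to exchange the average with the integral along the characteristic, by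
    [ri_swap]. *)
Lemma stek_sol : sol U gamma C stek.
Proof.
split; [exact: stek_meas|exact: stek_bd|move=> z t t0].
have [M [M0 HM]] := (lbm_lam U2 z).2 t.
(* The indicator makes the kernel bounded: along a characteristic the bounce rate is bounded on
   [0, t] only. *)
pose K r q := gen U gamma (F (q + r)) (shift_flow q z) * \1_(`[0, t]%classic : set R) q.
have mI : measurable_fun [set: mR * mR] (fun p : mR * mR => \1_(`[0, t]%classic : set R) p.2 : R).
  rewrite (_ : (fun p : mR * mR => _) = (\1_(`[0, t]%classic : set R) : mR -> R) \o snd)//.
  by apply: measurableT_comp; [exact: measurable_indic|exact: measurable_snd].
have mG : measurable_fun [set: mR * mR] (fun p : mR * mR => gen U gamma (F (p.2 + p.1)) (shift_flow p.2 z)).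
  have m1 : measurable_fun [set: mR * mR] (fun p : mR * mR => p.2 + p.1 : mR).
    by apply: measurable_funD; [exact: measurable_snd|exact: measurable_fst].
  have m2 : measurable_fun [set: mR * mR] (fun p : mR * mR => shift_flow p.2 z).
    exact: (@measurable_comp2 _ _ _ _ _ mR E E (@shift_flow R d) _ _ (@measurable_shift_flow R d) measurable_snd (measurable_cst z)).
  exact: (@measurable_comp2 _ _ _ _ _ mR E mR (fun t z => gen U gamma (F t) z) _ _ (measurable_gen gamma U2 mF FC) m1 m2).
have mK : measurable_fun [set: mR * mR] (fun p : mR * mR => K p.1 p.2) by exact: (measurable_funM mG mI).
have KM r q : `|K r q| <= M * C + `|gamma| * C + (M + `|gamma|) * C.
  have B0 : 0 <= M * C + `|gamma| * C + (M + `|gamma|) * C.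
    by apply: addr_ge0; [apply: addr_ge0|]; apply: mulr_ge0 => //; try exact: C_ge0; exact: addr_ge0.
  rewrite /K indicE; case: (boolP (q \in _)) => [/set_mem|_]; last by rewrite mulr0 normr0.
  rewrite mulr1/= in_itv/= => /andP[q0 qt].
  have lM : `|lam U (shift_flow q z)| <= M by apply: HM; rewrite ger0_norm.
  rewrite /gen; apply: le_trans (ler_normB _ _) _; apply: lerD.
    apply: le_trans (ler_normD _ _) _; rewrite (normrM (lam _ _)) (normrM gamma); apply: lerD; apply: ler_pM => //.
    - exact: Bop_bd mF FC _ _.
    - exact: Pi_bd mF FC _ _.
  rewrite normrM; apply: ler_pM => //.
  by apply: le_trans (ler_normD _ _) _; exact: lerD.
have sw := ri_swap e0 t0 mK KM.
have E1 : ri (fun q => gen U gamma (stek q) (shift_flow q z)) 0 t = e^-1 * ri (fun q => ri (K ^~ q) 0 e) 0 t.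
  rewrite -riZ.
    apply: ri_eq => q qt; rewrite gen_stek; congr (_ * _); apply: ri_eq => r _.
    by rewrite /K indicE mem_set ?mulr1//= in_itv.
  apply: (@lbm_bd _ _ ((M * C + `|gamma| * C + (M + `|gamma|) * C) * e)).
    exact: (measurable_ri e0 mK KM).
  move=> q; have lK : lbm (K ^~ q).
    by apply: (@lbm_bd _ _ _ _ (KM ^~ q)); exact: (measurableT_comp mK (@measurable_pair2 _ _ mR mR q)).
  by have := ri_bound (ltW e0) lK (fun r _ => KM r q); rewrite subr0.
rewrite E1 sw /stek -mulrDr; congr (_ * _).
have lK : lbm (fun r => ri (K r) 0 t).
  apply: (@lbm_bd _ _ ((M * C + `|gamma| * C + (M + `|gamma|) * C) * t)).
    apply: (@measurable_ri_le _ _ mR (fun q r => K r q) _ _ t0 _ (fun q r => KM r q)).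
    by apply: (@measurable_comp2 _ _ _ _ (mR * mR)%type mR mR mR K snd fst mK); [exact: measurable_snd|exact: measurable_fst].
  move=> r; have lK : lbm (K r).
    by apply: (@lbm_bd _ _ _ _ (KM r)); exact: (measurableT_comp mK (@measurable_pair1 _ _ mR mR r)).
  by have := ri_bound t0 lK (fun q _ => KM r q); rewrite subr0.
rewrite -(riD _ _ (lbm_shiftl 0 (lbm_Fz z)) lK); apply: ri_eq => r /andP[r0 _].
have [_ _ ch] := sol_shift U2 sF r0.
rewrite add0r addrC (ch z t t0) addr0; congr (_ + _).
apply: ri_eq => q qt; rewrite /K indicE mem_set ?mulr1 1?addrC//=.
Qed.

(** The difference of the two windows is the integral over [s + e, t + e] minus the one over [s, t].
    The constant explodes as e tends to 0, which is harmless since [decay_lip] does not depend on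
    it. *)
Lemma stek_lip s t z : 0 <= s -> s <= t -> `|stek t z - stek s z| <= 2 * C / e * (t - s).
Proof.
move=> s0 st; have t0 := le_trans s0 st; have lF := lbm_Fz z.
have se : s <= s + e by rewrite lerDl ltW.
rewrite /stek !(ri_window _ (ltW e0) lF)// -mulrBr normrM (ger0_norm ei).
have -> : ri (F ^~ z) 0 (t + e) - ri (F ^~ z) 0 t - (ri (F ^~ z) 0 (s + e) - ri (F ^~ z) 0 s) =
  ri (F ^~ z) (s + e) (t + e) - ri (F ^~ z) s t.
  rewrite (ri_cat (s := 0) (t := s + e) (u := t + e) lF) ?lerD2r ?addr_ge0 ?(ltW e0)//.
  rewrite (ri_cat (s := 0) (t := s) (u := t) lF)//.
  by move: (ri _ _ _) (ri _ _ _) (ri _ _ _) (ri _ _ _) => *; ring.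
rewrite ler_pdivrMl// (_ : e * _ = C * (t - s) + C * (t - s)); last by field; rewrite gt_eqF.
apply: le_trans (ler_normB _ _) _; apply: lerD.
  have := ri_bound (s := s + e) (t := t + e) _ lF (fun x _ => FC x z); rewrite lerD2r => /(_ st).
  by rewrite (_ : t + e - (s + e) = t - s)//; ring.
exact: (ri_bound st lF (fun x _ => FC x z)).
Qed.

Lemma stek_mean : EX muh (F 0) = 0 -> EX muh (stek 0) = 0.
Proof.
move=> mean0; have [_] := @EX_stek _ E muh (fun=> 1) id 0 (itg_cst _ _) (@measurable_id _ _ _).
have -> : EX muh (fun z => 1 * stek 0 z) = EX muh (stek 0) by apply: EX_eq => z; rewrite mul1r.
move=> ->; rewrite (_ : ri _ 0 e = ri (fun=> 0) 0 e); first by rewrite (ri_cst _ (ltW e0)) mul0r mulr0.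
apply: ri_eq => r /andP[r0 _]; rewrite add0r -mean0 -(mean_conserved U2 gU sF r0).
by apply: EX_eq => z; rewrite mul1r.
Qed.

End steklov.

Section decay_sol.
Context (R : realType) (d : nat) (U : 'rV[R]_d -> R) (mu : probability 'rV[R]_d R) (gamma : R).
Hypothesis U2 : is_C 2 U.
Hypothesis gU : gibbs_measure U mu.
Notation V := 'rV[R]_d.
Notation E := (V * V)%type.
Notation kappa := (@gaussm R d).
Notation muh := (prodp mu kappa).
Notation mR := (measurableTypeR R).
Variables (m K a b : R).
Hypothesis m0 : 0 < m.
Hypothesis pc : poincare mu m^-1.
Hypothesis ds : discrete_spectrum mu (langevin_closure U mu).
Hypothesis K0 : 0 <= K.
Hypothesis hK : forall x v : V, - (K * m) * dotv v v <= (v *m hess U x *m v^T) ord0 ord0.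
Hypothesis a01 : 0 <= a < 1.
Hypothesis b0 : 0 <= b.
Hypothesis hab : forall x, laplacian U x <= a * dotv (grad U x) (grad U x) + b.
Hypothesis g0 : 0 < gamma.
Variables (C : R) (F : R -> E -> R).
Hypothesis sF : sol U gamma C F.
Hypothesis mean0 : EX muh (F 0) = 0.
Variable T : R.
Hypothesis T0 : 0 < T.
Hypothesis Tm : T ^+ 2 * m = 1.
Let mF := sol_meas sF.
Let FC := sol_bd sF.
Let k := gamma / (160 * 160 * Gam2 gamma m K a b).
Let C0 : 0 <= C := C_ge0 sF.

(** The time integral is placed inside the expectation first: Lebesgue differentiation is available
    at fixed z for almost every time. Bounded convergence is then used in time and in z. *)
Lemma nrm_stek_cvg s t : 0 <= s -> s <= t ->
  (fun n : nat => ri (nrm mu (stek F n.+1%:R^-1)) s t) @ \oo --> ri (nrm mu F) s t.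
Proof.
move=> s0 st.
have sn n : sol U gamma C (stek F n.+1%:R^-1) by apply: (stek_sol U2 sF); rewrite invr_gt0 ltr0n.
have E1 G : sol U gamma C G -> itg muh (fun z => ri (fun r => G r z ^+ 2) s t) /\ ri (nrm mu G) s t = EX muh (fun z => ri (fun r => G r z ^+ 2) s t).
  move=> sG; have mG := sol_meas sG; have GC := sol_bd sG.
  have m2 : measurable_fun [set: mR * E] (fun p : mR * E => G p.1 p.2 ^+ 2) by exact: measurable_funX.
  have b2 r z : `|G r z ^+ 2| <= C ^+ 2 by rewrite normrX lerXn2r// nnegrE.
  have i2 r : itg muh (fun z => G r z ^+ 2).
    by apply: bddm_itg; split; [exact: (measurableT_comp m2 (@measurable_pair1 _ _ mR E r))|exists (C ^+ 2); split => //; exact: sqr_ge0].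
  have [||i E] := @EX_ri R _ E muh (fun r z => G r z ^+ 2) s t (C ^+ 2) st m2; last by split.
    by move=> z; apply: (@lbm_bd _ _ (C ^+ 2)) => //; exact: (measurableT_comp m2 (@measurable_pair2 _ _ mR E z)).
  move=> r _; split; first exact: i2.
  by apply: le_trans (EX_le (integrable_norm (i2 r)) (itg_cst _ (C ^+ 2)) (b2 r)) _; rewrite EX_cst.
have B G : sol U gamma C G -> forall z, lbm (fun r => G r z ^+ 2) /\ forall r, `|G r z ^+ 2| <= C ^+ 2.
  move=> sG z; have b2 r : `|G r z ^+ 2| <= C ^+ 2 by rewrite normrX lerXn2r ?nnegrE// (sol_bd sG).
  split => //; apply: (@lbm_bd _ _ (C ^+ 2)) => //; apply: measurable_funX.
  exact: (lbm_Fz sG z).1.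
rewrite (E1 _ sF).2 (_ : (fun n => _) = (fun n : nat => EX muh (fun z => ri (fun r => stek F n.+1%:R^-1 r z ^+ 2) s t))); last first.
  by apply/funext => n; rewrite (E1 _ (sn n)).2.
apply: (@EX_dom_cvg _ _ _ muh _ _ (fun=> C ^+ 2 * (t - s))).
- by move=> n; exact: (itg_meas (E1 _ (sn n)).1).
- exact: (itg_meas (E1 _ sF).1).
- exact: itg_cst.
- by move=> n z; have [l bd] := B _ (sn n) z; exact: (ri_bound st l (fun r _ => bd r)).
move=> z; apply: (@ri_dom_cvg _ _ _ (C ^+ 2)).
- by move=> n; exact: (B _ (sn n) z).1.
- exact: (B _ sF z).1.
- by move=> n r _; exact: (B _ (sn n) z).2.
have sc := steklov_cvg (lbm_Fz sF z).
(* [steklov_cvg] concerns positive times; time 0 is negligible. *)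
have ne : {ae @lebesgue_measure R, forall x, x != 0}.
  exists [set 0]; split; [exact: measurable_set1|exact: lebesgue_measure_set1|].
  by move=> x /= /negP; rewrite negbK => /eqP.
apply: (@filterS2 _ _ (ae_filter_ringOfSetsType (@lebesgue_measure R)) _ _ _ _ sc ne) => x h xn /andP[sx _].
have x0 : 0 < x by rewrite lt_neqAle eq_sym xn (le_trans s0).
have c := h x0.
have -> : (fun n : nat => stek F n.+1%:R^-1 x z ^+ 2) = (fun n : nat => n.+1%:R * ri (fun r => F (x + r) z) 0 n.+1%:R^-1 * (n.+1%:R * ri (fun r => F (x + r) z) 0 n.+1%:R^-1)).
  by apply/funext => n; rewrite /stek invrK expr2.
by rewrite expr2; exact: cvgM.
Qed.

(** [decay_lip] holds for each Steklov average from every starting time, with a factor independent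
    of the window. Integrated over starting times in [p, q], it passes to the limit by
    [nrm_stek_cvg]; this is why [average_decay] asks for an integrated one-period inequality. *)
Lemma decay_sol t : 0 <= t ->
  ri (nrm mu F) t (t + T) <= expR (- (k * t)) * ri (nrm mu F) 0 T.
Proof.
have G1 := Gam2_ge1 gamma m0 K0 a01 b0; have G0 : 0 < Gam2 gamma m K a b by apply: lt_le_trans G1.
have k0 : 0 <= k.
  by exact: divr_ge0 (ltW g0) (mulr_ge0 (mulr_ge0 (ler0n _ _) (ler0n _ _)) (ltW G0)).
apply: average_decay => //.
- exact: (lbm_nrm mu sF).
- by move=> r; apply: EX_ge0 => z; exact: sqr_ge0.
- by move=> p q p0 pq; exact: (nrm_noninc U2 gU g0 sF).
move=> p q p0 pq.
have pT : p + T <= q + T by rewrite lerD2r.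
have pT0 : 0 <= p + T by rewrite addr_ge0// ltW.
have c1 := nrm_stek_cvg pT0 pT; have c2 := nrm_stek_cvg p0 pq.
have c3 : (fun n : nat => (1 - T * k) * ri (nrm mu (stek F n.+1%:R^-1)) p q) @ \oo --> (1 - T * k) * ri (nrm mu F) p q.
  by apply: cvgM => //; exact: cvg_cst.
refine (@ler_cvg_to nat \oo _ R _ _ _ _ c1 c3 _); apply: nearW => n.
have e0 : 0 < n.+1%:R^-1 :> R by rewrite invr_gt0.
have sn := stek_sol U2 sF e0.
have lN := lbm_nrm mu sn.
rewrite addrC [q + T]addrC.
have -> : ri (nrm mu (stek F n.+1%:R^-1)) (T + p) (T + q) = ri (fun r => nrm mu (stek F n.+1%:R^-1) (T + r)) p q.
  exact: (ri_shiftl lN (ltW T0) p0 pq).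
rewrite -(riZ _ _ _ lN); apply: (ri_le (lbm_shiftl T lN) (lbmM (lbm_cst _) lN)).
move=> r /andP[pr _]; have r0 := le_trans p0 pr.
have sr := sol_shift U2 sn r0.
have mr : EX muh (stek F n.+1%:R^-1 (r + 0)) = 0.
  by rewrite addr0 (mean_conserved U2 gU sn r0) (stek_mean U2 gU sF e0 mean0).
have lip s t' z : 0 <= s -> s <= t' -> `|stek F n.+1%:R^-1 (r + t') z - stek F n.+1%:R^-1 (r + s) z| <= 2 * C / n.+1%:R^-1 * (t' - s).
  move=> s0 st; have := stek_lip sF e0 z (addr_ge0 r0 s0) (_ : r + s <= r + t'); rewrite lerD2l => /(_ st).
  by rewrite (_ : r + t' - (r + s) = t' - s)//; ring.
have L0 : 0 <= 2 * C / n.+1%:R^-1 by rewrite divr_ge0 ?mulr_ge0// ltW.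
have := decay_lip U2 gU m0 pc ds K0 hK a01 b0 hab g0 sr L0 lip mr T0 Tm.
by rewrite /nrm addr0 addrC -/k.
Qed.

End decay_sol.

Lemma rate_arith (R : comNzRingType) (p D e A B c : R) :
  A - B = - (p * D) + c -> p * e - A - (p - B) = p * (e - 1 + D) - c.
Proof. by move=> /eqP; rewrite subr_eq => /eqP ->; ring. Qed.

(** * Construction of the semigroup on bounded functions *)

Section exp_rate.
Context (R : realType).
Notation mR := (measurableTypeR R).
Notation leb := (@lebesgue_measure R).

Lemma ri_ge0 (f : R -> R) s t : (forall x, 0 <= f x) -> 0 <= ri f s t.
Proof. by move=> f0; apply: Rintegral_ge0. Qed.

Lemma ri_E (f : R -> R) s t : lbm f -> (\int[leb]_(x in `[s, t]) (f x)%:E = (ri f s t)%:E)%E.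
Proof. by move=> lf; rewrite /ri /Rintegral fineK// integrable_fin_num//; exact: lbm_integrable. Qed.

Lemma lbm_refl (f : R -> R) t : lbm f -> lbm (fun r => f (t - r)).
Proof.
move=> [mf bf]; split.
  apply: (measurableT_comp mf); apply: measurable_funB => //; exact: measurable_id.
move=> N; have [M [M0 HM]] := bf (`|t| + N); exists M; split => // x xN; apply: HM.
by rewrite (le_trans (ler_normB _ _))// lerD2l.
Qed.

Lemma ri_refl (f : R -> R) t : lbm f -> (forall x, 0 <= f x) ->
  ri (fun s => f (t - s)) 0 t = ri f 0 t.
Proof.
move=> lf f0; rewrite /ri /Rintegral; congr fine.
rewrite integral_mkcond [RHS]integral_mkcond.
pose g := (fun x => (f x)%:E) \_ `[0, t].
have mg : measurable_fun [set: mR] g.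
  apply/(measurable_restrictT _ (measurable_itv `[0, t])).
  by apply: measurable_funTS; apply/measurable_EFinP; exact: lf.1.
have g0 x : (0 <= g x)%E by rewrite /g patchE; case: ifP => // _; rewrite lee_fin.
rewrite -[RHS](ge0_integral_lebesgueD t mg g0).
rewrite -[RHS](ge0_integral_lebesgueN (f := fun x => g (x + t)%R)) //.
  apply: eq_integral => x _; rewrite /g !patchE.
  rewrite (_ : (x \in `[0, t]%classic) = (- x + t \in `[0, t]%classic)); first by rewrite addrC.
  by apply/idP/idP => /set_mem/=; rewrite in_itv/= => /andP[a1 a2]; apply/mem_set; rewrite /= in_itv/=; apply/andP; split; lra.
by apply: (measurableT_comp mg); exact: measurable_funD.
Qed.

Lemma ri_mono (l : R -> R) s u : lbm l -> (forall x, 0 <= l x) -> s <= u -> ri l 0 s <= ri l 0 u.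
Proof.
move=> ll l0.
  move=> su; have [u0|u0] := ltP u 0.
    have z x : x < 0 -> ri l 0 x = 0 by move=> x0; rewrite /ri set_itv_ge ?Rintegral_set0// bnd_simp -ltNge.
    by rewrite !z// (le_lt_trans su).
  have [s0|s0] := leP 0 s; first by rewrite (ri_cat ll s0 su) lerDl ri_ge0.
  by rewrite [leLHS]/ri set_itv_ge ?Rintegral_set0 ?ri_ge0// bnd_simp -ltNge.
Qed.

Lemma lbm_expR_ri (l : R -> R) : lbm l -> (forall x, 0 <= l x) -> lbm (fun r => expR (ri l 0 r)).
Proof.
move=> ll l0; split.
  apply: nondecreasing_measurable => [|s u su]; first exact: measurableT.
  by rewrite ler_expR; exact: ri_mono.
move=> N; exists (expR (ri l 0 N)); split; first exact: expR_ge0.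
move=> x xN; rewrite ger0_norm ?expR_ge0// ler_expR.
exact: (ri_mono ll l0 (le_trans (ler_norm x) xN)).
Qed.

Lemma lbm_ri (l : R -> R) : lbm l -> (forall x, 0 <= l x) -> lbm (fun r => ri l 0 r).
Proof.
move=> ll l0; split.
  apply: nondecreasing_measurable => [|s u su]; first exact: measurableT.
  exact: ri_mono.
move=> N; exists (ri l 0 N); split; first exact: ri_ge0.
move=> x xN; rewrite ger0_norm ?ri_ge0//; apply: ri_mono => //.
exact: le_trans (ler_norm x) xN.
Qed.

Lemma expRN_small (D : R) : 0 <= D -> 0 <= 1 - expR (- D) <= D.
Proof.
move=> D0; have := expR_ge1Dx (- D) => e0.
by rewrite subr_ge0 -expR0 ler_expR oppr_le0 D0/= expR0; move: e0; move: (expR _) => x; lra.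
Qed.

Lemma expRN_small2 (D : R) : 0 <= D -> 0 <= expR (- D) - 1 + D <= D ^+ 2.
Proof.
move=> D0; have e0 := expR_ge1Dx (- D).
have D3 : 0 <= D ^+ 3 by exact: exprn_ge0.
have D2 := sqr_ge0 (1 - D); have D2' := sqr_ge0 D.
have p : 0 < 1 - D + D ^+ 2 by move: D2 D2'; nra.
have e1 : expR (- D) <= 1 - D + D ^+ 2.
  rewrite expRN -[leRHS]invrK lef_pV2 ?posrE ?invr_gt0 ?expR_gt0//.
  apply: le_trans (expR_ge1Dx D).
  rewrite -(mul1r _^-1) ler_pdivrMr//.
  rewrite (_ : _ * _ = 1 + D ^+ 3); last by ring.
  by rewrite lerDl.
by move: e0 e1; move: (expR _) (D ^+ 2) => x y *; apply/andP; split; lra.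
Qed.

(** The rate l is only measurable and locally bounded, so the chain rule is replaced by
    [quad_increment_cst]. With D the integral of l over [s, u], at most M (u - s), both exp(-D) - 1
    + D and the variation of the exponential inside the integral contribute at most (M (u -
    s))^2. *)
Lemma expR_rate (l : R -> R) (t : R) : 0 <= t -> lbm l -> (forall x, 0 <= l x) ->
  expR (- ri l 0 t) = 1 + ri (fun r => - l r * expR (- ri l 0 r)) 0 t /\
  lbm (fun r => expR (- ri l 0 r)).
Proof.
move=> t0 ll l0.
have mono s u : s <= u -> ri l 0 s <= ri l 0 u by exact: ri_mono.
have ex1 r : 0 <= expR (- ri l 0 r) <= 1.
  by rewrite expR_ge0/= -expR0 ler_expR oppr_le0 ri_ge0.
have lE : lbm (fun r => expR (- ri l 0 r)).
  apply: (@lbm_bd _ _ 1) => [|r]; last by rewrite ger0_norm; have /andP[] := ex1 r.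
  apply: nonincreasing_measurable => [|s u su]; first exact: measurableT.
  by rewrite ler_expR lerN2; exact: mono.
split=> //.
have [M [M0 HM]] := ll.2 t.
have lle := lbmM (lbmN ll) lE.
pose h t := expR (- ri l 0 t) - ri (fun r => - l r * expR (- ri l 0 r)) 0 t.
suff : h t = h 0.
  have -> : h 0 = 1 by rewrite /h (ri_pt l) oppr0 expR0 ri_pt subr0.
  by rewrite /h => /eqP; rewrite subr_eq => /eqP.
apply: (@quad_increment_cst _ h t (2 * M ^+ 2) t0); first by rewrite mulr_ge0// sqr_ge0.
move=> s u s0 su ut; pose D := ri l s u.
have D0 : 0 <= D by exact: ri_ge0.
have DM : D <= M * (u - s).
  have bl x : s <= x <= u -> `|l x| <= M.
    by move=> /andP[sx xu]; apply: HM; rewrite ger0_norm ?(le_trans s0 sx)// (le_trans xu ut).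
  by have := ri_bound su ll bl; rewrite ger0_norm.
have E1 : ri (fun r => - l r * expR (- ri l 0 r)) 0 u - ri (fun r => - l r * expR (- ri l 0 r)) 0 s =
   - (expR (- ri l 0 s) * D) + ri (fun r => l r * (expR (- ri l 0 s) - expR (- ri l 0 r))) s u.
  rewrite (ri_cat lle s0 su) [X in X - _]addrC addrK /D -(riZ _ _ _ ll).
  have lA : lbm (fun r => - expR (- ri l 0 s) * l r) by exact: (lbmM (lbm_cst _) ll).
  have lB : lbm (fun r => l r * (expR (- ri l 0 s) - expR (- ri l 0 r))).
    by apply: (lbmM ll); exact: (lbmD (lbm_cst _) (lbmN lE)).
  have -> : - ri (fun r => expR (- ri l 0 s) * l r) s u = ri (fun r => - expR (- ri l 0 s) * l r) s u.
    by rewrite !(riZ _ _ _ ll) mulNr.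
  by rewrite -(riD _ _ lA lB); apply: ri_eq => r _; move: (expR _) (expR _) (l r) => x y v; ring.
have E2 : expR (- ri l 0 u) = expR (- ri l 0 s) * expR (- D).
  by rewrite (ri_cat ll s0 su) opprD expRD.
have /andP[e0 e1] := expRN_small2 D0.
have b2 : `|ri (fun r => l r * (expR (- ri l 0 s) - expR (- ri l 0 r))) s u| <= M * D * (u - s).
  apply: ri_bound => // [|r /andP[sr ru]].
    by apply: lbmM => //; apply: lbmD; [exact: lbm_cst|exact: lbmN].
  have r0 := le_trans s0 sr; rewrite normrM; apply: ler_pM => //.
    by apply: HM; rewrite ger0_norm// (le_trans ru).
  have d0 : 0 <= ri l s r by exact: ri_ge0.
  have dD : ri l s r <= D by rewrite /D (ri_cat ll sr ru) lerDl ri_ge0.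
  rewrite (ri_cat ll s0 sr) opprD expRD -{1}(mulr1 (expR (- ri l 0 s))) -mulrBr normrM.
  have /andP[p0 p1] := ex1 s.
  have /andP[q0 q1] := expRN_small d0.
  rewrite (ger0_norm p0) (ger0_norm q0).
  exact: le_trans (ler_piMl q0 p1) (le_trans q1 dD).
have hE v : h v = expR (- ri l 0 v) - ri (fun r => - l r * expR (- ri l 0 r)) 0 v by [].
rewrite !hE E2 (_ : _ - _ - _ = expR (- ri l 0 s) * (expR (- D) - 1 + D) - (ri (fun r => l r * (expR (- ri l 0 s) - expR (- ri l 0 r))) s u)); last first.
  exact: rate_arith.
have /andP[p0 p1] := ex1 s.
apply: le_trans (ler_normB _ _) _.
have us0 : 0 <= u - s by rewrite subr_ge0.
have c1 : `|expR (- ri l 0 s) * (expR (- D) - 1 + D)| <= (M * (u - s)) ^+ 2.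
  rewrite normrM (ger0_norm p0) (ger0_norm e0).
  apply: le_trans (ler_piMl e0 p1) (le_trans e1 _).
  by rewrite ler_sqr ?nnegrE// mulr_ge0.
have c2 : M * D * (u - s) <= (M * (u - s)) ^+ 2.
  rewrite (_ : _ ^+ 2 = M * (M * (u - s)) * (u - s)); last by ring.
  by rewrite ler_wpM2r// ler_wpM2l.
rewrite (_ : 2 * M ^+ 2 * (u - s) ^+ 2 = (M * (u - s)) ^+ 2 + (M * (u - s)) ^+ 2); last by ring.
by apply: lerD => //; exact: le_trans b2 c2.
Qed.

(** The moving endpoint is encoded by the indicators of s >= 0 and tau y - s >= 0, jointly
    measurable, so that Tonelli applies on a fixed product space. *)
Lemma measurable_ri_var disp (T : measurableType disp) (K : R -> T -> R) (tau : T -> mR) :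
  measurable_fun [set: mR * T] (fun p : mR * T => K p.1 p.2) -> measurable_fun [set: T] tau ->
  (forall s y, 0 <= K s y) ->
  measurable_fun [set: T] (fun y => ri (K ^~ y) 0 (tau y)).
Proof.
move=> mK mt K0.
pose I : set R := `[0, +oo[%classic.
have mI : measurable_fun [set: mR] (\1_I : mR -> R) by apply: measurable_indic; exact: measurable_itv.
pose KD (p : mR * T) : \bar R := (K p.1 p.2 * (\1_I (p.1 : R) * \1_I (tau p.2 - p.1)))%:E.
have mKD : measurable_fun [set: mR * T] KD.
  apply/measurable_EFinP; apply: measurable_funM => //; apply: measurable_funM.
    exact: (measurableT_comp mI measurable_fst).
  apply: (measurableT_comp mI); apply: measurable_funB; last exact: measurable_fst.
  exact: (measurableT_comp mt measurable_snd).
have KD0 p : (0 <= KD p)%E by rewrite lee_fin !mulr_ge0.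
rewrite (_ : (fun y => _) = fine \o fubini_G leb KD).
  by apply: measurableT_comp => //; exact: measurable_fun_fubini_tonelli_G.
apply/funext => y; rewrite /ri /Rintegral /= /fubini_G; congr fine.
rewrite [LHS]integral_mkcond; apply: eq_integral => r _; rewrite /KD/= !indicE patchE.
rewrite (_ : (r \in `[0, tau y]%classic) = (r \in I) && ((tau y : R) - r \in I)).
  by case: (_ \in I); case: (_ \in I); rewrite ?mulr1 ?mulr0 ?mul0r ?mul1r ?mulr0.
apply/idP/andP => [/set_mem/=|[/set_mem/= + /set_mem/=]]; rewrite /I/= !in_itv/= ?andbT.
  by move=> /andP[r0 rt]; split; apply/mem_set; rewrite /= in_itv/= andbT// subr_ge0.
by move=> r0; rewrite subr_ge0 => rt; apply/mem_set; rewrite /= in_itv/= r0.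
Qed.

End exp_rate.

(** * Iteration over the number of jumps and the resulting bounded solution *)

Section forward_process.
Context (R : realType) (d : nat) (U : 'rV[R]_d -> R) (gamma : R).
Hypothesis U2 : is_C 2 U.
Hypothesis g0 : 0 <= gamma.
Notation V := 'rV[R]_d.
Notation E := (V * V)%type.
Notation kappa := (@gaussm R d).
Notation mR := (measurableTypeR R).
Notation leb := (@lebesgue_measure R).
Implicit Types (G H : R -> E -> R) (z : E).

Definition frate (z : E) (s : R) : R := lam U (flow s z) + gamma.
Definition surv (t : R) (z : E) : R := expR (- ri (frate z) 0 t).
Definition jop (h : E -> R) (z : E) : R := lam U z * Bop U h z.1 + gamma * Pi h z.1.
(** Duhamel operator: integration over the time and place of the first jump. The semigroup is the
    fixed point of [mild] plus the no-jump term. *)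
Definition mild G (t : R) z : R := ri (fun s => surv s z * jop (G (t - s)) (flow s z)) 0 t.
Definition nice (A : R) G := measurable_fun [set: mR * E] (fun p : mR * E => G p.1 p.2) /\
  forall t z, 0 <= G t z <= A.

Lemma flowE s z : flow s z = shift_flow (- s) z.
Proof. by rewrite /flow /shift_flow scaleNr opprK. Qed.

Lemma measurable_flow : measurable_fun [set: mR * E] (fun p : mR * E => flow p.1 p.2).
Proof.
rewrite (_ : (fun p => _) = fun p : mR * E => shift_flow (- p.1) p.2); last by apply/funext => p; exact: flowE.
apply: (@measurable_comp2 _ _ _ _ _ mR E E (@shift_flow R d) _ _ (@measurable_shift_flow R d)).
  by apply: measurableT_comp => //; exact: measurable_fst.
exact: measurable_snd.
Qed.

Lemma lam_ge0 z : 0 <= lam U z. Proof. exact: posp_ge0. Qed.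

Lemma lbm_frate z : lbm (frate z).
Proof.
apply: lbmD; last exact: lbm_cst.
have := lbm_refl 0 (lbm_lam U2 z); rewrite (_ : (fun r => _) = fun s => lam U (flow s z))//.
by apply/funext => s; rewrite sub0r flowE.
Qed.

Lemma frate_ge0 z s : 0 <= frate z s.
Proof. by rewrite addr_ge0// lam_ge0. Qed.

Lemma ri_neg (f : R -> R) t : t < 0 -> ri f 0 t = 0.
Proof. by move=> t0; rewrite /ri set_itv_ge ?Rintegral_set0// bnd_simp -ltNge. Qed.

Lemma surv01 t z : 0 <= surv t z <= 1.
Proof. by rewrite expR_ge0/= -expR0 ler_expR oppr_le0 ri_ge0//; exact: frate_ge0. Qed.

Lemma lbm_surv z : lbm (fun r => surv r z).
Proof. exact: (expR_rate (lexx 0) (lbm_frate z) (frate_ge0 z)).2. Qed.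

(** The density of the first jump time integrates to the probability of a jump before t. This keeps
    the iterates below the bound C of the data, as [mild_bd] shows. *)
Lemma surv_rate t z : 0 <= t -> ri (fun r => surv r z * frate z r) 0 t = 1 - surv t z.
Proof.
move=> t0; rewrite {2}/surv (expR_rate t0 (lbm_frate z) (frate_ge0 z)).1 opprD addrA subrr add0r.
have l : lbm (fun r => - frate z r * expR (- ri (frate z) 0 r)).
  by apply: lbmM (lbm_surv z); apply: lbmN; exact: lbm_frate.
by rewrite -mulN1r -(riZ _ _ _ l); apply: ri_eq => r _; rewrite /surv; move: (expR _) (frate z r) => x y; ring.
Qed.

Lemma measurable_surv : measurable_fun [set: mR * E] (fun p : mR * E => surv p.1 p.2).
Proof.
apply: measurableT_comp => //; apply: measurableT_comp => //.
apply: (@measurable_ri_var _ _ _ (fun s (p : mR * E) => frate p.2 s) fst).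
- apply: measurable_funD => //; apply: (measurableT_comp (measurable_lam U2)).
  apply: (@measurable_comp2 _ _ _ _ _ mR E E (@flow R d) _ _ measurable_flow); first exact: measurable_fst.
  by apply: (measurableT_comp measurable_snd); exact: measurable_snd.
- exact: measurable_fst.
- by move=> s p; exact: frate_ge0.
Qed.

Section operators.
Variables (A : R) (G : R -> E -> R).
Hypothesis nG : nice A G.
Let mG := nG.1.
Let GA t z : `|G t z| <= A. Proof. by have /andP[h1 h2] := nG.2 t z; rewrite ger0_norm. Qed.

Lemma itg_betF t x : itg kappa (fun w => bet U (x, w) * G t (x, w)).
Proof.
rewrite (_ : (fun w => _) = fun w => G t (x, w) * bet U (x, w)); last by apply/funext => w; rewrite mulrC.
apply: itgM; last exact: (itg_negp (grad U x)).
split; first exact: (msec2 mG).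
by exists A; split => //; exact: le_trans (normr_ge0 _) (GA 0 0).
Qed.

Lemma jop_bd t z : 0 <= jop (G t) z <= (lam U z + gamma) * A.
Proof.
have G0 y : 0 <= G t y by have /andP[] := nG.2 t y.
have P0 : 0 <= Pi (G t) z.1 by apply: EX_ge0 => w.
have B0 : 0 <= Bop U (G t) z.1.
  by apply: mulr_ge0; [rewrite invr_ge0 Zn_ge0|apply: EX_ge0 => w; apply: mulr_ge0 => //; exact: negp_ge0].
have l0 := lam_ge0 z.
have B1 := Bop_bd U mG GA t z.1; have P1 := Pi_bd mG GA t z.1.
rewrite ger0_norm// in B1; rewrite ger0_norm// in P1.
rewrite /jop; apply/andP; split; first by apply: addr_ge0; exact: mulr_ge0.
by rewrite mulrDl; apply: lerD; exact: ler_wpM2l.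
Qed.

Lemma measurable_jop : measurable_fun [set: mR * E] (fun p : mR * E => jop (G p.1) p.2).
Proof.
have m1 : measurable_fun [set: mR * E] (fun p : mR * E => p.2.1).
  by apply: (measurableT_comp measurable_fst); exact: measurable_snd.
apply: measurable_funD; apply: measurable_funM => //.
- by apply: (measurableT_comp (measurable_lam U2)); exact: measurable_snd.
- exact: (@measurable_comp2 _ _ _ _ _ mR V mR (fun t x => Bop U (G t) x) _ _ (measurable_BopF U2 mG GA) measurable_fst m1).
- exact: (@measurable_comp2 _ _ _ _ _ mR V mR (fun t x => Pi (G t) x) _ _ (measurable_PiF mG GA) measurable_fst m1).
Qed.

Lemma measurable_integrand : measurable_fun [set: mR * (mR * E)]
  (fun p : mR * (mR * E) => surv p.1 p.2.2 * jop (G (p.2.1 - p.1)) (flow p.1 p.2.2)).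
Proof.
have m2 : measurable_fun [set: mR * (mR * E)] (fun p : mR * (mR * E) => p.2.2).
  by apply: (measurableT_comp measurable_snd); exact: measurable_snd.
have m3 : measurable_fun [set: mR * (mR * E)] (fun p : mR * (mR * E) => p.2.1 - p.1 : mR).
  apply: measurable_funB; last exact: measurable_fst.
  by apply: (measurableT_comp measurable_fst); exact: measurable_snd.
apply: measurable_funM.
  exact: (@measurable_comp2 _ _ _ _ _ mR E mR surv _ _ measurable_surv measurable_fst m2).
have m4 := @measurable_comp2 _ _ _ _ _ mR E E (@flow R d) _ _ measurable_flow measurable_fst m2.
exact: (@measurable_comp2 _ _ _ _ _ mR E mR (fun t z => jop (G t) z) _ _ measurable_jop m3 m4).
Qed.

Lemma integrand_bd t z s : 0 <= surv s z * jop (G (t - s)) (flow s z) <= surv s z * frate z s * A.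
Proof.
have /andP[j0 j1] := jop_bd (t - s) (flow s z); have /andP[s0 s1] := surv01 s z.
by rewrite mulr_ge0//= -mulrA ler_wpM2l.
Qed.

Lemma A_ge0 : 0 <= A. Proof. exact: le_trans (normr_ge0 _) (GA 0 0). Qed.

Lemma lbm_integrand t z : lbm (fun s => surv s z * jop (G (t - s)) (flow s z)).
Proof.
split; first exact: (measurableT_comp measurable_integrand (@measurable_pair2 _ _ mR (mR * E)%type (t, z))).
move=> N; have [M [M0 HM]] := (lbm_frate z).2 N; exists (M * A); split; first by rewrite mulr_ge0// A_ge0.
move=> s sN; have /andP[i0 i1] := integrand_bd t z s; rewrite ger0_norm//; apply: le_trans i1 _.
have /andP[s0 s1] := surv01 s z; rewrite ler_wpM2r ?A_ge0//.
apply: le_trans (ler_piMl (frate_ge0 z s) s1) _.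
by have := HM s sN; rewrite ger0_norm ?frate_ge0.
Qed.

Lemma measurable_mild : measurable_fun [set: mR * E] (fun p : mR * E => mild G p.1 p.2).
Proof.
apply: (@measurable_ri_var _ _ _ (fun s (p : mR * E) => surv s p.2 * jop (G (p.1 - s)) (flow s p.2)) fst).
- exact: measurable_integrand.
- exact: measurable_fst.
- by move=> s [t z]; have /andP[] := integrand_bd t z s.
Qed.

Lemma mild_bd t z : 0 <= mild G t z <= (1 - surv t z) * A.
Proof.
have [t0|t0] := ltP t 0.
  by rewrite /mild /surv !ri_neg// oppr0 expR0 subrr mul0r lexx.
apply/andP; split; first by apply: ri_ge0 => s; have /andP[] := integrand_bd t z s.
have l := lbmM (lbm_surv z) (lbm_frate z).
rewrite -surv_rate// mulrC -(riZ _ _ _ l); apply: ri_le; first exact: lbm_integrand.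
  by apply: lbmM => //; exact: lbm_cst.
by move=> s _; have /andP[_ h] := integrand_bd t z s; rewrite [leRHS]mulrC.
Qed.

End operators.

Lemma jopB A G H t z : nice A G -> nice A H ->
  jop (fun y => G t y - H t y) z = jop (G t) z - jop (H t) z.
Proof.
move=> nG nH.
have bG t' y : `|G t' y| <= A by have /andP[h1 h2] := nG.2 t' y; rewrite ger0_norm.
have bH t' y : `|H t' y| <= A by have /andP[h1 h2] := nH.2 t' y; rewrite ger0_norm.
have P : Pi (fun y => G t y - H t y) z.1 = Pi (G t) z.1 - Pi (H t) z.1.
  by apply: EXB; [exact: (itgF nG.1 bG)|exact: (itgF nH.1 bH)].
have B : Bop U (fun y => G t y - H t y) z.1 = Bop U (G t) z.1 - Bop U (H t) z.1.
  rewrite /Bop -mulrBr -EXB; [|exact: (itg_betF nG)|exact: (itg_betF nH)].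
  by congr (_ * _); apply: EX_eq => w; rewrite mulrBr.
by rewrite /jop P B; move: (Pi _ _) (Pi _ _) (Bop _ _ _) (Bop _ _ _) (lam _ _) => *; ring.
Qed.

Lemma mildB A G H t z : nice A G -> nice A H ->
  mild (fun s y => G s y - H s y) t z = mild G t z - mild H t z.
Proof.
move=> nG nH; rewrite /mild -riB; [|exact: (lbm_integrand nG)|exact: (lbm_integrand nH)].
by apply: ri_eq => s _; rewrite (jopB _ _ nG nH) mulrBr.
Qed.

Variables (C : R) (g : E -> R).
Hypothesis mg : measurable_fun [set: E] g.
Hypothesis gC : forall z, 0 <= g z <= C.

(* By [forward_jumpsE], picard n.+1 - picard n is the contribution of the paths with
   exactly n jumps. *)
Fixpoint picard n (t : R) z : R :=
  if n is n'.+1 then surv t z * g (flow t z) + mild (picard n') t z else 0.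

Lemma nice_picard n : nice C (picard n).
Proof.
have C0 : 0 <= C by have /andP[h1 h2] := gC 0; exact: le_trans h2.
elim: n => [|n IH]; first by split => // t z; rewrite /= lexx.
split=> [|t z].
  apply: measurable_funD; last exact: measurable_mild IH.
  apply: measurable_funM; first exact: measurable_surv.
  by apply: (measurableT_comp mg); exact: measurable_flow.
have /andP[s0 s1] := surv01 t z; have /andP[m0 m1] := mild_bd IH t z; have /andP[h0 h1] := gC (flow t z).
rewrite /= addr_ge0 ?mulr_ge0//=.
have := ler_wpM2l s0 h1; move: m1; rewrite mulrBl mul1r.
by move: (surv t z * C) (surv t z * g _) (mild _ _ _) => *; lra.
Qed.

Lemma jop_le A G H t z : nice A G -> nice A H -> (forall y, G t y <= H t y) -> jop (G t) z <= jop (H t) z.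
Proof.
move=> nG nH GH.
have bG t' y : `|G t' y| <= A by have /andP[h1 h2] := nG.2 t' y; rewrite ger0_norm.
have bH t' y : `|H t' y| <= A by have /andP[h1 h2] := nH.2 t' y; rewrite ger0_norm.
rewrite /jop; apply: lerD; apply: ler_wpM2l => //; first exact: lam_ge0.
  rewrite /Bop; apply: ler_wpM2l; first by rewrite invr_ge0 Zn_ge0.
  apply: EX_le; [exact: (itg_betF nG)|exact: (itg_betF nH)|move=> w].
  by apply: ler_wpM2l => //; exact: negp_ge0.
by apply: EX_le; [exact: (itgF nG.1 bG)|exact: (itgF nH.1 bH)|].
Qed.

Lemma mild_le A G H t z : nice A G -> nice A H -> (forall s y, G s y <= H s y) -> mild G t z <= mild H t z.
Proof.
move=> nG nH GH; apply: ri_le; [exact: (lbm_integrand nG)|exact: (lbm_integrand nH)|].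
move=> s _; have /andP[s0 _] := surv01 s z; apply: ler_wpM2l => //.
by apply: (jop_le _ nG nH) => y; exact: GH.
Qed.

Lemma picard_le n t z : picard n t z <= picard n.+1 t z.
Proof.
elim: n t z => [|n IH] t z; first by have /andP[] := (nice_picard 1).2 t z.
by rewrite [leLHS]/= [leRHS]/= lerD2l; exact: (mild_le t z (nice_picard n) (nice_picard n.+1)).
Qed.

Definition fwd (t : R) z : R := limn (fun n => picard n t z).

Lemma picard_cvg t z : (fun n => picard n t z) @ \oo --> fwd t z.
Proof.
apply: nondecreasing_is_cvgn; first by apply/nondecreasing_seqP => n; exact: picard_le.
by exists C => _ [n _ <-]; have /andP[] := (nice_picard n).2 t z.
Qed.

Lemma nice_fwd : nice C fwd.
Proof.
split=> [|t z].
  apply: (measurable_fun_cvg (fun n => (nice_picard n).1)) => p _; exact: picard_cvg.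
apply/andP; split.
  refine (@ler_cvg_to nat \oo _ R _ _ _ _ (cvg_cst 0) (@picard_cvg t z) _).
  by apply: nearW => n; have /andP[] := (nice_picard n).2 t z.
refine (@ler_cvg_to nat \oo _ R _ _ _ _ (@picard_cvg t z) (cvg_cst C) _).
by apply: nearW => n; have /andP[] := (nice_picard n).2 t z.
Qed.

Lemma jop_cvg t z : (fun n => jop (picard n t) z) @ \oo --> jop (fwd t) z.
Proof.
have bG n t' y : `|picard n t' y| <= C by have /andP[h1 h2] := (nice_picard n).2 t' y; rewrite ger0_norm.
have bH t' y : `|fwd t' y| <= C by have /andP[h1 h2] := nice_fwd.2 t' y; rewrite ger0_norm.
have ib := itg_negp (grad U z.1).
apply: cvgD; apply: cvgM => //; try exact: cvg_cst.
  apply: cvgM; first exact: cvg_cst.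
  apply: (@EX_dom_cvg _ _ _ kappa _ _ (fun w => C * bet U (z.1, w))).
  - by move=> n; exact: (itg_meas (itg_betF (nice_picard n) t z.1)).
  - exact: (itg_meas (itg_betF nice_fwd t z.1)).
  - exact: itgZ.
  - move=> n w; rewrite normrM ger0_norm ?negp_ge0// mulrC ler_wpM2r ?negp_ge0//.
  - by move=> w; apply: cvgM; [exact: cvg_cst|exact: picard_cvg].
apply: (@EX_dom_cvg _ _ _ kappa _ _ (fun=> C)).
- by move=> n; exact: (msec2 (nice_picard n).1).
- exact: (msec2 nice_fwd.1).
- exact: itg_cst.
- by move=> n w; exact: bG.
- by move=> w; exact: picard_cvg.
Qed.

(** The recursion for [picard] passes to the limit by dominated convergence, in the velocity for
    each jump operator and in time for [mild]. *)
Lemma fwd_mild t z : fwd t z = surv t z * g (flow t z) + mild fwd t z.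
Proof.
have c1 : [sequence picard n.+1 t z]_n @ \oo --> fwd t z by rewrite (cvg_shiftS (fun n => picard n t z)); exact: picard_cvg.
have [M [M0 HM]] := (lbm_frate z).2 `|t|.
have C0 := A_ge0 nice_fwd.
have c2 : (fun n => mild (picard n) t z) @ \oo --> mild fwd t z.
  apply: (@ri_dom_cvg _ _ _ (M * C)).
  - by move=> n; exact: (lbm_integrand (nice_picard n)).
  - exact: (lbm_integrand nice_fwd).
  - move=> n s /andP[s0 st]; have /andP[i0 i1] := integrand_bd (nice_picard n) t z s.
    rewrite ger0_norm//; apply: le_trans i1 _; rewrite ler_wpM2r//.
    have /andP[_ s1] := surv01 s z; apply: le_trans (ler_piMl (frate_ge0 z s) s1) _.
    have := HM s; rewrite !ger0_norm ?frate_ge0//; first by apply.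
    exact: le_trans st.
  - by apply: aeW => s _; apply: cvgM; [exact: cvg_cst|exact: jop_cvg].
have c3 : (fun n => picard n.+1 t z) @ \oo --> surv t z * g (flow t z) + mild fwd t z.
  by apply: cvgD => //; exact: cvg_cst.
exact: (cvg_unique _ c1 c3).
Qed.

Lemma fwd0 z : fwd 0 z = g z.
Proof.
by rewrite fwd_mild /mild /surv !ri_pt oppr0 expR0 mul1r addr0 /flow scale0r addr0 -surjective_pairing.
Qed.

Lemma flow_shift s t z : flow s (shift_flow t z) = shift_flow (t - s) z.
Proof. by rewrite /flow /shift_flow/= scalerBl opprB addrA addrAC. Qed.

(** Let La(r) be the integral of the jump rate over [0, r] along the backward characteristic of z.
    Started at [shift_flow u z], the forward flow runs back along it, so survival up to s is exp(La
    (u - s) - La u). The Duhamel equation becomes F_u = exp(- La u) W u with W a primitive, and the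
    product rule [ri_mul] gives the integrated equation of [sol]. *)
Lemma fwd_sol : sol U gamma C fwd.
Proof.
have bH t' y : `|fwd t' y| <= C by have /andP[h1 h2] := nice_fwd.2 t' y; rewrite ger0_norm.
split; [exact: nice_fwd.1|exact: bH|move=> z t t0].
pose l r := lam U (shift_flow r z) + gamma.
pose h r := jop (fwd r) (shift_flow r z).
have ll : lbm l by apply: lbmD; [exact: lbm_lam|exact: lbm_cst].
have l0 r : 0 <= l r by rewrite addr_ge0// lam_ge0.
have h0 r : 0 <= h r by have /andP[] := jop_bd nice_fwd r (shift_flow r z).
have lh : lbm h.
  split.
    apply: (@measurable_comp2 _ _ _ _ _ mR E mR (fun t z => jop (fwd t) z) _ _ (measurable_jop nice_fwd) (@measurable_id _ _ _)).
    exact: (measurableT_comp (@measurable_shift_flow R d) (@measurable_pair2 _ _ mR E z)).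
  move=> N; have [M [M0 HM]] := ll.2 N; exists (M * C); split; first by rewrite mulr_ge0// (A_ge0 nice_fwd).
  move=> r rN; have /andP[j0 j1] := jop_bd nice_fwd r (shift_flow r z).
  rewrite ger0_norm//; apply: le_trans j1 _; rewrite ler_wpM2r ?(A_ge0 nice_fwd)//.
  by have := HM r rN; rewrite ger0_norm.
pose La r := ri l 0 r.
have sE s u : 0 <= s -> s <= u -> surv s (shift_flow u z) = expR (- La u) * expR (La (u - s)).
  move=> s0 su; rewrite /surv -expRD; congr expR.
  have us : 0 <= u - s by rewrite subr_ge0.
  have lus := lbm_shiftl (u - s) ll.
  have <- : La u - La (u - s) = ri (frate (shift_flow u z)) 0 s.
    have := ri_window us s0 ll; rewrite subrK => <-.
    rewrite -(ri_refl s lus) => [|r]; last exact: l0.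
    apply: ri_eq => r _; by rewrite /frate flow_shift /l addrA subrK.
  by rewrite opprB addrC.
have lE : lbm (fun r => expR (La r)) by exact: lbm_expR_ri.
pose W r := g z + ri (fun r => expR (La r) * h r) 0 r.
have lp : lbm (fun r => expR (La r) * h r) by exact: lbmM.
have yE u : 0 <= u -> fwd u (shift_flow u z) = expR (- La u) * W u.
  move=> u0.
  have s1 : surv u (shift_flow u z) = expR (- La u) by rewrite (sE u u u0 (lexx u)) subrr {2}/La ri_pt expR0 mulr1.
  have s2 : flow u (shift_flow u z) = z by rewrite flow_shift subrr /shift_flow scale0r subr0 -surjective_pairing.
  have s3 : mild fwd u (shift_flow u z) = expR (- La u) * ri (fun r => expR (La r) * h r) 0 u.
    rewrite -(ri_refl u lp) => [|r]; last by rewrite mulr_ge0// expR_ge0.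
    rewrite -(riZ _ _ _ (lbm_refl u lp)).
    apply: ri_eq => s /andP[s0 su]; by rewrite (sE s u s0 su) -mulrA flow_shift.
  by rewrite fwd_mild s1 s2 s3 -mulrDr.
have [_ lE'] := expR_rate t0 ll l0.
have lW : lbm W.
  by apply: (lbmD (lbm_cst _)); apply: lbm_ri => // r; rewrite mulr_ge0// expR_ge0.
have la' : lbm (fun r => - l r * expR (- La r)) by exact: (lbmM (lbmN ll) lE').
have eA u : 0 <= u <= t -> expR (- La u) = expR (- La 0) + ri (fun r => - l r * expR (- La r)) 0 u.
  by move=> /andP[u0 _]; rewrite /La (expR_rate u0 ll l0).1 ri_pt oppr0 expR0.
have eW u : 0 <= u <= t -> W u = W 0 + ri (fun r => expR (La r) * h r) 0 u.
  by rewrite /W ri_pt addr0.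
rewrite yE// (@ri_mul _ (fun r => expR (- La r)) (fun r => - l r * expR (- La r)) W (fun r => expR (La r) * h r) t t0 lE' lW la' lp eA eW).
rewrite {1}/La {1}/W !ri_pt oppr0 expR0 mul1r addr0 fwd0; congr (_ + _); apply: ri_eq => r /andP[r0 _].
have e1 : expR (- La r) * expR (La r) = 1 by rewrite -expRD addNr expR0.
by rewrite mulrA e1 mul1r -mulrA -(yE r r0) /gen /h /jop /l mulNr addrC.
Qed.

Lemma bounce_normE x : bounce_norm U x = Zn U x.
Proof. by rewrite /bounce_norm /Rintegral integral_gaussmE. Qed.

Lemma bounceE (h : E -> R) z : itg kappa (fun w => bet U (z.1, w) * h (z.1, w)) ->
  bounce U (EFin \o h) z = (Bop U h z.1)%:E.
Proof.
move=> i; rewrite /bounce bounce_normE integral_gaussmE /Bop EFinM -(EX_E i).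
by congr (_ * _)%E; apply: eq_integral => w _; rewrite EFinM.
Qed.

Lemma refreshE (h : E -> R) z : itg kappa (fun w => h (z.1, w)) ->
  refresh (EFin \o h) z = (Pi h z.1)%:E.
Proof. by move=> i; rewrite /refresh integral_gaussmE /Pi -(EX_E i). Qed.

Lemma nice_increment n : nice C (fun t z => picard n.+1 t z - picard n t z).
Proof.
have [m1 b1] := nice_picard n.+1; have [m2 b2] := nice_picard n.
split; first exact: measurable_funB.
move=> t z; have /andP[h1 h2] := b1 t z; have /andP[h3 h4] := b2 t z.
by rewrite subr_ge0 picard_le/= lerBlDr (le_trans h2)// lerDl.
Qed.

Lemma picard_incr0 t z : picard 1 t z - picard 0 t z = surv t z * g (flow t z).
Proof.
rewrite [picard 0 t z]/= subr0 [picard 1 t z]/= (_ : mild _ t z = 0) ?addr0//.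
rewrite /mild (_ : ri _ 0 t = ri (fun=> 0) 0 t).
  have [t0|t0] := ltP t 0; first by rewrite ri_neg.
  by rewrite (ri_cst _ t0) mul0r.
apply: ri_eq => s _; rewrite /jop /Pi /Bop.
rewrite (_ : EX kappa (fun=> 0) = 0) ?EX_cst// (@EX_eq _ _ _ _ (fun w => bet U ((flow s z).1, w) * 0) (fun=> 0)) ?EX_cst ?mulr0 ?addr0 ?mulr0//.
by move=> w; rewrite mulr0.
Qed.

Lemma picard_incrS n t z : picard n.+2 t z - picard n.+1 t z = mild (fun s y => picard n.+1 s y - picard n s y) t z.
Proof.
rewrite (mildB _ _ (nice_picard n.+1) (nice_picard n)) [picard n.+2 t z]/= [picard n.+1 t z in LHS]/=.
by rewrite opprD addrACA subrr add0r.
Qed.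

(** The link with the extended-real definition of the process: for bounded data all integrals are
    finite, so [bounce], [refresh] and the time integral coincide with [Bop], [Pi] and [mild]. *)
Lemma forward_jumpsE n t z :
  forward_jumps U gamma n (EFin \o g) t z = (picard n.+1 t z - picard n t z)%:E.
Proof.
elim: n t z => [|n IH] t z; first by rewrite picard_incr0 EFinM.
have nI := nice_increment n.
rewrite picard_incrS /mild -(ri_E _ _ (lbm_integrand nI t z)) [forward_jumps _ _ _ _ _ _]/=.
apply: eq_integral => s _; rewrite EFinM; congr (_ * _)%E.
have IH' r : forward_jumps U gamma n (EFin \o g) r = EFin \o (fun y => picard n.+1 r y - picard n r y).
  by apply/funext => y; rewrite IH.
rewrite IH' bounceE ?refreshE//.
  have bI t' y : `|picard n.+1 t' y - picard n t' y| <= C by have /andP[h1 h2] := nI.2 t' y; rewrite ger0_norm.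
  exact: (@itgF _ _ C (fun s y => picard n.+1 s y - picard n s y) nI.1 bI).
exact: (itg_betF nI).
Qed.

Lemma forward_sumE t z :
  (\sum_(0 <= n <oo) forward_jumps U gamma n (EFin \o g) t z = (fwd t z)%:E)%E.
Proof.
apply/cvg_lim => //.
rewrite (_ : (fun n => _) = (fun n => (picard n t z)%:E)).
  by apply: cvg_EFin; [exact: nearW|exact: picard_cvg].
apply/funext => n; elim: n => [|n IH]; first by rewrite big_geq.
by rewrite big_nat_recr//= IH forward_jumpsE -EFinD addrC subrK.
Qed.

End forward_process.

Section sol_linear.
Context (R : realType) (d : nat) (U : 'rV[R]_d -> R) (gamma : R).
Hypothesis U2 : is_C 2 U.
Notation V := 'rV[R]_d.
Notation E := (V * V)%type.
Notation kappa := (@gaussm R d).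
Notation mR := (measurableTypeR R).

Lemma sol_sub C1 C2 F G : sol U gamma C1 F -> sol U gamma C2 G ->
  sol U gamma (C1 + C2) (fun t z => F t z - G t z).
Proof.
move=> sF sG; have [mF bF cF] := sF; have [mG bG cG] := sG.
split; first exact: measurable_funB.
  by move=> t z; apply: le_trans (ler_normB _ _) _; exact: lerD.
move=> z t t0; rewrite cF// cG//.
have itb C H s x : sol U gamma C H -> itg kappa (fun w => bet U (x, w) * H s (x, w)).
  move=> sH; rewrite (_ : (fun w => _) = fun w => H s (x, w) * bet U (x, w)); last by apply/funext => w; rewrite mulrC.
  apply: itgM; last exact: (itg_negp (grad U x)).
  split; first exact: (msec2 (sol_meas sH)).
  by exists C; split => [|w]; [exact: (C_ge0 sH)|exact: (sol_bd sH)].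
have E1 s y : gen U gamma (fun z => F s z - G s z) y = gen U gamma (F s) y - gen U gamma (G s) y.
  have P : Pi (fun z => F s z - G s z) y.1 = Pi (F s) y.1 - Pi (G s) y.1.
    by apply: EXB; [exact: (itgF mF bF)|exact: (itgF mG bG)].
  have B : Bop U (fun z => F s z - G s z) y.1 = Bop U (F s) y.1 - Bop U (G s) y.1.
    rewrite /Bop -mulrBr -EXB; [|exact: (itb _ _ _ _ sF)|exact: (itb _ _ _ _ sG)].
    by congr (_ * _); apply: EX_eq => w; rewrite mulrBr.
  by rewrite /gen P B; move: (Pi _ _) (Pi _ _) (Bop _ _ _) (Bop _ _ _) (lam _ _) => *; ring.
have -> : ri (fun r => gen U gamma (fun z => F r z - G r z) (shift_flow r z)) 0 t =
   ri (fun r => gen U gamma (F r) (shift_flow r z)) 0 t - ri (fun r => gen U gamma (G r) (shift_flow r z)) 0 t.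
  rewrite -riB; [|exact: lbm_gen mF bF z|exact: lbm_gen mG bG z].
  by apply: ri_eq => r _; exact: E1.
by rewrite opprD addrACA.
Qed.

(** Conservation of constants, which later allows a mean to be subtracted from a solution. At a
    critical point [Bop] sends a constant to 0 instead of itself, but the bounce rate in front of it
    vanishes. *)
Lemma gen_cst c z : gen U gamma (fun=> c) z = 0.
Proof.
have P : Pi (fun _ : E => c) z.1 = c by exact: EX_cst.
rewrite /gen P; have [Z0|Z0] := eqVneq (Zn U z.1) 0.
  have -> : lam U z = 0.
    have := Zn0_bet (- z.2) Z0; rewrite /bet/= /lam dotvN /negp opprK => <-.
    by case: z {P Z0}.
  by ring.
have -> : Bop U (fun=> c) z.1 = c.
  have := Zn_Bop U z.1 (fun=> 1).
  have -> : EX kappa (fun w => bet U (z.1, w) * 1) = Zn U z.1.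
    rewrite (@EX_eq _ _ _ _ _ (fun w => bet U (z.1, w))); last by move=> w; rewrite mulr1.
    exact: (EX_negp (grad U z.1)).
  rewrite /Bop => /esym h.
  have e1 : EX kappa (fun w => bet U (z.1, w) * c) = c * EX kappa (fun w => bet U (z.1, w)).
    by rewrite -EXZ; [apply: EX_eq => w; rewrite mulrC|exact: (itg_negp (grad U z.1))].
  rewrite e1.
  have -> : EX kappa (fun w => bet U (z.1, w)) = Zn U z.1 by exact: (EX_negp (grad U z.1)).
  by rewrite mulrCA mulVf// mulr1.
by ring.
Qed.

Lemma sol_cst c : sol U gamma `|c| (fun _ _ => c).
Proof.
split => // z t t0; rewrite (_ : ri _ 0 t = ri (fun=> 0) 0 t); first by rewrite (ri_cst _ t0) mul0r addr0.
by apply: ri_eq => r _; exact: gen_cst.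
Qed.

End sol_linear.

Lemma mct disp (T : measurableType disp) (R : realType) (m : {measure set T -> \bar R}) (D : set T)
  (g_ : nat -> T -> \bar R) (g : T -> \bar R) : measurable D ->
  (forall n, measurable_fun D (g_ n)) -> (forall n x, D x -> (0 <= g_ n x)%E) ->
  (forall x, D x -> nondecreasing_seq (g_ ^~ x)) -> (forall x, D x -> g_ ^~ x @ \oo --> g x) ->
  (fun n => \int[m]_(x in D) g_ n x)%E @ \oo --> (\int[m]_(x in D) g x)%E.
Proof.
move=> mD mg g0 nd cg; have := @cvg_monotone_convergence _ _ _ m D mD g_ mg g0 nd.
rewrite (_ : (\int[m]_(x in D) limn (g_^~ x))%E = (\int[m]_(x in D) g x)%E)//.
by apply: eq_integral => x /set_mem Dx; apply/cvg_lim => //; exact: cg.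
Qed.

Lemma nd_cvg_le (R : realType) (u : nat -> \bar R) (l : \bar R) : nondecreasing_seq u -> u @ \oo --> l ->
  forall n, (u n <= l)%E.
Proof.
move=> nd c n; have h := ereal_nondecreasing_cvgn nd.
by rewrite (cvg_unique _ c h)//; apply: ereal_sup_ubound; exists n.
Qed.

Lemma cvge_le_bound (R : realType) (u : nat -> \bar R) (l x : \bar R) : u @ \oo --> l ->
  (forall n, (u n <= x)%E) -> (l <= x)%E.
Proof.
move=> c h; rewrite -(cvg_lim _ c)//; apply: lime_le; first by apply/cvg_ex; exists l.
exact: nearW.
Qed.

(** * Square-integrable data *)

Section truncation.
Context (R : realType) (d : nat) (U : 'rV[R]_d -> R) (gamma : R).
Hypothesis U2 : is_C 2 U.
Hypothesis g0 : 0 <= gamma.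
Notation V := 'rV[R]_d.
Notation E := (V * V)%type.
Notation kappa := (@gaussm R d).
Notation mR := (measurableTypeR R).
Variable f : E -> R.
Hypothesis mf : measurable_fun [set: E] f.
Hypothesis f0 : forall z, 0 <= f z.

Definition trunc_at (n : nat) z : R := Num.min (f z) n%:R.

Lemma measurable_trunc n : measurable_fun [set: E] (trunc_at n).
Proof. by apply: measurable_minr. Qed.

Lemma trunc_bd n z : 0 <= trunc_at n z <= n%:R.
Proof. by rewrite le_min f0 ler0n/= ge_min lexx orbT. Qed.

Lemma trunc_le n z : trunc_at n z <= f z.
Proof. by rewrite ge_min lexx. Qed.

Lemma trunc_mono n z : trunc_at n z <= trunc_at n.+1 z.
Proof. by rewrite le_min trunc_le/= ge_min ler_nat leqnSn orbT. Qed.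

Lemma trunc_cvg z : trunc_at ^~ z @ \oo --> f z.
Proof.
apply: cvg_near_cst; near=> n; rewrite /trunc_at min_l//.
by near: n; exact: nbhs_infty_ger.
Unshelve. all: by end_near. Qed.

Let J n k t z := picard U gamma (trunc_at n) k.+1 t z - picard U gamma (trunc_at n) k t z.

Let nJ n k : nice n%:R (J n k).
Proof. exact: (nice_increment U2 g0 (measurable_trunc n) (trunc_bd n)). Qed.

Let nJ' n k : nice n.+1%:R (J n k).
Proof.
have [m1 b1] := nJ n k; split => // t z; have /andP[-> h]/= := b1 t z.
by apply: le_trans h _; rewrite ler_nat.
Qed.

Let JS n k t z : J n k.+1 t z = mild U gamma (J n k) t z.
Proof. exact: (picard_incrS U2 g0 (measurable_trunc n) (trunc_bd n) k t z). Qed.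

(** Induction on the number of jumps: truncation is increasing in n, and the bounce, refresh and
    Duhamel operators preserve order. *)
Lemma jumps_mono n k t z : J n k t z <= J n.+1 k t z.
Proof.
elim: k t z => [|k IH] t z.
  rewrite /J !picard_incr0 ler_wpM2l ?trunc_mono//.
  by have /andP[] := surv01 U g0 t z.
rewrite !JS.
exact: (mild_le U2 g0 t z (nJ' n k) (nJ n.+1 k) IH).
Qed.

Let Jnd k t z : nondecreasing_seq (fun n => (J n k t z)%:E).
Proof. by apply/nondecreasing_seqP => n; rewrite lee_fin jumps_mono. Qed.

Notation fj k := (forward_jumps U gamma k (EFin \o f)).

(** Monotone convergence, for each number of jumps, through the two velocity averages and the time
    integral. It requires nonnegative data, hence the separate treatment of the positive and
    negative parts. *)
Lemma jumps_cvg k t z : (fun n => (J n k t z)%:E) @ \oo --> fj k t z.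
Proof.
elim: k t z => [|k IH] t z.
  rewrite [fj 0%N t z]/= -EFinM.
  rewrite (_ : (fun n => _) = (fun n => (surv U gamma t z * trunc_at n (flow t z))%:E)).
    by apply: cvg_EFin; [exact: nearW|apply: cvgM; [exact: cvg_cst|exact: trunc_cvg]].
  by apply/funext => n; rewrite /J picard_incr0.
have ndJ k' r y : {homo (fun n => J n k' r y) : m n / (m <= n)%N >-> m <= n}.
  by apply/nondecreasing_seqP => n; exact: jumps_mono.
have cP r y : (fun n => (Pi (J n k r) y.1)%:E) @ \oo --> refresh (fj k r) y.
  have bJ n t' y' : `|J n k t' y'| <= n%:R by have /andP[h1 h2] := (nJ n k).2 t' y'; rewrite ger0_norm.
  have iJ n : itg kappa (fun w => J n k r (y.1, w)) by exact: (@itgF _ _ n%:R (J n k) (nJ n k).1 (bJ n)).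
  rewrite /refresh integral_gaussmE (_ : (fun n => _) = (fun n => \int[kappa]_w (J n k r (y.1, w))%:E)%E).
    apply: mct => //.
    - by move=> n; apply/measurable_EFinP; exact: (itg_meas (iJ n)).
    - by move=> n w _; rewrite lee_fin; have /andP[] := (nJ n k).2 r (y.1, w).
  by apply/funext => n; rewrite (EX_E (iJ n)).
have cB r y : (fun n => (Bop U (J n k r) y.1)%:E) @ \oo --> bounce U (fj k r) y.
  have iJ n := itg_betF U (nJ n k) r y.1.
  rewrite /bounce bounce_normE integral_gaussmE.
  rewrite (_ : (fun n => _) = (fun n => (Zn U y.1)^-1%:E * \int[kappa]_w (bet U (y.1, w) * J n k r (y.1, w))%:E)%E).
    apply: cvgeZl => //; apply: mct => //.
    - by move=> n; apply/measurable_EFinP; exact: (itg_meas (iJ n)).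
    - move=> n w _; rewrite lee_fin mulr_ge0//; first exact: negp_ge0.
      by have /andP[] := (nJ n k).2 r (y.1, w).
    - move=> w _ m n mn; rewrite lee_fin ler_wpM2l//; first exact: negp_ge0.
      exact: ndJ.
    - move=> w _; rewrite (_ : (fun n => _) = (fun n => (bet U (y.1, w))%:E * (J n k r (y.1, w))%:E)%E).
        by apply: cvgeZl => //; exact: IH.
      by apply/funext => n; rewrite EFinM.
  by apply/funext => n; rewrite (EX_E (iJ n)) -EFinM.
have fj0 r y : (0 <= fj k r y)%E.
  by have := nd_cvg_le (Jnd k r y) (IH r y) 0%N; apply: le_trans; rewrite lee_fin; have /andP[] := (nJ 0 k).2 r y.
rewrite [fj k.+1 t z]/=.
rewrite (_ : (fun n => _) = (fun n => \int[lebesgue_measure]_(s in `[0%R, t]) (surv U gamma s z * jop U gamma (J n k (t - s)) (flow s z))%:E)%E); last first.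
  apply/funext => n; rewrite JS /mild.
  by rewrite -(ri_E _ _ (lbm_integrand U2 g0 (nJ n k) t z)).
apply: mct.
- exact: measurable_itv.
- move=> n; apply/measurable_EFinP; apply: measurable_funTS.
  exact: (lbm_integrand U2 g0 (nJ n k) t z).1.
- by move=> n s _; rewrite lee_fin; have /andP[] := integrand_bd U g0 (nJ n k) t z s.
- move=> s _; apply/nondecreasing_seqP => n; rewrite lee_fin ler_wpM2l//.
    by have /andP[] := surv01 U g0 s z.
  by apply: (jop_le U g0 _ (nJ' n k) (nJ n.+1 k)) => y; exact: jumps_mono.
move=> s _; rewrite (_ : (fun n => _) = (fun n => (surv U gamma s z)%:E *
   ((lam U (flow s z))%:E * (Bop U (J n k (t - s)) (flow s z).1)%:E + gamma%:E * (Pi (J n k (t - s)) (flow s z).1)%:E))%E); last first.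
  by apply/funext => n; rewrite EFinM EFinD !EFinM.
apply: cvgeZl => //; apply: cvgeD.
- apply: ge0_adde_def; rewrite inE mule_ge0 ?lee_fin//; first exact: lam_ge0.
    apply: mule_ge0; first by rewrite lee_fin invr_ge0 bounce_normE Zn_ge0.
    by apply: integral_ge0 => w _; rewrite mule_ge0// lee_fin negp_ge0.
  by apply: integral_ge0.
- by apply: cvgeZl => //; exact: cB.
- by apply: cvgeZl => //; exact: cP.
Qed.

Lemma fwd_trunc_mono n t z : fwd U gamma (trunc_at n) t z <= fwd U gamma (trunc_at n.+1) t z.
Proof.
rewrite -lee_fin -!(forward_sumE U2 g0 (measurable_trunc _) (trunc_bd _)).
apply: lee_nneseries => k _; rewrite ?(forward_jumpsE U2 g0 (measurable_trunc _) (trunc_bd _)).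
  by move=> _; rewrite lee_fin; have /andP[] := (nJ n k).2 t z.
by rewrite lee_fin; exact: jumps_mono.
Qed.

(** Exchange of two increasing limits, in the truncation level n and in the number of jumps k: each
    partial sum over k is reached as n grows, and each truncated series stays below the full one. *)
Lemma fwd_trunc_cvg t z : (fun n => (fwd U gamma (trunc_at n) t z)%:E) @ \oo --> 
  (\sum_(0 <= k <oo) fj k t z)%E.
Proof.
have nd : nondecreasing_seq (fun n => (fwd U gamma (trunc_at n) t z)%:E).
  by apply/nondecreasing_seqP => n; rewrite lee_fin fwd_trunc_mono.
have c := ereal_nondecreasing_cvgn nd; set l := ereal_sup _ in c.
have J0 n k : (0 <= (J n k t z)%:E)%E by rewrite lee_fin; have /andP[] := (nJ n k).2 t z.
have E n : (fwd U gamma (trunc_at n) t z)%:E = (\sum_(0 <= k <oo) (J n k t z)%:E)%E.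
  rewrite -(forward_sumE U2 g0 (measurable_trunc n) (trunc_bd n)).
  by apply: eq_eseriesr => k _; rewrite (forward_jumpsE U2 g0 (measurable_trunc n) (trunc_bd n)).
have Jle n k := nd_cvg_le (Jnd k t z) (@jumps_cvg k t z) n.
have fj0 k : (0 <= fj k t z)%E := le_trans (J0 0%N k) (Jle 0%N k).
suff -> : (\sum_(0 <= k <oo) fj k t z)%E = l by [].
apply/eqP; rewrite eq_le; apply/andP; split; last first.
  by apply: (cvge_le_bound c) => n; rewrite E; apply: lee_nneseries => k _.
apply: lime_le; first by apply: is_cvg_nneseries => k _ _; exact: fj0.
apply: nearW => N.
have cs : (fun n => \sum_(0 <= k < N) (J n k t z)%:E)%E @ \oo --> (\sum_(0 <= k < N) fj k t z)%E.
  elim: N => [|N IH].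
    rewrite big_geq// (_ : (fun n => _) = fun=> 0%E); first exact: cvg_cst.
    by apply/funext => n; rewrite big_geq.
  rewrite big_nat_recr//= (_ : (fun n => _) = fun n => (\sum_(0 <= k < N) (J n k t z)%:E + (J n N t z)%:E)%E).
    apply: cvgeD => //; last exact: jumps_cvg.
    by apply: ge0_adde_def; rewrite inE ?fj0// sume_ge0.
  by apply/funext => n; rewrite big_nat_recr.
apply: (cvge_le_bound cs) => n; apply: le_trans (nd_cvg_le nd c n).
by rewrite E; apply: nneseries_lim_ge => k _ _; exact: J0.
Qed.

End truncation.

Section square_limit.
Context (R : realType) (d : nat) (U : 'rV[R]_d -> R) (mu : probability 'rV[R]_d R) (gamma : R).
Hypothesis U2 : is_C 2 U.
Hypothesis gU : gibbs_measure U mu.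
Hypothesis g0 : 0 < gamma.
Notation V := 'rV[R]_d.
Notation E := (V * V)%type.
Notation kappa := (@gaussm R d).
Notation muh := (prodp mu kappa).
Notation mR := (measurableTypeR R).
Definition P0 (g : E -> R) (s : R) (z : E) : \bar R := (\sum_(0 <= k <oo) forward_jumps U gamma k (EFin \o g) s z)%E.

Lemma itg_sol2 C (G : R -> E -> R) r : sol U gamma C G -> itg muh (fun z => G r z ^+ 2).
Proof.
move=> sG; have b := bddF (sol_meas sG) (sol_bd sG) r.
by rewrite (_ : (fun z => _) = fun z => G r z * G r z)//; apply: itgM => //; exact: bddm_itg.
Qed.

Section one_side.
Variable f : E -> R.
Hypothesis mf : measurable_fun [set: E] f.
Hypothesis f0 : forall z, 0 <= f z.
Hypothesis f2 : itg muh (fun z => f z ^+ 2).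

Let mt := measurable_trunc mf.
Let bt := trunc_bd f0.
Let sp n := fwd_sol U2 (ltW g0) (mt n) (bt n).
Notation p n := (fwd U gamma (trunc_at f n)).

Lemma fwd_trunc_ge0 n s z : 0 <= p n s z.
Proof. by have /andP[] := (nice_fwd U2 (ltW g0) (mt n) (bt n)).2 s z. Qed.

(** The norm is nonincreasing in time and truncation lowers the data; the bound is uniform in n,
    which gives square-integrability of the limit. *)
Lemma nrm_trunc n s : 0 <= s -> nrm mu (p n) s <= EX muh (fun z => f z ^+ 2).
Proof.
move=> s0; apply: le_trans (nrm_noninc U2 gU g0 (sp n) (lexx 0) s0) _.
apply: EX_le => //; first exact: (itg_sol2 0 (sp n)).
move=> z; rewrite (fwd0 U2 (ltW g0) (mt n) (bt n)) ler_sqr ?nnegrE//; last by have /andP[] := bt n z.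
exact: trunc_le.
Qed.

Lemma trunc_nd s z : nondecreasing_seq (fun n => (p n s z)%:E).
Proof. by apply/nondecreasing_seqP => n; rewrite lee_fin (fwd_trunc_mono U2 (ltW g0) mf f0). Qed.

Lemma fwd_trunc_le n s z : ((p n s z)%:E <= P0 f s z)%E.
Proof. exact: (nd_cvg_le (trunc_nd s z) (@fwd_trunc_cvg R d U gamma U2 (ltW g0) f mf f0 s z)). Qed.

Lemma P0_ge0 s z : (0 <= P0 f s z)%E.
Proof. by apply: le_trans (fwd_trunc_le 0 s z); rewrite lee_fin fwd_trunc_ge0. Qed.

Lemma measurable_P0 s : measurable_fun [set: E] (P0 f s).
Proof.
apply: (emeasurable_fun_cvg (fun n z => (p n s z)%:E)) => [n|z _]; last exact: (fwd_trunc_cvg U2 (ltW g0) mf f0).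
by apply/measurable_EFinP; exact: (msec (sol_meas (sp n))).
Qed.

Lemma P0_sqr_integrable s : 0 <= s -> muh.-integrable [set: E] (fun z => P0 f s z ^+ 2)%E.
Proof.
move=> s0; have m2 : measurable_fun [set: E] (fun z => P0 f s z ^+ 2)%E.
  by apply: emeasurable_funM; exact: measurable_P0.
apply/integrableP; split => //.
have c : (fun n => \int[muh]_z (p n s z ^+ 2)%:E)%E @ \oo --> (\int[muh]_z (P0 f s z ^+ 2))%E.
  apply: mct => //.
  - by move=> n; apply/measurable_EFinP; apply: measurable_funX; exact: (msec (sol_meas (sp n))).
  - by move=> n z _; rewrite lee_fin sqr_ge0.
  - move=> z _; apply/nondecreasing_seqP => n; rewrite lee_fin ler_sqr ?nnegrE ?fwd_trunc_ge0//.
    exact: (fwd_trunc_mono U2 (ltW g0) mf f0).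
  - move=> z _; rewrite (_ : (fun n => _) = fun n => ((p n s z)%:E * (p n s z)%:E)%E).
      by apply: cvgeM; [case: (P0 f s z)|exact: (fwd_trunc_cvg U2 (ltW g0) mf f0)|exact: (fwd_trunc_cvg U2 (ltW g0) mf f0)].
    by apply/funext => n; rewrite expr2 EFinM.
rewrite (eq_integral (fun z => (P0 f s z ^+ 2)%E)); last first.
  by move=> z _; rewrite gee0_abs// mule_ge0 ?P0_ge0.
apply: le_lt_trans (ltry (EX muh (fun z => f z ^+ 2))).
apply: (cvge_le_bound c) => n; rewrite EX_E; last exact: (itg_sol2 s (sp n)).
by rewrite lee_fin; exact: nrm_trunc.
Qed.

(** Makes the difference of the two series in [forward_semigroup] meaningful almost everywhere,
    although either may be infinite at some points. *)
Lemma P0_fin s : 0 <= s -> {ae muh, forall z, P0 f s z \is a fin_num}.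
Proof.
move=> s0; have := integrable_ae measurableT (P0_sqr_integrable s0).
apply: filterS => z /(_ I); case: (P0 f s z) => //=.
Qed.

End one_side.
Section two_sides.
Variable f : E -> R.
Hypothesis mf : measurable_fun [set: E] f.
Hypothesis f2 : itg muh (fun z => f z ^+ 2).
Hypothesis f1 : itg muh f.
Hypothesis mean0 : EX muh f = 0.

Let mp : measurable_fun [set: E] f^\+. Proof. exact: measurable_funrpos. Qed.
Let mn : measurable_fun [set: E] f^\-. Proof. exact: measurable_funrneg. Qed.
Let p0 z : 0 <= f^\+ z. Proof. exact: funrpos_ge0. Qed.
Let n0 z : 0 <= f^\- z. Proof. exact: funrneg_ge0. Qed.
Let pn z : f^\+ z - f^\- z = f z.
Proof. by rewrite /funrpos /funrneg -[Num.max (f z) 0]/(posp (f z)) -[Num.max (- f z) 0]/(negp (f z)) pospBnegp. Qed.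
Let pna z : f^\+ z + f^\- z = `|f z|.
Proof. by rewrite /funrpos /funrneg -[Num.max (f z) 0]/(posp (f z)) -[Num.max (- f z) 0]/(negp (f z)) pospDnegp. Qed.
Let p2 : itg muh (fun z => f^\+ z ^+ 2).
Proof.
apply: itg_dom f2 _; first exact: measurable_funX.
move=> z; rewrite ger0_norm ?sqr_ge0// -(real_normK (num_real (f z))) ler_sqr ?nnegrE//.
by rewrite -pna lerDl.
Qed.
Let n2 : itg muh (fun z => f^\- z ^+ 2).
Proof.
apply: itg_dom f2 _; first exact: measurable_funX.
move=> z; rewrite ger0_norm ?sqr_ge0// -(real_normK (num_real (f z))) ler_sqr ?nnegrE//.
by rewrite -pna lerDr.
Qed.

Let sp n := fwd_sol U2 (ltW g0) (measurable_trunc mp n) (trunc_bd p0 n).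
Let sn n := fwd_sol U2 (ltW g0) (measurable_trunc mn n) (trunc_bd n0 n).
Notation p n := (fwd U gamma (trunc_at f^\+ n)).
Notation q n := (fwd U gamma (trunc_at f^\- n)).
(** Truncating the two parts of f destroys the mean-zero condition. The mean c n of the truncated
    data tends to 0 and is subtracted, constants being solutions. *)
Let c n : R := EX muh (fun z => trunc_at f^\+ n z - trunc_at f^\- n z).
Let F n s z := p n s z - q n s z - c n.
Let sF n : sol U gamma (n%:R + n%:R + `|c n|) (F n).
Proof. by apply: (sol_sub U2 (sol_sub U2 (sp n) (sn n))); exact: sol_cst. Qed.

Let tb n z : `|trunc_at f^\+ n z - trunc_at f^\- n z| <= `|f z|.
Proof.
rewrite -pna; apply: le_trans (ler_normB _ _) _.
have /andP[a1 _] := trunc_bd p0 n z; have /andP[a2 _] := trunc_bd n0 n z.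
by rewrite (ger0_norm a1) (ger0_norm a2) lerD// trunc_le.
Qed.

Let M := EX muh (fun z => `|f z|).

Let cM n : `|c n| <= M.
Proof.
have i : itg muh (fun z => trunc_at f^\+ n z - trunc_at f^\- n z).
  by apply: itg_dom (integrable_norm f1) (tb n); apply: measurable_funB; exact: measurable_trunc.
exact: le_trans (EX_abs i) (EX_le (integrable_norm i) (integrable_norm f1) (tb n)).
Qed.

Let c0 : c @ \oo --> (0 : R).
Proof.
rewrite -mean0; apply: (@EX_dom_cvg _ _ _ muh _ f (fun z => `|f z|)) => //.
- by move=> n; apply: measurable_funB; exact: measurable_trunc.
- exact: (integrable_norm f1).
- by move=> z; rewrite -pn; apply: cvgB; exact: trunc_cvg.
Qed.

Let meanF n : EX muh (F n 0) = 0.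
Proof.
rewrite /F (@EX_eq _ _ _ _ _ (fun z => (trunc_at f^\+ n z - trunc_at f^\- n z) - c n)); last first.
  move=> z; rewrite (fwd0 U2 (ltW g0) (measurable_trunc mp n) (trunc_bd p0 n)).
  by rewrite (fwd0 U2 (ltW g0) (measurable_trunc mn n) (trunc_bd n0 n)).
rewrite EXB ?EX_cst ?subrr//; last exact: itg_cst.
by apply: itg_dom (integrable_norm f1) (tb n); apply: measurable_funB; exact: measurable_trunc.
Qed.

Let sq3 (x y w : R) : (x - y - w) ^+ 2 <= 3 * (x ^+ 2 + y ^+ 2 + w ^+ 2).
Proof. by have := sqr_ge0 (x + y); have := sqr_ge0 (x + w); have := sqr_ge0 (y - w); nra. Qed.

Let B := 3 * (EX muh (fun z => f^\+ z ^+ 2) + EX muh (fun z => f^\- z ^+ 2) + M ^+ 2).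

Let nrmB n s : 0 <= s -> nrm mu (F n) s <= B.
Proof.
move=> s0.
apply: (@le_trans _ _ (3 * (nrm mu (p n) s + nrm mu (q n) s + c n ^+ 2))).
  have i1 := itg_sol2 s (sp n); have i2 := itg_sol2 s (sn n).
  rewrite -(EX_cst muh (c n ^+ 2)) -EXD// -EXD; [|exact: itgD|exact: itg_cst].
  rewrite -EXZ; last by apply: itgD; [exact: itgD|exact: itg_cst].
  apply: EX_le; [exact: (itg_sol2 s (sF n))|by apply: itgZ; apply: itgD; [exact: itgD|exact: itg_cst]|].
  by move=> z; exact: sq3.
rewrite ler_wpM2l// lerD//.
  by rewrite lerD// nrm_trunc.
by rewrite -(real_normK (num_real (c n))) ler_sqr ?nnegrE ?cM ?(le_trans _ (cM 0)).
Qed.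

Let Pf s z := (P0 f^\+%R s z - P0 f^\-%R s z)%E.

Lemma measurable_Pf s : measurable_fun [set: E] (Pf s).
Proof. by apply: emeasurable_funB; apply: measurable_P0. Qed.

(** Dominated convergence: truncated solutions increase to [P0], so [P0] applied to the positive and
    negative parts, together with the bound M on |c n|, dominates them all. Pointwise convergence
    holds where both limits are finite. *)
Lemma nrm_cvg s : 0 <= s -> (fun n => (nrm mu (F n) s)%:E) @ \oo --> (\int[muh]_z (`|Pf s z| ^+ 2))%E.
Proof.
move=> s0.
have m2 : measurable_fun [set: E] (fun z => `|Pf s z| ^+ 2)%E.
  by apply: emeasurable_funM; apply: measurableT_comp => //; exact: measurable_Pf.
have i1 := P0_sqr_integrable mp p0 p2 s0; have i2 := P0_sqr_integrable mn n0 n2 s0.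
pose G z : \bar R := (3%:E * (P0 f^\+%R s z ^+ 2 + P0 f^\-%R s z ^+ 2 + (M ^+ 2)%:E))%E.
have iG : muh.-integrable [set: E] G.
  apply: integrableZl => //; apply: integrableD => //; first exact: integrableD.
  exact: (itg_cst muh (M ^+ 2)).
have [] := @dominated_convergence _ _ _ muh setT measurableT (fun n z => (F n s z ^+ 2)%:E) (fun z => `|Pf s z| ^+ 2)%E G.
- by move=> n; apply/measurable_EFinP; exact: (itg_meas (itg_sol2 s (sF n))).
- exact: m2.
- have h1 := P0_fin mp p0 p2 s0; have h2 := P0_fin mn n0 n2 s0.
  apply: (@filterS2 _ _ (ae_filter_ringOfSetsType muh) _ _ _ _ h1 h2) => z a1 a2 _.
  have cp : (fun n => (p n s z)%:E) @ \oo --> P0 f^\+ s z := @fwd_trunc_cvg R d U gamma U2 (ltW g0) _ mp p0 s z.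
  have cn : (fun n => (q n s z)%:E) @ \oo --> P0 f^\- s z := @fwd_trunc_cvg R d U gamma U2 (ltW g0) _ mn n0 s z.
  rewrite /Pf; move: a1 a2 cp cn; case: (P0 f^\+ s z) => // x _; case: (P0 f^\- s z) => // y _.
  move=> /fine_cvgP[_ cx] /fine_cvgP[_ cy].
  rewrite -EFinB abse_sqr; apply: cvg_EFin; first exact: nearW.
  have cF : (fun n => F n s z) @ \oo --> x - y.
    by rewrite -[x - y]subr0; apply: cvgB => //; apply: cvgB.
  by rewrite expr2; exact: (cvgM cF cF).
- exact: iG.
- apply: aeW => z n _; rewrite gee0_abs ?lee_fin ?sqr_ge0//.
  apply: (@le_trans _ _ (3 * (p n s z ^+ 2 + q n s z ^+ 2 + c n ^+ 2))%:E); first by rewrite lee_fin; exact: sq3.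
  rewrite /G EFinM lee_pmul2l// !EFinD; apply: leeD; last first.
    by rewrite lee_fin -(real_normK (num_real (c n))) ler_sqr ?nnegrE ?cM ?(le_trans _ (cM 0)).
  have le2 (g : E -> R) (mg : measurable_fun [set: E] g) (g1 : forall z, 0 <= g z) :
      ((fwd U gamma (trunc_at g n) s z ^+ 2)%:E <= P0 g s z ^+ 2)%E.
    rewrite expr2 EFinM; apply: lee_pmul; rewrite ?lee_fin ?fwd_trunc_ge0//; exact: fwd_trunc_le.
  by apply: leeD; apply: le2.
move=> _ _; rewrite (_ : (fun n => _) = (fun n => (nrm mu (F n) s)%:E))//.
by apply/funext => n; rewrite (EX_E (itg_sol2 s (sF n))).
Qed.

Lemma time_cvg t T : 0 <= t -> 0 <= T ->
  (fun n => (ri (nrm mu (F n)) t (t + T))%:E) @ \oo -->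
  (\int[@lebesgue_measure R]_(s in `[t, (t + T)%R]) \int[muh]_z (`|Pf s z| ^+ 2))%E.
Proof.
move=> t0 T0; pose D := `[t, t + T]%classic.
have mD : measurable (D : set mR) by exact: measurable_itv.
have m1 n : measurable_fun (D : set mR) (fun s => (nrm mu (F n) s)%:E).
  by apply/measurable_EFinP; apply: measurable_funTS; exact: (lbm_nrm mu (sF n)).1.
have cD s : D s -> (fun n => (nrm mu (F n) s)%:E) @ \oo --> (\int[muh]_z (`|Pf s z| ^+ 2))%E.
  by rewrite /D/= in_itv/= => /andP[ts _]; apply: nrm_cvg; exact: le_trans ts.
have [] := @dominated_convergence _ mR _ (@lebesgue_measure R) D mD (fun n s => (nrm mu (F n) s)%:E)
  (fun s => \int[muh]_z (`|Pf s z| ^+ 2))%E (fun=> B%:E) m1.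
- by apply: (emeasurable_fun_cvg (fun n s => (nrm mu (F n) s)%:E)) => //.
- by apply: aeW => s; exact: cD.
- exact: (lbm_integrable t (t + T) (lbm_cst B)).
- apply: aeW => s n; rewrite /D/= in_itv/= => /andP[ts _].
  rewrite lee_fin ger0_norm; first by apply: nrmB; exact: le_trans ts.
  by apply: EX_ge0 => z; exact: sqr_ge0.
move=> _ _; rewrite (_ : (fun n => _) = (fun n => (ri (nrm mu (F n)) t (t + T))%:E))//.
by apply/funext => n; rewrite -(ri_E _ _ (lbm_nrm mu (sF n))).
Qed.

Variables (m K a b T : R).
Hypothesis m0 : 0 < m.
Hypothesis pc : poincare mu m^-1.
Hypothesis ds : discrete_spectrum mu (langevin_closure U mu).
Hypothesis K0 : 0 <= K.
Hypothesis hK : forall x v : V, - (K * m) * dotv v v <= (v *m hess U x *m v^T) ord0 ord0.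
Hypothesis a01 : 0 <= a < 1.
Hypothesis b0 : 0 <= b.
Hypothesis hab : forall x, laplacian U x <= a * dotv (grad U x) (grad U x) + b.
Hypothesis T0 : 0 < T.
Hypothesis Tm : T ^+ 2 * m = 1.

Lemma decay_L2 t : 0 <= t ->
  (\int[@lebesgue_measure R]_(s in `[t, (t + T)%R]) \int[muh]_z (`|Pf s z| ^+ 2) <=
   (expR (- (gamma / (160 * 160 * Gam2 gamma m K a b) * t)))%:E *
   \int[@lebesgue_measure R]_(s in `[0%R, T]) \int[muh]_z (`|Pf s z| ^+ 2))%E.
Proof.
move=> t0; set e := expR _.
have c1 := time_cvg t0 (ltW T0); have c2 := time_cvg (lexx 0) (ltW T0); rewrite add0r in c2.
have c3 : (fun n => e%:E * (ri (nrm mu (F n)) 0 T)%:E)%E @ \oo --> (e%:E *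
   \int[@lebesgue_measure R]_(s in `[0%R, T]) \int[muh]_z (`|Pf s z| ^+ 2))%E by apply: cvgeZl.
rewrite -(cvg_lim _ c1)// -[leRHS](cvg_lim _ c3)//; apply: lee_lim.
- by apply/cvg_ex; eexists; exact: c1.
- by apply/cvg_ex; eexists; exact: c3.
apply: nearW => n; rewrite -EFinM lee_fin.
exact: (decay_sol U2 gU m0 pc ds K0 hK a01 b0 hab g0 (sF n) (meanF n) T0 Tm t0).
Qed.

End two_sides.
End square_limit.

(** * Contraction rate and universal constants *)

Section main.
Context (R : realType).

Lemma T_average_contractive_le disp (E : measurableType disp) (P : R -> (E -> R) -> E -> \bar R)
    (m : {measure set E -> \bar R}) (T nu nu' : R) : nu' <= nu ->
  T_average_contractive P m T nu -> T_average_contractive P m T nu'.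
Proof.
move=> le h f fL f0 t t0; apply: le_trans (h f fL f0 t t0) _.
apply: lee_wpmul2r.
  by apply: integral_ge0 => s _; rewrite mule_ge0 ?Lnorm_ge0.
by rewrite lee_fin ler_expR lerN2 ler_wpM2r// ler_wpM2l.
Qed.

Lemma rate_eq (c g m X t : R) : c != 0 -> m != 0 -> X + g ^+ 2 != 0 ->
  g / (c * ((X + g ^+ 2) / m)) * t = 2 * ((2 * c)^-1 * (g * m / (g ^+ 2 + X))) * t.
Proof. by move=> c0 m0 X0; rewrite (addrC (g ^+ 2) X); field; rewrite X0 m0 c0. Qed.

Lemma main_rate d (U : 'rV[R]_d -> R) (mu : probability 'rV[R]_d R) (m K a b gamma : R) :
  standing_assumptions U mu m K -> 0 <= a < 1 -> 0 <= b ->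
  (forall x, laplacian U x <= a * dotv (grad U x) (grad U x) + b) -> 0 < gamma ->
  T_average_contractive (forward_semigroup U gamma) (mu \x std_gauss R d)%E (Num.sqrt m)^-1
    ((2 * (160 * 160))^-1 * (gamma * m / (gamma ^+ 2 + (m * (1 + K) + b) / (1 - a) ^+ 2))).
Proof.
move=> [[U2 gU] [m0 pc] ds [K0 hK]] a01 b0 hab g0 f fL fmean t t0.
pose T : R := (Num.sqrt m)^-1.
have T0 : 0 < T by rewrite invr_gt0 sqrtr_gt0.
have Tm : T ^+ 2 * m = 1 by rewrite exprVn sqr_sqrtr ?ltW// mulVf// gt_eqF.
have mf : measurable_fun [set: 'rV[R]_d * 'rV[R]_d] f by have := sub_Lfun_mfun fL; rewrite inE.
have f2 : itg (prodp mu (@gaussm R d)) (fun z => f z ^+ 2) by exact: (Lfun2_integrable_sqr fL).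
have f1 : itg (prodp mu (@gaussm R d)) f.
  apply: (itg_dom mf (itgD (itg_cst _ 1) f2)) => z.
  by have := sqr_ge0 (`|f z| - 1); rewrite sqrrB real_normK ?num_real// mulr1 expr1n; nra.
have mean0 : EX (prodp mu (@gaussm R d)) f = 0.
  by rewrite /EX /Rintegral; move: fmean => /= ->.
have NE s : ('N[(mu \x std_gauss R d)%E]_(2%:E)[forward_semigroup U gamma s f] ^+ 2 =
   \int[prodp mu (@gaussm R d)]_z (`|forward_semigroup U gamma s f z| ^+ 2))%E by exact: Lnorm_sqr.
under eq_integral do rewrite NE.
under [in leRHS]eq_integral do rewrite NE.
have := decay_L2 U2 gU g0 mf f2 f1 mean0 m0 pc ds K0 hK a01 b0 hab T0 Tm t0.
(* The decay of squared norms is compared with exp(- 2 nu t). *)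
have -> : gamma / (160 * 160 * Gam2 gamma m K a b) * t =
  2 * ((2 * (160 * 160))^-1 * (gamma * m / (gamma ^+ 2 + (m * (1 + K) + b) / (1 - a) ^+ 2))) * t.
  apply: rate_eq; [by rewrite mulf_neq0// pnatr_eq0|by rewrite gt_eqF|].
  rewrite gt_eqF// ltr_wpDl// ?exprn_gt0// divr_ge0 ?sqr_ge0//.
  by apply: addr_ge0 => //; apply: mulr_ge0; [exact: ltW|exact: addr_ge0].
by [].
Qed.

End main.

Theorem corollary23 (R : realType) :
  (exists c : R, 0 < c /\
     forall (d : nat) (U : 'rV[R]_d -> R) (mu : probability 'rV[R]_d R)
       (m K a b gamma : R),
     standing_assumptions U mu m K ->
     0 <= a < 1 -> 0 <= b ->
     (forall x, laplacian U x <= a * dotv (grad U x) (grad U x) + b) ->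
     0 < gamma ->
     T_average_contractive (forward_semigroup U gamma)
       (mu \x std_gauss R d)%E (Num.sqrt m)^-1
       (c * (gamma * m /
             (gamma ^+ 2 + (m * (1 + K) + b) / (1 - a) ^+ 2)))) /\
  (forall c1 c2 : R, 0 < c1 -> 0 < c2 ->
   exists c : R, 0 < c /\
     forall (d : nat) (U : 'rV[R]_d -> R) (mu : probability 'rV[R]_d R)
       (m K a b gamma : R),
     standing_assumptions U mu m K ->
     0 <= a < 1 -> 0 <= b ->
     (forall x, laplacian U x <= a * dotv (grad U x) (grad U x) + b) ->
     0 < gamma ->
     c1 * (Num.sqrt (m * (1 + K) + b) / (1 - a)) <= gamma ->
     gamma <= c2 * (Num.sqrt (m * (1 + K) + b) / (1 - a)) ->
     T_average_contractive (forward_semigroup U gamma)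
       (mu \x std_gauss R d)%E (Num.sqrt m)^-1
       (c * (Num.sqrt m * (1 - a) / Num.sqrt (1 + K + b / m)))).
Proof.
(* 160 * 160 is the constant of [decay_lip]; the additional 2 passes from the rate of the squared
   norm to nu. *)
pose c : R := (2 * (160 * 160))^-1.
have c0 : 0 < c by rewrite invr_gt0 mulr_gt0// mulr_gt0// ltr0n.
split.
  by exists c; split => // d U mu m K a b gamma sa a01 b0 hab g0; exact: main_rate.
(* With A = sqrt(m (1 + K) + b) / (1 - a), the lower bound on gamma serves in the numerator, and the
   upper bound gives gamma^2 + A^2 <= (1 + c2^2) A^2. The rate is then at least a multiple c1 / (1 +
   c2^2) of m / A, which is the target expression. *)
move=> c1 c2 c10 c20; exists (c * (c1 / (1 + c2 ^+ 2))).
have c21 : 0 < 1 + c2 ^+ 2 by rewrite ltr_pwDl ?sqr_ge0.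
split; first by rewrite mulr_gt0// divr_gt0.
move=> d U mu m K a b gamma sa a01 b0 hab g0 h1 h2.
apply: T_average_contractive_le (main_rate sa a01 b0 hab g0).
have [_ [m0 _] _ [K0 _]] := sa; have [a0 a1] := andP a01.
rewrite -/c -mulrA ler_wpM2l ?(ltW c0)//.
pose S := m * (1 + K) + b; pose A := Num.sqrt S / (1 - a).
have S0 : 0 < S by rewrite /S ltr_wpDr// mulr_gt0// ltr_pwDl.
have a10 : 0 < 1 - a by rewrite subr_gt0.
have A0 : 0 < A by rewrite divr_gt0// sqrtr_gt0.
have A2 : S / (1 - a) ^+ 2 = A ^+ 2 by rewrite /A exprMn exprVn sqr_sqrtr// ltW.
rewrite -/S -/A A2 in h1 h2 *.
have -> : Num.sqrt m * (1 - a) / Num.sqrt (1 + K + b / m) = m / A.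
  have -> : 1 + K + b / m = S / m by rewrite /S; field; rewrite gt_eqF.
  rewrite sqrtrM ?(ltW S0)// sqrtrV ?(ltW m0)// /A -{3}(sqr_sqrtr (ltW m0)).
  by field; rewrite !gt_eqF ?sqrtr_gt0.
have D0 : 0 < gamma ^+ 2 + A ^+ 2 by rewrite ltr_wpDl ?sqr_ge0// exprn_gt0.
have D1 : gamma ^+ 2 + A ^+ 2 <= (1 + c2 ^+ 2) * A ^+ 2.
  rewrite mulrDl mul1r addrC lerD2l -exprMn ler_sqr ?nnegrE ?(ltW g0)//.
  by rewrite mulr_ge0// ltW.
rewrite ler_pdivlMr//; apply: (@le_trans _ _ (c1 / (1 + c2 ^+ 2) * (m / A) * ((1 + c2 ^+ 2) * A ^+ 2))).
  by rewrite ler_wpM2l// mulr_ge0// divr_ge0// ltW.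
rewrite (_ : _ * _ = c1 * A * m); last by field; rewrite !gt_eqF.
by rewrite ler_wpM2r// ltW.
Qed.
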